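(* Let $N$ be a positive integer and $h$ an integer with $0\leq h<N/2$. Let $x>0$ and $0<a\leq 1$. Put $A_{N,j}(y):=\pi(2\pi y)^{\frac{1}{N}}e^{\frac{i\pi j}{N}}$. (i) Let $N$ be odd, and let \begin{align*} S(x,a)&:=\frac{(-1)^{h+1}}{N}\left(\frac{2\pi}{x}\right)^{\frac{N-2h+1}{N}}\sum_{j=-\frac{N-1}{2}}^{\frac{N-1}{2}}e^{\frac{i\pi(1-2h)j}{N}}\Bigg\{\sum_{n=1}^{\infty}\frac{\cos(2\pi na)}{n^{\frac{2h-1}{N}}\left(\exp\left(2A_{N,j}\left(\frac{n}{x}\right)\right)-1\right)}\\ &\quad+\frac{(-1)^{j+\frac{N+1}{2}}}{\pi}\sum_{n=1}^{\infty}\frac{\sin(2\pi na)}{n^{\frac{2h-1}{N}}}\left\{\log\left(\tfrac{1}{\pi}A_{N,j}\left(\tfrac{n}{x}\right)\right)-\tfrac{1}{2}\left(\psi\left(\tfrac{i}{\pi}A_{N,j}\left(\tfrac{n}{x}\right)\right)+\psi\left(-\tfrac{i}{\pi}A_{N,j}\left(\tfrac{n}{x}\right)\right)\right)\right\}\Bigg\}. \end{align*} Define $g(N,h,a):=-\frac{1}{2}\zeta(-N+2h)$ if $a=1$ and $g(N,h,a):=0$ if $0<a<1$. Then \[ \sum_{n=1}^{\infty}n^{N-2h}\frac{\exp(-an^{N}x)}{1-\exp(-n^{N}x)}=\frac{\zeta(2h)}{x}+\frac{1}{N}\Gamma\!\left(\tfrac{N-2h+1}{N}\right)\zeta\!\left(\tfrac{N-2h+1}{N},a\right)x^{-\frac{N-2h+1}{N}}+S(x,a)+g(N,h,a).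 \] (ii) Let $N$ be even, and let \[ S(x,a):=\frac{(-1)^{h+1}}{N}\left(\frac{2\pi}{x}\right)^{\frac{N-2h+1}{N}}\sum_{j=-\frac{N}{2}}^{\frac{N}{2}-1}e^{\frac{i\pi(1-2h)(j+\frac{1}{2})}{N}}\sum_{n=1}^{\infty}\frac{\cos(2\pi na)+i(-1)^{j+\frac{N}{2}+1}\sin(2\pi na)}{n^{\frac{2h-1}{N}}\left(\exp\left(2A_{N,j+\frac{1}{2}}\left(\frac{n}{x}\right)\right)-1\right)}. \] Then \[ \sum_{n=1}^{\infty}n^{N-2h}\frac{\exp(-an^{N}x)}{1-\exp(-n^{N}x)}=\frac{\zeta(2h)}{x}+\frac{1}{N}\Gamma\!\left(\tfrac{N-2h+1}{N}\right)\zeta\!\left(\tfrac{N-2h+1}{N},a\right)x^{-\frac{N-2h+1}{N}}+S(x,a). \] Moreover, the identity in (ii) also holds for every integer $h<0$ (with $N$ even).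
   Context: $\zeta(s)$ is the Riemann zeta function (so $\zeta(0)=-\tfrac12$) and $\zeta(s,a)$ the Hurwitz zeta function. $\psi=\Gamma'/\Gamma$ is the digamma function; $\log$ is the principal branch. Sums over $j$ run through integers; $A_{N,j+1/2}$ means $A_{N,j}$ with $j$ replaced by $j+\tfrac12$. *)

(* Defs.v *)
From Stdlib Require Import Reals ZArith.
From Coquelicot Require Import Coquelicot.
Open Scope R_scope.

Definition cexp (z : C) : C :=
  (exp (Re z) * cos (Im z), exp (Re z) * sin (Im z)).

Definition carg (z : C) : R :=
  let x := Re z in let y := Im z in
  if Rlt_dec 0 x then atan (y / x)
  else if Rlt_dec x 0 then
    (if Rle_dec 0 y then atan (y / x) + PI else atan (y / x) - PI)
  else if Rlt_dec 0 y then PI / 2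
  else if Rlt_dec y 0 then - (PI / 2)
  else 0.

Definition clog (z : C) : C := (ln (Cmod z), carg z).

Definition cLim_seq (u : nat -> C) : C :=
  (real (Lim_seq (fun n => Re (u n))), real (Lim_seq (fun n => Im (u n)))).

Definition cex_series (u : nat -> C) : Prop :=
  ex_series (fun n => Re (u n)) /\ ex_series (fun n => Im (u n)).

Definition cSeries (u : nat -> C) : C :=
  (Series (fun n => Re (u n)), Series (fun n => Im (u n))).

Definition Gamma (s : R) : R :=
  RInt_gen (fun t => Rpower t (s - 1) * exp (- t)) (at_right 0) (Rbar_locally p_infty).

(* Digamma psi = Gamma'/Gamma, via Gauss' limit formula
   psi(z) = lim_{M -> oo} ( ln M - sum_{k=0}^{M} 1/(z+k) ),
   valid for every complex z that is not a non-positive integer. *)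
Definition digamma (z : C) : C :=
  cLim_seq (fun M => Cminus (RtoC (ln (INR M)))
                            (sum_n (fun k => Cinv (Cplus z (RtoC (INR k)))) M)).

(* Hurwitz zeta function zeta(s,a) for real s <> 1 and a > 0, i.e. the analytic
   continuation of sum_{n>=0} (n+a)^(-s), given by Hasse's globally convergent series
   zeta(s,a) = 1/(s-1) sum_{n>=0} 1/(n+1) sum_{k=0}^n (-1)^k C(n,k) (a+k)^(1-s). *)
Definition hurwitz_zeta (s a : R) : R :=
  / (s - 1) *
  Series (fun n => / INR (n + 1) *
    sum_f_R0 (fun k => (-1) ^ k * Binomial.C n k * Rpower (a + INR k) (1 - s)) n).

Definition riemann_zeta (s : R) : R := hurwitz_zeta s 1.

Definition A_ (N : nat) (j y : R) : C :=
  Cmult (RtoC (PI * Rpower (2 * PI * y) (1 / INR N))) (cexp (0, PI * j / INR N)).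

Definition lhs_term (N : nat) (h : Z) (x a : R) (n : nat) : R :=
  powerRZ (INR n) (Z.of_nat N - 2 * h) * exp (- a * INR n ^ N * x)
  / (1 - exp (- INR n ^ N * x)).

Definition lhs_seq (N : nat) (h : Z) (x a : R) : nat -> R :=
  fun n => lhs_term N h x a (S n).

Definition npow (N : nat) (h : Z) (n : nat) : R :=
  Rpower (INR n) (IZR (2 * h - 1) / INR N).

Definition pref (N : nat) (h : Z) (x : R) : R :=
  powerRZ (-1) (h + 1) / INR N * Rpower (2 * PI / x) (IZR (Z.of_nat N - 2 * h + 1) / INR N).

(* ---- odd N ---- j ranges over -(N-1)/2 .. (N-1)/2, written j = k - (N-1)/2, k < N *)
Definition jodd (N k : nat) : Z := (Z.of_nat k - Z.of_nat ((N - 1) / 2))%Z.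

Definition odd_cos_term (N : nat) (h : Z) (x a : R) (j : Z) (m : nat) : C :=
  let n := S m in
  Cdiv (RtoC (cos (2 * PI * INR n * a)))
       (Cmult (RtoC (npow N h n))
              (Cminus (cexp (Cmult (RtoC 2) (A_ N (IZR j) (INR n / x)))) (RtoC 1))).

Definition odd_sin_term (N : nat) (h : Z) (x a : R) (j : Z) (m : nat) : C :=
  let n := S m in
  let w := A_ N (IZR j) (INR n / x) in
  let iw := Cmult (0, / PI) w in
  Cmult (RtoC (sin (2 * PI * INR n * a) / npow N h n))
        (Cminus (clog (Cmult (RtoC (/ PI)) w))
                (Cmult (RtoC (/ 2)) (Cplus (digamma iw) (digamma (Copp iw))))).

Definition S_odd (N : nat) (h : Z) (x a : R) : C :=
  Cmult (RtoC (pref N h x))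
   (sum_n (fun k =>
      let j := jodd N k in
      Cmult (cexp (0, PI * IZR (1 - 2 * h) * IZR j / INR N))
        (Cplus (cSeries (odd_cos_term N h x a j))
               (Cmult (RtoC (powerRZ (-1) (j + Z.of_nat ((N + 1) / 2)) / PI))
                      (cSeries (odd_sin_term N h x a j)))))
     (N - 1)).

Definition g_ (N : nat) (h : Z) (a : R) : R :=
  if Req_EM_T a 1 then - / 2 * riemann_zeta (IZR (- Z.of_nat N + 2 * h)) else 0.

(* ---- even N ---- j ranges over -N/2 .. N/2 - 1, written j = k - N/2, k < N *)
Definition jeven (N k : nat) : Z := (Z.of_nat k - Z.of_nat (N / 2))%Z.

Definition even_term (N : nat) (h : Z) (x a : R) (j : Z) (m : nat) : C :=
  let n := S m in
  Cdiv (Cplus (RtoC (cos (2 * PI * INR n * a)))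
              (Cmult (0, powerRZ (-1) (j + Z.of_nat (N / 2) + 1)) (RtoC (sin (2 * PI * INR n * a)))))
       (Cmult (RtoC (npow N h n))
              (Cminus (cexp (Cmult (RtoC 2) (A_ N (IZR j + / 2) (INR n / x)))) (RtoC 1))).

Definition S_even (N : nat) (h : Z) (x a : R) : C :=
  Cmult (RtoC (pref N h x))
   (sum_n (fun k =>
      let j := jeven N k in
      Cmult (cexp (0, PI * IZR (1 - 2 * h) * (IZR j + / 2) / INR N))
            (cSeries (even_term N h x a j)))
     (N - 1)).

Definition main_terms (N : nat) (h : Z) (x a : R) : R :=
  let s := IZR (Z.of_nat N - 2 * h + 1) / INR N in
  riemann_zeta (IZR (2 * h)) / x + / INR N * Gamma s * hurwitz_zeta s a * Rpower x (- s).

(* Main.v *)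
(** For [c = 2 pi m / x] the generating kernel [e^{-at}/(1 - e^{-t})], [0 < a < 1], has the Fourier
    expansion [sum_m e^{2 pi i m a} / (t + 2 pi i m)]. Put [t = x u^N], multiply by [u^{N-2h}] and
    compare the sum over [u = 1, 2, ...] with the integral over [u > 0]. On the left the integral is a
    Mellin transform, which gives the main terms. On the right each Fourier term is, up to a polynomial
    in [m], a rational function of [u] with denominator [u^{2N} + c^2]; partial fractions reduce it to
    [1/(u^2+z^2)] and [u/(u^2+z^2)] with [z^{2N} = +-c^2, Re z > 0], whose sum-minus-integral values are
    [(pi/z)/(e^{2 pi z}-1)] and [log z - (psi(iz)+psi(-iz))/2]. The expansion converges only
    conditionally; after [K] backward differences in [m], i.e. multiplication by [(1-e^{2 pi i a})^K], the
    polynomial parts disappear and the exchange of sums is absolutely justified. The case [a = 1]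
    follows by continuity when [N] is even. When [N] is odd the cosine part is
    [(Phi(a) + Phi(1-a))/2], and [a -> 0+] produces the extra term [-zeta(2h-N)/2]. *)
Require Import Defs.
From Stdlib Require Import Reals ZArith Lra Lia Psatz.
From Coquelicot Require Import Coquelicot.
Open Scope R_scope.

(** * Finite sums, limits and derivatives of complex-valued functions *)

(** Sum minus integral is treated as one linear functional [EM], the integral being a primitive that
    vanishes at 0+. A single estimate, [EM_bound], then justifies exchanging the Fourier sum with
    it. On the Mellin side the constants of the statement are themselves limits: [hurwitz_zeta] is
    Hasse's series, which has to be summed under the integral, and [digamma] is a [Lim_seq] whose
    convergence has to be proved. The exponent [N - 2h] has the parity of [N]. For even [N] only the
    kernel [1/(u^2+z^2)] arises and the terms decay faster than any power of [n], whatever the sign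
    of [h]. For odd [N] each Fourier term gives one kernel of each kind; the digamma expressions are
    bounded only by a multiple of [|z|^(-2)], so the sine series is summed by Dirichlet's test and
    resists a uniform estimate near [a = 1]. Hence the detour through the cosine part at the
    endpoint. *)

Fixpoint rsum (f : nat -> R) (n : nat) : R :=
  match n with O => 0 | S m => rsum f m + f m end.

Fixpoint csum (f : nat -> C) (n : nat) : C :=
  match n with O => RtoC 0 | S m => Cplus (csum f m) (f m) end.

Lemma C_ext (z w : C) : Re z = Re w -> Im z = Im w -> z = w.
Proof. destruct z, w; simpl; intros; subst; reflexivity. Qed.

Lemma rsum_ext f g n : (forall k, (k < n)%nat -> f k = g k) -> rsum f n = rsum g n.
Proof.
  induction n as [|n IH]; simpl; intros H; [reflexivity|].
  rewrite IH by (intros; apply H; lia). rewrite H by lia. reflexivity.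
Qed.

Lemma csum_ext f g n : (forall k, (k < n)%nat -> f k = g k) -> csum f n = csum g n.
Proof.
  induction n as [|n IH]; simpl; intros H; [reflexivity|].
  rewrite IH by (intros; apply H; lia). rewrite H by lia. reflexivity.
Qed.

Lemma rsum_plus f g n : rsum (fun k => f k + g k) n = rsum f n + rsum g n.
Proof. induction n as [|n IH]; simpl; [ring|rewrite IH; ring]. Qed.

Lemma rsum_scal c f n : rsum (fun k => c * f k) n = c * rsum f n.
Proof. induction n as [|n IH]; simpl; [ring|rewrite IH; ring]. Qed.

Lemma csum_plus f g n : csum (fun k => Cplus (f k) (g k)) n = Cplus (csum f n) (csum g n).
Proof. induction n as [|n IH]; simpl; [ring|rewrite IH; ring]. Qed.

Lemma csum_scal c f n : csum (fun k => Cmult c (f k)) n = Cmult c (csum f n).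
Proof. induction n as [|n IH]; simpl; [ring|rewrite IH; ring]. Qed.

Lemma csum_const c n : csum (fun _ => c) n = Cmult (RtoC (INR n)) c.
Proof.
  induction n as [|n IH]; [simpl; ring|].
  rewrite S_INR, RtoC_plus. simpl csum. rewrite IH. ring.
Qed.

Lemma csum_swap (f : nat -> nat -> C) n m :
  csum (fun i => csum (f i) m) n = csum (fun j => csum (fun i => f i j) n) m.
Proof.
  induction n as [|n IH]; simpl.
  - rewrite csum_const. ring.
  - rewrite IH, <- csum_plus. reflexivity.
Qed.

Lemma csum_add f n m : csum f (n + m) = Cplus (csum f n) (csum (fun k => f (n + k)%nat) m).
Proof.
  induction m as [|m IH]; simpl; [rewrite Nat.add_0_r; ring|].
  rewrite Nat.add_succ_r; simpl. rewrite IH. ring.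
Qed.

Lemma csum_S_l f n : csum f (S n) = Cplus (f O) (csum (fun k => f (S k)) n).
Proof. change (S n) with (1 + n)%nat. rewrite csum_add. simpl. ring. Qed.

Lemma csum_single f n j : (j < n)%nat -> (forall k, (k < n)%nat -> k <> j -> f k = RtoC 0) ->
  csum f n = f j.
Proof.
  intros Hj Hz. induction n as [|n IH]; [lia|]. simpl.
  destruct (Nat.eq_dec j n) as [->|Hne].
  - rewrite (csum_ext f (fun _ => RtoC 0)) by (intros; apply Hz; lia).
    rewrite csum_const. ring.
  - rewrite IH by (try lia; intros; apply Hz; lia). rewrite (Hz n) by lia. ring.
Qed.

Lemma Re_csum f n : Re (csum f n) = rsum (fun k => Re (f k)) n.
Proof. induction n as [|n IH]; simpl; [reflexivity|]. rewrite <- IH. reflexivity. Qed.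

Lemma Im_csum f n : Im (csum f n) = rsum (fun k => Im (f k)) n.
Proof. induction n as [|n IH]; simpl; [reflexivity|]. rewrite <- IH. reflexivity. Qed.

Lemma csum_RtoC f n : csum (fun k => RtoC (f k)) n = RtoC (rsum f n).
Proof. induction n as [|n IH]; simpl; [reflexivity|]. now rewrite IH, RtoC_plus. Qed.

Lemma Cmod_csum f n : Cmod (csum f n) <= rsum (fun k => Cmod (f k)) n.
Proof.
  induction n as [|n IH]; simpl; [rewrite Cmod_0; lra|].
  eapply Rle_trans; [apply Cmod_triangle|lra].
Qed.

Lemma rsum_le f g n : (forall k, (k < n)%nat -> f k <= g k) -> rsum f n <= rsum g n.
Proof.
  induction n as [|n IH]; simpl; intros H; [lra|].
  apply Rplus_le_compat; [apply IH; intros; apply H; lia|apply H; lia].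
Qed.

Lemma sum_n_rsum (f : nat -> R) n : sum_n f n = rsum f (S n).
Proof.
  induction n as [|n IH]; [rewrite sum_O; simpl; ring|].
  rewrite sum_Sn, IH. reflexivity.
Qed.

Lemma sum_n_csum (f : nat -> C) n : sum_n f n = csum f (S n).
Proof.
  induction n as [|n IH]; [rewrite sum_O; simpl; ring|].
  rewrite sum_Sn, IH. reflexivity.
Qed.

Lemma Cmod_le_abs z : Cmod z <= Rabs (Re z) + Rabs (Im z).
Proof.
  replace z with (Cplus (RtoC (Re z)) (Cmult Ci (RtoC (Im z)))) at 1
    by (apply C_ext; unfold Re, Im; simpl; ring).
  eapply Rle_trans; [apply Cmod_triangle|].
  rewrite Cmod_mult, !Cmod_R, Cmod_Ci. lra.
Qed.

Lemma im_le_Cmod z : Rabs (Im z) <= Cmod z.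
Proof.
  replace (Im z) with (Re (Cmult (Copp Ci) z)) by (unfold Re, Im; simpl; ring).
  eapply Rle_trans; [apply re_le_Cmod|].
  rewrite Cmod_mult, Cmod_opp, Cmod_Ci. lra.
Qed.

Lemma Cmod_minus_sym z w : Cmod (Cminus z w) = Cmod (Cminus w z).
Proof. rewrite <- Cmod_opp. f_equal. ring. Qed.

Lemma Cmod_triangle_inv z w : Cmod z - Cmod w <= Cmod (Cplus z w).
Proof.
  assert (H := Cmod_triangle (Cplus z w) (Copp w)). rewrite Cmod_opp in H.
  replace (Cplus (Cplus z w) (Copp w)) with z in H by ring. lra.
Qed.

(** * Limits of complex sequences *)

Lemma is_lim_seq_eq u l m : is_lim_seq u l -> l = m -> is_lim_seq u m.
Proof. intros H <-; exact H. Qed.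

(** Componentwise, because [cSeries] and [cLim_seq] in the statement are formed from real and
    imaginary parts. *)
Definition clim (u : nat -> C) (l : C) : Prop :=
  is_lim_seq (fun n => Re (u n)) (Re l) /\ is_lim_seq (fun n => Im (u n)) (Im l).

Lemma clim_ext u v l : (forall n, u n = v n) -> clim u l -> clim v l.
Proof.
  intros E [H1 H2]; split; [eapply is_lim_seq_ext; [|exact H1]|eapply is_lim_seq_ext; [|exact H2]];
    intros n; simpl; now rewrite E.
Qed.

Lemma clim_eq u l m : clim u l -> l = m -> clim u m.
Proof. intros H <-; exact H. Qed.

Lemma clim_ext_loc u v l : eventually (fun n => u n = v n) -> clim u l -> clim v l.
Proof.
  intros E [H1 H2]; split; [eapply is_lim_seq_ext_loc; [|exact H1]|eapply is_lim_seq_ext_loc; [|exact H2]];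
    (eapply filter_imp; [|exact E]); intros n ->; reflexivity.
Qed.

Lemma clim_const l : clim (fun _ => l) l.
Proof. split; apply is_lim_seq_const. Qed.

Lemma clim_plus u v l m : clim u l -> clim v m -> clim (fun n => Cplus (u n) (v n)) (Cplus l m).
Proof. intros [A1 A2] [B1 B2]; split; simpl; now apply is_lim_seq_plus'. Qed.

Lemma clim_opp u l : clim u l -> clim (fun n => Copp (u n)) (Copp l).
Proof.
  intros [A1 A2]; split; simpl.
  - apply (proj1 (is_lim_seq_opp _ _) A1).
  - apply (proj1 (is_lim_seq_opp _ _) A2).
Qed.

Lemma clim_minus u v l m : clim u l -> clim v m -> clim (fun n => Cminus (u n) (v n)) (Cminus l m).
Proof. intros A B. apply clim_plus; [exact A|now apply clim_opp]. Qed.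

Lemma clim_mult u v l m : clim u l -> clim v m -> clim (fun n => Cmult (u n) (v n)) (Cmult l m).
Proof.
  intros [A1 A2] [B1 B2]; split; simpl.
  - apply is_lim_seq_minus'; now apply is_lim_seq_mult'.
  - apply is_lim_seq_plus'; now apply is_lim_seq_mult'.
Qed.

Lemma clim_scal c u l : clim u l -> clim (fun n => Cmult c (u n)) (Cmult c l).
Proof. intros H. apply clim_mult; [apply clim_const|exact H]. Qed.

Lemma clim_RtoC u l : is_lim_seq u (Finite l) -> clim (fun n => RtoC (u n)) (RtoC l).
Proof. intros H; split; simpl; [exact H|apply is_lim_seq_const]. Qed.

Lemma clim_unique u l m : clim u l -> clim u m -> l = m.
Proof.
  intros [A1 A2] [B1 B2].
  apply is_lim_seq_unique in A1, A2, B1, B2.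
  apply C_ext.
  - rewrite A1 in B1. now injection B1.
  - rewrite A2 in B2. now injection B2.
Qed.

Lemma clim_csum (f : nat -> nat -> C) (l : nat -> C) n :
  (forall k, (k < n)%nat -> clim (fun M => f M k) (l k)) ->
  clim (fun M => csum (f M) n) (csum l n).
Proof.
  induction n as [|n IH]; intros H; simpl; [apply clim_const|].
  apply clim_plus; [apply IH; intros; apply H; lia|apply H; lia].
Qed.

Lemma clim_incr_1 u l : clim u l -> clim (fun n => u (S n)) l.
Proof. intros [A1 A2]; split; [now apply (is_lim_seq_incr_1 (fun n => Re (u n)))|
  now apply (is_lim_seq_incr_1 (fun n => Im (u n)))]. Qed.

Lemma clim_decr_1 u l : clim (fun n => u (S n)) l -> clim u l.
Proof. intros [A1 A2]; split; [now apply (is_lim_seq_incr_1 (fun n => Re (u n)))|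
  now apply (is_lim_seq_incr_1 (fun n => Im (u n)))]. Qed.

Lemma squeeze0 (u e : nat -> R) l :
  eventually (fun n => Rabs (u n - l) <= e n) -> is_lim_seq e 0 -> is_lim_seq u (Finite l).
Proof.
  intros H He.
  apply is_lim_seq_le_le_loc with (fun n => l - e n) (fun n => l + e n).
  - eapply filter_imp; [|exact H]. intros n Hn. apply Rabs_le_between in Hn. lra.
  - replace (Finite l) with (Finite (l - 0)) by (f_equal; ring).
    apply is_lim_seq_minus'; [apply is_lim_seq_const|exact He].
  - replace (Finite l) with (Finite (l + 0)) by (f_equal; ring).
    apply is_lim_seq_plus'; [apply is_lim_seq_const|exact He].
Qed.

Lemma clim_squeeze_loc u l e : eventually (fun n => Cmod (Cminus (u n) l) <= e n) ->
  is_lim_seq e 0 -> clim u l.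
Proof.
  intros H He; split; (apply squeeze0 with e; [|exact He]);
    (eapply filter_imp; [|exact H]); intros n Hn; simpl.
  - replace (Re (u n) - Re l) with (Re (Cminus (u n) l)) by (unfold Re, Im; simpl; ring).
    eapply Rle_trans; [apply re_le_Cmod|exact Hn].
  - replace (Im (u n) - Im l) with (Im (Cminus (u n) l)) by (unfold Re, Im; simpl; ring).
    eapply Rle_trans; [apply im_le_Cmod|exact Hn].
Qed.

Lemma clim_squeeze u l e : (forall n, Cmod (Cminus (u n) l) <= e n) -> is_lim_seq e 0 -> clim u l.
Proof. intros H. apply clim_squeeze_loc. exists O. auto. Qed.

Lemma clim_Cmod u l : clim u l -> is_lim_seq (fun n => Cmod (Cminus (u n) l)) 0.
Proof.
  intros [H1 H2].
  apply squeeze0 with (fun n => Rabs (Re (u n) - Re l) + Rabs (Im (u n) - Im l)).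
  - exists O; intros n _. rewrite Rminus_0_r, Rabs_pos_eq by apply Cmod_ge_0.
    apply (Cmod_le_abs (Cminus (u n) l)).
  - replace (Finite 0) with (Finite (Rabs (Re l - Re l) + Rabs (Im l - Im l)))
      by (rewrite !Rminus_diag, Rabs_R0; f_equal; ring).
    apply is_lim_seq_plus'; apply (is_lim_seq_abs _ (Finite _));
      apply is_lim_seq_minus'; try apply is_lim_seq_const; assumption.
Qed.

Lemma clim_Cmod_le u l B : clim u l -> (eventually (fun n => Cmod (u n) <= B)) -> Cmod l <= B.
Proof.
  intros H HB. apply clim_Cmod in H.
  apply Rnot_lt_le; intros Hlt.
  apply is_lim_seq_spec in H. destruct (H (mkposreal _ (Rlt_Rminus _ _ Hlt))) as [N1 H1].
  destruct HB as [N2 H2].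
  specialize (H1 (max N1 N2) ltac:(lia)). specialize (H2 (max N1 N2) ltac:(lia)).
  simpl in H1. rewrite Rminus_0_r, Rabs_pos_eq in H1 by apply Cmod_ge_0.
  rewrite Cmod_minus_sym in H1.
  assert (H3 := Cmod_triangle (Cminus l (u (max N1 N2))) (u (max N1 N2))).
  replace (Cplus (Cminus l (u (max N1 N2))) (u (max N1 N2))) with l in H3 by ring.
  lra.
Qed.

(** Differentiation in a real variable, componentwise, so that increments can be bounded by the real
    mean value theorem. *)
Definition cderiv (f : R -> C) (x : R) (l : C) : Prop :=
  is_derive (fun t => Re (f t)) x (Re l) /\ is_derive (fun t => Im (f t)) x (Im l).

Lemma cderiv_ext f g x l : (forall t, f t = g t) -> cderiv f x l -> cderiv g x l.
Proof.
  intros E [H1 H2]; split; [eapply is_derive_ext; [|exact H1]|eapply is_derive_ext; [|exact H2]];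
    intros t; simpl; now rewrite E.
Qed.

Lemma cderiv_eq f x l m : cderiv f x l -> l = m -> cderiv f x m.
Proof. intros H <-; exact H. Qed.

Lemma cderiv_const c x : cderiv (fun _ => c) x (RtoC 0).
Proof. split; apply (is_derive_const (K := R_AbsRing) (V := R_NormedModule)). Qed.

Lemma cderiv_RtoC f x l : is_derive f x l -> cderiv (fun t => RtoC (f t)) x (RtoC l).
Proof. intros H; split; simpl; [exact H|apply (is_derive_const (K := R_AbsRing) (V := R_NormedModule))]. Qed.

Lemma cderiv_id x : cderiv RtoC x (RtoC 1).
Proof. apply (cderiv_RtoC (fun t => t)). apply (is_derive_id (K := R_AbsRing)). Qed.

Lemma cderiv_plus f g x l m : cderiv f x l -> cderiv g x m ->
  cderiv (fun t => Cplus (f t) (g t)) x (Cplus l m).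
Proof. intros [A1 A2] [B1 B2]; split; simpl; apply @is_derive_plus; assumption. Qed.

Lemma cderiv_opp f x l : cderiv f x l -> cderiv (fun t => Copp (f t)) x (Copp l).
Proof. intros [A1 A2]; split; simpl; apply @is_derive_opp; assumption. Qed.

Lemma cderiv_minus f g x l m : cderiv f x l -> cderiv g x m ->
  cderiv (fun t => Cminus (f t) (g t)) x (Cminus l m).
Proof. intros A B. apply cderiv_plus; [exact A|now apply cderiv_opp]. Qed.

Lemma is_derive_mult_R (f g : R -> R) x l m : is_derive f x l -> is_derive g x m ->
  is_derive (fun t => f t * g t) x (l * g x + f x * m).
Proof. intros A B. apply (is_derive_mult f g x l m A B). intros; apply Rmult_comm. Qed.

Lemma cderiv_mult f g x l m : cderiv f x l -> cderiv g x m ->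
  cderiv (fun t => Cmult (f t) (g t)) x (Cplus (Cmult l (g x)) (Cmult (f x) m)).
Proof.
  intros [A1 A2] [B1 B2]; split; simpl.
  - replace (fst l * fst (g x) - snd l * snd (g x) + (fst (f x) * fst m - snd (f x) * snd m))
      with ((Re l * Re (g x) + Re (f x) * Re m) - (Im l * Im (g x) + Im (f x) * Im m)) by (simpl; unfold Re, Im; ring).
    apply @is_derive_minus; now apply is_derive_mult_R.
  - replace (fst l * snd (g x) + snd l * fst (g x) + (fst (f x) * snd m + snd (f x) * fst m))
      with ((Re l * Im (g x) + Re (f x) * Im m) + (Im l * Re (g x) + Im (f x) * Re m)) by (simpl; unfold Re, Im; ring).
    apply @is_derive_plus; now apply is_derive_mult_R.
Qed.

Lemma cderiv_scal c f x l : cderiv f x l -> cderiv (fun t => Cmult c (f t)) x (Cmult c l).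
Proof.
  intros H. eapply cderiv_eq; [apply cderiv_mult; [apply cderiv_const|exact H]|]. simpl. ring.
Qed.

Lemma is_derive_comp_R (f g : R -> R) x l d : is_derive f (g x) l -> is_derive g x d ->
  is_derive (fun t => f (g t)) x (d * l).
Proof. intros A B. apply (is_derive_comp f g x l d A B). Qed.

Lemma cderiv_cexp f x l : cderiv f x l -> cderiv (fun t => cexp (f t)) x (Cmult l (cexp (f x))).
Proof.
  intros [A1 A2].
  assert (E1 := is_derive_comp_R exp (fun t => Re (f t)) x _ _ (is_derive_exp _) A1).
  assert (E2 := is_derive_comp_R cos (fun t => Im (f t)) x _ _ (is_derive_cos _) A2).
  assert (E3 := is_derive_comp_R sin (fun t => Im (f t)) x _ _ (is_derive_sin _) A2).
  split; unfold cexp.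
  - evar_last; [exact (is_derive_mult_R _ _ _ _ _ E1 E2)|unfold Re, Im; simpl; ring].
  - evar_last; [exact (is_derive_mult_R _ _ _ _ _ E1 E3)|unfold Re, Im; simpl; ring].
Qed.

Lemma Re_neq_0 z : Re z <> 0 -> z <> RtoC 0.
Proof. intros H E; apply H; rewrite E; reflexivity. Qed.

Lemma Cnormsq_pos z : z <> RtoC 0 -> 0 < Re z ^ 2 + Im z ^ 2.
Proof.
  intros H. destruct z as [a b]; simpl.
  destruct (Req_dec a 0) as [->|Ha].
  - destruct (Req_dec b 0) as [->|Hb]; [now elim H|].
    assert (0 < b * b) by nra. nra.
  - assert (0 < a * a) by nra. nra.
Qed.

Lemma is_derive_normsq f x l : cderiv f x l ->
  is_derive (fun t => Re (f t) ^ 2 + Im (f t) ^ 2) x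
    (2 * (Re l * Re (f x) + Im l * Im (f x))).
Proof.
  intros [A1 A2].
  assert (D := is_derive_plus (K := R_AbsRing) (V := R_NormedModule) _ _ _ _ _
    (is_derive_mult_R _ _ _ _ _ A1 A1) (is_derive_mult_R _ _ _ _ _ A2 A2)).
  eapply is_derive_ext; [|evar_last; [exact D|]].
  - intros t; unfold plus; simpl; ring.
  - unfold plus; simpl; ring.
Qed.

Lemma cderiv_inv f x l : cderiv f x l -> f x <> RtoC 0 ->
  cderiv (fun t => Cinv (f t)) x (Copp (Cdiv l (Cmult (f x) (f x)))).
Proof.
  intros H Hf. assert (Hp := Cnormsq_pos _ Hf).
  assert (D := is_derive_normsq _ _ _ H). destruct H as [A1 A2].
  assert (Di := is_derive_inv _ _ _ D (Rgt_not_eq _ _ Hp)).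
  assert (Hq : (Re (f x) * Re (f x) - Im (f x) * Im (f x)) ^ 2 + (Re (f x) * Im (f x) + Im (f x) * Re (f x)) ^ 2 <> 0).
  { replace (_ + _) with ((Re (f x) ^ 2 + Im (f x) ^ 2) ^ 2) by ring. apply pow_nonzero. lra. }
  split.
  - assert (E := is_derive_mult_R _ _ _ _ _ A1 Di).
    evar_last; [exact E|]. unfold Re, Im in *; simpl in *. field. split; lra.
  - assert (E := is_derive_mult_R _ _ _ _ _ (is_derive_opp (K := R_AbsRing) (V := R_NormedModule) _ _ _ A2) Di).
    evar_last; [exact E|]. unfold Re, Im, opp in *; simpl in *. field. split; lra.
Qed.

(** On the open right half-plane the principal argument is [atan (y / x)] in a whole neighbourhood,
    so the cut never interferes. All logarithms differentiated below are of [z + iu] or [z - iu]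
    with [Re z > 0]. *)
Lemma cderiv_clog f x l : cderiv f x l -> 0 < Re (f x) ->
  cderiv (fun t => clog (f t)) x (Cdiv l (f x)).
Proof.
  intros H Hp.
  assert (D := is_derive_normsq _ _ _ H). destruct H as [A1 A2].
  assert (Hpos : locally x (fun t => 0 < Re (f t))).
  { assert (Hc : continuous (fun t => Re (f t)) x).
    { apply @ex_derive_continuous. eexists; exact A1. }
    apply (Hc (fun v => 0 < v)). now apply open_gt. }
  assert (Hn : 0 < Re (f x) ^ 2 + Im (f x) ^ 2) by nra.
  split.
  - assert (E := is_derive_scal _ _ (/ 2) _ (is_derive_comp_R ln _ _ _ _ (is_derive_ln _ Hn) D)).
    eapply is_derive_ext_loc; [|evar_last; [exact E|]].
    + eapply filter_imp; [|exact Hpos]. intros t Ht. simpl.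
      unfold Cmod, Re, Im in *.
      assert (H2 : 0 < fst (f t) ^ 2 + snd (f t) ^ 2) by nra.
      replace (fst (f t) * (fst (f t) * 1) + snd (f t) * (snd (f t) * 1)) with
        (sqrt (fst (f t) ^ 2 + snd (f t) ^ 2) * sqrt (fst (f t) ^ 2 + snd (f t) ^ 2))
        by (rewrite sqrt_sqrt; [ring|lra]).
      rewrite ln_mult by (now apply sqrt_lt_R0). simpl. lra.
    + unfold Re, Im in *; simpl in *. field. lra.
  - assert (Da : is_derive atan (Im (f x) * / Re (f x)) (/ (1 + (Im (f x) * / Re (f x)) ^ 2)))
      by (apply is_derive_Reals, derivable_pt_lim_atan).
    assert (E := is_derive_comp_R atan _ _ _ _ Da
      (is_derive_mult_R _ _ _ _ _ A2 (is_derive_inv _ _ _ A1 (Rgt_not_eq _ _ Hp)))).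
    eapply is_derive_ext_loc; [|evar_last; [exact E|]].
    + eapply filter_imp; [|exact Hpos]. intros t Ht. simpl.
      unfold carg. destruct (Rlt_dec 0 (Re (f t))); [reflexivity|contradiction].
    + unfold Re, Im, Rsqr in *; simpl in *. field. repeat split; nra.
Qed.

Lemma cderiv_continuous f x l : cderiv f x l ->
  continuous (fun t => Re (f t)) x /\ continuous (fun t => Im (f t)) x.
Proof.
  intros [A1 A2]; split; apply @ex_derive_continuous; eexists; eassumption.
Qed.

(** The mean value theorem for [G - F] replaces the comparison of the integrals of [f] and [g].
    Derivatives are asked for only inside the interval, continuity up to its ends. *)
Lemma increment_le (F G f g : R -> R) a b : a <= b ->
  (forall t, a < t < b -> is_derive F t (f t)) ->
  (forall t, a < t < b -> is_derive G t (g t)) ->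
  (forall t, a <= t <= b -> continuity_pt F t) ->
  (forall t, a <= t <= b -> continuity_pt G t) ->
  (forall t, a < t < b -> f t <= g t) ->
  F b - F a <= G b - G a.
Proof.
  intros Hab HF HG CF CG Hfg.
  destruct (Req_dec a b) as [->|Hne]; [lra|].
  assert (D : forall c, a < c < b -> derivable_pt_lim (fun t => G t - F t) c (g c - f c)).
  { intros c P. apply is_derive_Reals.
    apply (is_derive_minus (K := R_AbsRing) (V := R_NormedModule)); [now apply HG|now apply HF]. }
  destruct (MVT (fun t => G t - F t) id a b
    (fun c P => exist _ (g c - f c) (D c P)) (fun c P => derivable_pt_id c)) as [c [P E]].
  - lra.
  - intros t Ht. apply continuity_pt_minus; [now apply CG|now apply CF].
  - intros t Ht. apply derivable_continuous_pt, derivable_pt_id.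
  - rewrite derive_pt_id in E. unfold id in E. simpl in E.
    specialize (Hfg c P). nra.
Qed.

Lemma increment_abs_le (F G f g : R -> R) a b : a <= b ->
  (forall t, a < t < b -> is_derive F t (f t)) ->
  (forall t, a < t < b -> is_derive G t (g t)) ->
  (forall t, a <= t <= b -> continuity_pt F t) ->
  (forall t, a <= t <= b -> continuity_pt G t) ->
  (forall t, a < t < b -> Rabs (f t) <= g t) ->
  Rabs (F b - F a) <= G b - G a.
Proof.
  intros Hab HF HG CF CG Hfg. apply Rabs_le. split.
  - assert (H := increment_le (fun t => - F t) G (fun t => - f t) g a b Hab).
    simpl in H. cut (- F b - - F a <= G b - G a); [lra|]. apply H; auto.
    + intros t Ht. apply @is_derive_opp. auto.
    + intros t Ht. apply continuity_pt_opp. auto.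
    + intros t Ht. specialize (Hfg t Ht). apply Rabs_le_between in Hfg. lra.
  - apply (increment_le F G f g a b Hab); auto.
    intros t Ht. specialize (Hfg t Ht). apply Rabs_le_between in Hfg. lra.
Qed.

Lemma is_derive_continuity_pt (f : R -> R) x l : is_derive f x l -> continuity_pt f x.
Proof. intros H. apply continuity_pt_filterlim, (ex_derive_continuous (K := R_AbsRing) (V := R_NormedModule)). eexists; exact H. Qed.

(** The factor 2 is the price of bounding real and imaginary parts separately; it reappears in the
    constants of [EM_bound] and [EM_order]. *)
Lemma cincrement_le (F f : R -> C) (G g : R -> R) a b : a <= b ->
  (forall t, a < t < b -> cderiv F t (f t)) ->
  (forall t, a < t < b -> is_derive G t (g t)) ->
  (forall t, a <= t <= b -> continuity_pt (fun t => Re (F t)) t /\ continuity_pt (fun t => Im (F t)) t) ->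
  (forall t, a <= t <= b -> continuity_pt G t) ->
  (forall t, a < t < b -> Cmod (f t) <= g t) ->
  Cmod (Cminus (F b) (F a)) <= 2 * (G b - G a).
Proof.
  intros Hab HF HG CF CG Hfg.
  eapply Rle_trans; [apply Cmod_le_abs|].
  assert (H1 : Rabs (Re (F b) - Re (F a)) <= G b - G a).
  { apply (increment_abs_le (fun t => Re (F t)) G (fun t => Re (f t)) g); auto.
    - intros t Ht. apply HF, Ht.
    - intros t Ht. apply CF, Ht.
    - intros t Ht. eapply Rle_trans; [apply re_le_Cmod|auto]. }
  assert (H2 : Rabs (Im (F b) - Im (F a)) <= G b - G a).
  { apply (increment_abs_le (fun t => Im (F t)) G (fun t => Im (f t)) g); auto.
    - intros t Ht. apply HF, Ht.
    - intros t Ht. apply CF, Ht.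
    - intros t Ht. eapply Rle_trans; [apply im_le_Cmod|auto]. }
  change (Re (Cminus (F b) (F a))) with (Re (F b) - Re (F a)).
  change (Im (Cminus (F b) (F a))) with (Im (F b) - Im (F a)). lra.
Qed.

(** * Fourier expansion of the generating kernel *)

Definition ei (th : R) : C := cexp (0, th).

Lemma cexp_plus z w : cexp (Cplus z w) = Cmult (cexp z) (cexp w).
Proof.
  unfold cexp. apply C_ext; simpl; rewrite exp_plus, ?cos_plus, ?sin_plus; unfold Re, Im; ring.
Qed.

Lemma cexp_0 : cexp (RtoC 0) = RtoC 1.
Proof. unfold cexp; apply C_ext; simpl; rewrite exp_0, ?cos_0, ?sin_0; ring. Qed.

Lemma Cmod_cexp z : Cmod (cexp z) = exp (Re z).
Proof.
  unfold Cmod, cexp; simpl.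
  replace (_ + _) with (exp (Re z) * exp (Re z) * ((sin (Im z))² + (cos (Im z))²)) by (unfold Rsqr; ring).
  rewrite sin2_cos2, Rmult_1_r. apply sqrt_square. left; apply exp_pos.
Qed.

Lemma cexp_neq_0 z : cexp z <> RtoC 0.
Proof. apply Cmod_gt_0. rewrite Cmod_cexp. apply exp_pos. Qed.

Lemma cexp_opp z : cexp (Copp z) = Cinv (cexp z).
Proof.
  assert (H : Cmult (cexp (Copp z)) (cexp z) = RtoC 1).
  { rewrite <- cexp_plus. replace (Cplus (Copp z) z) with (RtoC 0) by ring. apply cexp_0. }
  assert (Hz := cexp_neq_0 z).
  replace (cexp (Copp z)) with (Cmult (Cmult (cexp (Copp z)) (cexp z)) (Cinv (cexp z))) by (field; exact Hz).
  rewrite H. ring.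
Qed.

Lemma ei_plus a b : ei (a + b) = Cmult (ei a) (ei b).
Proof.
  unfold ei. rewrite <- cexp_plus. f_equal. apply C_ext; unfold Re, Im; simpl; ring.
Qed.

Lemma ei_0 : ei 0 = RtoC 1.
Proof. apply cexp_0. Qed.

Lemma Cmod_ei a : Cmod (ei a) = 1.
Proof. unfold ei. rewrite Cmod_cexp. apply exp_0. Qed.

Lemma ei_opp a : ei (- a) = Cinv (ei a).
Proof. unfold ei. rewrite <- cexp_opp. f_equal. apply C_ext; unfold Re, Im; simpl; ring. Qed.

Lemma ei_eq a : ei a = Cplus (RtoC (cos a)) (Cmult Ci (RtoC (sin a))).
Proof. unfold ei, cexp; apply C_ext; simpl; rewrite exp_0; ring. Qed.

Lemma ei_INR n a : ei (INR n * a) = Cpow (ei a) n.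
Proof.
  induction n as [|n IH]; [simpl; rewrite Rmult_0_l; apply ei_0|].
  rewrite S_INR, Rmult_plus_distr_r, Rmult_1_l, ei_plus, IH. simpl. ring.
Qed.

Lemma ei_2PI_Z k : ei (2 * PI * IZR k) = RtoC 1.
Proof.
  assert (Hn : forall n, ei (2 * PI * INR n) = RtoC 1).
  { intros n. rewrite ei_eq.
    replace (2 * PI * INR n) with (0 + 2 * INR n * PI) by ring.
    rewrite cos_period, sin_period, cos_0, sin_0. ring. }
  destruct (Z_le_gt_dec 0 k) as [H|H].
  - rewrite <- (Z2Nat.id k) by lia. rewrite <- INR_IZR_INZ. apply Hn.
  - replace (2 * PI * IZR k) with (- (2 * PI * INR (Z.to_nat (- k)))).
    + rewrite ei_opp, Hn. field.
    + rewrite INR_IZR_INZ, Z2Nat.id, opp_IZR by lia. ring.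
Qed.

(** Symmetric partial sums, the terms [m] and [-m] entering together: the Fourier series of the
    kernel has terms of size [1/m], and its sum is taken in this order. *)
Fixpoint zsum (g : Z -> C) (M : nat) : C :=
  match M with
  | O => g 0%Z
  | S M' => Cplus (zsum g M') (Cplus (g (Z.of_nat M)) (g (- Z.of_nat M)%Z))
  end.

Lemma zsum_ext f g M : (forall m, (Z.abs m <= Z.of_nat M)%Z -> f m = g m) -> zsum f M = zsum g M.
Proof.
  induction M as [|M IH]; intros H; [apply H; lia|]. cbn [zsum].
  rewrite IH by (intros; apply H; lia). rewrite !H by lia. reflexivity.
Qed.

Lemma zsum_plus f g M : zsum (fun m => Cplus (f m) (g m)) M = Cplus (zsum f M) (zsum g M).
Proof. induction M as [|M IH]; cbn [zsum]; [reflexivity|rewrite IH; ring]. Qed.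

Lemma zsum_scal c f M : zsum (fun m => Cmult c (f m)) M = Cmult c (zsum f M).
Proof. induction M as [|M IH]; cbn [zsum]; [reflexivity|rewrite IH; ring]. Qed.

Lemma zsum_opp_idx f M : zsum (fun m => f (- m)%Z) M = zsum f M.
Proof.
  induction M as [|M IH]; cbn [zsum]; [reflexivity|]. rewrite IH, Z.opp_involutive. ring.
Qed.

Lemma cderiv_zsum (f : Z -> R -> C) (l : Z -> C) x M :
  (forall m, cderiv (f m) x (l m)) -> cderiv (fun t => zsum (fun m => f m t) M) x (zsum l M).
Proof.
  intros H; induction M as [|M IH]; cbn [zsum]; [apply H|].
  apply cderiv_plus; [exact IH|apply cderiv_plus; apply H].
Qed.

Definition wz (a : R) (m : Z) : C := ei (2 * PI * IZR m * a).

Lemma Cmod_wz a m : Cmod (wz a m) = 1.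
Proof. apply Cmod_ei. Qed.

Definition cz (t : C) (m : Z) : C := Cinv (Cplus t (0, 2 * PI * IZR m)).

Lemma cz_den_neq_0 t m : Re t <> 0 -> Cplus t (0, 2 * PI * IZR m) <> RtoC 0.
Proof. intros H. apply Re_neq_0. simpl. unfold Re in H. lra. Qed.

Definition gsum (t : C) (a : R) (M : nat) : C := zsum (fun m => Cmult (wz a m) (cz t m)) M.

Lemma cderiv_cexp_lin t x : cderiv (fun v => cexp (Cmult t (RtoC v))) x (Cmult t (cexp (Cmult t (RtoC x)))).
Proof.
  eapply cderiv_eq; [apply (cderiv_cexp (fun v => Cmult t (RtoC v))), cderiv_scal, cderiv_id|]. cbv beta. ring.
Qed.

Lemma cderiv_ei_lin c x : cderiv (fun v => ei (c * v)) x (Cmult (0, c) (ei (c * x))).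
Proof.
  apply cderiv_ext with (fun v => cexp (Cmult (0, c) (RtoC v))).
  - intros v. unfold ei. f_equal. apply C_ext; unfold Re, Im; simpl; ring.
  - eapply cderiv_eq; [apply cderiv_cexp_lin|]. unfold ei. do 2 f_equal. apply C_ext; unfold Re, Im; simpl; ring.
Qed.

(** The factor [e^{tv}] turns each Fourier term into a primitive: its derivative loses the
    denominator [t + 2 pi i m], and what remains is [e^{tv}] times the Dirichlet kernel. Limits of
    [gsum] thus become Riemann-Lebesgue statements. *)
Lemma cderiv_exp_gsum t M x : Re t <> 0 ->
  cderiv (fun v => Cmult (cexp (Cmult t (RtoC v))) (gsum t v M)) x
    (Cmult (cexp (Cmult t (RtoC x))) (zsum (wz x) M)).
Proof.
  intros Ht.
  assert (D : cderiv (fun v => gsum t v M) x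
     (zsum (fun m => Cmult (Cmult (0, 2 * PI * IZR m) (wz x m)) (cz t m)) M)).
  { unfold gsum. apply (cderiv_zsum (fun m v => Cmult (wz v m) (cz t m))). intros m.
    eapply cderiv_eq; [apply cderiv_mult; [apply cderiv_ei_lin|apply cderiv_const]|].
    unfold wz. ring. }
  eapply cderiv_eq; [apply cderiv_mult; [apply cderiv_cexp_lin|exact D]|].
  cbv beta.
  replace (Cmult (Cmult t (cexp (Cmult t (RtoC x)))) (gsum t x M)) with
    (Cmult (cexp (Cmult t (RtoC x))) (Cmult t (gsum t x M))) by ring.
  rewrite <- Cmult_plus_distr_l. f_equal.
  unfold gsum. rewrite <- zsum_scal, <- zsum_plus. apply zsum_ext. intros m _.
  unfold cz. field. now apply cz_den_neq_0.
Qed.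

Lemma dirichlet_kernel v M :
  Cmult (RtoC (sin (PI * v))) (zsum (wz v) M) = RtoC (sin ((2 * INR M + 1) * PI * v)).
Proof.
  induction M as [|M IH].
  - simpl. unfold wz. replace (2 * PI * 0 * v) with 0 by ring. rewrite ei_0.
    replace ((2 * 0 + 1) * PI * v) with (PI * v) by ring. ring.
  - cbn [zsum]. rewrite Cmult_plus_distr_l, IH.
    unfold wz. rewrite opp_IZR, <- INR_IZR_INZ.
    replace (2 * PI * - INR (S M) * v) with (- (2 * PI * INR (S M) * v)) by ring.
    rewrite !ei_eq, cos_neg, sin_neg.
    replace ((2 * INR (S M) + 1) * PI * v) with (2 * PI * INR (S M) * v + PI * v) by ring.
    replace ((2 * INR M + 1) * PI * v) with (2 * PI * INR (S M) * v - PI * v) by (rewrite S_INR; ring).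
    rewrite sin_plus, sin_minus. apply C_ext; unfold Re, Im; simpl; ring.
Qed.

(** From [y cos y <= sin y] at [y = x/2]: [sin x = 2 sin(x/2) cos(x/2) >= x cos(x/2)^2], and
    [cos(x/2)^2 >= 1/2] because [cos x >= 0]. *)
Lemma sin_ge_half x : 0 <= x <= PI / 2 -> x / 2 <= sin x.
Proof.
  intros Hx.
  assert (Ht : forall y, 0 <= y <= PI / 2 -> y * cos y <= sin y).
  { intros y Hy.
    assert (H := increment_le (fun _ => 0) (fun t => sin t - t * cos t) (fun _ => 0) (fun t => t * sin t) 0 y).
    cut (0 - 0 <= sin y - y * cos y - (sin 0 - 0 * cos 0)); [rewrite sin_0; lra|].
    assert (D : forall t, is_derive (fun t => sin t - t * cos t) t (t * sin t)).
    { intros t. auto_derive; [trivial|ring]. }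
    apply H; [lra| | | | |].
    - intros t _. apply (is_derive_const (K := R_AbsRing) (V := R_NormedModule)).
    - intros t _. apply D.
    - intros t _. apply continuity_pt_const. intros ? ?; reflexivity.
    - intros t _. eapply is_derive_continuity_pt, D.
    - intros t Ht. assert (0 <= sin t) by (apply sin_ge_0; lra). nra. }
  assert (H1 := Ht (x / 2) ltac:(lra)).
  replace x with (2 * (x / 2)) at 2 by field. rewrite sin_2a.
  assert (Hc : 0 <= cos (x / 2)) by (apply cos_ge_0; lra).
  assert (Hx0 : 0 <= cos x) by (apply cos_ge_0; lra).
  replace x with (2 * (x / 2)) in Hx0 at 1 by field. rewrite cos_2a_cos in Hx0.
  assert (Hs : / 2 <= cos (x / 2) * cos (x / 2)) by lra.
  assert (x / 2 * (/2) <= x / 2 * (cos (x / 2) * cos (x / 2))) by (apply Rmult_le_compat_l; lra).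
  nra.
Qed.

(* Integration by parts against [sin (lam v)], phrased through the corrected primitive
   [J + q cos(lam v) / lam], whose derivative is [q1 cos(lam v) / lam]. *)
Lemma riemann_lebesgue (J q q1 : R -> C) lam B a b : a <= b -> 0 < lam ->
  (forall v, a <= v <= b -> cderiv J v (Cmult (q v) (RtoC (sin (lam * v))))) ->
  (forall v, a <= v <= b -> cderiv q v (q1 v)) ->
  (forall v, a <= v <= b -> Cmod (q v) <= B) ->
  (forall v, a <= v <= b -> Cmod (q1 v) <= B) ->
  Cmod (Cminus (J b) (J a)) <= (2 * B * (b - a) + 2 * B) / lam.
Proof.
  intros Hab Hl HJ Hq Bq Bq1.
  set (K := fun v => Cplus (J v) (Cmult (q v) (RtoC (cos (lam * v) / lam)))).
  assert (DK : forall v, a <= v <= b -> cderiv K v (Cmult (q1 v) (RtoC (cos (lam * v) / lam)))).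
  { intros v Hv. eapply cderiv_eq.
    - apply cderiv_plus; [apply HJ, Hv|]. apply cderiv_mult; [apply Hq, Hv|].
      apply cderiv_RtoC with (l := - sin (lam * v)).
      auto_derive; [lra|field; lra].
    - rewrite RtoC_opp. ring. }
  assert (Hcos : forall v, Rabs (cos (lam * v) / lam) <= / lam).
  { intros v. unfold Rdiv. rewrite Rabs_mult, (Rabs_pos_eq (/ lam)) by (left; now apply Rinv_0_lt_compat).
    rewrite <- (Rmult_1_l (/ lam)) at 2. apply Rmult_le_compat_r; [left; now apply Rinv_0_lt_compat|].
    apply Rabs_le. assert (H := COS_bound (lam * v)). lra. }
  assert (HB : 0 <= B) by (eapply Rle_trans; [apply Cmod_ge_0|apply (Bq a); lra]).
  assert (H1 : Cmod (Cminus (K b) (K a)) <= 2 * (B / lam * b - B / lam * a)).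
  { apply (cincrement_le K (fun v => Cmult (q1 v) (RtoC (cos (lam * v) / lam)))
      (fun t => B / lam * t) (fun _ => B / lam)); auto.
    - intros t Ht. apply DK; lra.
    - intros t _. auto_derive; [trivial|ring].
    - intros t Ht. destruct (DK t Ht) as [D1 D2].
      split; eapply is_derive_continuity_pt; eassumption.
    - intros t _. apply (is_derive_continuity_pt _ _ (B / lam)). auto_derive; [trivial|ring].
    - intros t Ht. rewrite Cmod_mult, Cmod_R.
      apply Rmult_le_compat; [apply Cmod_ge_0|apply Rabs_pos|apply Bq1; lra|apply Hcos]. }
  assert (H2 : forall v, a <= v <= b -> Cmod (Cmult (q v) (RtoC (cos (lam * v) / lam))) <= B / lam).
  { intros v Hv. rewrite Cmod_mult, Cmod_R.
    apply Rmult_le_compat; [apply Cmod_ge_0|apply Rabs_pos|apply Bq; lra|apply Hcos]. }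
  replace (Cminus (J b) (J a)) with
    (Cplus (Cminus (K b) (K a)) (Cminus (Cmult (q a) (RtoC (cos (lam * a) / lam)))
        (Cmult (q b) (RtoC (cos (lam * b) / lam))))) by (unfold K; ring).
  eapply Rle_trans; [apply Cmod_triangle|].
  assert (H3 := Cmod_triangle (Cmult (q a) (RtoC (cos (lam * a) / lam)))
     (Copp (Cmult (q b) (RtoC (cos (lam * b) / lam))))).
  rewrite Cmod_opp in H3.
  assert (Ha := H2 a ltac:(lra)). assert (Hb := H2 b ltac:(lra)).
  unfold Cminus at 2. replace ((2 * B * (b - a) + 2 * B) / lam) with
    (2 * (B / lam * b - B / lam * a) + (B / lam + B / lam)) by (field; lra).
  lra.
Qed.

Lemma is_lim_seq_inv_INR : is_lim_seq (fun n => / INR (S n)) 0.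
Proof.
  apply (is_lim_seq_incr_1 (fun n => / INR n)).
  apply (is_lim_seq_inv INR p_infty); [apply is_lim_seq_INR|discriminate].
Qed.

Lemma is_lim_seq_div_INR B : is_lim_seq (fun n => B / INR (S n)) 0.
Proof.
  replace (Finite 0) with (Finite (B * 0)) by (f_equal; ring).
  apply is_lim_seq_mult'; [apply is_lim_seq_const|apply is_lim_seq_inv_INR].
Qed.

(** The Riemann-Lebesgue estimate is applied on [[e, 1/2]], away from the zero of [sin (pi v)], with
    a bound independent of [e]; continuity carries it to [e = 0]. *)
Lemma Cmod_le_at_limit (J : R -> C) z B d : 0 < d ->
  continuity_pt (fun t => Re (J t)) 0 -> continuity_pt (fun t => Im (J t)) 0 ->
  (forall e, 0 < e < d -> Cmod (Cminus z (J e)) <= B) -> Cmod (Cminus z (J 0)) <= B.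
Proof.
  intros Hd C1 C2 H.
  apply clim_Cmod_le with (u := fun n => Cminus z (J (/ INR (S n)))).
  - apply clim_minus; [apply clim_const|].
    split; [apply (is_lim_seq_continuous (fun t => Re (J t)))|apply (is_lim_seq_continuous (fun t => Im (J t)))];
      try assumption; apply is_lim_seq_inv_INR.
  - assert (L := is_lim_seq_inv_INR). apply is_lim_seq_spec in L.
    destruct (L (mkposreal d Hd)) as [N HN]. exists N. intros n Hn. apply H.
    specialize (HN n Hn). cbv beta in HN. rewrite Rminus_0_r in HN.
    assert (0 < / INR (S n)) by (apply Rinv_0_lt_compat, lt_0_INR; lia).
    apply Rabs_def2 in HN. cbn [pos] in HN. lra.
Qed.

Lemma Cmod_cexp_minus_1 t v : 0 <= v <= / 2 ->
  Cmod (Cminus (cexp (Cmult t (RtoC v))) (RtoC 1)) <= 2 * Cmod t * exp (Cmod t) * v.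
Proof.
  intros Hv.
  replace (RtoC 1) with (cexp (Cmult t (RtoC 0))) by (rewrite Cmult_0_r; apply cexp_0).
  replace (2 * Cmod t * exp (Cmod t) * v) with (2 * (Cmod t * exp (Cmod t) * v - Cmod t * exp (Cmod t) * 0)) by ring.
  apply (cincrement_le (fun v => cexp (Cmult t (RtoC v))) (fun v => Cmult t (cexp (Cmult t (RtoC v))))
    (fun v => Cmod t * exp (Cmod t) * v) (fun _ => Cmod t * exp (Cmod t))); [lra| | | | |].
  - intros x _. apply cderiv_cexp_lin.
  - intros x _. auto_derive; [trivial|ring].
  - intros x _. destruct (cderiv_cexp_lin t x) as [D1 D2]; split; eapply is_derive_continuity_pt; eassumption.
  - intros x _. apply (is_derive_continuity_pt _ _ (Cmod t * exp (Cmod t))). auto_derive; [trivial|ring].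
  - intros x Hx. rewrite Cmod_mult, Cmod_cexp.
    apply Rmult_le_compat_l; [apply Cmod_ge_0|].
    assert (H := re_le_Cmod t). apply Rabs_le_between in H. assert (H0 := Cmod_ge_0 t).
    assert (Hle : Re (Cmult t (RtoC x)) <= Cmod t) by (rewrite re_scal_r; nra).
    destruct Hle as [Hlt|Heq]; [left; now apply exp_increasing|rewrite Heq; lra].
Qed.

(** The primitive of the Dirichlet kernel that vanishes at 0. Subtracting it replaces [e^{tv}] by
    [e^{tv} - 1], which vanishes at 0 together with [sin (pi v)]; its value 1/2 at [v = 1/2], half
    the mass of the kernel on a period, is the limit in [gsum_half_minus_gsum_0]. *)
Definition dprim (M : nat) (v : R) : C :=
  Cplus (RtoC v) (csum (fun k => RtoC (sin (2 * PI * INR (S k) * v) / (PI * INR (S k)))) M).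

Lemma cderiv_dprim M v : cderiv (dprim M) v (zsum (wz v) M).
Proof.
  induction M as [|M IH].
  - apply cderiv_ext with RtoC; [intros t; unfold dprim; simpl; ring|].
    cbn [zsum]. unfold wz. replace (2 * PI * 0 * v) with 0 by ring. rewrite ei_0. apply cderiv_id.
  - cbn [zsum].
    apply cderiv_ext with (fun v0 => Cplus (dprim M v0) (RtoC (sin (2 * PI * INR (S M) * v0) / (PI * INR (S M))))).
    { intros; unfold dprim; cbn [csum]; ring. }
    apply cderiv_plus; [exact IH|].
    assert (HS : INR (S M) <> 0) by (apply not_0_INR; lia). assert (Hpi := PI_neq0).
    eapply cderiv_eq; [apply cderiv_RtoC with (l := 2 * cos (2 * PI * INR (S M) * v))|].
    + clear IH. revert HS. generalize (INR (S M)). intros s HS. auto_derive; [trivial|field; split; assumption].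
    + unfold wz. rewrite opp_IZR, <- INR_IZR_INZ.
      replace (2 * PI * - INR (S M) * v) with (- (2 * PI * INR (S M) * v)) by ring.
      rewrite !ei_eq, cos_neg, sin_neg. apply C_ext; unfold Re, Im; simpl; ring.
Qed.

Lemma dprim_half M : dprim M (/ 2) = RtoC (/ 2).
Proof.
  unfold dprim. rewrite (csum_ext _ (fun _ => RtoC 0)).
  - rewrite csum_const. ring.
  - intros k _. f_equal. replace (2 * PI * INR (S k) * / 2) with (INR (S k) * PI) by field.
    rewrite (INR_IZR_INZ (S k)). rewrite (sin_eq_0_1 (IZR _ * PI)) by (eexists; reflexivity).
    unfold Rdiv; ring.
Qed.

Lemma dprim_0 M : dprim M 0 = RtoC 0.
Proof.
  unfold dprim. rewrite (csum_ext _ (fun _ => RtoC 0)).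
  - rewrite csum_const. ring.
  - intros k _. f_equal. rewrite Rmult_0_r, sin_0. unfold Rdiv; ring.
Qed.

Lemma is_lim_seq_div_odd B : is_lim_seq (fun M => B / ((2 * INR M + 1) * PI)) 0.
Proof.
  apply squeeze0 with (fun M => Rabs B / INR (S M)).
  - exists O. intros M _. rewrite Rminus_0_r. unfold Rdiv. rewrite Rabs_mult.
    assert (HM := pos_INR M). assert (Hpi := PI_RGT_0). assert (Hp2 := PI2_1).
    rewrite S_INR. rewrite (Rabs_pos_eq (/ _)) by (left; apply Rinv_0_lt_compat; nra).
    apply Rmult_le_compat_l; [apply Rabs_pos|]. apply Rinv_le_contravar; nra.
  - apply is_lim_seq_div_INR.
Qed.

Lemma PI_ge_2 : 2 <= PI.
Proof. assert (H := PI2_1). lra. Qed.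

(* [q = (e^{tv}-1)/sin(pi v)] has a removable singularity at [v = 0]; both [q] and [q'] stay
   bounded because the numerator of [q'] vanishes to second order there. *)
Lemma gsum_half_minus_gsum_0 t : Re t <> 0 ->
  clim (fun M => Cminus (Cmult (cexp (Cmult t (RtoC (/ 2)))) (gsum t (/ 2) M)) (gsum t 0 M)) (RtoC (/ 2)).
Proof.
  intros Ht.
  set (E := fun v : R => cexp (Cmult t (RtoC v))).
  set (c0 := 2 * Cmod t * exp (Cmod t)).
  assert (Hc0 : 0 <= c0).
  { unfold c0. apply Rmult_le_pos; [|left; apply exp_pos]. assert (H := Cmod_ge_0 t). lra. }
  assert (HE : forall v, 0 <= v <= / 2 -> Cmod (Cminus (E v) (RtoC 1)) <= c0 * v).
  { intros v Hv. apply Cmod_cexp_minus_1, Hv. }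
  assert (Hpi := PI_ge_2).
  assert (Hsin : forall v, 0 <= v <= / 2 -> v <= sin (PI * v)).
  { intros v Hv. assert (H := sin_ge_half (PI * v)). assert (PI * v / 2 <= sin (PI * v)) by (apply H; nra). nra. }
  assert (Hsin2 : forall v, 0 <= v -> Rabs (sin (PI * v)) <= PI * v).
  { intros v Hv. destruct (Req_dec v 0) as [->|Hv0]; [rewrite Rmult_0_r, sin_0, Rabs_R0; lra|].
    assert (0 < PI * v) by nra.
    apply Rabs_le. split.
    - assert (Hu := sin_lt_x (PI * v) ltac:(lra)).
      destruct (Rle_dec (PI * v) 1) as [H1|H1].
      + assert (0 <= sin (PI * v)) by (apply sin_ge_0; lra). lra.
      + assert (H2 := SIN_bound (PI * v)). lra.
    - left. now apply sin_lt_x. }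
  set (N := fun v : R => Cminus (Cmult (Cmult t (E v)) (RtoC (sin (PI * v))))
     (Cmult (RtoC (PI * cos (PI * v))) (Cminus (E v) (RtoC 1)))).
  set (N1 := fun v : R => Cmult (RtoC (sin (PI * v)))
     (Cplus (Cmult (Cmult t t) (E v)) (Cmult (RtoC (PI * PI)) (Cminus (E v) (RtoC 1))))).
  assert (DE : forall v, cderiv E v (Cmult t (E v))) by (intros v; apply cderiv_cexp_lin).
  assert (DN : forall v, cderiv N v (N1 v)).
  { intros v. eapply cderiv_eq.
    - apply cderiv_minus.
      + apply cderiv_mult; [apply cderiv_scal, DE|].
        apply cderiv_RtoC with (l := PI * cos (PI * v)). auto_derive; [trivial|ring].
      + apply cderiv_mult; [apply cderiv_RtoC with (l := - (PI * PI * sin (PI * v))); auto_derive; [trivial|ring]|].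
        apply cderiv_minus; [apply DE|apply cderiv_const].
    - unfold N1. rewrite RtoC_opp, !RtoC_mult. ring. }
  set (c1 := PI * (Cmod t * Cmod t * (1 + c0) + PI * PI * c0)).
  assert (HN1 : forall v, 0 <= v <= / 2 -> Cmod (N1 v) <= c1 * v).
  { intros v Hv. unfold N1. rewrite Cmod_mult, Cmod_R. unfold c1.
    replace (PI * (Cmod t * Cmod t * (1 + c0) + PI * PI * c0) * v) with
      ((PI * v) * (Cmod t * Cmod t * (1 + c0) + PI * PI * c0)) by ring.
    apply Rmult_le_compat; [apply Rabs_pos|apply Cmod_ge_0|apply Hsin2; lra|].
    eapply Rle_trans; [apply Cmod_triangle|]. rewrite !Cmod_mult, Cmod_R, (Rabs_pos_eq (PI * PI)) by nra.
    assert (H := HE v Hv). assert (Ht0 := Cmod_ge_0 t).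
    assert (HEv : Cmod (E v) <= 1 + c0).
    { replace (E v) with (Cplus (Cminus (E v) (RtoC 1)) (RtoC 1)) by ring.
      eapply Rle_trans; [apply Cmod_triangle|]. rewrite Cmod_1. nra. }
    apply Rplus_le_compat.
    - apply Rmult_le_compat_l; [nra|exact HEv].
    - apply Rmult_le_compat_l; [nra|]. nra. }
  assert (HN0 : N 0 = RtoC 0).
  { unfold N, E. rewrite Rmult_0_r, sin_0, !Cmult_0_r, cexp_0. ring. }
  assert (HN : forall v, 0 <= v <= / 2 -> Cmod (N v) <= c1 * (v * v)).
  { intros v Hv. replace (N v) with (Cminus (N v) (N 0)) by (rewrite HN0; ring).
    replace (c1 * (v * v)) with (2 * (c1 * (v * v / 2) - c1 * (0 * 0 / 2))) by field.
    apply (cincrement_le N N1 (fun v => c1 * (v * v / 2)) (fun v => c1 * v)); [lra| | | | |].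
    - intros x _. apply DN.
    - intros x _. auto_derive; [trivial|field].
    - intros x _. destruct (DN x) as [D1 D2]; split; eapply is_derive_continuity_pt; eassumption.
    - intros x _. apply (is_derive_continuity_pt _ _ (c1 * x)). auto_derive; [trivial|field].
    - intros x Hx. apply HN1; lra. }
  set (q := fun v : R => Cmult (Cminus (E v) (RtoC 1)) (Cinv (RtoC (sin (PI * v))))).
  set (q1 := fun v : R => Cmult (N v) (Cinv (Cmult (RtoC (sin (PI * v))) (RtoC (sin (PI * v)))))).
  set (B := c0 + c1).
  assert (Hc1 : 0 <= c1) by (unfold c1; assert (H := Cmod_ge_0 t); assert (0 <= Cmod t * Cmod t) by nra; assert (0 <= Cmod t * Cmod t * (1 + c0)) by nra; assert (0 <= PI * PI * c0) by nra; nra).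
  set (J := fun M v => Cminus (Cmult (E v) (gsum t v M)) (dprim M v)).
  assert (Hs0 : forall v, 0 < v <= / 2 -> RtoC (sin (PI * v)) <> RtoC 0).
  { intros v Hv H. apply RtoC_inj in H. assert (H1 := Hsin v ltac:(lra)). lra. }
  assert (Hmain : forall M, Cmod (Cminus (J M (/ 2)) (J M 0)) <= (4 * B) / ((2 * INR M + 1) * PI)).
  { intros M. set (lam := (2 * INR M + 1) * PI).
    assert (Hlam : 0 < lam) by (unfold lam; assert (H := pos_INR M); nra).
    assert (DJ : forall v, cderiv (J M) v (Cmult (Cminus (E v) (RtoC 1)) (zsum (wz v) M))).
    { intros v. eapply cderiv_eq.
      - apply cderiv_minus; [apply (cderiv_exp_gsum t M v Ht)|apply cderiv_dprim].
      - unfold E. ring. }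
    apply Cmod_le_at_limit with (/ 2); [lra| | |].
    - destruct (DJ 0) as [D1 _]. eapply is_derive_continuity_pt; exact D1.
    - destruct (DJ 0) as [_ D2]. eapply is_derive_continuity_pt; exact D2.
    - intros e He.
      eapply Rle_trans; [apply (riemann_lebesgue (J M) q q1 lam B e (/ 2)); auto; try lra|].
      + intros v Hv. eapply cderiv_eq; [apply DJ|]. unfold q, lam.
        rewrite <- dirichlet_kernel. field. apply Hs0. lra.
      + intros v Hv. eapply cderiv_eq.
        * apply cderiv_mult; [apply cderiv_minus; [apply DE|apply cderiv_const]|].
          apply cderiv_inv; [|apply Hs0; lra].
          apply cderiv_RtoC with (l := PI * cos (PI * v)). auto_derive; [trivial|ring].
        * unfold q1, N. field. apply Hs0; lra.
      + intros v Hv. unfold q. rewrite Cmod_mult, Cmod_inv, Cmod_R by (apply Hs0; lra).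
        assert (H1 := Hsin v ltac:(lra)). assert (H2 := HE v ltac:(lra)).
        rewrite Rabs_pos_eq by lra.
        apply Rmult_le_reg_r with (sin (PI * v)); [lra|].
        rewrite Rmult_assoc, Rinv_l, Rmult_1_r by lra. unfold B. nra.
      + intros v Hv. unfold q1. rewrite Cmod_mult, Cmod_inv, Cmod_mult, Cmod_R
          by (apply Cmult_neq_0; apply Hs0; lra).
        assert (H1 := Hsin v ltac:(lra)). assert (H2 := HN v ltac:(lra)).
        rewrite Rabs_pos_eq by lra.
        apply Rmult_le_reg_r with (sin (PI * v) * sin (PI * v)); [nra|].
        rewrite Rmult_assoc, Rinv_l, Rmult_1_r by nra.
        assert (v * v <= sin (PI * v) * sin (PI * v)) by nra. unfold B. nra.
      + unfold Rdiv. apply Rmult_le_compat_r; [left; now apply Rinv_0_lt_compat|].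
        assert (0 <= B) by (unfold B; lra). nra. }
  apply clim_squeeze with (fun M => (4 * B) / ((2 * INR M + 1) * PI)); [|apply is_lim_seq_div_odd].
  intros M. eapply Rle_trans; [|apply (Hmain M)]. right. f_equal. unfold J.
  rewrite dprim_half, dprim_0.
  replace (E 0) with (RtoC 1) by (unfold E; rewrite Cmult_0_r; symmetry; apply cexp_0).
  unfold E. ring.
Qed.

Lemma gsum_opp t v M : Re t <> 0 -> gsum (Copp t) v M = Copp (gsum t (- v) M).
Proof.
  intros Ht. unfold gsum. rewrite <- zsum_opp_idx.
  replace (Copp (zsum (fun m => Cmult (wz (- v) m) (cz t m)) M)) with
    (Cmult (Copp (RtoC 1)) (zsum (fun m => Cmult (wz (- v) m) (cz t m)) M)) by ring.
  rewrite <- zsum_scal. apply zsum_ext. intros m _.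
  unfold wz, cz. rewrite opp_IZR.
  replace (2 * PI * - IZR m * v) with (2 * PI * IZR m * - v) by ring.
  replace (Cplus (Copp t) (0, 2 * PI * - IZR m)) with (Copp (Cplus t (0, 2 * PI * IZR m)))
    by (apply C_ext; unfold Re, Im; simpl; ring).
  field. now apply cz_den_neq_0.
Qed.

Lemma gsum_opp_half t M : gsum t (- / 2) M = gsum t (/ 2) M.
Proof.
  unfold gsum. apply zsum_ext. intros m _. f_equal. unfold wz.
  replace (2 * PI * IZR m * / 2) with (2 * PI * IZR m * - / 2 + 2 * PI * IZR m) by field.
  rewrite ei_plus, ei_2PI_Z. ring.
Qed.

Lemma cexp_neq_1 t : 0 < Re t -> cexp t <> RtoC 1.
Proof.
  intros Ht H. assert (E := Cmod_cexp t). rewrite H, Cmod_1 in E.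
  assert (H1 := exp_increasing 0 (Re t) Ht). rewrite exp_0 in H1. lra.
Qed.

(** The limits [X] at 1/2 and [Y] at 0 are tied by one linear relation for [t] and, through
    [m -> -m], by a second one for [-t]. With [e = e^{t/2}] the relations [e X - Y = 1/2] and
    [Y - X/e = 1/2] determine both. *)
Lemma gsum_half_lim t : 0 < Re t ->
  clim (fun M => gsum t (/ 2) M) (Cdiv (cexp (Cmult t (RtoC (/ 2)))) (Cminus (cexp t) (RtoC 1))) /\
  clim (fun M => gsum t 0 M) (Cplus (RtoC (/ 2)) (Cinv (Cminus (cexp t) (RtoC 1)))).
Proof.
  intros Ht.
  assert (H1 := gsum_half_minus_gsum_0 t ltac:(lra)).
  assert (H2 := gsum_half_minus_gsum_0 (Copp t) ltac:(unfold Re in *; simpl; lra)).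
  set (e := cexp (Cmult t (RtoC (/ 2)))) in *.
  assert (He : e <> RtoC 0) by apply cexp_neq_0.
  assert (Hee : cexp t = Cmult e e).
  { unfold e. rewrite <- cexp_plus. f_equal. apply C_ext; unfold Re, Im; simpl; field. }
  assert (Hne : Cminus (Cmult e e) (RtoC 1) <> RtoC 0).
  { rewrite <- Hee. intros H. apply (cexp_neq_1 t Ht).
    replace (cexp t) with (Cplus (Cminus (cexp t) (RtoC 1)) (RtoC 1)) by ring. rewrite H. ring. }
  assert (H3 : clim (fun M => Cplus (Copp (Cmult (Cinv e) (gsum t (/ 2) M))) (gsum t 0 M)) (RtoC (/ 2))).
  { eapply clim_ext; [|exact H2]. intros M. cbv beta.
    replace (Cmult (Copp t) (RtoC (/ 2))) with (Copp (Cmult t (RtoC (/ 2)))) by ring.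
    rewrite cexp_opp, !gsum_opp, gsum_opp_half, Ropp_0 by lra. fold e. ring. }
  assert (HX : clim (fun M => gsum t (/ 2) M) (Cdiv e (Cminus (Cmult e e) (RtoC 1)))).
  { eapply clim_ext; [|eapply clim_eq; [exact (clim_scal (Cdiv e (Cminus (Cmult e e) (RtoC 1))) _ _ (clim_plus _ _ _ _ H1 H3))|]].
    - intros M. cbv beta. field. split; assumption.
    - rewrite <- RtoC_plus. replace (/ 2 + / 2) with 1 by field. ring. }
  rewrite Hee. split; [exact HX|].
  eapply clim_ext; [|eapply clim_eq; [exact (clim_minus _ _ _ _ (clim_scal e _ _ HX) H1)|]].
  - intros M. cbv beta. ring.
  - rewrite RtoC_inv by lra. field. exact Hne.
Qed.

Lemma cderiv_bounded f a b : a <= b -> (forall v, a <= v <= b -> exists l, cderiv f v l) ->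
  exists B, forall v, a <= v <= b -> Cmod (f v) <= B.
Proof.
  intros Hab H.
  destruct (continuity_ab_maj (fun v => Rabs (Re (f v)) + Rabs (Im (f v))) a b Hab) as [x [Hx _]].
  - intros c Hc. destruct (H c Hc) as [l [D1 D2]].
    apply continuity_pt_plus.
    + apply (continuity_pt_comp (fun v => Re (f v)) Rabs); [eapply is_derive_continuity_pt; exact D1|apply Rcontinuity_abs].
    + apply (continuity_pt_comp (fun v => Im (f v)) Rabs); [eapply is_derive_continuity_pt; exact D2|apply Rcontinuity_abs].
  - exists (Rabs (Re (f x)) + Rabs (Im (f x))). intros v Hv.
    eapply Rle_trans; [apply Cmod_le_abs|apply (Hx v Hv)].
Qed.

(** Between [a] and [b] the factor [sin (pi v)] does not vanish, so [e^{tv} / sin (pi v)] is smooth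
    and the Riemann-Lebesgue bound applies without a correction. In the limit [e^{tv} gsum t v] is
    constant on [(0, 1)], and its value at 1/2 fixes all others. *)
Lemma gsum_increment t a b : Re t <> 0 -> 0 < a -> a <= b -> b < 1 ->
  clim (fun M => Cminus (Cmult (cexp (Cmult t (RtoC b))) (gsum t b M))
                        (Cmult (cexp (Cmult t (RtoC a))) (gsum t a M))) (RtoC 0).
Proof.
  intros Ht Ha Hab Hb.
  set (E := fun v : R => cexp (Cmult t (RtoC v))).
  set (S := fun v : R => RtoC (sin (PI * v))).
  assert (Hpi := PI_ge_2).
  assert (HS : forall v, a <= v <= b -> S v <> RtoC 0).
  { intros v Hv H. apply RtoC_inj in H.
    assert (0 < sin (PI * v)) by (apply sin_gt_0; nra). lra. }
  set (q := fun v : R => Cmult (E v) (Cinv (S v))).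
  set (r := fun v : R => Cplus t (Copp (Cmult (RtoC (PI * cos (PI * v))) (Cinv (S v))))).
  assert (DSi : forall v, a <= v <= b -> cderiv (fun v => Cinv (S v)) v
     (Copp (Cdiv (RtoC (PI * cos (PI * v))) (Cmult (S v) (S v))))).
  { intros v Hv. apply cderiv_inv; [|now apply HS].
    apply cderiv_RtoC with (l := PI * cos (PI * v)). auto_derive; [trivial|ring]. }
  assert (Dq : forall v, a <= v <= b -> cderiv q v (Cmult (q v) (r v))).
  { intros v Hv. eapply cderiv_eq; [apply cderiv_mult; [apply cderiv_cexp_lin|apply DSi, Hv]|].
    unfold q, r, E. field. now apply HS. }
  assert (Dr : forall v, a <= v <= b -> exists l, cderiv r v l).
  { intros v Hv. eexists. apply cderiv_plus; [apply cderiv_const|apply cderiv_opp, cderiv_mult; [|apply DSi, Hv]].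
    apply cderiv_RtoC with (l := - (PI * PI * sin (PI * v))). auto_derive; [trivial|ring]. }
  destruct (cderiv_bounded q a b Hab) as [B1 HB1]; [intros v Hv; eexists; apply Dq, Hv|].
  destruct (cderiv_bounded (fun v => Cmult (q v) (r v)) a b Hab) as [B2 HB2].
  { intros v Hv. destruct (Dr v Hv) as [l Hl]. eexists. apply cderiv_mult; [apply Dq, Hv|exact Hl]. }
  set (B := Rmax B1 B2).
  apply clim_squeeze with (fun M => (2 * B * (b - a) + 2 * B) / ((2 * INR M + 1) * PI)); [|apply is_lim_seq_div_odd].
  intros M. replace (Cminus (Cminus (Cmult (cexp (Cmult t (RtoC b))) (gsum t b M))
                        (Cmult (cexp (Cmult t (RtoC a))) (gsum t a M))) (RtoC 0)) with
    (Cminus (Cmult (cexp (Cmult t (RtoC b))) (gsum t b M))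
                        (Cmult (cexp (Cmult t (RtoC a))) (gsum t a M))) by ring.
  apply (riemann_lebesgue (fun v => Cmult (cexp (Cmult t (RtoC v))) (gsum t v M)) q (fun v => Cmult (q v) (r v))).
  - exact Hab.
  - assert (H := pos_INR M). nra.
  - intros v Hv. eapply cderiv_eq; [now apply cderiv_exp_gsum|].
    rewrite <- dirichlet_kernel. unfold q, E. fold (S v). field. now apply HS.
  - exact Dq.
  - intros v Hv. eapply Rle_trans; [apply HB1, Hv|apply Rmax_l].
  - intros v Hv. eapply Rle_trans; [apply HB2, Hv|apply Rmax_r].
Qed.

Lemma gsum_lim t a : 0 < Re t -> 0 < a < 1 ->
  clim (fun M => gsum t a M) (Cdiv (cexp (Copp (Cmult t (RtoC a)))) (Cminus (RtoC 1) (cexp (Copp t)))).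
Proof.
  intros Ht Ha.
  destruct (gsum_half_lim t Ht) as [HX _].
  assert (D : clim (fun M => Cminus (Cmult (cexp (Cmult t (RtoC a))) (gsum t a M))
                        (Cmult (cexp (Cmult t (RtoC (/ 2)))) (gsum t (/ 2) M))) (RtoC 0)).
  { destruct (Rle_dec (/ 2) a) as [H|H].
    - apply gsum_increment; lra.
    - assert (D := gsum_increment t a (/ 2) ltac:(lra) ltac:(lra) ltac:(lra) ltac:(lra)).
      eapply clim_ext; [|eapply clim_eq; [exact (clim_opp _ _ D)|ring]].
      intros M. cbv beta. ring. }
  set (ea := cexp (Cmult t (RtoC a))) in *.
  set (e := cexp (Cmult t (RtoC (/ 2)))) in *.
  assert (He : e <> RtoC 0) by apply cexp_neq_0. assert (Hea : ea <> RtoC 0) by apply cexp_neq_0.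
  assert (Hee : cexp t = Cmult e e).
  { unfold e. rewrite <- cexp_plus. f_equal. apply C_ext; unfold Re, Im; simpl; field. }
  assert (Hne : Cminus (Cmult e e) (RtoC 1) <> RtoC 0).
  { rewrite <- Hee. intros H. apply (cexp_neq_1 t Ht).
    replace (cexp t) with (Cplus (Cminus (cexp t) (RtoC 1)) (RtoC 1)) by ring. rewrite H. ring. }
  rewrite Hee in HX.
  eapply clim_ext; [|eapply clim_eq; [exact (clim_scal (Cinv ea) _ _ (clim_plus _ _ _ _ D (clim_scal e _ _ HX)))|]].
  - intros M. cbv beta. field. exact Hea.
  - rewrite !cexp_opp, Hee. fold ea. field. repeat split; assumption.
Qed.

(** * Regularised differences between sums and integrals *)

Definition nab (c : Z -> C) (m : Z) : C := Cminus (c m) (c (m - 1)%Z).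

Fixpoint nabn (K : nat) (c : Z -> C) : Z -> C :=
  match K with O => c | S K' => nab (nabn K' c) end.

Definition zvanish (c : Z -> C) : Prop :=
  clim (fun n => c (Z.of_nat n)) (RtoC 0) /\ clim (fun n => c (- Z.of_nat n)%Z) (RtoC 0).

Lemma nabn_ext K c d m : (forall k, c k = d k) -> nabn K c m = nabn K d m.
Proof.
  intros H; revert m; induction K as [|K IH]; intros m; simpl; [apply H|].
  unfold nab. now rewrite !IH.
Qed.

Lemma nabn_plus K c d m : nabn K (fun k => Cplus (c k) (d k)) m = Cplus (nabn K c m) (nabn K d m).
Proof.
  revert m; induction K as [|K IH]; intros m; simpl; [reflexivity|].
  unfold nab. rewrite !IH. ring.
Qed.

Lemma nabn_scal K a c m : nabn K (fun k => Cmult a (c k)) m = Cmult a (nabn K c m).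
Proof.
  revert m; induction K as [|K IH]; intros m; simpl; [reflexivity|].
  unfold nab. rewrite !IH. ring.
Qed.

Lemma zvanish_nab c : zvanish c -> zvanish (nab c).
Proof.
  intros [H1 H2]; split; unfold nab.
  - apply clim_decr_1.
    apply clim_ext with (fun n => Cminus (c (Z.of_nat (S n))) (c (Z.of_nat n))).
    + intros n. do 2 f_equal. lia.
    + replace (RtoC 0) with (Cminus (RtoC 0) (RtoC 0)) by ring.
      apply clim_minus; [now apply (clim_incr_1 (fun n => c (Z.of_nat n)))|exact H1].
  - apply clim_ext with (fun n => Cminus (c (- Z.of_nat n)%Z) (c (- Z.of_nat (S n))%Z)).
    + intros n. do 2 f_equal. lia.
    + replace (RtoC 0) with (Cminus (RtoC 0) (RtoC 0)) by ring.
      apply clim_minus; [exact H2|now apply (clim_incr_1 (fun n => c (- Z.of_nat n)%Z))].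
Qed.

Lemma zvanish_nabn K c : zvanish c -> zvanish (nabn K c).
Proof. intros H; induction K as [|K IH]; simpl; [exact H|now apply zvanish_nab]. Qed.

Lemma wz_plus a m n : wz a (m + n) = Cmult (wz a m) (wz a n).
Proof. unfold wz. rewrite <- ei_plus. f_equal. rewrite plus_IZR. ring. Qed.

(** Summation by parts over a symmetric range; the two boundary terms are those by which the range
    [-M..M] and its shift differ. *)
Lemma zsum_nab a c M :
  zsum (fun m => Cmult (wz a m) (nab c m)) M =
  Cplus (Cmult (Cminus (RtoC 1) (wz a 1)) (zsum (fun m => Cmult (wz a m) (c m)) M))
    (Cminus (Cmult (wz a (Z.of_nat M + 1)) (c (Z.of_nat M)))
            (Cmult (wz a (- Z.of_nat M)) (c (- Z.of_nat M - 1)%Z))).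
Proof.
  assert (H0 : wz a 0 = RtoC 1).
  { unfold wz. replace (2 * PI * 0 * a) with 0 by ring. apply ei_0. }
  induction M as [|M IH].
  - cbn [zsum]. unfold nab. change (Z.of_nat 0) with 0%Z.
    rewrite (wz_plus a 0 1), !H0. change (0 - 1)%Z with (-0 - 1)%Z.
    change (- 0)%Z with 0%Z. rewrite H0. ring.
  - cbn [zsum]. rewrite IH. unfold nab.
    replace (Z.of_nat (S M) - 1)%Z with (Z.of_nat M) by lia.
    replace (- Z.of_nat M - 1)%Z with (- Z.of_nat (S M))%Z by lia.
    replace (- Z.of_nat M)%Z with (- Z.of_nat (S M) + 1)%Z by lia.
    replace (Z.of_nat M + 1)%Z with (Z.of_nat (S M)) by lia.
    rewrite !(wz_plus a _ 1). ring.
Qed.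

Lemma clim_wz_vanish a f (c : nat -> C) : clim c (RtoC 0) -> clim (fun n => Cmult (wz a (f n)) (c n)) (RtoC 0).
Proof.
  intros H. apply clim_Cmod in H.
  apply clim_squeeze with (fun n => Cmod (Cminus (c n) (RtoC 0))); [|exact H].
  intros n. right. replace (Cminus (Cmult (wz a (f n)) (c n)) (RtoC 0)) with
    (Cmult (wz a (f n)) (Cminus (c n) (RtoC 0))) by ring.
  rewrite Cmod_mult, Cmod_wz. ring.
Qed.

Lemma zsum_nab_boundary a c : zvanish c ->
  clim (fun M => Cminus (Cmult (wz a (Z.of_nat M + 1)) (c (Z.of_nat M)))
            (Cmult (wz a (- Z.of_nat M)) (c (- Z.of_nat M - 1)%Z))) (RtoC 0).
Proof.
  intros [H1 H2]. replace (RtoC 0) with (Cminus (RtoC 0) (RtoC 0)) by ring.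
  apply clim_minus; apply clim_wz_vanish; [exact H1|].
  apply clim_incr_1 in H2. eapply clim_ext; [|exact H2].
  intros n. cbv beta. f_equal. lia.
Qed.

Lemma clim_zsum_nabn a c l K : zvanish c ->
  clim (zsum (fun m => Cmult (wz a m) (c m))) l ->
  clim (zsum (fun m => Cmult (wz a m) (nabn K c m))) (Cmult (Cpow (Cminus (RtoC 1) (wz a 1)) K) l).
Proof.
  intros Hc Hl. induction K as [|K IH]; simpl nabn.
  - simpl Cpow. now rewrite Cmult_1_l.
  - eapply clim_ext; [intros M; symmetry; apply zsum_nab|].
    eapply clim_eq; [apply clim_plus; [apply clim_scal, IH|apply zsum_nab_boundary, zvanish_nabn, Hc]|].
    simpl. ring.
Qed.

(** Dividing by [(1 - w)^K], with [w = wz a 1] different from 1, recovers the original series. Its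
    convergence is a conclusion here: the coefficients are only assumed to tend to 0. *)
Lemma clim_zsum_of_nabn a c l K : zvanish c -> wz a 1 <> RtoC 1 ->
  clim (zsum (fun m => Cmult (wz a m) (nabn K c m))) (Cmult (Cpow (Cminus (RtoC 1) (wz a 1)) K) l) ->
  clim (zsum (fun m => Cmult (wz a m) (c m))) l.
Proof.
  intros Hc Hw. assert (Hw' : Cminus (RtoC 1) (wz a 1) <> RtoC 0).
  { intros H. apply Hw. symmetry. now apply Ceq_minus. }
  induction K as [|K IH]; simpl nabn; intros H.
  - eapply clim_eq; [exact H|]. simpl. ring.
  - apply IH.
    eapply clim_ext with (fun M => Cmult (Cinv (Cminus (RtoC 1) (wz a 1)))
      (Cminus (zsum (fun m => Cmult (wz a m) (nab (nabn K c) m)) M)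
        (Cminus (Cmult (wz a (Z.of_nat M + 1)) (nabn K c (Z.of_nat M)))
            (Cmult (wz a (- Z.of_nat M)) (nabn K c (- Z.of_nat M - 1)%Z))))).
    + intros M. rewrite zsum_nab. field. exact Hw'.
    + eapply clim_eq.
      * apply clim_scal, clim_minus; [exact H|apply zsum_nab_boundary, zvanish_nabn, Hc].
      * simpl. field. exact Hw'.
Qed.

Lemma wz_1_neq_1 a : 0 < a < 1 -> wz a 1 <> RtoC 1.
Proof.
  intros Ha H. unfold wz in H. rewrite ei_eq in H.
  assert (Hpi := PI_RGT_0).
  assert (Hc : cos (2 * PI * 1 * a) = 1).
  { apply (f_equal Re) in H. unfold Re in H; simpl in H. lra. }
  replace (2 * PI * 1 * a) with (2 * (PI * a)) in Hc by ring.
  rewrite cos_2a_sin in Hc.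
  assert (0 < sin (PI * a)) by (apply sin_gt_0; nra). nra.
Qed.

(* [EM f f0 l]: the regularised Euler-Maclaurin difference
   f0/2 + sum_{n>=1} f(n) - int_0^oo f equals [l]; the integral is expressed by a primitive
   vanishing at 0+, and [f0] stands for f(0+). *)
Definition EM (f : R -> C) (f0 l : C) : Prop :=
  exists F : R -> C,
    (forall u, 0 < u -> cderiv F u (f u)) /\
    (forall eps, 0 < eps -> exists d, 0 < d /\ forall u, 0 < u < d -> Cmod (F u) < eps) /\
    clim (fun M => Cminus (Cplus (Cmult (RtoC (/ 2)) f0) (csum (fun k => f (INR (S k))) M)) (F (INR M))) l.

Lemma EM_ext f g f0 l : (forall u, 0 < u -> f u = g u) -> EM f f0 l -> EM g f0 l.
Proof.
  intros E [F [H1 [H2 H3]]]. exists F. split; [|split; [exact H2|]].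
  - intros u Hu. rewrite <- E by exact Hu. auto.
  - eapply clim_ext; [|exact H3]. intros M. cbv beta. do 2 f_equal.
    apply csum_ext. intros k _. apply E, lt_0_INR. lia.
Qed.

Lemma EM_eq f f0 l f0' l' : EM f f0 l -> f0 = f0' -> l = l' -> EM f f0' l'.
Proof. intros H <- <-; exact H. Qed.

Lemma EM_scal a f f0 l : EM f f0 l -> EM (fun u => Cmult a (f u)) (Cmult a f0) (Cmult a l).
Proof.
  intros [F [H1 [H2 H3]]]. exists (fun u => Cmult a (F u)). split; [|split].
  - intros u Hu. apply cderiv_scal. auto.
  - intros eps Heps. assert (Ha := Cmod_ge_0 a).
    destruct (H2 (eps / (Cmod a + 1))) as [d [Hd H]]; [apply Rdiv_lt_0_compat; lra|].
    exists d; split; [exact Hd|]. intros u Hu. specialize (H u Hu). rewrite Cmod_mult.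
    apply Rle_lt_trans with (Cmod a * (eps / (Cmod a + 1))); [apply Rmult_le_compat_l; lra|].
    apply Rmult_lt_reg_r with (Cmod a + 1); [lra|]. field_simplify; [|lra]. nra.
  - eapply clim_ext; [|exact (clim_scal a _ _ H3)].
    intros M. cbv beta. rewrite csum_scal. ring.
Qed.

Lemma EM_plus f g f0 g0 l m : EM f f0 l -> EM g g0 m ->
  EM (fun u => Cplus (f u) (g u)) (Cplus f0 g0) (Cplus l m).
Proof.
  intros [F [H1 [H2 H3]]] [G [K1 [K2 K3]]]. exists (fun u => Cplus (F u) (G u)). split; [|split].
  - intros u Hu. apply cderiv_plus; auto.
  - intros eps Heps.
    destruct (H2 (eps / 2)) as [d1 [Hd1 Q1]]; [lra|]. destruct (K2 (eps / 2)) as [d2 [Hd2 Q2]]; [lra|].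
    exists (Rmin d1 d2); split; [now apply Rmin_pos|]. intros u Hu.
    assert (Hm1 := Rmin_l d1 d2). assert (Hm2 := Rmin_r d1 d2).
    specialize (Q1 u ltac:(lra)). specialize (Q2 u ltac:(lra)).
    eapply Rle_lt_trans; [apply Cmod_triangle|lra].
  - eapply clim_ext; [|exact (clim_plus _ _ _ _ H3 K3)].
    intros M. cbv beta. rewrite csum_plus. ring.
Qed.

Lemma EM_zero : EM (fun _ => RtoC 0) (RtoC 0) (RtoC 0).
Proof.
  exists (fun _ => RtoC 0). split; [|split].
  - intros; apply cderiv_const.
  - intros eps Heps. exists 1. split; [lra|]. intros. now rewrite Cmod_0.
  - eapply clim_ext; [|apply clim_const]. intros M. cbv beta. rewrite csum_const. ring.
Qed.

Lemma EM_csum (f : nat -> R -> C) f0 l n : (forall k, (k < n)%nat -> EM (f k) (f0 k) (l k)) ->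
  EM (fun u => csum (fun k => f k u) n) (csum f0 n) (csum l n).
Proof.
  induction n as [|n IH]; intros H; simpl; [apply EM_zero|].
  apply (EM_plus (fun u => csum (fun k => f k u) n)); [apply IH; intros; apply H; lia|apply H; lia].
Qed.

Lemma EM_zsum (f : Z -> R -> C) f0 l M : (forall k, EM (f k) (f0 k) (l k)) ->
  EM (fun u => zsum (fun k => f k u) M) (zsum f0 M) (zsum l M).
Proof.
  intros H; induction M as [|M IH]; cbn [zsum]; [apply H|].
  apply (EM_plus (fun u => zsum (fun k => f k u) M)); [exact IH|].
  apply (EM_plus (f (Z.of_nat (S M)))); apply H.
Qed.

Lemma EM_nabn K (f : Z -> R -> C) f0 l m : (forall k, EM (f k) (f0 k) (l k)) ->
  EM (fun u => nabn K (fun k => f k u) m) (nabn K f0 m) (nabn K l m).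
Proof.
  intros H; revert m; induction K as [|K IH]; intros m; simpl; [apply H|].
  assert (E := EM_plus _ _ _ _ _ _ (IH m) (EM_scal (Copp (RtoC 1)) _ _ _ (IH (m - 1)%Z))).
  eapply EM_ext; [|eapply EM_eq; [exact E| |]]; unfold nab; intros; ring.
Qed.

Lemma sum_inv_sq_le M : rsum (fun k => / (1 + INR (S k) ^ 2)) M <= 2.
Proof.
  assert (H : rsum (fun k => / (1 + INR (S k) ^ 2)) M <= 2 - 2 / INR (S M)).
  { induction M as [|M IH]; [simpl; lra|]. cbn [rsum].
    assert (HM : 1 <= INR (S M)) by (rewrite S_INR; assert (H := pos_INR M); lra).
    rewrite (S_INR (S M)). set (s := INR (S M)) in *.
    assert (/ (1 + s ^ 2) <= 2 / s - 2 / (s + 1)).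
    { replace (2 / s - 2 / (s + 1)) with (/ (s * (s + 1) / 2)) by (field; lra).
      apply Rinv_le_contravar; nra. }
    lra. }
  assert (0 < 2 / INR (S M)) by (apply Rdiv_lt_0_compat; [lra|apply lt_0_INR; lia]). lra.
Qed.

(** The sum contributes [2 * eps], by [sum_inv_sq_le], and the primitive [4 * eps]: twice
    [eps * atan u], with [atan u < pi/2 <= 2]. The bound depends on [f] only through its majorant,
    so it passes to limits of functions. *)
Lemma EM_bound f f0 l eps : EM f f0 l -> (forall u, 0 < u -> Cmod (f u) <= eps / (1 + u ^ 2)) ->
  Cmod l <= Cmod f0 / 2 + 6 * eps.
Proof.
  intros [F [H1 [H2 H3]]] Hb.
  assert (He : 0 <= eps).
  { specialize (Hb 1 ltac:(lra)). assert (H := Cmod_ge_0 (f 1)).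
    replace (eps / (1 + 1 ^ 2)) with (eps / 2) in Hb by (field; lra). lra. }
  (* Nothing is known of [F] at 0 itself. Its smallness near 0+ stands in for [F 0 = 0]: a value
     above [4 * eps] is compared with that at a point [v] close to 0. *)
  assert (HF : forall u, 0 < u -> Cmod (F u) <= 4 * eps).
  { intros u Hu. apply Rnot_lt_le. intros Hlt.
    destruct (H2 (Cmod (F u) - 4 * eps)) as [d [Hd H]]; [lra|].
    set (v := Rmin (d / 2) (u / 2)).
    assert (Hv : 0 < v) by (apply Rmin_pos; lra).
    assert (Hv1 := Rmin_l (d / 2) (u / 2)). assert (Hv2 := Rmin_r (d / 2) (u / 2)). fold v in Hv1, Hv2.
    specialize (H v ltac:(lra)).
    assert (K : Cmod (Cminus (F u) (F v)) <= 2 * (eps * atan u - eps * atan v)).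
    { apply (cincrement_le F f (fun u => eps * atan u) (fun u => eps / (1 + u ^ 2))); [lra| | | | |].
      - intros t Ht. apply H1; lra.
      - intros t Ht. auto_derive; [trivial|]. field. nra.
      - intros t Ht. destruct (H1 t ltac:(lra)) as [D1 D2]; split; eapply is_derive_continuity_pt; eassumption.
      - intros t Ht. apply (is_derive_continuity_pt _ _ (eps / (1 + t ^ 2))). auto_derive; [trivial|]. field. nra.
      - intros t Ht. apply Hb; lra. }
    assert (Ku := atan_bound u). assert (Kv : 0 < atan v) by (rewrite <- atan_0; now apply atan_increasing).
    assert (Hpi := PI_4).
    assert (K2 := Cmod_triangle (Cminus (F u) (F v)) (F v)).
    replace (Cplus (Cminus (F u) (F v)) (F v)) with (F u) in K2 by ring.
    assert (eps * atan u <= eps * 2) by (apply Rmult_le_compat_l; lra).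
    assert (0 <= eps * atan v) by (apply Rmult_le_pos; lra). lra. }
  apply clim_Cmod_le with (1 := H3). exists 1%nat. intros M HM.
  eapply Rle_trans; [apply Cmod_triangle|]. rewrite Cmod_opp.
  assert (A1 := HF (INR M) ltac:(apply lt_0_INR; lia)).
  assert (A2 := Cmod_triangle (Cmult (RtoC (/ 2)) f0) (csum (fun k => f (INR (S k))) M)).
  rewrite Cmod_mult, Cmod_R, Rabs_pos_eq in A2 by lra.
  assert (A3 := Cmod_csum (fun k => f (INR (S k))) M).
  assert (A4 : rsum (fun k => Cmod (f (INR (S k)))) M <= eps * 2).
  { eapply Rle_trans; [apply rsum_le with (g := fun k => eps * / (1 + INR (S k) ^ 2))|].
    - intros k _. apply Hb. apply lt_0_INR; lia.
    - rewrite rsum_scal. apply Rmult_le_compat_l; [exact He|apply sum_inv_sq_le]. }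
  lra.
Qed.

(** * The kernels 1/(u^2+z^2) and u/(u^2+z^2) *)

Lemma lim0_of_cderiv F l : cderiv F 0 l -> F 0 = RtoC 0 ->
  forall eps, 0 < eps -> exists d, 0 < d /\ forall u, 0 < u < d -> Cmod (F u) < eps.
Proof.
  intros HD F0 eps Heps. destruct (cderiv_continuous _ _ _ HD) as [C1 C2].
  assert (Hh : 0 < eps / 2) by lra.
  destruct (proj1 (filterlim_locally _ _) C1 (mkposreal _ Hh)) as [d1 H1].
  destruct (proj1 (filterlim_locally _ _) C2 (mkposreal _ Hh)) as [d2 H2].
  exists (Rmin d1 d2). split; [apply Rmin_pos; apply cond_pos|].
  intros u Hu. assert (M1 := Rmin_l d1 d2). assert (M2 := Rmin_r d1 d2).
  assert (B0 : forall d : posreal, Rmin d1 d2 <= d -> ball 0 d u).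
  { intros d Hd. unfold ball; simpl; unfold AbsRing_ball, abs, minus, plus, opp; simpl.
    rewrite Ropp_0, Rplus_0_r, Rabs_pos_eq; lra. }
  specialize (H1 u (B0 d1 M1)). specialize (H2 u (B0 d2 M2)). rewrite F0 in H1, H2.
  unfold ball in H1, H2; simpl in H1, H2; unfold AbsRing_ball, abs, minus, plus, opp in H1, H2; simpl in H1, H2.
  rewrite Ropp_0, Rplus_0_r in H1, H2.
  eapply Rle_lt_trans; [apply Cmod_le_abs|]. unfold Re, Im in *. lra.
Qed.

Lemma atan_lower v : 0 < v -> PI / 2 - / v <= atan v.
Proof.
  intros Hv. assert (H := atan_inv v Hv).
  assert (atan (/ v) <= / v).
  { assert (Hp := Rinv_0_lt_compat v Hv).
    assert (E := increment_le atan (fun t => t) (fun t => / (1 + t ^ 2)) (fun _ => 1) 0 (/ v)).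
    rewrite atan_0 in E. cut (atan (/ v) - 0 <= / v - 0); [lra|]. apply E; [lra| | | | |].
    - intros t _. auto_derive; [trivial|]. field. nra.
    - intros t _. auto_derive; [trivial|ring].
    - intros t _. apply (is_derive_continuity_pt _ _ (/ (1 + t ^ 2))). auto_derive; [trivial|]. field. nra.
    - intros t _. apply (is_derive_continuity_pt _ _ 1). auto_derive; [trivial|ring].
    - intros t _. rewrite <- Rinv_1. apply Rinv_le_contravar; nra. }
  lra.
Qed.

Lemma is_lim_seq_atan_affine x y : 0 < x -> is_lim_seq (fun M => atan ((INR M - y) / x)) (PI / 2).
Proof.
  intros Hx.
  apply is_lim_seq_le_le_loc with (fun M => PI / 2 - x * / (INR M - y)) (fun _ => PI / 2).
  - destruct (nfloor_ex (Rabs y) (Rabs_pos y)) as [n [_ Hn]]. exists (S n). intros M HM.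
    assert (HM' : INR n + 1 <= INR M) by (rewrite <- S_INR; now apply le_INR).
    assert (Hy := Rle_abs y). assert (Hp : 0 < INR M - y) by lra.
    split.
    - assert (H := atan_lower ((INR M - y) / x) ltac:(now apply Rdiv_lt_0_compat)).
      replace (/ ((INR M - y) / x)) with (x * / (INR M - y)) in H by (field; lra). lra.
    - assert (H := atan_bound ((INR M - y) / x)). lra.
  - replace (Finite (PI / 2)) with (Finite (PI / 2 - x * 0)) by (f_equal; ring).
    apply is_lim_seq_minus'; [apply is_lim_seq_const|].
    apply is_lim_seq_mult'; [apply is_lim_seq_const|].
    apply (is_lim_seq_inv (fun M => INR M - y) p_infty); [|discriminate].
    eapply is_lim_seq_minus; [apply is_lim_seq_INR|apply is_lim_seq_const|reflexivity].
  - apply is_lim_seq_const.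
Qed.

(** [|x + i(M+y)|^2 / M^2] is [1 + 2y/M + (x^2+y^2)/M^2], whose logarithm tends to 0. *)
Lemma is_lim_seq_ln_ratio x y : 
  is_lim_seq (fun M => ln (Cmod (x, INR M + y)) - ln (INR M)) 0.
Proof.
  assert (H : is_lim_seq (fun M => / 2 * ln (1 + 2 * y * / INR M + (x ^ 2 + y ^ 2) * (/ INR M * / INR M))) 0).
  { replace (Finite 0) with (Finite (/ 2 * ln (1 + 2 * y * 0 + (x ^ 2 + y ^ 2) * (0 * 0))))
      by (f_equal; rewrite !Rmult_0_r, !Rplus_0_r, ln_1; ring).
    assert (Hi : is_lim_seq (fun M => / INR M) 0) by (apply is_lim_seq_incr_1, is_lim_seq_inv_INR).
    apply is_lim_seq_mult'; [apply is_lim_seq_const|].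
    apply is_lim_seq_continuous.
    - eapply is_derive_continuity_pt, is_derive_ln. rewrite !Rmult_0_r, !Rplus_0_r. lra.
    - apply is_lim_seq_plus'; [apply is_lim_seq_plus'; [apply is_lim_seq_const|]|];
        (apply is_lim_seq_mult'; [apply is_lim_seq_const|]); [exact Hi|now apply is_lim_seq_mult']. }
  eapply is_lim_seq_ext_loc; [|exact H].
  destruct (nfloor_ex (Rabs y) (Rabs_pos y)) as [n [_ Hn]]. exists (S n). intros M HM.
  assert (HM' : INR n + 1 <= INR M) by (rewrite <- S_INR; now apply le_INR).
  assert (Hy : - y <= Rabs y) by (rewrite <- Rabs_Ropp; apply Rle_abs).
  assert (Hn0 := pos_INR n).
  assert (Hp : 0 < INR M + y) by lra. assert (HM0 : 0 < INR M) by lra.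
  unfold Cmod; simpl fst; simpl snd.
  set (m := INR M) in *.
  assert (Hq : 0 < x ^ 2 + (m + y) ^ 2) by nra.
  replace (1 + 2 * y * / m + (x ^ 2 + y ^ 2) * (/ m * / m)) with ((x ^ 2 + (m + y) ^ 2) * / (m * m)) by (field; lra).
  rewrite ln_mult by (try apply Rinv_0_lt_compat; nra).
  rewrite ln_Rinv, ln_mult by nra.
  assert (E : ln (x ^ 2 + (m + y) ^ 2) = 2 * ln (sqrt (x ^ 2 + (m + y) ^ 2))).
  { rewrite <- (sqrt_sqrt (x ^ 2 + (m + y) ^ 2)) at 1 by lra.
    rewrite ln_mult by (now apply sqrt_lt_R0). ring. }
  rewrite E. field.
Qed.

Section HalfPlane.
Variable z : C.
Hypothesis Hz : 0 < Re z.

Let zp (u : R) : C := Cplus z (0, u).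
Let zm (u : R) : C := Cminus z (0, u).

Lemma zp_zm u : Cmult (zp u) (zm u) = Cplus (RtoC (u ^ 2)) (Cmult z z).
Proof. unfold zp, zm. apply C_ext; unfold Re, Im; simpl; ring. Qed.

Lemma zp_neq u : zp u <> RtoC 0.
Proof. apply Re_neq_0. unfold zp, Re in *; simpl. lra. Qed.

Lemma zm_neq u : zm u <> RtoC 0.
Proof. apply Re_neq_0. unfold zm, Re in *; simpl. lra. Qed.

Lemma half_plane_neq_0 : z <> RtoC 0.
Proof. apply Re_neq_0. lra. Qed.

Lemma sq_plus_sq_neq_0 u : Cplus (RtoC (u ^ 2)) (Cmult z z) <> RtoC 0.
Proof. rewrite <- zp_zm. apply Cmult_neq_0; [apply zp_neq|apply zm_neq]. Qed.

Lemma cderiv_clog_zp u : cderiv (fun u => clog (zp u)) u (Cdiv Ci (zp u)).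
Proof.
  apply cderiv_clog.
  - eapply cderiv_eq; [apply cderiv_plus; [apply cderiv_const|]|].
    + apply cderiv_ext with (fun u => Cmult Ci (RtoC u)).
      * intros t; apply C_ext; unfold Re, Im; simpl; ring.
      * apply cderiv_scal, cderiv_id.
    + ring.
  - unfold zp, Re in *; simpl. lra.
Qed.

Lemma cderiv_clog_zm u : cderiv (fun u => clog (zm u)) u (Cdiv (Copp Ci) (zm u)).
Proof.
  apply cderiv_clog.
  - eapply cderiv_eq; [apply cderiv_minus; [apply cderiv_const|]|].
    + apply cderiv_ext with (fun u => Cmult Ci (RtoC u)).
      * intros t; apply C_ext; unfold Re, Im; simpl; ring.
      * apply cderiv_scal, cderiv_id.
    + ring.
  - unfold zm, Re in *; simpl. lra.
Qed.

Lemma carg_right w : 0 < Re w -> carg w = atan (Im w / Re w).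
Proof. intros H. unfold carg. destruct (Rlt_dec 0 (Re w)); [reflexivity|contradiction]. Qed.

(** The logarithms of the moduli of [z + iu] and [z - iu] both behave like [ln u], and the arguments
    tend to [pi/2] and [-pi/2]. The difference of the logarithms therefore tends to [i pi], while
    their half-sum behaves like [ln u]: these are the values at infinity of the primitives of the
    two kernels. *)
Lemma clim_clog_diff : clim (fun M => Cminus (clog (zp (INR M))) (clog (zm (INR M)))) (0, PI).
Proof.
  assert (L1 := is_lim_seq_ln_ratio (Re z) (Im z)).
  assert (L2 := is_lim_seq_ln_ratio (Re z) (- Im z)).
  assert (A1 := is_lim_seq_atan_affine (Re z) (- Im z) Hz).
  assert (A2 := is_lim_seq_atan_affine (Re z) (Im z) Hz).
  assert (Hmod : forall M, Cmod (zm (INR M)) = Cmod (Re z, INR M + - Im z)).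
  { intros M. unfold Cmod, zm, Re, Im; simpl. f_equal. ring. }
  assert (Hmod1 : forall M, Cmod (zp (INR M)) = Cmod (Re z, INR M + Im z)).
  { intros M. unfold Cmod, zp, Re, Im; simpl. f_equal. ring. }
  split.
  - eapply is_lim_seq_ext; [|eapply is_lim_seq_eq; [exact (is_lim_seq_minus' _ _ _ _ L1 L2)|]].
    + intros M. unfold clog. simpl. rewrite Hmod, Hmod1. ring.
    + simpl. f_equal. ring.
  - eapply is_lim_seq_ext; [|eapply is_lim_seq_eq; [exact (is_lim_seq_plus' _ _ _ _ A1 A2)|]].
    + intros M. unfold clog. simpl. rewrite !carg_right by (unfold zp, zm, Re in *; simpl; lra).
      rewrite <- (Ropp_involutive (atan ((INR M - Im z) / Re z))), <- atan_opp. unfold Rminus. f_equal.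
      * f_equal. unfold zp, Re, Im in *; simpl. field. lra.
      * f_equal. f_equal. unfold zm, Re, Im in *; simpl. field. lra.
    + simpl. f_equal. field.
Qed.

Lemma clim_clog_sum : clim (fun M => Cminus (Cmult (RtoC (/ 2)) (Cplus (clog (zp (INR M))) (clog (zm (INR M)))))
   (RtoC (ln (INR M)))) (RtoC 0).
Proof.
  assert (L1 := is_lim_seq_ln_ratio (Re z) (Im z)).
  assert (L2 := is_lim_seq_ln_ratio (Re z) (- Im z)).
  assert (A1 := is_lim_seq_atan_affine (Re z) (- Im z) Hz).
  assert (A2 := is_lim_seq_atan_affine (Re z) (Im z) Hz).
  assert (Hmod : forall M, Cmod (zm (INR M)) = Cmod (Re z, INR M + - Im z)).
  { intros M. unfold Cmod, zm, Re, Im; simpl. f_equal. ring. }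
  assert (Hmod1 : forall M, Cmod (zp (INR M)) = Cmod (Re z, INR M + Im z)).
  { intros M. unfold Cmod, zp, Re, Im; simpl. f_equal. ring. }
  split.
  - eapply is_lim_seq_ext; [|eapply is_lim_seq_eq; [exact (is_lim_seq_mult' _ _ _ _ (is_lim_seq_const (/ 2)) (is_lim_seq_plus' _ _ _ _ L1 L2))|]].
    + intros M. unfold clog. simpl. rewrite Hmod, Hmod1. field.
    + simpl. f_equal. ring.
  - eapply is_lim_seq_ext; [|eapply is_lim_seq_eq; [exact (is_lim_seq_mult' _ _ _ _ (is_lim_seq_const (/ 2)) (is_lim_seq_minus' _ _ _ _ A1 A2))|]].
    + intros M. unfold clog. simpl. rewrite !carg_right by (unfold zp, zm, Re in *; simpl; lra).
      rewrite <- (Ropp_involutive (atan ((INR M - Im z) / Re z))), <- atan_opp.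
      replace (Im (zp (INR M)) / Re (zp (INR M))) with ((INR M - - Im z) / Re z)
        by (unfold zp, Re, Im in *; simpl; field; lra).
      replace (Im (zm (INR M)) / Re (zm (INR M))) with (- ((INR M - Im z) / Re z))
        by (unfold zm, Re, Im in *; simpl; field; lra).
      ring.
    + simpl. f_equal. ring.
Qed.

Definition Bz : C := Cdiv (Cdiv (RtoC PI) z) (Cminus (cexp (Cmult (RtoC (2 * PI)) z)) (RtoC 1)).

(** The partial fractions of the hyperbolic cotangent, read off from the Fourier expansion at
    [a = 0] and [t = 2 pi z]: the terms [m] and [-m] combine to [(z/pi) / (m^2 + z^2)]. *)
Lemma clim_sum_lorentz :
  clim (fun M => csum (fun k => Cinv (Cplus (RtoC (INR (S k) ^ 2)) (Cmult z z))) M)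
    (Cminus (Cplus (Cdiv (RtoC PI) (Cmult (RtoC 2) z)) Bz) (Cinv (Cmult (RtoC 2) (Cmult z z)))).
Proof.
  assert (Hpi := PI_RGT_0). assert (Hz0 := half_plane_neq_0).
  assert (HpiC : RtoC PI <> RtoC 0) by (intros H; apply RtoC_inj in H; lra).
  set (t := Cmult (RtoC (2 * PI)) z).
  assert (Ht : 0 < Re t) by (unfold t; rewrite re_scal_l; nra).
  destruct (gsum_half_lim t Ht) as [_ H].
  assert (E : forall M, gsum t 0 M = Cplus (Cinv t)
     (Cmult (Cdiv z (RtoC PI)) (csum (fun k => Cinv (Cplus (RtoC (INR (S k) ^ 2)) (Cmult z z))) M))).
  { unfold gsum. induction M as [|M IH].
    - cbn [zsum csum]. unfold wz, cz. rewrite Rmult_0_r, ei_0.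
      replace (Cplus t (0, 2 * PI * 0)) with t by (apply C_ext; unfold Re, Im; simpl; ring). ring.
    - cbn [zsum csum]. rewrite IH. unfold wz, cz. rewrite !Rmult_0_r, ei_0, opp_IZR, <- INR_IZR_INZ.
      set (s := INR (S M)).
      assert (D1 : Cplus t (0, 2 * PI * s) = Cmult (RtoC (2 * PI)) (zp s))
        by (unfold t, zp; apply C_ext; unfold Re, Im; simpl; ring).
      assert (D2 : Cplus t (0, 2 * PI * - s) = Cmult (RtoC (2 * PI)) (zm s))
        by (unfold t, zm; apply C_ext; unfold Re, Im; simpl; ring).
      rewrite D1, D2, <- zp_zm.
      assert (Hs : z = Cmult (RtoC (/ 2)) (Cplus (zp s) (zm s)))
        by (unfold zp, zm; apply C_ext; unfold Re, Im; simpl; field).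
      assert (P1 := zp_neq s). assert (P2 := zm_neq s).
      rewrite RtoC_mult, Cmult_plus_distr_l, Cplus_assoc, <- !Cplus_assoc. f_equal. f_equal.
      rewrite Hs at 1. rewrite RtoC_inv by lra. field. repeat split; assumption. }
  assert (H2 := clim_scal (Cdiv (RtoC PI) z) _ _ (clim_minus _ _ _ _ H (clim_const (Cinv t)))).
  eapply clim_ext; [|eapply clim_eq; [exact H2|]].
  - intros M. cbv beta. rewrite E. field. repeat split; try assumption. apply Re_neq_0; lra.
  - unfold Bz. fold t.
    assert (Hne : Cminus (cexp t) (RtoC 1) <> RtoC 0).
    { intros H0. apply (cexp_neq_1 t Ht). now apply Ceq_minus. }
    replace (Cinv t) with (Cinv (Cmult (Cmult (RtoC 2) (RtoC PI)) z)) by (unfold t; now rewrite RtoC_mult).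
    rewrite RtoC_inv by lra. field. repeat split; assumption.
Qed.

(** With the primitive [(log(z+iu) - log(z-iu)) / (2 i z)] the integral is [pi/(2z)], which cancels
    the part of the sum that is not exponentially small; half the boundary value cancels
    [-1/(2 z^2)], and [Bz] remains. *)
Lemma EM_lorentz : EM (fun u => Cinv (Cplus (RtoC (u ^ 2)) (Cmult z z))) (Cinv (Cmult z z)) Bz.
Proof.
  assert (Hz0 := half_plane_neq_0).
  set (k := Cinv (Cmult (Cmult (RtoC 2) Ci) z)).
  assert (D : forall u, cderiv (fun u => Cmult k (Cminus (clog (zp u)) (clog (zm u)))) u
    (Cinv (Cplus (RtoC (u ^ 2)) (Cmult z z)))).
  { intros u. eapply cderiv_eq.
    - apply cderiv_scal, cderiv_minus; [apply cderiv_clog_zp|apply cderiv_clog_zm].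
    - rewrite <- zp_zm. unfold k.
      assert (Hs : z = Cmult (Cinv (RtoC 2)) (Cplus (zp u) (zm u)))
        by (unfold zp, zm; field).
      assert (P1 := zp_neq u). assert (P2 := zm_neq u).
      assert (P3 : Cplus (zp u) (zm u) <> RtoC 0).
      { intros E. apply Hz0. rewrite Hs, E. ring. }
      rewrite Hs at 1. field. repeat split; try assumption; apply Ci_nz. }
  exists (fun u => Cmult k (Cminus (clog (zp u)) (clog (zm u)))). split; [|split].
  - intros u _. apply D.
  - eapply lim0_of_cderiv; [apply D|].
    replace (zp 0) with z by (unfold zp; apply C_ext; unfold Re, Im; simpl; ring).
    replace (zm 0) with z by (unfold zm; apply C_ext; unfold Re, Im; simpl; ring). ring.
  - eapply clim_eq; [apply clim_minus; [apply clim_plus; [apply clim_const|apply clim_sum_lorentz]|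
      apply clim_scal, clim_clog_diff]|].
    replace (0, PI) with (Cmult Ci (RtoC PI)) by (apply C_ext; unfold Re, Im; simpl; ring).
    unfold k. rewrite RtoC_inv by lra. field. split; [assumption|apply Ci_nz].
Qed.

End HalfPlane.

(** * Convergence of the limit defining digamma *)

Lemma ex_clim_of_increments (u : nat -> C) e n0 :
  (forall n, (n0 <= n)%nat -> Cmod (Cminus (u (S n)) (u n)) <= e n) -> ex_series e ->
  exists l, clim u l.
Proof.
  intros H He.
  assert (R1 : forall (v : nat -> R), (forall n, (n0 <= n)%nat -> Rabs (v (S n) - v n) <= e n) ->
     exists l, is_lim_seq v (Finite l)).
  { intros v Hv.
    assert (S1 : ex_series (fun n => v (S (n0 + n)) - v (n0 + n)%nat)).
    { apply (ex_series_le (K := R_AbsRing) (V := R_CompleteNormedModule)) with (fun n => e (n0 + n)%nat).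
      - intros n. apply Hv. lia.
      - now apply ex_series_incr_n. }
    destruct S1 as [l Hl]. exists (v n0 + l).
    apply is_lim_seq_incr_n with n0. apply is_lim_seq_incr_1.
    apply is_lim_seq_ext with (fun n => v n0 + sum_n (fun n => v (S (n0 + n)) - v (n0 + n)%nat) n).
    - intros n. rewrite sum_n_rsum. replace (S n + n0)%nat with (n0 + S n)%nat by lia.
      generalize (S n) as k. induction k as [|k IH]; simpl rsum.
      + rewrite Nat.add_0_r; ring.
      + rewrite Nat.add_succ_r. rewrite <- Rplus_assoc, IH. ring.
    - apply is_lim_seq_plus'; [apply is_lim_seq_const|exact Hl]. }
  destruct (R1 (fun n => Re (u n))) as [l1 H1].
  { intros n Hn. eapply Rle_trans; [|apply (H n Hn)]. apply (re_le_Cmod (Cminus (u (S n)) (u n))). }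
  destruct (R1 (fun n => Im (u n))) as [l2 H2].
  { intros n Hn. eapply Rle_trans; [|apply (H n Hn)]. apply (im_le_Cmod (Cminus (u (S n)) (u n))). }
  exists (l1, l2). split; assumption.
Qed.

Lemma ex_series_inv_sq : ex_series (fun n => / INR (S n) ^ 2).
Proof.
  destruct (ex_finite_lim_seq_incr (fun M => rsum (fun k => / INR (S k) ^ 2) (S M)) 2) as [l Hl].
  - intros n. cbn [rsum].
    assert (0 < / INR (S (S n)) ^ 2) by (apply Rinv_0_lt_compat, pow_lt, lt_0_INR; lia).
    cbn [rsum]. lra.
  - intros M.
    assert (H : forall M, rsum (fun k => / INR (S k) ^ 2) (S M) <= 2 - / INR (S M)).
    { clear M. induction M as [|M IH]; [simpl; lra|].
      cbn [rsum] in *. rewrite (S_INR (S M)) in *.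
      assert (HM : 1 <= INR (S M)) by (rewrite S_INR; assert (H := pos_INR M); lra).
      set (s := INR (S M)) in *.
      assert (/ (s + 1) ^ 2 <= / s - / (s + 1)).
      { replace (/ s - / (s + 1)) with (/ (s * (s + 1))) by (field; lra). apply Rinv_le_contravar; nra. }
      lra. }
    assert (0 < / INR (S M)) by (apply Rinv_0_lt_compat, lt_0_INR; lia). specialize (H M). lra.
  - exists l. apply (is_lim_seq_ext (fun M => rsum (fun k => / INR (S k) ^ 2) (S M)) _ l); [|exact Hl].
    intros n. symmetry. apply sum_n_rsum.
Qed.

(** Two instances of [1 + v <= e^v], at [v = 1/m] and [v = -1/(m+1)], enclose the increment of the
    logarithm between [1/(m+1)] and [1/m]. *)
Lemma ln_ratio_bound m : 1 <= m -> Rabs (ln (m + 1) - ln m - / (m + 1)) <= / m ^ 2.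
Proof.
  intros Hm.
  assert (H1 : ln (m + 1) - ln m <= / m).
  { assert (H := exp_ineq1_le (/ m)).
    assert (E : ln (m + 1) <= ln (m * exp (/ m))).
    { apply Rcomplements.ln_le; [lra|]. apply Rle_trans with (m * (1 + / m)).
      - right. field. lra.
      - apply Rmult_le_compat_l; lra. }
    rewrite ln_mult, ln_exp in E; [lra|lra|apply exp_pos]. }
  assert (H2 : / (m + 1) <= ln (m + 1) - ln m).
  { assert (H := exp_ineq1_le (- / (m + 1))).
    assert (E : ln m <= ln ((m + 1) * exp (- / (m + 1)))).
    { apply Rcomplements.ln_le; [lra|]. apply Rle_trans with ((m + 1) * (1 + - / (m + 1))).
      - right. field. lra.
      - apply Rmult_le_compat_l; lra. }
    rewrite ln_mult, ln_exp in E; [lra|lra|apply exp_pos]. }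
  assert (H3 : / m - / (m + 1) <= / m ^ 2).
  { replace (/ m - / (m + 1)) with (/ (m * (m + 1))) by (field; lra). apply Rinv_le_contravar; nra. }
  apply Rabs_le. assert (0 < / m ^ 2) by (apply Rinv_0_lt_compat; nra). lra.
Qed.

(** [digamma] is built on [Lim_seq], which has a value even without convergence, so convergence must
    be shown. Consecutive terms differ by [O(1/n^2)]: the increment of the logarithm is close to
    [1/(n+1)], and [1/(n+1) - 1/(s+n+1)] has modulus [|s| / ((n+1) |s+n+1|)]. *)
Lemma digamma_lim s : (forall k, Cplus s (RtoC (INR k)) <> RtoC 0) ->
  clim (fun M => Cminus (RtoC (ln (INR M))) (sum_n (fun k => Cinv (Cplus s (RtoC (INR k)))) M)) (digamma s).
Proof.
  intros Hs.
  set (u := fun M => Cminus (RtoC (ln (INR M))) (sum_n (fun k => Cinv (Cplus s (RtoC (INR k)))) M)).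
  assert (Hex : exists l, clim u l).
  { set (A := Cmod s). assert (HA : 0 <= A) by apply Cmod_ge_0.
    (* For [n > n0] one has [n > 2 |s|], hence [|s + n + 1| >= (n + 1) / 2]. *)
    destruct (nfloor_ex (2 * A) ltac:(lra)) as [n0 [_ Hn0]].
    apply ex_clim_of_increments with (e := fun n => (4 * (1 + 2 * A)) * / INR (S n) ^ 2) (n0 := S n0).
    - intros n Hn.
      assert (Hn' : INR n0 + 1 <= INR n) by (rewrite <- S_INR; now apply le_INR).
      assert (Hn1 : 1 <= INR n) by (assert (H := pos_INR n0); lra).
      set (m := INR n) in *.
      replace (Cminus (u (S n)) (u n)) with
        (Cplus (RtoC (ln (m + 1) - ln m - / (m + 1)))
          (Cminus (RtoC (/ (m + 1))) (Cinv (Cplus s (RtoC (m + 1)))))).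
      2: { unfold u. rewrite sum_Sn. fold m. rewrite S_INR. fold m. rewrite !RtoC_minus.
           change plus with Cplus. ring. }
      eapply Rle_trans; [apply Cmod_triangle|]. rewrite Cmod_R.
      assert (B1 := ln_ratio_bound m Hn1).
      assert (Hsm : Cplus s (RtoC (m + 1)) <> RtoC 0).
      { unfold m. rewrite <- S_INR. apply Hs. }
      assert (Hm1 : RtoC (m + 1) <> RtoC 0) by (intros H; apply RtoC_inj in H; lra).
      replace (Cminus (RtoC (/ (m + 1))) (Cinv (Cplus s (RtoC (m + 1))))) with
        (Cdiv s (Cmult (RtoC (m + 1)) (Cplus s (RtoC (m + 1))))).
      2: { rewrite RtoC_inv by lra. field. split; assumption. }
      rewrite Cmod_div by (now apply Cmult_neq_0). rewrite Cmod_mult, Cmod_R, (Rabs_pos_eq (m + 1)) by lra.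
      fold A. rewrite S_INR. fold m.
      assert (Hl : (m + 1) / 2 <= Cmod (Cplus s (RtoC (m + 1)))).
      { assert (H := Cmod_triangle_inv (RtoC (m + 1)) s). rewrite Cmod_R, Rabs_pos_eq in H by lra.
        rewrite Cplus_comm in H. fold A in H. lra. }
      assert (B2 : A / ((m + 1) * Cmod (Cplus s (RtoC (m + 1)))) <= 2 * A * / (m + 1) ^ 2).
      { unfold Rdiv. replace (2 * A * / (m + 1) ^ 2) with (A * / ((m + 1) * ((m + 1) / 2))) by (field; lra).
        apply Rmult_le_compat_l; [exact HA|]. apply Rinv_le_contravar; [nra|]. nra. }
      assert (B3 : / m ^ 2 <= 4 * / (m + 1) ^ 2).
      { replace (4 * / (m + 1) ^ 2) with (/ ((m + 1) ^ 2 / 4)) by (field; lra). apply Rinv_le_contravar; nra. }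
      assert (0 < / (m + 1) ^ 2) by (apply Rinv_0_lt_compat; nra). nra.
    - apply (ex_series_scal (4 * (1 + 2 * A)) (fun n => / INR (S n) ^ 2)). apply ex_series_inv_sq. }
  destruct Hex as [l Hl]. replace (digamma s) with l; [exact Hl|].
  unfold digamma, cLim_seq. destruct Hl as [H1 H2].
  apply is_lim_seq_unique in H1, H2. unfold u in H1, H2. rewrite H1, H2. now destruct l.
Qed.

Definition Lz (z : C) : C :=
  Cminus (clog z) (Cmult (RtoC (/ 2)) (Cplus (digamma (Cmult Ci z)) (digamma (Copp (Cmult Ci z))))).

(** [u/(u^2+z^2)] is half of [1/(u+iz) + 1/(u-iz)], which is how the two digamma limits enter. The
    [ln M] in them cancels the growth of the primitive, and [clog z] is what must be subtracted to
    make that primitive vanish at 0. *)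
Lemma EM_odd z : 0 < Re z ->
  EM (fun u => Cdiv (RtoC u) (Cplus (RtoC (u ^ 2)) (Cmult z z))) (RtoC 0) (Lz z).
Proof.
  intros Hz. assert (Hz0 := half_plane_neq_0 z Hz).
  set (zp := fun u : R => Cplus z (0, u)). set (zm := fun u : R => Cminus z (0, u)).
  assert (D : forall u, cderiv (fun u => Cminus (Cmult (RtoC (/ 2)) (Cplus (clog (zp u)) (clog (zm u)))) (clog z)) u
    (Cdiv (RtoC u) (Cplus (RtoC (u ^ 2)) (Cmult z z)))).
  { intros u. eapply cderiv_eq.
    - apply cderiv_minus; [apply cderiv_scal, cderiv_plus; [now apply cderiv_clog_zp|now apply cderiv_clog_zm]|apply cderiv_const].
    - rewrite <- zp_zm.
      assert (P1 := zp_neq z Hz u). assert (P2 := zm_neq z Hz u).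
      assert (Hs : RtoC u = Cmult (Cmult (RtoC (/ 2)) Ci) (Cminus (Cminus z (0, u)) (Cplus z (0, u))))
        by (apply C_ext; unfold Re, Im; simpl; field).
      rewrite Hs, RtoC_inv by lra. unfold zp, zm. field. split; assumption. }
  exists (fun u => Cminus (Cmult (RtoC (/ 2)) (Cplus (clog (zp u)) (clog (zm u)))) (clog z)). split; [|split].
  - intros u _. apply D.
  - eapply lim0_of_cderiv; [apply D|].
    replace (zp 0) with z by (unfold zp; apply C_ext; unfold Re, Im; simpl; ring).
    replace (zm 0) with z by (unfold zm; apply C_ext; unfold Re, Im; simpl; ring).
    rewrite RtoC_inv by lra. field.
  - assert (Hd1 : forall k, Cplus (Cmult Ci z) (RtoC (INR k)) <> RtoC 0).
    { intros k H. apply (f_equal Im) in H. unfold Re, Im in *; simpl in H. lra. }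
    assert (Hd2 : forall k, Cplus (Copp (Cmult Ci z)) (RtoC (INR k)) <> RtoC 0).
    { intros k H. apply (f_equal Im) in H. unfold Re, Im in *; simpl in H. lra. }
    assert (G1 := digamma_lim _ Hd1). assert (G2 := digamma_lim _ Hd2).
    assert (G3 := clim_clog_sum z Hz). fold zp zm in G3.
    eapply clim_ext; [|eapply clim_eq;
      [exact (clim_minus _ _ _ _ (clim_minus _ _ _ _ (clim_const (clog z)) (clim_scal (RtoC (/ 2)) _ _ (clim_plus _ _ _ _ G1 G2))) G3)|]].
    + intros M. cbv beta.
      (* The [k = 0] terms [1/(iz)] and [-1/(iz)] cancel, so the digamma sums starting at 0 match a
         sum starting at 1. *)
      assert (E : Cplus (sum_n (fun k => Cinv (Cplus (Cmult Ci z) (RtoC (INR k)))) M)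
                (sum_n (fun k => Cinv (Cplus (Copp (Cmult Ci z)) (RtoC (INR k)))) M) =
          Cmult (RtoC 2) (csum (fun k => Cdiv (RtoC (INR (S k))) (Cplus (RtoC (INR (S k) ^ 2)) (Cmult z z))) M)).
      { induction M as [|M IH].
        - rewrite !sum_O. simpl. field. split; [exact Hz0|apply Ci_nz].
        - rewrite !sum_Sn. change plus with Cplus. cbn [csum]. rewrite Cmult_plus_distr_l, <- IH.
          set (s := INR (S M)).
          assert (Hq : Cplus (RtoC (s ^ 2)) (Cmult z z) =
             Cmult (Cplus (Cmult Ci z) (RtoC s)) (Cplus (Copp (Cmult Ci z)) (RtoC s)))
            by (apply C_ext; unfold Re, Im; simpl; ring).
          assert (P1 : Cplus (Cmult Ci z) (RtoC s) <> RtoC 0) by apply Hd1.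
          assert (P2 : Cplus (Copp (Cmult Ci z)) (RtoC s) <> RtoC 0) by apply Hd2.
          rewrite Hq.
          replace (Cmult (RtoC 2) (Cdiv (RtoC s) (Cmult (Cplus (Cmult Ci z) (RtoC s)) (Cplus (Copp (Cmult Ci z)) (RtoC s)))))
            with (Cplus (Cinv (Cplus (Cmult Ci z) (RtoC s))) (Cinv (Cplus (Copp (Cmult Ci z)) (RtoC s))))
            by (field; split; assumption).
          ring. }
      replace (csum (fun k => Cdiv (RtoC (INR (S k))) (Cplus (RtoC (INR (S k) ^ 2)) (Cmult z z))) M) with
        (Cmult (RtoC (/ 2)) (Cmult (RtoC 2) (csum (fun k => Cdiv (RtoC (INR (S k))) (Cplus (RtoC (INR (S k) ^ 2)) (Cmult z z))) M)))
        by (rewrite RtoC_inv by lra; field).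
      rewrite <- E. rewrite RtoC_inv by lra. field.
    + unfold Lz. ring.
Qed.

(** * Bernoulli polynomials and the order-K Euler-Maclaurin formula *)

(** The inner sum of Hasse's series: the operator [(1 - T)^n], with [T] the unit shift, applied to
    [g]. The recursion [dn_S] makes both the values of zeta at negative integers and the Mellin
    transform inductive. *)
Definition dn (n : nat) (g : R -> R) (u : R) : R :=
  sum_f_R0 (fun k => (-1) ^ k * Binomial.C n k * g (u + INR k)) n.

Lemma binom_n_0 n : Binomial.C n 0 = 1.
Proof.
  unfold Binomial.C. rewrite Nat.sub_0_r. simpl (fact 0). simpl (INR 1).
  field. apply INR_fact_neq_0.
Qed.

Lemma binom_n_n n : Binomial.C n n = 1.
Proof.
  unfold Binomial.C. rewrite Nat.sub_diag. simpl (fact 0). simpl (INR 1).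
  field. apply INR_fact_neq_0.
Qed.

Lemma dn_S n g u : dn (S n) g u = dn n g u - dn n g (u + 1).
Proof.
  unfold dn.
  assert (H : forall m, (m <= n)%nat ->
    sum_f_R0 (fun k => (-1) ^ k * Binomial.C (S n) k * g (u + INR k)) m =
    sum_f_R0 (fun k => (-1) ^ k * Binomial.C n k * g (u + INR k)) m
    - (sum_f_R0 (fun k => (-1) ^ k * Binomial.C n k * g (u + 1 + INR k)) m
       - (-1) ^ m * Binomial.C n m * g (u + 1 + INR m))).
  { induction m as [|m IH]; intros Hm.
    - simpl. rewrite !binom_n_0. ring.
    - cbn [sum_f_R0]. rewrite IH by lia. rewrite <- pascal by lia.
      replace (u + 1 + INR m) with (u + INR (S m)) by (rewrite S_INR; ring). cbn [pow]. ring. }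
  cbn [sum_f_R0]. rewrite H by lia. rewrite !binom_n_n.
  replace (u + INR (S n)) with (u + 1 + INR n) by (rewrite S_INR; ring). cbn [pow]. ring.
Qed.

Lemma dn_0 g u : dn 0 g u = g u.
Proof. unfold dn. simpl. rewrite binom_n_0, Rplus_0_r. ring. Qed.

Lemma is_derive_dn n g g' : (forall x, is_derive g x (g' x)) -> forall u, is_derive (dn n g) u (dn n g' u).
Proof.
  intros H. induction n as [|n IH]; intros u.
  - eapply is_derive_ext; [intros t; symmetry; apply dn_0|]. rewrite dn_0. apply H.
  - eapply is_derive_ext; [intros t; symmetry; apply dn_S|]. rewrite dn_S.
    apply (is_derive_minus (K := R_AbsRing) (V := R_NormedModule)); [apply IH|].
    evar_last; [apply (is_derive_comp_R (dn n g) (fun t => t + 1)); [apply IH|]|].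
    + auto_derive; [trivial|reflexivity].
    + ring.
Qed.

Lemma dn_scal n c g u : dn n (fun x => c * g x) u = c * dn n g u.
Proof.
  revert u; induction n as [|n IH]; intros u; [now rewrite !dn_0|]. rewrite !dn_S, !IH. ring.
Qed.

Lemma is_derive_dn_pow n k u : is_derive (dn n (fun x => x ^ S k)) u (INR (S k) * dn n (fun x => x ^ k) u).
Proof.
  rewrite <- dn_scal. apply (is_derive_dn n (fun x => x ^ S k) (fun x => INR (S k) * x ^ k)).
  intros x. evar_last; [apply is_derive_pow, (is_derive_id (K := R_AbsRing))|].
  unfold one; simpl pred; cbn [Hierarchy.one]; simpl. ring.
Qed.

Lemma derive_0_const (f : R -> R) : (forall u, is_derive f u 0) -> forall u v, f u = f v.
Proof.
  intros H u v.
  assert (E : forall a b, a <= b -> f a = f b).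
  { intros a b Hab.
    assert (E := increment_abs_le f (fun _ => 0) (fun _ => 0) (fun _ => 0) a b Hab).
    assert (E' : Rabs (f b - f a) <= 0 - 0).
    { apply E; intros; auto.
      - apply (is_derive_const (K := R_AbsRing) (V := R_NormedModule)).
      - eapply is_derive_continuity_pt; apply H.
      - apply continuity_pt_const; intros ? ?; reflexivity.
      - rewrite Rabs_R0; lra. }
    assert (H0 := Rabs_pos (f b - f a)). apply Rminus_diag_uniq_sym.
    destruct (Req_dec (f b - f a) 0) as [E0|E0]; [exact E0|].
    apply Rabs_pos_lt in E0. lra. }
  destruct (Rle_dec u v); [apply E; lra|symmetry; apply E; lra].
Qed.

(** Induction on the degree: the derivative of a difference of [x^(k+1)] is a multiple of the
    difference of [x^k], hence 0; so the difference is constant in [u], and one further difference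
    vanishes. *)
Lemma dn_pow_0 k : forall n u, (k < n)%nat -> dn n (fun x => x ^ k) u = 0.
Proof.
  induction k as [|k IH]; intros n u Hn; (destruct n as [|n]; [lia|]); rewrite dn_S.
  - assert (E : forall v, dn n (fun x => x ^ 0) v = dn n (fun x => x ^ 0) 0).
    { intros v.
      clear Hn. revert v. induction n as [|n IHn]; intros v; [now rewrite !dn_0|].
      rewrite !dn_S, (IHn v), (IHn (v + 1)), (IHn (0 + 1)). reflexivity. }
    rewrite (E u), (E (u + 1)). ring.
  - rewrite (derive_0_const (dn n (fun x => x ^ S k))) with (u := u) (v := u + 1); [ring|].
    intros v. evar_last; [apply is_derive_dn_pow|]. rewrite IH by lia. ring.
Qed.

(** The Leibniz rule for a power of [1 - T] against multiplication by the variable. It drives both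
    the equality of the Bernoulli values at 0 and 1 and the closed form of [hasse_kernel]. *)
Lemma dn_mult_id n g u : dn (S n) (fun x => x * g x) u = u * dn (S n) g u - INR (S n) * dn n g (u + 1).
Proof.
  revert u; induction n as [|n IH]; intros u.
  - rewrite !dn_S, !dn_0. simpl. ring.
  - rewrite dn_S, !IH, (dn_S (S n) g u), (dn_S n g (u + 1)), (S_INR (S n)). ring.
Qed.

(** The Bernoulli polynomial [B_k], in the explicit form given by Hasse's series at [s = 1 - k],
    where differences of order above [k] vanish. Dividing it by [k!] makes each [bern] the
    derivative of the next. *)
Definition bern_q (k : nat) (u : R) : R :=
  rsum (fun n => / INR (S n) * dn n (fun x => x ^ k) u) (S k).

Definition bern (k : nat) (u : R) : R := bern_q k u / INR (fact k).

Lemma is_derive_rsum (f : nat -> R -> R) (l : nat -> R) x n : (forall k, is_derive (f k) x (l k)) ->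
  is_derive (fun t => rsum (fun k => f k t) n) x (rsum l n).
Proof.
  intros H; induction n as [|n IH]; simpl.
  - apply (is_derive_const (K := R_AbsRing) (V := R_NormedModule)).
  - apply (is_derive_plus (K := R_AbsRing) (V := R_NormedModule)); [exact IH|apply H].
Qed.

Lemma is_derive_bern k u : is_derive (bern (S k)) u (bern k u).
Proof.
  assert (D : is_derive (bern_q (S k)) u (INR (S k) * bern_q k u)).
  { evar_last.
    - apply (is_derive_rsum (fun n u => / INR (S n) * dn n (fun x => x ^ S k) u)).
      intros n. apply is_derive_scal, is_derive_dn_pow.
    - unfold bern_q. cbn [rsum]. rewrite (dn_pow_0 k (S k)) by lia.
      rewrite Rmult_plus_distr_l, <- rsum_scal.
      rewrite (rsum_ext _ (fun n => INR (S k) * (/ INR (S n) * dn n (fun x => x ^ k) u))) by (intros; ring).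
      rewrite !rsum_scal. ring. }
  unfold bern. evar_last.
  - apply (is_derive_scal _ u (/ INR (fact (S k)))) in D.
    eapply is_derive_ext; [|exact D]. intros t. simpl. unfold Rdiv. apply Rmult_comm.
  - rewrite fact_simpl, mult_INR. field. split; [apply INR_fact_neq_0|apply not_0_INR; lia].
Qed.

Lemma bern_0 u : bern 0 u = 1.
Proof. unfold bern, bern_q. simpl. rewrite dn_0. simpl. field. Qed.

Lemma bern_1 u : bern 1 u = u - / 2.
Proof. unfold bern, bern_q. cbn [rsum]. rewrite dn_S, !dn_0. simpl. field. Qed.

(** By the Leibniz rule at 0 the [m]-th term of the difference becomes [- dn m (x^k) 1], that is
    [dn (m+1) (x^k) 0 - dn m (x^k) 0]. The sum telescopes to [- 0^k], and here [k >= 1]. *)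
Lemma bern_q_01 k : (2 <= k)%nat -> bern_q k 0 = bern_q k 1.
Proof.
  intros Hk. destruct k as [|k]; [lia|].
  assert (E : bern_q (S k) 0 - bern_q (S k) 1 =
    - (dn 0 (fun x => x ^ k) 0 - dn (S (S k)) (fun x => x ^ k) 0)).
  { unfold bern_q. generalize (S (S k)) as m.
    induction m as [|m IH]; [simpl; ring|]. cbn [rsum].
    replace (rsum (fun n => / INR (S n) * dn n (fun x => x ^ S k) 0) m + / INR (S m) * dn m (fun x => x ^ S k) 0 -
      (rsum (fun n => / INR (S n) * dn n (fun x => x ^ S k) 1) m + / INR (S m) * dn m (fun x => x ^ S k) 1))
     with ((rsum (fun n => / INR (S n) * dn n (fun x => x ^ S k) 0) m -
      rsum (fun n => / INR (S n) * dn n (fun x => x ^ S k) 1) m) +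
      / INR (S m) * (dn m (fun x => x ^ S k) 0 - dn m (fun x => x ^ S k) (0 + 1))) by (rewrite Rplus_0_l; ring).
    rewrite IH, <- dn_S. change (fun x : R => x ^ S k) with (fun x : R => x * x ^ k).
    rewrite dn_mult_id, (dn_S m (fun x => x ^ k) 0). field. apply not_0_INR; lia. }
  rewrite (dn_pow_0 k (S (S k))), dn_0, pow_i in E by lia. lra.
Qed.

Lemma bern_01 k : (2 <= k)%nat -> bern k 1 = bern k 0.
Proof. intros Hk. unfold bern. now rewrite bern_q_01. Qed.

(* The reflection formula is proved by induction: both sides have the same derivative, and the
   constant vanishes because [bern (S k)] takes equal values at 0 and 1. *)
Lemma bern_reflect k u : bern k (1 - u) = (-1) ^ k * bern k u.
Proof.
  revert u; induction k as [|k IH]; intros u; [rewrite !bern_0; simpl; ring|].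
  destruct k as [|k]; [rewrite !bern_1; simpl; field|].
  set (f := fun u => bern (S (S k)) (1 - u) - (-1) ^ S (S k) * bern (S (S k)) u).
  assert (Hc : forall a b, f a = f b).
  { apply derive_0_const. intros v. unfold f. evar_last.
    - apply (is_derive_minus (K := R_AbsRing) (V := R_NormedModule)).
      + apply (is_derive_comp_R (bern (S (S k))) (fun t => 1 - t)); [apply is_derive_bern|].
        auto_derive; [trivial|reflexivity].
      + apply is_derive_scal, is_derive_bern.
    - unfold minus, plus, opp; simpl. rewrite IH. simpl. ring. }
  set (g := fun u => - bern (S (S (S k))) (1 - u) - (-1) ^ S (S k) * bern (S (S (S k))) u - f 0 * u).
  assert (Hg : forall a b, g a = g b).
  { apply derive_0_const. intros v. unfold g. evar_last.
    - apply (is_derive_minus (K := R_AbsRing) (V := R_NormedModule)).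
      + apply (is_derive_minus (K := R_AbsRing) (V := R_NormedModule)).
        * apply (is_derive_opp (K := R_AbsRing) (V := R_NormedModule)).
          apply (is_derive_comp_R (bern (S (S (S k)))) (fun t => 1 - t)); [apply is_derive_bern|].
          auto_derive; [trivial|reflexivity].
        * apply is_derive_scal, is_derive_bern.
      + apply is_derive_scal, (is_derive_id (K := R_AbsRing)).
    - unfold minus, plus, opp, one; simpl. rewrite (Hc 0 v). unfold f. simpl. ring. }
  specialize (Hg 0 1). unfold g in Hg. rewrite Rminus_0_r, Rminus_diag in Hg.
  rewrite (bern_01 (S (S (S k)))) in Hg by lia.
  assert (F0 : f u = 0) by (rewrite (Hc u 0); lra). unfold f in F0. lra.
Qed.

Lemma bern_odd_0 k : Nat.odd k = true -> (2 <= k)%nat -> bern k 1 = 0.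
Proof.
  intros Ho Hk. assert (E := bern_reflect k 0). rewrite Rminus_0_r, <- (bern_01 k Hk) in E.
  apply Nat.odd_spec in Ho. destruct Ho as [j ->].
  replace ((-1) ^ (2 * j + 1)) with (-1) in E by (rewrite pow_add, pow_1_even; ring). lra.
Qed.

Lemma is_series_finite (f : nat -> R) N : (forall n, (N <= n)%nat -> f n = 0) -> is_series f (rsum f N).
Proof.
  intros H. unfold is_series.
  apply (is_lim_seq_ext_loc (fun _ => rsum f N) _ (rsum f N)); [|apply is_lim_seq_const].
  exists N. intros n Hn. rewrite sum_n_rsum.
  replace (S n) with (N + (S n - N))%nat by lia. generalize (S n - N)%nat as k.
  induction k as [|k IH]; [now rewrite Nat.add_0_r|].
  rewrite Nat.add_succ_r. cbn [rsum]. rewrite <- IH, H by lia. ring.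
Qed.

(** At [s = -p] the powers in Hasse's series are polynomials of degree [p + 1], so the series stops
    after [n = p + 1]. *)
Lemma zeta_neg p : riemann_zeta (- INR p) = - INR (fact p) * bern (S p) 1.
Proof.
  unfold riemann_zeta, hurwitz_zeta.
  assert (E : forall n, / INR (n + 1) * sum_f_R0 (fun k => (-1) ^ k * Binomial.C n k * Rpower (1 + INR k) (1 - - INR p)) n
     = / INR (S n) * dn n (fun x => x ^ S p) 1).
  { intros n. rewrite Nat.add_1_r. f_equal. unfold dn. apply sum_eq. intros i _. f_equal.
    rewrite <- Rpower_pow by (assert (H := pos_INR i); lra). f_equal. rewrite S_INR. ring. }
  rewrite (Series_ext _ _ E).
  rewrite (is_series_unique _ _ (is_series_finite (fun n => / INR (S n) * dn n (fun x => x ^ S p) 1) (S (S p))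
    ltac:(intros n Hn; cbv beta; rewrite dn_pow_0 by lia; ring))).
  fold (bern_q (S p) 1). unfold bern. rewrite fact_simpl, mult_INR.
  assert (H := pos_INR p). rewrite S_INR. field. repeat split; try apply INR_fact_neq_0; lra.
Qed.

Lemma zeta_0 : riemann_zeta 0 = - / 2.
Proof.
  assert (E := zeta_neg 0). simpl INR in E. rewrite Ropp_0 in E. rewrite E, bern_1. simpl. field.
Qed.

Lemma zeta_neg_even l : (1 <= l)%nat -> riemann_zeta (- INR (2 * l)) = 0.
Proof.
  intros Hl. rewrite zeta_neg, bern_odd_0; [ring| |lia].
  apply Nat.odd_spec. exists l. lia.
Qed.

Lemma bern_bounded k : exists b, 0 <= b /\ forall u, 0 <= u <= 1 -> Rabs (bern k u) <= b.
Proof.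
  destruct (continuity_ab_maj (fun u => Rabs (bern k u)) 0 1 Rle_0_1) as [x [Hx _]].
  - intros c _. apply (continuity_pt_comp (bern k) Rabs); [|apply Rcontinuity_abs].
    destruct k as [|k].
    + apply continuity_pt_const. intros a b. now rewrite !bern_0.
    + eapply is_derive_continuity_pt, is_derive_bern.
  - exists (Rabs (bern k x)). split; [apply Rabs_pos|exact Hx].
Qed.

Lemma clim_at_0 F : (forall eps, 0 < eps -> exists d, 0 < d /\ forall u, 0 < u < d -> Cmod (F u) < eps) ->
  clim (fun n => F (/ INR (S n))) (RtoC 0).
Proof.
  intros H.
  assert (K : is_lim_seq (fun n => Cmod (F (/ INR (S n)))) 0).
  { apply is_lim_seq_spec. intros eps. destruct (H eps (cond_pos eps)) as [d [Hd Hu]].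
    assert (L := is_lim_seq_inv_INR). apply is_lim_seq_spec in L.
    destruct (L (mkposreal d Hd)) as [N HN]. exists N. intros n Hn.
    specialize (HN n Hn). cbv beta in HN. rewrite Rminus_0_r in HN.
    assert (0 < / INR (S n)) by (apply Rinv_0_lt_compat, lt_0_INR; lia).
    apply Rabs_def2 in HN. cbn [pos] in HN.
    rewrite Rminus_0_r, Rabs_pos_eq by apply Cmod_ge_0. apply Hu. lra. }
  eapply clim_squeeze; [|exact K]. intros n. right. f_equal. ring.
Qed.

(** Iterated integration by parts on [[n, n+1]], with [f j] standing for the [j]-th derivative of
    [f 0]: the derivative of this sum is [f 0] up to a term in [f K] alone. The shift by [n]
    replaces periodic Bernoulli functions. *)
Definition bern_prim (K : nat) (f : nat -> R -> C) (n : nat) (u : R) : C :=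
  csum (fun j => Cmult (RtoC ((-1) ^ j * bern (S j) (u - INR n))) (f j u)) K.

Lemma cderiv_bern_prim K f n u : (forall k, cderiv (f k) u (f (S k) u)) ->
  cderiv (bern_prim K f n) u
    (Cminus (f O u) (Cmult (RtoC ((-1) ^ K * bern K (u - INR n))) (f K u))).
Proof.
  intros H. induction K as [|K IH].
  - unfold bern_prim. simpl. eapply cderiv_eq; [apply cderiv_const|].
    rewrite bern_0. replace (1 * 1) with 1 by ring. ring.
  - unfold bern_prim. cbn [csum]. eapply cderiv_eq.
    + apply cderiv_plus; [exact IH|]. apply cderiv_mult; [|apply H].
      apply cderiv_RtoC. apply is_derive_scal.
      apply (is_derive_comp_R (bern (S K)) (fun u => u - INR n)); [apply is_derive_bern|].
      auto_derive; [trivial|reflexivity].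
    + cbv beta. rewrite Rmult_1_l. cbn [pow]. rewrite !RtoC_mult. ring.
Qed.

(** At interior integers the boundary terms cancel for Bernoulli polynomials of degree at least 2,
    which agree at 0 and 1. The linear one jumps from 1/2 to -1/2, and this jump produces the
    trapezoidal sum. *)
Lemma csum_bern_prim_increments K f M :
  csum (fun n => Cminus (bern_prim (S K) f n (INR (S n))) (bern_prim (S K) f n (INR n))) M =
  Cplus (Cplus (Cmult (RtoC (/ 2)) (f O 0)) (csum (fun k => f O (INR (S k))) M))
   (Cplus (Copp (Cmult (RtoC (/ 2)) (f O (INR M))))
     (csum (fun j => Cmult (RtoC ((-1) ^ S j * bern (S (S j)) 0)) (Cminus (f (S j) (INR M)) (f (S j) 0))) K)).
Proof.
  assert (E : forall n, Cminus (bern_prim (S K) f n (INR (S n))) (bern_prim (S K) f n (INR n)) =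
     Cplus (Cmult (RtoC (/ 2)) (Cplus (f O (INR (S n))) (f O (INR n))))
      (csum (fun j => Cmult (RtoC ((-1) ^ S j * bern (S (S j)) 0)) (Cminus (f (S j) (INR (S n))) (f (S j) (INR n)))) K)).
  { intros n. unfold bern_prim. rewrite !csum_S_l.
    replace (INR (S n) - INR n) with 1 by (rewrite S_INR; ring). rewrite Rminus_diag, !bern_1.
    rewrite (csum_ext (fun j => Cmult (RtoC ((-1) ^ S j * bern (S (S j)) 0)) (Cminus (f (S j) (INR (S n))) (f (S j) (INR n))))
      (fun j => Cplus (Cmult (RtoC ((-1) ^ S j * bern (S (S j)) 1)) (f (S j) (INR (S n))))
         (Cmult (Copp (RtoC 1)) (Cmult (RtoC ((-1) ^ S j * bern (S (S j)) 0)) (f (S j) (INR n)))))).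
    - rewrite csum_plus, csum_scal. cbn [pow].
      replace (1 * (1 - / 2)) with (/ 2) by field. replace (1 * (0 - / 2)) with (- / 2) by ring.
      rewrite RtoC_opp. ring.
    - intros j _. rewrite (bern_01 (S (S j))) by lia. ring. }
  rewrite (csum_ext _ _ M (fun n _ => E n)).
  clear E. induction M as [|M IH].
  - cbn [csum]. rewrite (csum_ext _ (fun _ => RtoC 0)).
    + rewrite csum_const. simpl (INR 0). ring.
    + intros j _. simpl (INR 0). ring.
  - cbn [csum]. rewrite IH.
    rewrite (csum_ext (fun j => Cmult (RtoC ((-1) ^ S j * bern (S (S j)) 0)) (Cminus (f (S j) (INR (S M))) (f (S j) 0)))
      (fun j => Cplus (Cmult (RtoC ((-1) ^ S j * bern (S (S j)) 0)) (Cminus (f (S j) (INR M)) (f (S j) 0)))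
        (Cmult (RtoC ((-1) ^ S j * bern (S (S j)) 0)) (Cminus (f (S j) (INR (S M))) (f (S j) (INR M)))))) by (intros; ring).
    rewrite csum_plus.
    assert (H2 : f O (INR M) = Cplus (Cmult (RtoC (/ 2)) (f O (INR M))) (Cmult (RtoC (/ 2)) (f O (INR M)))).
    { rewrite RtoC_inv by lra. field. }
    assert (H3 : f O (INR (S M)) = Cplus (Cmult (RtoC (/ 2)) (f O (INR (S M)))) (Cmult (RtoC (/ 2)) (f O (INR (S M))))).
    { rewrite RtoC_inv by lra. field. }
    rewrite H3 at 2. ring.
Qed.

(** The remainder is the integral of a bounded Bernoulli function against the derivative of order
    [K + 1]. That derivative is compared with [y/(u^2+y^2)], whose integral is [pi/2] for every
    scale [y], so that [B] depends on [K] only. The uniformity serves [y -> oo] in [Lz_expansion]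
    and the scale [1/d] in [EM_pexp_limit]. *)
Lemma EM_order K : exists B, 0 <= B /\ forall (f : nat -> R -> C) l eps y,
  (forall k u, cderiv (f k) u (f (S k) u)) -> 0 < y -> EM (f O) (f O 0) l ->
  (forall u, 0 <= u -> Cmod (f (S K) u) <= eps * (y / (u ^ 2 + y ^ 2))) ->
  (forall k, (k <= K)%nat -> clim (fun M => f k (INR M)) (RtoC 0)) ->
  Cmod (Cminus l (csum (fun j => Cmult (RtoC ((-1) ^ S j * bern (S (S j)) 0)) (f (S j) 0)) K)) <= B * eps.
Proof.
  destruct (bern_bounded (S K)) as [b [Hb Hbern]].
  (* A factor 2 comes from [cincrement_le], another from bounding [atan] by 2. *)
  exists (4 * b). split; [lra|].
  intros f l eps y Hf Hy [F [HF1 [HF2 HF3]]] Hbd Hlim.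
  assert (Heps : 0 <= eps).
  { specialize (Hbd 0 (Rle_refl 0)). assert (H := Cmod_ge_0 (f (S K) 0)).
    assert (0 < y / (0 ^ 2 + y ^ 2)) by (apply Rdiv_lt_0_compat; nra).
    apply Rnot_lt_le. intros Hneg. nra. }
  set (g := fun t => b * eps * atan (t / y)).
  assert (Dg : forall t, is_derive g t (b * (eps * (y / (t ^ 2 + y ^ 2))))).
  { intros t. unfold g. auto_derive; [trivial|]. field. repeat split; nra. }
  set (G := fun n u => Cminus (F u) (bern_prim (S K) f n u)).
  assert (DG : forall n u, 0 < u -> cderiv (G n) u (Cmult (RtoC ((-1) ^ S K * bern (S K) (u - INR n))) (f (S K) u))).
  { intros n u Hu. eapply cderiv_eq; [apply cderiv_minus; [apply HF1, Hu|apply cderiv_bern_prim; auto]|]. ring. }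
  assert (Inc : forall n v w, 0 < v -> INR n <= v -> v <= w -> w <= INR n + 1 ->
     Cmod (Cminus (G n w) (G n v)) <= 2 * (g w - g v)).
  { intros n v w Hv0 Hv Hvw Hw.
    apply (cincrement_le (G n) (fun u => Cmult (RtoC ((-1) ^ S K * bern (S K) (u - INR n))) (f (S K) u)) g
      (fun t => b * (eps * (y / (t ^ 2 + y ^ 2))))); [exact Hvw| | | | |].
    - intros t Ht. apply DG. lra.
    - intros t _. apply Dg.
    - intros t Ht. destruct (DG n t ltac:(lra)) as [D1 D2]; split; eapply is_derive_continuity_pt; eassumption.
    - intros t _. eapply is_derive_continuity_pt, Dg.
    - intros t Ht. rewrite Cmod_mult, Cmod_R, Rabs_mult, pow_1_abs, Rmult_1_l.
      apply Rmult_le_compat; [apply Rabs_pos|apply Cmod_ge_0|apply Hbern; lra|apply Hbd; lra]. }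
  (* [F] is constrained for [u > 0] only; [F'] puts its limit 0 at the integer 0. On [[0, 1]] the
     estimate is then obtained in the limit along the points [1/(k+1)]. *)
  set (F' := fun n => match n with O => RtoC 0 | S _ => F (INR n) end).
  assert (IncN : forall n, Cmod (Cminus (Cminus (F (INR (S n))) (bern_prim (S K) f n (INR (S n))))
     (Cminus (F' n) (bern_prim (S K) f n (INR n)))) <= 2 * (g (INR (S n)) - g (INR n))).
  { intros n. destruct n as [|n].
    - apply clim_Cmod_le with (u := fun k => Cminus (G O (INR 1)) (G O (/ INR (S k)))).
      + apply clim_minus; [apply clim_const|]. unfold G. apply clim_minus; [apply clim_at_0, HF2|].
        assert (D0 := cderiv_bern_prim (S K) f 0 0 (fun k => Hf k 0)).
        destruct D0 as [D1 D2].
        split; [apply (is_lim_seq_continuous (fun t => Re (bern_prim (S K) f 0 t)))|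
                apply (is_lim_seq_continuous (fun t => Im (bern_prim (S K) f 0 t)))];
          try (eapply is_derive_continuity_pt; eassumption); apply is_lim_seq_inv_INR.
      + exists O. intros k _.
        assert (Hk : 0 < / INR (S k)) by (apply Rinv_0_lt_compat, lt_0_INR; lia).
        assert (Hk1 : / INR (S k) <= 1).
        { rewrite <- Rinv_1. apply Rinv_le_contravar; [lra|]. rewrite S_INR. assert (H := pos_INR k). lra. }
        eapply Rle_trans; [apply Inc; simpl INR in *; lra|].
        assert (g (INR 0) <= g (/ INR (S k))).
        { unfold g. apply Rmult_le_compat_l; [nra|]. simpl (INR 0). left. apply atan_increasing.
          unfold Rdiv. apply Rmult_lt_compat_r; [now apply Rinv_0_lt_compat|exact Hk]. }
        lra.
    - apply (Inc (S n) (INR (S n)) (INR (S (S n)))); rewrite ?(S_INR (S n)); try lra.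
      apply lt_0_INR; lia. }
  set (T := fun M => csum (fun n => Cminus (Cminus (F (INR (S n))) (bern_prim (S K) f n (INR (S n))))
     (Cminus (F' n) (bern_prim (S K) f n (INR n)))) M).
  assert (HT : forall M, Cmod (T M) <= 4 * b * eps).
  { intros M. unfold T. eapply Rle_trans; [apply Cmod_csum|].
    apply Rle_trans with (2 * (g (INR M) - g 0)).
    - induction M as [|M IH]; [simpl; lra|]. cbn [rsum]. assert (H := IncN M). lra.
    - unfold g. replace (0 / y) with 0 by (field; lra). rewrite atan_0.
      assert (H := atan_bound (INR M / y)). assert (Hpi := PI_4).
      assert (b * eps * atan (INR M / y) <= b * eps * 2) by (apply Rmult_le_compat_l; nra). lra. }
  assert (ET : forall M, (1 <= M)%nat -> T M = Cminus (F (INR M))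
     (csum (fun n => Cminus (bern_prim (S K) f n (INR (S n))) (bern_prim (S K) f n (INR n))) M)).
  { intros M HM. unfold T.
    assert (E : forall m, csum (fun n => Cminus (Cminus (F (INR (S n))) (bern_prim (S K) f n (INR (S n))))
        (Cminus (F' n) (bern_prim (S K) f n (INR n)))) m =
       Cminus (F' m) (csum (fun n => Cminus (bern_prim (S K) f n (INR (S n))) (bern_prim (S K) f n (INR n))) m)).
    { induction m as [|m IH]; cbn [csum]; [simpl; ring|]. rewrite IH. change (F' (S m)) with (F (INR (S m))). ring. }
    rewrite E. destruct M; [lia|reflexivity]. }
  apply clim_Cmod_le with (u := fun M => Copp (T M)).
  - apply clim_ext_loc with (fun M => Copp (Cminus (F (INR M))
     (csum (fun n => Cminus (bern_prim (S K) f n (INR (S n))) (bern_prim (S K) f n (INR n))) M)));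
      [exists 1%nat; intros M HM; now rewrite ET by exact HM|].
    assert (HS : clim (fun M => csum (fun j => Cmult (RtoC ((-1) ^ S j * bern (S (S j)) 0)) (Cminus (f (S j) (INR M)) (f (S j) 0))) K)
      (csum (fun j => Cmult (RtoC ((-1) ^ S j * bern (S (S j)) 0)) (Cminus (RtoC 0) (f (S j) 0))) K)).
    { apply (clim_csum (fun M j => Cmult (RtoC ((-1) ^ S j * bern (S (S j)) 0)) (Cminus (f (S j) (INR M)) (f (S j) 0)))).
      intros k Hk. apply clim_scal, clim_minus; [apply Hlim; lia|apply clim_const]. }
    assert (HL := clim_plus _ _ _ _ HF3 (clim_plus _ _ _ _ (clim_opp _ _ (clim_scal (RtoC (/ 2)) _ _ (Hlim O ltac:(lia)))) HS)).
    eapply clim_ext; [|eapply clim_eq; [exact HL|]].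
    + intros M. cbv beta. rewrite csum_bern_prim_increments. ring.
    + rewrite (csum_ext (fun j => Cmult (RtoC ((-1) ^ S j * bern (S (S j)) 0)) (Cminus (RtoC 0) (f (S j) 0)))
        (fun j => Cmult (Copp (RtoC 1)) (Cmult (RtoC ((-1) ^ S j * bern (S (S j)) 0)) (f (S j) 0)))) by (intros; ring).
      rewrite csum_scal. ring.
  - exists O. intros M _. rewrite Cmod_opp. apply HT.
Qed.

(** * Asymptotics of the digamma terms *)

Lemma cderiv_pow f n x l : cderiv f x l ->
  cderiv (fun t => Cpow (f t) (S n)) x (Cmult (RtoC (INR (S n))) (Cmult l (Cpow (f x) n))).
Proof.
  intros H. induction n as [|n IH].
  - eapply cderiv_ext; [|eapply cderiv_eq; [exact H|]].
    + intros t. simpl. ring.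
    + simpl. ring.
  - apply cderiv_ext with (fun t => Cmult (f t) (Cpow (f t) (S n))); [intros; reflexivity|].
    eapply cderiv_eq; [apply cderiv_mult; [exact H|exact IH]|].
    rewrite (S_INR (S n)), RtoC_plus. simpl Cpow. ring.
Qed.

(** The [k]-th derivative in [u] of [u/(u^2+z^2)], from its decomposition into [1/(u+iz)] and
    [1/(u-iz)]. *)
Definition odd_derivs (z : C) (k : nat) (u : R) : C :=
  Cmult (RtoC ((-1) ^ k * INR (fact k) / 2))
    (Cplus (Cinv (Cpow (Cplus (RtoC u) (Cmult Ci z)) (S k)))
           (Cinv (Cpow (Cminus (RtoC u) (Cmult Ci z)) (S k)))).

Section OddDerivs.
Variable z : C.
Hypothesis Hz : 0 < Re z.

Lemma u_plus_iz_neq_0 u : Cplus (RtoC u) (Cmult Ci z) <> RtoC 0.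
Proof. intros H. apply (f_equal Im) in H. unfold Re, Im in *; simpl in H. lra. Qed.

Lemma u_minus_iz_neq_0 u : Cminus (RtoC u) (Cmult Ci z) <> RtoC 0.
Proof. intros H. apply (f_equal Im) in H. unfold Re, Im in *; simpl in H. lra. Qed.

Lemma cderiv_odd_derivs k u : cderiv (odd_derivs z k) u (odd_derivs z (S k) u).
Proof.
  assert (P1 := u_plus_iz_neq_0 u). assert (P2 := u_minus_iz_neq_0 u).
  unfold odd_derivs. eapply cderiv_eq.
  - apply cderiv_scal, cderiv_plus; apply cderiv_inv.
    + apply cderiv_pow, cderiv_plus; [apply cderiv_id|apply cderiv_const].
    + now apply Cpow_nz.
    + apply cderiv_pow, cderiv_minus; [apply cderiv_id|apply cderiv_const].
    + now apply Cpow_nz.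
  - cbv beta. rewrite fact_simpl, mult_INR.
    replace ((-1) ^ S k * (INR (S k) * INR (fact k)) / 2) with (- INR (S k) * ((-1) ^ k * INR (fact k) / 2))
      by (cbn [pow]; field).
    rewrite RtoC_mult, RtoC_opp. cbn [Cpow].
    field. repeat split; try (apply Cpow_nz); assumption.
Qed.

Lemma odd_derivs_0 u : odd_derivs z 0 u = Cdiv (RtoC u) (Cplus (RtoC (u ^ 2)) (Cmult z z)).
Proof.
  assert (P1 := u_plus_iz_neq_0 u). assert (P2 := u_minus_iz_neq_0 u).
  unfold odd_derivs.
  assert (E : Cplus (RtoC (u ^ 2)) (Cmult z z) = Cmult (Cplus (RtoC u) (Cmult Ci z)) (Cminus (RtoC u) (Cmult Ci z)))
    by (apply C_ext; unfold Re, Im; simpl; ring).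
  rewrite E. replace ((-1) ^ 0 * INR (fact 0) / 2) with (/ 2) by (simpl; field).
  rewrite RtoC_inv by lra. simpl. field. repeat split; assumption.
Qed.

(** The poles [iz] and [-iz] stay at a distance comparable to [u + y] from the point [u]: for
    [u <= 2y] because their imaginary parts have size [Re z >= kap y], for larger [u] because
    [|z| <= y]. *)
Lemma Cmod_u_iz_lower kap y u : 0 < kap <= 1 -> 0 < y -> 0 <= u -> kap * y <= Re z -> Cmod z <= y ->
  kap / 3 * (u + y) <= Cmod (Cplus (RtoC u) (Cmult Ci z)) /\
  kap / 3 * (u + y) <= Cmod (Cminus (RtoC u) (Cmult Ci z)).
Proof.
  intros Hk Hy Hu Hre Hm.
  assert (G : forall w, Cmod w = Cmod z -> Re z <= Rabs (Im w) -> kap / 3 * (u + y) <= Cmod (Cplus (RtoC u) w)).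
  { intros w Hw Hi. destruct (Rle_dec u (2 * y)) as [H|H].
    - assert (H1 := im_le_Cmod (Cplus (RtoC u) w)).
      assert (E : Im (Cplus (RtoC u) w) = Im w) by (unfold Im; simpl; ring). rewrite E in H1. nra.
    - assert (H1 := Cmod_triangle_inv (RtoC u) w). rewrite Cmod_R, Rabs_pos_eq in H1 by lra. rewrite Hw in H1. nra. }
  split.
  - apply G; [rewrite Cmod_mult, Cmod_Ci; ring|]. replace (Im (Cmult Ci z)) with (Re z) by (unfold Re, Im; simpl; ring). apply Rle_abs.
  - apply (G (Copp (Cmult Ci z))); [rewrite Cmod_opp, Cmod_mult, Cmod_Ci; ring|].
    replace (Im (Copp (Cmult Ci z))) with (- Re z) by (unfold Re, Im; simpl; ring).
    rewrite Rabs_Ropp. apply Rle_abs.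
Qed.

Lemma Cmod_odd_derivs_le kap y u k : 0 < kap <= 1 -> 0 < y -> 0 <= u -> kap * y <= Re z -> Cmod z <= y ->
  Cmod (odd_derivs z k u) <= INR (fact k) * (3 / kap) ^ S k * / (u + y) ^ S k.
Proof.
  intros Hk Hy Hu Hre Hm.
  destruct (Cmod_u_iz_lower kap y u Hk Hy Hu Hre Hm) as [L1 L2].
  assert (P1 := u_plus_iz_neq_0 u). assert (P2 := u_minus_iz_neq_0 u).
  assert (Hb : forall w, w <> RtoC 0 -> kap / 3 * (u + y) <= Cmod w -> Cmod (Cinv (Cpow w (S k))) <= (3 / kap) ^ S k * / (u + y) ^ S k).
  { intros w Hw Hl. rewrite Cmod_inv, Cmod_pow by (now apply Cpow_nz).
    replace ((3 / kap) ^ S k * / (u + y) ^ S k) with (/ (kap / 3 * (u + y)) ^ S k).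
    - apply Rinv_le_contravar; [apply pow_lt|apply pow_incr; split; [|exact Hl]]; apply Rlt_le || idtac; try (apply Rmult_lt_0_compat; lra).
    - rewrite Rpow_mult_distr, Rinv_mult. f_equal. rewrite <- pow_inv. f_equal. field. lra. }
  unfold odd_derivs. rewrite Cmod_mult, Cmod_R. unfold Rdiv at 1.
  rewrite !Rabs_mult, pow_1_abs, Rmult_1_l, (Rabs_pos_eq (INR _)), (Rabs_pos_eq (/ 2)) by (try apply pos_INR; lra).
  assert (H := Cmod_triangle (Cinv (Cpow (Cplus (RtoC u) (Cmult Ci z)) (S k))) (Cinv (Cpow (Cminus (RtoC u) (Cmult Ci z)) (S k)))).
  assert (H1 := Hb _ P1 L1). assert (H2 := Hb _ P2 L2).
  rewrite !Rmult_assoc. apply Rmult_le_compat_l; [apply pos_INR|]. lra.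
Qed.

End OddDerivs.

Lemma clim_pow_decay (f : nat -> C) c k y : 0 < y ->
  (forall M, Cmod (f M) <= c * / (INR M + y) ^ S k) -> clim f (RtoC 0).
Proof.
  intros Hy H.
  assert (L : is_lim_seq (fun M => / (INR M + y)) 0).
  { apply (is_lim_seq_inv (fun M => INR M + y) p_infty); [|discriminate].
    eapply is_lim_seq_plus; [apply is_lim_seq_INR|apply is_lim_seq_const|reflexivity]. }
  apply clim_squeeze with (fun M => c * (/ (INR M + y) * (/ (y + 0)) ^ k)).
  - intros M. replace (Cminus (f M) (RtoC 0)) with (f M) by ring. eapply Rle_trans; [apply H|].
    assert (HM := pos_INR M).
    assert (Hc : 0 <= c).
    { assert (H0 := Rle_trans _ _ _ (Cmod_ge_0 _) (H M)).
      assert (0 < / (INR M + y) ^ S k) by (apply Rinv_0_lt_compat, pow_lt; lra). nra. }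
    apply Rmult_le_compat_l; [exact Hc|]. cbn [pow]. rewrite Rinv_mult.
    apply Rmult_le_compat_l; [left; apply Rinv_0_lt_compat; lra|].
    rewrite pow_inv. apply Rinv_le_contravar; [apply pow_lt; lra|apply pow_incr; lra].
  - replace (Finite 0) with (Finite (c * (0 * (/ (y + 0)) ^ k))) by (f_equal; ring).
    apply is_lim_seq_mult'; [apply is_lim_seq_const|].
    apply is_lim_seq_mult'; [exact L|apply is_lim_seq_const].
Qed.

(** Euler-Maclaurin of order [K] for [u/(u^2+z^2)] along a ray, where the derivatives at 0 are
    homogeneous in [y]. Splitting off inverse powers of [y] prepares the sine series: each power is
    accessible to Dirichlet's test, and the remainder can be made summable. *)
Lemma Lz_expansion zeta K : 0 < Re zeta -> Cmod zeta = 1 ->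
  exists (a : nat -> C) B, forall y, 0 < y ->
    Cmod (Cminus (Lz (Cmult (RtoC y) zeta)) (csum (fun j => Cdiv (a j) (RtoC (y ^ (j + 2)))) K)) <= B / y ^ (K + 1).
Proof.
  intros Hre Hmod. destruct (EM_order K) as [b [Hb HEM]].
  set (kap := Re zeta) in *.
  assert (Hk : 0 < kap <= 1).
  { split; [exact Hre|]. rewrite <- Hmod. eapply Rle_trans; [apply Rle_abs|apply re_le_Cmod]. }
  exists (fun j => Cmult (RtoC ((-1) ^ S j * bern (S (S j)) 0)) (odd_derivs zeta (S j) 0)),
    (b * (INR (fact (S K)) * (3 / kap) ^ S (S K))).
  intros y Hy. set (z := Cmult (RtoC y) zeta).
  assert (Hz : 0 < Re z) by (unfold z; rewrite re_scal_l; fold kap; nra).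
  assert (Hz1 : kap * y <= Re z) by (unfold z; rewrite re_scal_l; fold kap; lra).
  assert (Hz2 : Cmod z <= y) by (unfold z; rewrite Cmod_mult, Cmod_R, Hmod, Rabs_pos_eq; lra).
  assert (HE : EM (odd_derivs z 0) (odd_derivs z 0 0) (Lz z)).
  { eapply EM_ext; [|eapply EM_eq; [apply (EM_odd z Hz)| |reflexivity]].
    - intros u _. symmetry. now apply odd_derivs_0.
    - rewrite odd_derivs_0 by exact Hz. unfold Cdiv. ring. }
  specialize (HEM (odd_derivs z) (Lz z) (INR (fact (S K)) * (3 / kap) ^ S (S K) * / y ^ (K + 1)) y
    (cderiv_odd_derivs z Hz) Hy HE).
  assert (HF : 0 <= INR (fact (S K)) * (3 / kap) ^ S (S K)).
  { apply Rmult_le_pos; [apply pos_INR|apply pow_le]. left. apply Rdiv_lt_0_compat; lra. }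
  eapply Rle_trans; [|eapply Rle_trans; [apply HEM|]].
  - right. f_equal. f_equal. apply csum_ext. intros j _.
    assert (E : odd_derivs z (S j) 0 = Cdiv (odd_derivs zeta (S j) 0) (RtoC (y ^ (j + 2)))).
    { unfold odd_derivs. unfold z.
      replace (Cplus (RtoC 0) (Cmult Ci (Cmult (RtoC y) zeta))) with (Cmult (RtoC y) (Cplus (RtoC 0) (Cmult Ci zeta))) by ring.
      replace (Cminus (RtoC 0) (Cmult Ci (Cmult (RtoC y) zeta))) with (Cmult (RtoC y) (Cminus (RtoC 0) (Cmult Ci zeta))) by ring.
      rewrite !Cpow_mult_l. replace (j + 2)%nat with (S (S j)) by lia. rewrite RtoC_pow.
      assert (Hyc : RtoC y <> RtoC 0) by (intros H; apply RtoC_inj in H; lra).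
      field. repeat split; apply Cpow_nz; try exact Hyc; [apply u_minus_iz_neq_0|apply u_plus_iz_neq_0]; exact Hre. }
    rewrite E. unfold Cdiv. ring.
  - intros u Hu. eapply Rle_trans; [apply (Cmod_odd_derivs_le z Hz kap y u (S K)); auto|].
    rewrite (Rmult_assoc (INR (fact (S K)) * (3 / kap) ^ S (S K))). apply Rmult_le_compat_l; [exact HF|].
    assert (Hp : y ^ K * (u ^ 2 + y ^ 2) <= (u + y) ^ S (S K)).
    { replace ((u + y) ^ S (S K)) with ((u + y) ^ K * (u + y) ^ 2) by (rewrite <- pow_add; f_equal; lia).
      apply Rmult_le_compat; [apply pow_le; lra|nra|apply pow_incr; lra|nra]. }
    assert (Hyk : 0 < y ^ K) by now apply pow_lt.
    replace (/ y ^ (K + 1) * (y / (u ^ 2 + y ^ 2))) with (/ (y ^ K * (u ^ 2 + y ^ 2))).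
    + apply Rinv_le_contravar; [apply Rmult_lt_0_compat; [exact Hyk|clear - Hy Hu; nra]|exact Hp].
    + rewrite pow_add, pow_1. field. repeat split; nra.
  - intros k _. apply clim_pow_decay with (INR (fact k) * (3 / kap) ^ S k) k y; [exact Hy|].
    intros M. apply (Cmod_odd_derivs_le z Hz kap y (INR M) k); auto. apply pos_INR.
  - right. field. apply pow_nonzero. lra.
Qed.

Lemma sin_partial_sums_bounded a n : 0 < a < 1 ->
  Rabs (rsum (fun m => sin (2 * PI * INR (S m) * a)) n) <= / sin (PI * a).
Proof.
  intros Ha. assert (Hpi := PI_RGT_0).
  assert (Hs : 0 < sin (PI * a)) by (apply sin_gt_0; nra).
  assert (E : 2 * sin (PI * a) * rsum (fun m => sin (2 * PI * INR (S m) * a)) n =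
     cos (PI * a) - cos ((2 * INR n + 1) * (PI * a))).
  { induction n as [|n IH]; [simpl; replace ((2 * 0 + 1) * (PI * a)) with (PI * a) by ring; ring|].
    cbn [rsum]. rewrite Rmult_plus_distr_l, IH, S_INR.
    replace ((2 * (INR n + 1) + 1) * (PI * a)) with (2 * PI * (INR n + 1) * a + PI * a) by ring.
    replace ((2 * INR n + 1) * (PI * a)) with (2 * PI * (INR n + 1) * a - PI * a) by ring.
    rewrite cos_plus, cos_minus. ring. }
  assert (H1 := COS_bound (PI * a)). assert (H2 := COS_bound ((2 * INR n + 1) * (PI * a))).
  set (s := rsum _ n) in *.
  apply Rmult_le_reg_r with (sin (PI * a)); [exact Hs|]. rewrite Rinv_l by lra.
  rewrite <- (Rabs_pos_eq (sin (PI * a))) at 1 by lra. rewrite <- Rabs_mult.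
  apply Rabs_le. lra.
Qed.

Lemma dirichlet_test (s al : nat -> R) B : (forall n, Rabs (rsum s n) <= B) ->
  (forall n, al (S n) <= al n) -> is_lim_seq al 0 -> ex_series (fun m => s m * al m).
Proof.
  intros HB Hdec Hlim.
  assert (HB0 : 0 <= B) by (eapply Rle_trans; [apply Rabs_pos|apply (HB O)]).
  set (t := fun n => rsum (fun m => s m * al m) n - rsum s n * al n).
  destruct (ex_clim_of_increments (fun n => RtoC (t n)) (fun n => B * (al n - al (S n))) 0) as [l [Hl _]].
  - intros n _. rewrite <- RtoC_minus, Cmod_R.
    replace (t (S n) - t n) with (rsum s (S n) * (al n - al (S n))) by (unfold t; simpl; ring).
    rewrite Rabs_mult, (Rabs_pos_eq (al n - al (S n))) by (specialize (Hdec n); lra).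
    apply Rmult_le_compat_r; [specialize (Hdec n); lra|apply HB].
  - apply (ex_series_scal B (fun n => al n - al (S n))).
    exists (al O). apply (is_lim_seq_ext (fun n => al O - al (S n)) _ (al O)).
    + intros n. rewrite sum_n_rsum. induction n as [|n IH]; [simpl; ring|]. cbn [rsum] in *. rewrite <- IH. ring.
    + replace (Finite (al O)) with (Finite (al O - 0)) by (f_equal; ring).
      apply is_lim_seq_minus'; [apply is_lim_seq_const|now apply (is_lim_seq_incr_1 al)].
  - simpl in Hl. exists (Re l).
    apply (is_lim_seq_ext (fun n => t (S n) + rsum s (S n) * al (S n)) _ (Re l)).
    + intros n. rewrite sum_n_rsum. unfold t. ring.
    + replace (Finite (Re l)) with (Finite (Re l + 0)) by (f_equal; ring).
      apply is_lim_seq_plus'; [apply (is_lim_seq_incr_1 t); exact Hl|].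
      apply squeeze0 with (fun n => B * Rabs (al (S n))).
      * exists O. intros n _. rewrite Rminus_0_r, Rabs_mult. apply Rmult_le_compat_r; [apply Rabs_pos|apply HB].
      * replace (Finite 0) with (Finite (B * Rabs 0)) by (rewrite Rabs_R0; f_equal; ring).
        apply is_lim_seq_mult'; [apply is_lim_seq_const|].
        apply (is_lim_seq_abs (fun n => al (S n)) (Finite 0)). now apply (is_lim_seq_incr_1 al).
Qed.

(** * The value of zeta at negative integers as a limit *)

(** Polynomials as a closure property of functions: only stability under differentiation and
    polynomial growth matter below, never coefficients or degree. *)
Inductive is_poly : (R -> R) -> Prop :=
| ip_const c : is_poly (fun _ => c)
| ip_id : is_poly (fun u => u)
| ip_plus P Q : is_poly P -> is_poly Q -> is_poly (fun u => P u + Q u)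
| ip_mult P Q : is_poly P -> is_poly Q -> is_poly (fun u => P u * Q u).

Lemma ip_pow n : is_poly (fun u => u ^ n).
Proof.
  induction n as [|n IH]; [apply (ip_const 1)|]. apply (ip_mult (fun u => u) (fun u => u ^ n)); [apply ip_id|exact IH].
Qed.

Lemma poly_derive P : is_poly P -> exists P', is_poly P' /\ forall u, is_derive P u (P' u).
Proof.
  induction 1 as [c| |P Q _ [P' [HP DP]] _ [Q' [HQ DQ]]|P Q PP [P' [HP DP]] PQ [Q' [HQ DQ]]].
  - exists (fun _ => 0). split; [apply ip_const|intros u; apply (is_derive_const (K := R_AbsRing) (V := R_NormedModule))].
  - exists (fun _ => 1). split; [apply ip_const|intros u; apply (is_derive_id (K := R_AbsRing))].
  - exists (fun u => P' u + Q' u). split; [now apply ip_plus|].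
    intros u. apply (is_derive_plus (K := R_AbsRing) (V := R_NormedModule)); auto.
  - exists (fun u => P' u * Q u + P u * Q' u). split; [apply ip_plus; now apply ip_mult|].
    intros u. apply is_derive_mult_R; auto.
Qed.

Lemma poly_growth P : is_poly P -> exists c d, 0 <= c /\ forall u, 0 <= u -> Rabs (P u) <= c * (1 + u) ^ d.
Proof.
  assert (W : forall c d e u, 0 <= c -> 0 <= u -> (d <= e)%nat -> c * (1 + u) ^ d <= c * (1 + u) ^ e).
  { intros c d e u Hc Hu Hde. apply Rmult_le_compat_l; [exact Hc|]. apply Rle_pow; [lra|exact Hde]. }
  induction 1 as [c| |P Q _ [c1 [d1 [H1 G1]]] _ [c2 [d2 [H2 G2]]]|P Q _ [c1 [d1 [H1 G1]]] _ [c2 [d2 [H2 G2]]]].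
  - exists (Rabs c), O. split; [apply Rabs_pos|]. intros u _. simpl. lra.
  - exists 1, 1%nat. split; [lra|]. intros u Hu. rewrite Rabs_pos_eq by lra. simpl. lra.
  - exists (c1 + c2), (max d1 d2). split; [lra|]. intros u Hu.
    eapply Rle_trans; [apply Rabs_triang|]. rewrite Rmult_plus_distr_r.
    apply Rplus_le_compat.
    + eapply Rle_trans; [now apply G1|]. apply W; auto; lia.
    + eapply Rle_trans; [now apply G2|]. apply W; auto; lia.
  - exists (c1 * c2), (d1 + d2)%nat. split; [now apply Rmult_le_pos|]. intros u Hu.
    rewrite Rabs_mult, pow_add. replace (c1 * c2 * ((1 + u) ^ d1 * (1 + u) ^ d2)) with
      ((c1 * (1 + u) ^ d1) * (c2 * (1 + u) ^ d2)) by ring.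
    apply Rmult_le_compat; auto using Rabs_pos.
Qed.

Lemma exp_pow_INR x n : exp x ^ n = exp (INR n * x).
Proof.
  induction n as [|n IH]; [simpl; rewrite Rmult_0_l, exp_0; reflexivity|].
  cbn [pow]. rewrite IH, <- exp_plus, S_INR. f_equal. ring.
Qed.

(** With [m = d + 1], [1 + v <= m (1 + v/m) <= m e^{v/m}]; the [m]-th power of this gives the
    constant. *)
Lemma pow_exp_bound d : exists c, 0 <= c /\ forall v, 0 <= v -> (1 + v) ^ d * exp (- v) <= c.
Proof.
  exists (INR (S d) ^ S d). split; [apply pow_le, pos_INR|]. intros v Hv.
  set (m := INR (S d)). assert (Hm : 1 <= m) by (unfold m; rewrite S_INR; assert (H := pos_INR d); lra).
  assert (H : (1 + v) ^ S d <= m ^ S d * exp v).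
  { replace (exp v) with (exp (v / m) ^ S d).
    - rewrite <- Rpow_mult_distr. apply pow_incr. split; [lra|].
      assert (E := exp_ineq1_le (v / m)).
      apply Rle_trans with (m * (1 + v / m)); [|apply Rmult_le_compat_l; lra].
      replace (m * (1 + v / m)) with (m + v) by (field; lra). lra.
    - rewrite exp_pow_INR. f_equal. fold m. field. lra. }
  assert (H2 : (1 + v) ^ d <= (1 + v) ^ S d) by (apply Rle_pow; [lra|lia]).
  rewrite exp_Ropp. assert (He := exp_pos v).
  apply Rmult_le_reg_r with (exp v); [exact He|]. rewrite Rmult_assoc, Rinv_l by lra. lra.
Qed.

Lemma poly_exp_decay P N : is_poly P -> (1 <= N)%nat ->
  exists c, 0 <= c /\ forall v, 0 <= v -> Rabs (P v * exp (- v ^ N)) <= c / (1 + v ^ 2).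
Proof.
  intros HP HN. destruct (poly_growth _ HP) as [c [d [Hc HG]]].
  destruct (pow_exp_bound (d + 2)) as [c2 [Hc2 HE]].
  exists (c * c2 * exp 1). split; [assert (H := exp_pos 1); apply Rmult_le_pos; [nra|lra]|].
  intros v Hv.
  (* [v - 1 <= v^N] reduces every [N >= 1] to the plain exponential, at the cost of a factor [e]. *)
  assert (E1 : exp (- v ^ N) <= exp 1 * exp (- v)).
  { rewrite <- exp_plus. assert (H : v - 1 <= v ^ N).
    { destruct (Rle_dec v 1) as [H|H]; [assert (0 <= v ^ N) by (now apply pow_le); lra|].
      assert (H1 : v ^ 1 <= v ^ N) by (apply Rle_pow; [lra|lia]). rewrite pow_1 in H1. lra. }
    destruct (Req_dec (- v ^ N) (1 + - v)) as [->|Hne]; [lra|]. left. apply exp_increasing. lra. }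
  rewrite Rabs_mult, (Rabs_pos_eq (exp _)) by (left; apply exp_pos).
  apply Rmult_le_reg_r with (1 + v ^ 2); [nra|].
  replace (c * c2 * exp 1 / (1 + v ^ 2) * (1 + v ^ 2)) with (c * (exp 1 * c2)) by (field; nra).
  assert (Hp : 0 < exp (- v)) by apply exp_pos. assert (Hp1 : 0 < exp 1) by apply exp_pos.
  apply Rle_trans with (c * (1 + v) ^ d * (exp 1 * exp (- v)) * (1 + v) ^ 2).
  - assert (H0 : 0 <= (1 + v) ^ d) by (apply pow_le; lra).
    apply Rmult_le_compat; [apply Rmult_le_pos; [apply Rabs_pos|left; apply exp_pos]|nra| |nra].
    apply Rmult_le_compat; [apply Rabs_pos|left; apply exp_pos|now apply HG|exact E1].
  - specialize (HE v Hv). rewrite pow_add in HE.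
    replace (c * (1 + v) ^ d * (exp 1 * exp (- v)) * (1 + v) ^ 2) with
      (c * (exp 1 * ((1 + v) ^ d * (1 + v) ^ 2 * exp (- v)))) by ring.
    apply Rmult_le_compat_l; [exact Hc|]. apply Rmult_le_compat_l; lra.
Qed.

Section PowExp.
Variables N p : nat.
Hypothesis HN : (1 <= N)%nat.

Definition pexp (u : R) : R := u ^ p * exp (- u ^ N).

Lemma is_derive_exp_pow u : is_derive (fun u => exp (- u ^ N)) u (- (INR N * u ^ pred N) * exp (- u ^ N)).
Proof.
  apply (is_derive_comp_R exp (fun u => - u ^ N)); [apply is_derive_exp|].
  apply (is_derive_opp (K := R_AbsRing) (V := R_NormedModule)).
  evar_last; [apply is_derive_pow, (is_derive_id (K := R_AbsRing))|]. unfold one; simpl. ring.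
Qed.

Lemma pexp_derive_step P : is_poly P -> exists P', is_poly P' /\
  forall u, is_derive (fun u => P u * exp (- u ^ N)) u (P' u * exp (- u ^ N)).
Proof.
  intros HP. destruct (poly_derive P HP) as [P1 [HP1 DP]].
  exists (fun u => P1 u + P u * ((- INR N) * u ^ pred N)). split.
  - apply ip_plus; [exact HP1|]. apply (ip_mult P); [exact HP|]. apply (ip_mult (fun _ => - INR N)); [apply ip_const|apply ip_pow].
  - intros u. evar_last; [apply is_derive_mult_R; [apply DP|apply is_derive_exp_pow]|]. cbv beta. ring.
Qed.

Lemma Derive_n_pexp k : exists P, is_poly P /\ forall u, Derive_n pexp k u = P u * exp (- u ^ N).
Proof.
  induction k as [|k [P [HP E]]]; [exists (fun u => u ^ p); split; [apply ip_pow|reflexivity]|].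
  destruct (pexp_derive_step P HP) as [P' [HP' D]]. exists P'. split; [exact HP'|].
  intros u. simpl. rewrite (Derive_ext _ _ u E). apply is_derive_unique, D.
Qed.

Lemma is_derive_Derive_n_pexp k u : is_derive (Derive_n pexp k) u (Derive_n pexp (S k) u).
Proof.
  destruct (Derive_n_pexp k) as [P [HP E]]. destruct (pexp_derive_step P HP) as [P' [HP' D]].
  simpl. apply Derive_correct. exists (P' u * exp (- u ^ N)).
  eapply is_derive_ext; [intros t; symmetry; apply E|apply D].
Qed.

(** For [k <= p] the factor [u^(p-k)] stays explicit, multiplied by a function with value
    [p!/(p-k)!] at 0. Nothing is left at 0 below order [p], and [p!] at order [p]. *)
Lemma Derive_n_pexp_low k : (k <= p)%nat -> exists Q, is_poly Q /\
  forall u, Derive_n pexp k u = u ^ (p - k) * (INR (fact p) / INR (fact (p - k)) + u * Q u) * exp (- u ^ N).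
Proof.
  induction k as [|k IH]; intros Hk.
  - exists (fun _ => 0). split; [apply ip_const|]. intros u. simpl. rewrite Nat.sub_0_r. unfold pexp. field. apply INR_fact_neq_0.
  - destruct IH as [Q [HQ E]]; [lia|]. destruct (poly_derive Q HQ) as [Q' [HQ' DQ]].
    remember (p - S k)%nat as r eqn:Er. replace (p - k)%nat with (S r) in E by lia.
    set (c := INR (fact p) / INR (fact (S r))) in *.
    exists (fun u => INR (S r) * Q u + (Q u + u * Q' u) + (- INR N) * u ^ pred N * (c + u * Q u)). split.
    + apply ip_plus.
      * apply (ip_plus (fun u => INR (S r) * Q u)).
        -- apply (ip_mult (fun _ => INR (S r))); [apply ip_const|exact HQ].
        -- apply (ip_plus Q); [exact HQ|]. apply (ip_mult (fun u => u)); [apply ip_id|exact HQ'].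
      * apply (ip_mult (fun u => (- INR N) * u ^ pred N)).
        -- apply (ip_mult (fun _ => - INR N)); [apply ip_const|apply ip_pow].
        -- apply (ip_plus (fun _ => c)); [apply ip_const|]. apply (ip_mult (fun u => u)); [apply ip_id|exact HQ].
    + intros u. simpl Derive_n. rewrite (Derive_ext _ _ u E). apply is_derive_unique.
      assert (D1 : is_derive (fun u => u ^ S r) u (INR (S r) * u ^ r)).
      { evar_last; [apply is_derive_pow, (is_derive_id (K := R_AbsRing))|]. unfold one; simpl pred; cbn [Hierarchy.one]; simpl. ring. }
      assert (D2 : is_derive (fun u => c + u * Q u) u (Q u + u * Q' u)).
      { evar_last; [apply (is_derive_plus (K := R_AbsRing) (V := R_NormedModule));
          [apply (is_derive_const (K := R_AbsRing) (V := R_NormedModule))|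
           apply is_derive_mult_R; [apply (is_derive_id (K := R_AbsRing))|apply DQ]]|].
        unfold plus, zero, one; simpl. ring. }
      assert (D3 : is_derive (fun u => exp (- u ^ N)) u (- (INR N * u ^ pred N) * exp (- u ^ N))).
      { apply is_derive_exp_pow. }
      evar_last; [exact (is_derive_mult_R _ _ _ _ _ (is_derive_mult_R _ _ _ _ _ D1 D2) D3)|].
      cbv beta. unfold c. rewrite fact_simpl, mult_INR. cbn [pow].
      field. split; [apply INR_fact_neq_0|apply not_0_INR; lia].
Qed.

Lemma Derive_n_pexp_0_low k : (k < p)%nat -> Derive_n pexp k 0 = 0.
Proof.
  intros Hk. destruct (Derive_n_pexp_low k) as [Q [_ E]]; [lia|]. rewrite E, pow_i by lia. ring.
Qed.

Lemma Derive_n_pexp_0_p : Derive_n pexp p 0 = INR (fact p).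
Proof.
  destruct (Derive_n_pexp_low p) as [Q [_ E]]; [lia|]. rewrite E, Nat.sub_diag, (pow_i N) by lia.
  rewrite Ropp_0, exp_0. simpl. field.
Qed.

(* Only the derivative of order [p] of [u^p e^{-(d u)^N}] at 0 survives as [d -> 0], and its
   Euler-Maclaurin coefficient is [zeta(-p)]. *)
Lemma EM_pexp_limit : Nat.odd p = true -> exists c, forall d l, 0 < d <= 1 ->
  EM (fun u => RtoC (u ^ p * exp (- (d * u) ^ N))) (RtoC 0) l ->
  Cmod (Cminus l (RtoC (riemann_zeta (- INR p)))) <= c * d.
Proof.
  intros Hp. destruct (EM_order (S p)) as [b [Hb HEM]].
  destruct (Derive_n_pexp (S (S p))) as [P [HP EP]].
  destruct (poly_exp_decay P N HP HN) as [cP [HcP HdP]].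
  set (A := Rabs (bern (S (S p)) 0) * Rabs (Derive_n pexp (S p) 0)).
  exists (b * cP + A). intros d l Hd HE.
  assert (Hp0 : (1 <= p)%nat) by (destruct p; [discriminate|lia]).
  (* Derivatives of [d^(-p) pexp (d u)]: order [k] carries [d^(k-p)], so order [p] is independent of
     [d] at 0 while order [p + 1] brings a factor [d]. *)
  set (f := fun k u => RtoC (/ d ^ p * d ^ k * Derive_n pexp k (d * u))).
  assert (Hdp : 0 < d ^ p) by (apply pow_lt; lra).
  assert (Df : forall k u, cderiv (f k) u (f (S k) u)).
  { intros k u. unfold f. apply cderiv_RtoC. evar_last.
    - apply is_derive_scal. apply (is_derive_comp_R (Derive_n pexp k) (fun u => d * u)).
      + apply is_derive_Derive_n_pexp.
      + auto_derive; [trivial|reflexivity].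
    - cbn [pow]. ring. }
  assert (f0 : forall u, f O u = RtoC (u ^ p * exp (- (d * u) ^ N))).
  { intros u. unfold f. f_equal. simpl Derive_n. unfold pexp. rewrite Rpow_mult_distr. simpl pow at 2. field. lra. }
  specialize (HEM f l (cP * d) (/ d) Df ltac:(apply Rinv_0_lt_compat; lra)).
  assert (E0 : csum (fun j => Cmult (RtoC ((-1) ^ S j * bern (S (S j)) 0)) (f (S j) 0)) (S p) =
    Cplus (RtoC (riemann_zeta (- INR p))) (RtoC ((-1) ^ S p * bern (S (S p)) 0 * (d * Derive_n pexp (S p) 0)))).
  { cbn [csum]. f_equal.
    - rewrite zeta_neg, (bern_01 (S p)) by lia.
      rewrite (csum_single _ p (p - 1)%nat); [|lia|].
      + unfold f. rewrite Rmult_0_r, <- RtoC_mult. f_equal.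
        replace (S (p - 1)) with p by lia. rewrite Derive_n_pexp_0_p.
        replace ((-1) ^ p) with (-1).
        * field. lra.
        * apply Nat.odd_spec in Hp. destruct Hp as [j ->]. rewrite pow_add, pow_1_even. ring.
      + intros k Hk Hne. unfold f. rewrite Rmult_0_r, Derive_n_pexp_0_low by lia. rewrite Rmult_0_r. ring.
    - unfold f. rewrite Rmult_0_r, <- RtoC_mult. f_equal. cbn [pow]. field. lra. }
  rewrite E0 in HEM.
  assert (HC : Cmod (Cminus l (Cplus (RtoC (riemann_zeta (- INR p)))
     (RtoC ((-1) ^ S p * bern (S (S p)) 0 * (d * Derive_n pexp (S p) 0))))) <= b * (cP * d)).
  { apply HEM.
    - eapply EM_ext; [|eapply EM_eq; [exact HE| |reflexivity]].
      + intros u _. now rewrite f0.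
      + rewrite f0, pow_i by lia. f_equal. ring.
    - intros u Hu. unfold f. rewrite Cmod_R.
      replace (/ d ^ p * d ^ S (S p)) with (d * d) by (cbn [pow]; field; lra).
      rewrite Rabs_mult, (Rabs_pos_eq (d * d)) by nra. rewrite EP.
      assert (H := HdP (d * u) ltac:(nra)).
      apply Rle_trans with (d * d * (cP / (1 + (d * u) ^ 2))); [apply Rmult_le_compat_l; [nra|exact H]|].
      right. field. repeat split; nra.
    - intros k _. destruct (Derive_n_pexp k) as [Q [HQ EQ]].
      destruct (poly_exp_decay Q N HQ HN) as [cQ [HcQ HdQ]].
      apply clim_pow_decay with (/ d ^ p * d ^ k * (4 * cQ / (d * d))) 1%nat 1; [lra|].
      intros M. unfold f. rewrite Cmod_R, Rabs_mult.
      assert (Hk : 0 < / d ^ p * d ^ k) by (apply Rmult_lt_0_compat; [now apply Rinv_0_lt_compat|apply pow_lt; lra]).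
      rewrite (Rabs_pos_eq (/ d ^ p * d ^ k)), EQ, (Rmult_assoc (/ d ^ p * d ^ k)) by lra.
      apply Rmult_le_compat_l; [lra|].
      assert (HM := pos_INR M).
      eapply Rle_trans; [apply HdQ; nra|].
      unfold Rdiv. rewrite Rmult_assoc, (Rmult_comm 4 cQ), !Rmult_assoc. apply Rmult_le_compat_l; [exact HcQ|].
      replace (4 * (/ (d * d) * / (INR M + 1) ^ 2)) with (/ (d * d * (INR M + 1) ^ 2 / 4)) by (field; lra).
      assert (Hd1 : d * d <= 1) by nra. assert (Hd2 : 0 < d * d) by nra.
      assert (H2 : (INR M + 1) ^ 2 <= 2 * (INR M ^ 2 + 1)) by (assert (H1 := pow2_ge_0 (INR M - 1)); lra).
      assert (H3 : d * d * (INR M + 1) ^ 2 <= d * d * (2 * (INR M ^ 2 + 1))) by (apply Rmult_le_compat_l; lra).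
      assert (H4 : 0 < (INR M + 1) ^ 2) by (apply pow_lt; lra).
      apply Rinv_le_contravar; [apply Rmult_lt_0_compat; [now apply Rmult_lt_0_compat|lra]|].
      replace ((d * INR M) ^ 2) with (d * d * INR M ^ 2) by ring.
      assert (H5 : 0 <= d * d * INR M ^ 2) by (apply Rmult_le_pos; [lra|apply pow2_ge_0]). lra. }
  replace (Cminus l (RtoC (riemann_zeta (- INR p)))) with
    (Cplus (Cminus l (Cplus (RtoC (riemann_zeta (- INR p)))
     (RtoC ((-1) ^ S p * bern (S (S p)) 0 * (d * Derive_n pexp (S p) 0)))))
     (RtoC ((-1) ^ S p * bern (S (S p)) 0 * (d * Derive_n pexp (S p) 0)))) by ring.
  eapply Rle_trans; [apply Cmod_triangle|]. rewrite Cmod_R, !Rabs_mult, pow_1_abs, (Rabs_pos_eq d) by lra.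
  rewrite Rmult_plus_distr_r. apply Rplus_le_compat; [lra|]. right. unfold A. ring.
Qed.

End PowExp.

(** * Improper integrals and the Mellin transform *)

(** A convergent improper integral over [(0, oo)], expressed by a primitive with limit 0 at 0+ and
    [l] at infinity. Linearity and substitution act directly on the primitive, and [EM] can take it
    over. *)
Definition IG (f : R -> R) (l : R) : Prop :=
  exists F : R -> R, (forall t, 0 < t -> is_derive F t (f t)) /\
    filterlim F (at_right 0) (locally 0) /\ filterlim F (Rbar_locally p_infty) (locally l).

Lemma at_right_pos : at_right 0 (fun t => 0 < t).
Proof. exists (mkposreal 1 Rlt_0_1). intros y _ H; exact H. Qed.

Lemma pinfty_pos : Rbar_locally p_infty (fun t => 0 < t).
Proof. exists 0; auto. Qed.

Lemma filterlim_at_0_seq (F : R -> R) l : filterlim F (at_right 0) (locally l) ->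
  is_lim_seq (fun n => F (/ INR (S n))) l.
Proof.
  intros H. unfold is_lim_seq. simpl. eapply filterlim_comp; [|exact H].
  intros P [d Hd]. assert (L := is_lim_seq_inv_INR). apply is_lim_seq_spec in L.
  destruct (L d) as [n0 Hn0]. exists n0. intros n Hn. apply Hd.
  - specialize (Hn0 n Hn). unfold ball; simpl; unfold AbsRing_ball, abs, minus, plus, opp; simpl.
    unfold Rminus in Hn0. exact Hn0.
  - apply Rinv_0_lt_compat, (lt_0_INR (S n)); lia.
Qed.

Lemma filterlim_at_infty_seq (F : R -> R) l : filterlim F (Rbar_locally p_infty) (locally l) ->
  is_lim_seq (fun n => F (INR n)) l.
Proof.
  intros H. unfold is_lim_seq. simpl. eapply filterlim_comp; [|exact H]. apply is_lim_seq_INR.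
Qed.

Lemma filterlim_sub_const (F : R -> R) (Fi : (R -> Prop) -> Prop) {FF : Filter Fi} (l c : R) :
  filterlim F Fi (locally l) -> filterlim (fun t => F t - c) Fi (locally (l - c)).
Proof.
  intros H. apply (filterlim_comp_2 F (fun _ => - c) Rplus H (filterlim_const (- c))).
  apply (filterlim_plus (K := R_AbsRing) (V := R_NormedModule) l (- c)).
Qed.

Lemma IG_ext f g l : (forall t, 0 < t -> f t = g t) -> IG f l -> IG g l.
Proof.
  intros E [F [H1 H2]]. exists F. split; [|exact H2]. intros t Ht. rewrite <- E by exact Ht. auto.
Qed.

Lemma IG_scal c f l : IG f l -> IG (fun t => c * f t) (c * l).
Proof.
  intros [F [H1 [H2 H3]]]. exists (fun t => c * F t). split; [|split].
  - intros t Ht. apply is_derive_scal. auto.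
  - replace 0 with (c * 0) at 2 by ring. eapply filterlim_comp; [exact H2|apply (filterlim_scal_r (K := R_AbsRing) (V := R_NormedModule) c)].
  - eapply filterlim_comp; [exact H3|apply (filterlim_scal_r (K := R_AbsRing) (V := R_NormedModule) c)].
Qed.

Lemma IG_plus f g l m : IG f l -> IG g m -> IG (fun t => f t + g t) (l + m).
Proof.
  intros [F [H1 [H2 H3]]] [G [K1 [K2 K3]]]. exists (fun t => F t + G t). split; [|split].
  - intros t Ht. apply (is_derive_plus (K := R_AbsRing) (V := R_NormedModule)); auto.
  - replace 0 with (0 + 0) at 2 by ring. eapply filterlim_comp_2; [exact H2|exact K2|apply (filterlim_plus (K := R_AbsRing) (V := R_NormedModule) 0 0)].
  - eapply filterlim_comp_2; [exact H3|exact K3|apply (filterlim_plus (K := R_AbsRing) (V := R_NormedModule) l m)].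
Qed.

Lemma IG_minus f g l m : IG f l -> IG g m -> IG (fun t => f t - g t) (l - m).
Proof.
  intros H1 H2. apply IG_ext with (fun t => f t + -1 * g t); [intros; ring|].
  replace (l - m) with (l + -1 * m) by ring. apply IG_plus; [exact H1|now apply IG_scal].
Qed.

Lemma IG_zero : IG (fun _ => 0) 0.
Proof.
  exists (fun _ => 0). split; [|split; apply filterlim_const].
  intros t _. apply (is_derive_const (K := R_AbsRing) (V := R_NormedModule)).
Qed.

Lemma IG_rsum (f : nat -> R -> R) l n : (forall k, (k < n)%nat -> IG (f k) (l k)) ->
  IG (fun t => rsum (fun k => f k t) n) (rsum l n).
Proof.
  induction n as [|n IH]; intros H; simpl; [apply IG_zero|].
  apply (IG_plus (fun t => rsum (fun k => f k t) n)); [apply IH; intros; apply H; lia|apply H; lia].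
Qed.

Lemma IG_rescale b f l : 0 < b -> IG f l -> IG (fun t => b * f (b * t)) l.
Proof.
  intros Hb [F [H1 [H2 H3]]]. exists (fun t => F (b * t)). split; [|split].
  - intros t Ht. apply (is_derive_comp_R F (fun t => b * t)); [apply H1; nra|].
    auto_derive; [trivial|ring].
  - eapply filterlim_comp; [|exact H2]. intros P [d Hd].
    assert (Hdb : 0 < d / b) by (apply Rdiv_lt_0_compat; [apply cond_pos|exact Hb]).
    exists (mkposreal _ Hdb). intros t Ht Ht0. apply Hd; [|nra].
    revert Ht. unfold ball; simpl; unfold AbsRing_ball, abs, minus, plus, opp; simpl.
    rewrite Ropp_0, !Rplus_0_r, !Rabs_pos_eq by nra. intros Ht.
    apply (Rmult_lt_compat_l b) in Ht; [|exact Hb]. replace (b * (d / b)) with (pos d) in Ht by (field; lra). exact Ht.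
  - eapply filterlim_comp; [|exact H3]. intros P [M HM]. exists (M / b). intros t Ht. apply HM.
    apply (Rmult_lt_compat_l b) in Ht; [|exact Hb]. replace (b * (M / b)) with M in Ht by (field; lra). exact Ht.
Qed.

Lemma primitive_compare F G f g u v : 0 < u -> u <= v ->
  (forall t, 0 < t -> is_derive F t (f t)) -> (forall t, 0 < t -> is_derive G t (g t)) ->
  (forall t, 0 < t -> Rabs (f t) <= g t) -> Rabs (F v - F u) <= G v - G u.
Proof.
  intros Hu Huv HF HG H. apply (increment_abs_le F G f g u v Huv).
  - intros t Ht. apply HF; lra.
  - intros t Ht. apply HG; lra.
  - intros t Ht. eapply is_derive_continuity_pt, HF; lra.
  - intros t Ht. eapply is_derive_continuity_pt, HG; lra.
  - intros t Ht. apply H; lra.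
Qed.

(** In [primitive_compare] one endpoint is sent to 0+ or to infinity. These two tails are what
    dominated convergence has to control. *)
Lemma primitive_tails F G f g lf lg t : 0 < t ->
  (forall t, 0 < t -> is_derive F t (f t)) -> (forall t, 0 < t -> is_derive G t (g t)) ->
  (forall t, 0 < t -> Rabs (f t) <= g t) ->
  filterlim F (at_right 0) (locally 0) -> filterlim F (Rbar_locally p_infty) (locally lf) ->
  filterlim G (at_right 0) (locally 0) -> filterlim G (Rbar_locally p_infty) (locally lg) ->
  Rabs (F t) <= G t /\ Rabs (lf - F t) <= lg - G t.
Proof.
  intros Ht HF HG H F0 Fi G0 Gi. split.
  - apply filterlim_at_0_seq in F0, G0.
    assert (L1 : is_lim_seq (fun n => Rabs (F t - F (/ INR (S n)))) (Rabs (F t - 0))).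
    { apply (is_lim_seq_abs _ (Finite _)), is_lim_seq_minus'; [apply is_lim_seq_const|exact F0]. }
    assert (L2 : is_lim_seq (fun n => G t - G (/ INR (S n))) (G t - 0)).
    { apply is_lim_seq_minus'; [apply is_lim_seq_const|exact G0]. }
    assert (Ev : eventually (fun n => Rabs (F t - F (/ INR (S n))) <= G t - G (/ INR (S n)))).
    { assert (L0 := is_lim_seq_inv_INR). apply is_lim_seq_spec in L0. destruct (L0 (mkposreal t Ht)) as [N HN].
      exists N. intros n Hn. specialize (HN n Hn). cbv beta in HN. rewrite Rminus_0_r in HN.
      assert (Hp : 0 < / INR (S n)) by (apply Rinv_0_lt_compat, lt_0_INR; lia).
      apply Rabs_def2 in HN. cbn [pos] in HN.
      apply (primitive_compare F G f g); auto; lra. }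
    assert (L := is_lim_seq_le_loc _ _ _ _ Ev L1 L2).
    simpl in L. now rewrite !Rminus_0_r in L.
  - apply filterlim_at_infty_seq in Fi, Gi.
    assert (L1 : is_lim_seq (fun n => Rabs (F (INR n) - F t)) (Rabs (lf - F t))).
    { apply (is_lim_seq_abs _ (Finite _)), is_lim_seq_minus'; [exact Fi|apply is_lim_seq_const]. }
    assert (L2 : is_lim_seq (fun n => G (INR n) - G t) (lg - G t)).
    { apply is_lim_seq_minus'; [exact Gi|apply is_lim_seq_const]. }
    assert (Ev : eventually (fun n => Rabs (F (INR n) - F t) <= G (INR n) - G t)).
    { destruct (nfloor_ex t (Rlt_le _ _ Ht)) as [N [_ HN]]. exists (S N). intros n Hn.
      apply le_INR in Hn. rewrite S_INR in Hn.
      apply (primitive_compare F G f g); auto; lra. }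
    exact (is_lim_seq_le_loc _ _ _ _ Ev L1 L2).
Qed.

(** At both ends the primitive [RInt f 1 t] inherits the Cauchy property from a primitive of the
    majorant; subtracting its limit at 0+ gives the normalisation of [IG]. *)
Lemma IG_comparison f g lg : (forall t, 0 < t -> continuous f t) ->
  (forall t, 0 < t -> Rabs (f t) <= g t) -> IG g lg -> exists l, IG f l.
Proof.
  intros Cf Hfg [G [K1 [K2 K3]]].
  set (F := fun t => RInt f 1 t).
  assert (DF : forall t, 0 < t -> is_derive F t (f t)).
  { intros t Ht. apply (is_derive_RInt f F 1 t); [|now apply Cf].
    exists (mkposreal t Ht). intros v Hv.
    assert (Hv0 : 0 < v).
    { unfold ball in Hv; simpl in Hv; unfold AbsRing_ball, abs, minus, plus, opp in Hv; simpl in Hv.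
      apply Rabs_def2 in Hv. lra. }
    apply (RInt_correct (V := R_CompleteNormedModule)), (ex_RInt_continuous (V := R_CompleteNormedModule)).
    intros w Hw. apply Cf. assert (0 < Rmin 1 v) by (apply Rmin_pos; lra). lra. }
  assert (Cauchy : forall (Fi : (R -> Prop) -> Prop) (PF : ProperFilter Fi) lG, filterlim G Fi (locally lG) ->
     Fi (fun t => 0 < t) -> exists l, filterlim F Fi (locally l)).
  { intros Fi PF lG HlG Hpos.
    apply (Hierarchy.filterlim_locally_cauchy (U := R_CompleteSpace)). intros eps.
    destruct (proj2 (Hierarchy.filterlim_locally_cauchy (U := R_CompleteSpace) (F := Fi) G) (ex_intro _ lG HlG) eps) as [P [HP Hc]].
    exists (fun t => P t /\ 0 < t). split; [now apply filter_and|].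
    intros u v [Pu Hu] [Pv Hv]. specialize (Hc u v Pu Pv).
    unfold ball in *; simpl in *; unfold AbsRing_ball, abs, minus, plus, opp in *; simpl in *.
    destruct (Rle_dec u v) as [Huv|Huv].
    - assert (H := primitive_compare F G f g u v Hu Huv DF K1 Hfg).
      eapply Rle_lt_trans; [|exact Hc]. eapply Rle_trans; [exact H|]. apply Rle_abs.
    - assert (H := primitive_compare F G f g v u Hv ltac:(lra) DF K1 Hfg).
      eapply Rle_lt_trans; [|exact Hc].
      replace (F v + - F u) with (- (F u - F v)) by ring. rewrite Rabs_Ropp.
      eapply Rle_trans; [exact H|]. replace (G v + - G u) with (- (G u - G v)) by ring. rewrite Rabs_Ropp. apply Rle_abs. }
  destruct (Cauchy (at_right 0) _ _ K2 at_right_pos) as [l0 H0].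
  destruct (Cauchy (Rbar_locally p_infty) _ _ K3 pinfty_pos) as [li Hi].
  exists (li - l0), (fun t => F t - l0). split; [|split].
  - intros t Ht. evar_last.
    + apply (is_derive_minus (K := R_AbsRing) (V := R_NormedModule)); [now apply DF|apply (is_derive_const (K := R_AbsRing) (V := R_NormedModule))].
    + unfold minus, plus, opp, zero; simpl; ring.
  - assert (H := filterlim_sub_const F (at_right 0) l0 l0 H0). rewrite Rminus_diag in H. exact H.
  - exact (filterlim_sub_const F (Rbar_locally p_infty) li l0 Hi).
Qed.

(** Dominated convergence with uniform convergence on compact intervals: outside [[a, b]] the tails
    of [2 g] are below [eps/3], inside the increment is at most [e n * b]. Here [ln] names the
    sequence of integrals, not the logarithm. *)
Lemma IG_dominated (fn : nat -> R -> R) f g ln l lg :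
  (forall n, IG (fn n) (ln n)) -> IG f l -> IG g lg ->
  (forall n t, 0 < t -> Rabs (fn n t) <= g t) -> (forall t, 0 < t -> Rabs (f t) <= g t) ->
  (forall a b, 0 < a -> a <= b -> exists e, is_lim_seq e 0 /\
      forall n t, a <= t <= b -> Rabs (fn n t - f t) <= e n) ->
  is_lim_seq ln l.
Proof.
  intros Hn Hf Hg Bn Bf U.
  assert (Hg2 := IG_scal 2 _ _ Hg). destruct Hg2 as [G [K1 [K2 K3]]].
  apply is_lim_seq_spec. intros eps.
  assert (He : 0 < eps / 3) by (assert (H := cond_pos eps); lra).
  destruct (proj2 (is_lim_seq_spec _ _) (filterlim_at_0_seq _ _ K2) (mkposreal _ He)) as [N1 H1].
  destruct (proj2 (is_lim_seq_spec _ _) (filterlim_at_infty_seq _ _ K3) (mkposreal _ He)) as [N2 H2].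
  set (a := / INR (S N1)). set (b := INR (S N2)).
  assert (Ha : 0 < a) by (apply Rinv_0_lt_compat, lt_0_INR; lia).
  assert (Ha1 : a <= 1) by (unfold a; rewrite <- Rinv_1; apply Rinv_le_contravar; [lra|rewrite S_INR; assert (H := pos_INR N1); lra]).
  assert (Hb1 : 1 <= b) by (unfold b; rewrite S_INR; assert (H := pos_INR N2); lra).
  specialize (H1 N1 (le_n _)). fold a in H1. specialize (H2 (S N2) ltac:(lia)). fold b in H2. cbn [pos] in H1, H2.
  destruct (U a b Ha ltac:(lra)) as [e [Le He']].
  destruct (proj2 (is_lim_seq_spec _ _) Le (mkposreal (eps / 3 / b) ltac:(apply Rdiv_lt_0_compat; lra))) as [N3 H3].
  exists N3. intros n HN. specialize (H3 n HN). cbn [pos] in H3.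
  destruct (IG_minus _ _ _ _ (Hn n) Hf) as [F [D1 [D2 D3]]].
  assert (Hd : forall t, 0 < t -> Rabs (fn n t - f t) <= 2 * g t).
  { intros t Ht. eapply Rle_trans; [apply Rabs_triang|]. rewrite Rabs_Ropp.
    specialize (Bn n t Ht). specialize (Bf t Ht). lra. }
  destruct (primitive_tails F G _ _ _ _ a Ha D1 K1 Hd D2 D3 K2 K3) as [T1 _].
  destruct (primitive_tails F G _ _ _ _ b ltac:(lra) D1 K1 Hd D2 D3 K2 K3) as [_ T2].
  assert (M : Rabs (F b - F a) <= e n * b - e n * a).
  { apply (increment_abs_le F (fun t => e n * t) (fun t => fn n t - f t) (fun _ => e n)); [lra| | | | |].
    - intros t Ht. apply D1; lra.
    - intros t _. auto_derive; [trivial|ring].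
    - intros t Ht. eapply is_derive_continuity_pt, D1; lra.
    - intros t _. apply (is_derive_continuity_pt _ _ (e n)). auto_derive; [trivial|ring].
    - intros t Ht. apply He'; lra. }
  assert (He0 : 0 <= e n) by (eapply Rle_trans; [apply Rabs_pos|apply (He' n a); lra]).
  rewrite Rminus_0_r, Rabs_pos_eq in H3 by exact He0.
  apply (Rmult_lt_compat_r b) in H3; [|lra]. replace (eps / 3 / b * b) with (eps / 3) in H3 by (field; lra).
  rewrite Rminus_0_r in H1. apply Rabs_def2 in H1. apply Rabs_def2 in H2.
  replace (ln n - l) with ((ln n - l - F b) + ((F b - F a) + F a)) by ring.
  eapply Rle_lt_trans; [apply Rabs_triang|].
  assert (T3 := Rabs_triang (F b - F a) (F a)).
  assert (0 <= e n * a) by nra. lra.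
Qed.

(** The bridge from primitives to [RInt_gen], through which [Gamma] is defined in the statement. *)
Lemma IG_is_RInt_gen f l : (forall t, 0 < t -> continuous f t) -> IG f l ->
  is_RInt_gen f (at_right 0) (Rbar_locally p_infty) l.
Proof.
  intros Cf [F [D1 [D2 D3]]].
  apply (is_RInt_gen_ext (Derive F)).
  - apply (Filter_prod _ _ _ (fun t => 0 < t) (fun t => 0 < t) at_right_pos pinfty_pos).
    intros a b Ha Hb x Hx. simpl in Hx. apply is_derive_unique, D1.
    assert (0 < Rmin a b) by now apply Rmin_pos. lra.
  - replace l with (l - 0) by ring.
    apply (is_RInt_gen_Derive F 0 l).
    + apply (Filter_prod _ _ _ (fun t => 0 < t) (fun t => 0 < t) at_right_pos pinfty_pos).
      intros a b Ha Hb x Hx. simpl in Hx. eexists; apply D1.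
      assert (0 < Rmin a b) by now apply Rmin_pos. lra.
    + apply (Filter_prod _ _ _ (fun t => 0 < t) (fun t => 0 < t) at_right_pos pinfty_pos).
      intros a b Ha Hb x Hx. simpl in Hx.
      assert (Hx0 : 0 < x) by (assert (0 < Rmin a b) by (now apply Rmin_pos); lra).
      apply continuous_ext_loc with f; [|now apply Cf].
      exists (mkposreal x Hx0). intros v Hv. symmetry. apply is_derive_unique, D1.
      unfold ball in Hv; simpl in Hv; unfold AbsRing_ball, abs, minus, plus, opp in Hv; simpl in Hv.
      apply Rabs_def2 in Hv. lra.
    + exact D2.
    + exact D3.
Qed.

(** * Power functions and the Gamma integral *)

Lemma Rpower_pos t s : 0 < Rpower t s.
Proof. apply exp_pos. Qed.

Lemma filterlim_squeeze0 (Fi : (R -> Prop) -> Prop) {FF : Filter Fi} (f g : R -> R) :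
  Fi (fun t => Rabs (f t) <= g t) -> filterlim g Fi (locally 0) -> filterlim f Fi (locally 0).
Proof.
  intros H Hg. apply filterlim_locally. intros eps.
  assert (Hg' := proj1 (filterlim_locally _ _) Hg eps).
  eapply filter_imp; [|exact (filter_and _ _ H Hg')].
  intros t [H1 H2]. unfold ball in *; simpl in *; unfold AbsRing_ball, abs, minus, plus, opp in *; simpl in *.
  rewrite Ropp_0, Rplus_0_r in *. apply Rabs_def2 in H2. lra.
Qed.

Lemma Rpower_lim_0 s : 0 < s -> filterlim (fun t => Rpower t s) (at_right 0) (locally 0).
Proof.
  intros Hs. apply filterlim_locally. intros eps. exists (mkposreal _ (Rpower_pos eps (/ s))).
  intros t Ht Ht0. unfold ball in *; simpl in *; unfold AbsRing_ball, abs, minus, plus, opp in *; simpl in *.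
  rewrite Ropp_0, Rplus_0_r in *.
  rewrite Rabs_pos_eq in Ht by lra. rewrite Rabs_pos_eq by (left; apply Rpower_pos).
  apply (fun H => Rlt_Rpower_l t (Rpower eps (/ s)) s Hs (conj Ht0 H)) in Ht.
  rewrite Rpower_mult, Rinv_l, Rpower_1 in Ht by (try apply cond_pos; lra). exact Ht.
Qed.

Lemma Rpower_lim_infty s : s < 0 -> filterlim (fun t => Rpower t s) (Rbar_locally p_infty) (locally 0).
Proof.
  intros Hs. apply filterlim_locally. intros eps. exists (Rpower eps (/ s)).
  intros t Ht. unfold ball; simpl; unfold AbsRing_ball, abs, minus, plus, opp; simpl.
  rewrite Ropp_0, Rplus_0_r. rewrite Rabs_pos_eq by (left; apply Rpower_pos).
  assert (Hp := Rpower_pos eps (/ s)).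
  apply (fun H => Rlt_Rpower_l (Rpower eps (/ s)) t (- s) ltac:(lra) (conj Hp H)) in Ht.
  rewrite Rpower_mult in Ht. replace (/ s * - s) with (- (1)) in Ht by (field; lra).
  rewrite Rpower_Ropp, Rpower_1 in Ht by apply cond_pos.
  replace s with (- - s) by ring. rewrite Rpower_Ropp.
  rewrite <- (Rinv_inv eps). apply Rinv_lt_contravar; [|exact Ht].
  apply Rmult_lt_0_compat; [apply Rinv_0_lt_compat, cond_pos|apply Rpower_pos].
Qed.

(** The maximum lies at [t = al]; comparison with it is [ln v <= v - 1] at [v = t/al]. *)
Lemma Rpower_exp_bound al : 0 < al -> exists c, 0 < c /\ forall t, 0 < t -> Rpower t al * exp (- t) <= c.
Proof.
  intros Ha. exists (Rpower al al). split; [apply Rpower_pos|]. intros t Ht.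
  unfold Rpower. rewrite <- exp_plus.
  assert (H : ln (t / al) <= t / al - 1).
  { assert (E := exp_ineq1_le (t / al - 1)). replace (1 + (t / al - 1)) with (t / al) in E by ring.
    apply Rcomplements.ln_le in E; [|apply Rdiv_lt_0_compat; lra]. now rewrite ln_exp in E. }
  unfold Rdiv in H at 1. rewrite ln_mult, ln_Rinv in H by (try apply Rinv_0_lt_compat; lra).
  apply (Rmult_le_compat_l al) in H; [|lra].
  replace (al * (t / al - 1)) with (t - al) in H by (field; lra).
  destruct (Req_dec (al * ln t + - t) (al * ln al)) as [->|Hne]; [lra|]. left. apply exp_increasing. lra.
Qed.

Lemma continuous_Rpower_mult f s t : 0 < t -> continuous f t -> continuous (fun t => Rpower t s * f t) t.
Proof.
  intros Ht Hf. apply (continuous_mult (K := R_AbsRing) (fun t => Rpower t s) f); [|exact Hf].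
  apply (ex_derive_continuous (K := R_AbsRing) (V := R_NormedModule)). unfold Rpower. auto_derive. exact Ht.
Qed.

Lemma IG_gamma_exists s : 0 < s -> exists l, IG (fun t => Rpower t (s - 1) * exp (- t)) l.
Proof.
  intros Hs. destruct (Rpower_exp_bound (2 * s)) as [c [Hc Hb]]; [lra|].
  (* The majorant is a multiple of the derivative of [1 - 1/(1+t^s)]: it behaves like [t^(s-1)] at 0
     and is integrable at infinity, so both ends are treated at once. *)
  set (k := (2 + 2 * c) / s).
  assert (Hk : 0 < k) by (apply Rdiv_lt_0_compat; lra).
  apply IG_comparison with (g := fun t => k * (s * Rpower t (s - 1) / (1 + Rpower t s) ^ 2)) (lg := k * 1).
  - intros t Ht. apply continuous_Rpower_mult; [exact Ht|].
    apply (ex_derive_continuous (K := R_AbsRing) (V := R_NormedModule)). auto_derive. trivial.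
  - intros t Ht. assert (P := Rpower_pos t s). assert (P1 := Rpower_pos t (s - 1)).
    assert (Pe := exp_pos (- t)).
    rewrite Rabs_pos_eq by nra.
    replace (k * (s * Rpower t (s - 1) / (1 + Rpower t s) ^ 2)) with
      (Rpower t (s - 1) * ((2 + 2 * c) / (1 + Rpower t s) ^ 2)) by (unfold k; field; lra).
    apply Rmult_le_compat_l; [lra|].
    assert (Hq : 0 < (1 + Rpower t s) ^ 2) by (apply pow_lt; lra).
    apply Rmult_le_reg_r with ((1 + Rpower t s) ^ 2); [exact Hq|].
    replace ((2 + 2 * c) / (1 + Rpower t s) ^ 2 * (1 + Rpower t s) ^ 2) with (2 + 2 * c) by (field; lra).
    assert (H2 : (1 + Rpower t s) ^ 2 <= 2 + 2 * Rpower t (2 * s)).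
    { replace (2 * s) with (s + s) by ring. rewrite Rpower_plus.
      assert (H := pow2_ge_0 (1 - Rpower t s)). lra. }
    assert (He1 : exp (- t) <= 1).
    { rewrite <- exp_0. left. apply exp_increasing. lra. }
    specialize (Hb t Ht).
    apply Rle_trans with (exp (- t) * (2 + 2 * Rpower t (2 * s))); [apply Rmult_le_compat_l; lra|]. lra.
  - apply IG_scal. exists (fun t => 1 - / (1 + Rpower t s)). split; [|split].
    + intros t Ht. assert (P := Rpower_pos t s).
      unfold Rpower in *. auto_derive; [split; [exact Ht|split; [lra|trivial]]|].
      replace ((s - 1) * ln t) with (s * ln t + - ln t) by ring. rewrite exp_plus, exp_Ropp, exp_ln by exact Ht.
      field. lra.
    + apply (filterlim_squeeze0 (at_right 0) _ (fun t => Rpower t s)).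
      * apply (filter_imp (fun t => 0 < t)); [|exact at_right_pos]. intros t Ht. simpl. assert (P := Rpower_pos t s).
        replace (1 - / (1 + Rpower t s)) with (Rpower t s * / (1 + Rpower t s)) by (field; lra).
        assert (Q : 0 < / (1 + Rpower t s)) by (apply Rinv_0_lt_compat; lra).
        assert (Q1 : / (1 + Rpower t s) <= 1) by (rewrite <- Rinv_1 at 2; apply Rinv_le_contravar; lra).
        rewrite Rabs_pos_eq by nra. nra.
      * now apply Rpower_lim_0.
    + assert (H : filterlim (fun t => - / (1 + Rpower t s)) (Rbar_locally p_infty) (locally 0)).
      { apply (filterlim_squeeze0 (Rbar_locally p_infty) _ (fun t => Rpower t (- s))).
        - apply (filter_imp (fun t => 0 < t)); [|exact pinfty_pos]. intros t Ht. simpl. assert (P := Rpower_pos t s).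
          rewrite Rabs_Ropp, Rabs_pos_eq by (left; apply Rinv_0_lt_compat; lra).
          rewrite Rpower_Ropp. apply Rinv_le_contravar; lra.
        - apply Rpower_lim_infty. lra. }
      apply (filterlim_sub_const _ _ 0 (-1)) in H. replace (0 - -1) with 1 in H by ring.
      eapply filterlim_ext; [|exact H]. intros t. simpl. ring.
Qed.

Lemma IG_gamma s : 0 < s -> IG (fun t => Rpower t (s - 1) * exp (- t)) (Gamma s).
Proof.
  intros Hs. destruct (IG_gamma_exists s Hs) as [l Hl].
  replace (Gamma s) with l; [exact Hl|]. symmetry. unfold Gamma.
  apply is_RInt_gen_unique. apply IG_is_RInt_gen; [|exact Hl].
  intros t Ht. apply continuous_Rpower_mult; [exact Ht|].
  apply (ex_derive_continuous (K := R_AbsRing) (V := R_NormedModule)). auto_derive. trivial.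
Qed.

Lemma IG_gamma_scaled s b : 0 < s -> 0 < b -> IG (fun t => Rpower t (s - 1) * exp (- b * t)) (Gamma s * Rpower b (- s)).
Proof.
  intros Hs Hb. assert (H := IG_scal (Rpower b (- s)) _ _ (IG_rescale b _ _ Hb (IG_gamma s Hs))).
  rewrite Rmult_comm in H. eapply IG_ext; [|exact H]. intros t Ht. simpl.
  rewrite <- Rpower_mult_distr by assumption.
  replace (Rpower b (- s) * (b * (Rpower b (s - 1) * Rpower t (s - 1) * exp (- (b * t))))) with
    ((Rpower b (- s) * Rpower b 1 * Rpower b (s - 1)) * (Rpower t (s - 1) * exp (- (b * t))))
    by (rewrite (Rpower_1 b) by exact Hb; ring).
  rewrite <- !Rpower_plus. replace (- s + 1 + (s - 1)) with 0 by ring. rewrite Rpower_O by exact Hb.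
  replace (- b * t) with (- (b * t)) by ring. ring.
Qed.

(** Dividing by [Gamma s] turns Mellin identities into statements about series. Positivity comes
    from the increment of the primitive on [[1, 2]], both tails being nonnegative. *)
Lemma Gamma_pos s : 0 < s -> 0 < Gamma s.
Proof.
  intros Hs. destruct (IG_gamma s Hs) as [F [H1 [H2 H3]]].
  set (f := fun t => Rpower t (s - 1) * exp (- t)) in *.
  assert (Hf : forall t, 0 < t -> 0 < f t) by (intros t Ht; unfold f; apply Rmult_lt_0_compat; [apply Rpower_pos|apply exp_pos]).
  assert (Hf' : forall t, 0 < t -> Rabs (f t) <= f t) by (intros t Ht; rewrite Rabs_pos_eq; [lra|left; now apply Hf]).
  destruct (primitive_tails F F f f _ _ 1 Rlt_0_1 H1 H1 Hf' H2 H3 H2 H3) as [A1 _].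
  destruct (primitive_tails F F f f _ _ 2 ltac:(lra) H1 H1 Hf' H2 H3 H2 H3) as [_ A2].
  assert (B1 := Rle_trans _ _ _ (Rabs_pos _) A1). assert (B2 := Rle_trans _ _ _ (Rabs_pos _) A2).
  destruct (MVT_cor2 F f 1 2) as [c [Hc1 Hc2]]; [lra|intros c Hc; apply is_derive_Reals, H1; lra|].
  specialize (Hf c ltac:(lra)). lra.
Qed.

(** * Hasse's series under the Mellin integral *)

Lemma one_plus_exp_neg t : (1 + t) * exp (- t) <= 1.
Proof.
  rewrite exp_Ropp. assert (H := exp_ineq1_le t). assert (P := exp_pos t).
  apply Rmult_le_reg_r with (exp t); [exact P|]. rewrite Rmult_assoc, Rinv_l by lra. lra.
Qed.

Lemma one_minus_exp_neg t : 0 < t -> 0 < 1 - exp (- t) < 1 /\ 1 - exp (- t) <= t /\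
  t * exp (- t) <= 1 - exp (- t) /\ t / (1 - exp (- t)) <= 1 + t /\ 1 <= t / (1 - exp (- t)).
Proof.
  intros Ht. assert (P := exp_pos (- t)).
  assert (H1 : exp (- t) < 1) by (rewrite <- exp_0; apply exp_increasing; lra).
  assert (H2 := exp_ineq1_le (- t)). assert (H3 := one_plus_exp_neg t).
  repeat split; try lra.
  - apply Rmult_le_reg_r with (1 - exp (- t)); [lra|]. unfold Rdiv. rewrite Rmult_assoc, Rinv_l by lra. nra.
  - apply Rmult_le_reg_r with (1 - exp (- t)); [lra|]. unfold Rdiv. rewrite Rmult_assoc, Rinv_l by lra. lra.
Qed.

(* Partial sums of [-ln(1-y)/y] at [y = 1 - e^{-t}], converging to [t/y]. *)
Definition hasse_sum (M : nat) (t : R) : R := rsum (fun n => (1 - exp (- t)) ^ n / INR (S n)) (S M).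

(** With [y = 1 - e^{-t}], the remainder [t - y * hasse_sum M t] has derivative [y^(M+1)], since
    differentiating the partial sum of [-ln(1-y)] gives a geometric sum. As [y] increases with [t],
    the remainder lies between 0 and [t y^(M+1)]. *)
Lemma hasse_sum_bounds M t : 0 < t ->
  1 <= hasse_sum M t <= t / (1 - exp (- t)) /\
  t / (1 - exp (- t)) - hasse_sum M t <= t * (1 - exp (- t)) ^ M.
Proof.
  intros Ht. destruct (one_minus_exp_neg t Ht) as [Hy _].
  set (r := fun t => t - (1 - exp (- t)) * hasse_sum M t).
  assert (Dr : forall t, is_derive r t ((1 - exp (- t)) ^ S M)).
  { clear. intros t. unfold r, hasse_sum.
    assert (E : forall n t, (1 - exp (- t)) * rsum (fun n => (1 - exp (- t)) ^ n / INR (S n)) n =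
       rsum (fun k => (1 - exp (- t)) ^ S k / INR (S k)) n).
    { intros n t'. rewrite <- rsum_scal. apply rsum_ext. intros k _. cbn [pow]. unfold Rdiv; ring. }
    assert (D : is_derive (fun t => rsum (fun k => (1 - exp (- t)) ^ S k / INR (S k)) (S M)) t
      (rsum (fun k => (1 - exp (- t)) ^ k * exp (- t)) (S M))).
    { apply (is_derive_rsum (fun k t => (1 - exp (- t)) ^ S k / INR (S k))). intros k.
      assert (D1 : is_derive (fun t => 1 - exp (- t)) t (exp (- t))) by (auto_derive; [trivial|ring]).
      evar_last.
      - apply (is_derive_ext (fun t => / INR (S k) * (1 - exp (- t)) ^ S k)); [intros; unfold Rdiv; apply Rmult_comm|].
        apply is_derive_scal, is_derive_pow, D1.
      - simpl pred. cbv beta. field. apply not_0_INR; lia. }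
    apply is_derive_ext with (fun t => t - rsum (fun k => (1 - exp (- t)) ^ S k / INR (S k)) (S M)).
    { intros t'. now rewrite E. }
    evar_last; [apply (is_derive_minus (K := R_AbsRing) (V := R_NormedModule)); [apply (is_derive_id (K := R_AbsRing))|exact D]|].
    unfold minus, plus, opp, one; simpl Hierarchy.one.
    assert (G : forall n, 1 + - rsum (fun k => (1 - exp (- t)) ^ k * exp (- t)) n = (1 - exp (- t)) ^ n).
    { induction n as [|n IH]; [simpl; ring|]. cbn [rsum pow]. rewrite <- IH at 2.
      assert (E2 : rsum (fun k => (1 - exp (- t)) ^ k * exp (- t)) n = 1 - (1 - exp (- t)) ^ n) by lra.
      rewrite E2. ring. }
    apply (G (S M)). }
  assert (Dy : forall u v, 0 <= u -> u <= v -> 1 - exp (- u) <= 1 - exp (- v)).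
  { intros u v Hu Huv. destruct (Req_dec u v) as [->|Hne]; [lra|].
    assert (exp (- v) < exp (- u)) by (apply exp_increasing; lra). lra. }
  assert (R0 : r 0 = 0) by (unfold r; rewrite Ropp_0, exp_0; ring).
  assert (Hr1 : 0 <= r t).
  { assert (H := increment_le (fun _ => 0) r (fun _ => 0) (fun t => (1 - exp (- t)) ^ S M) 0 t).
    cut (0 - 0 <= r t - r 0); [lra|]. apply H; [lra| | | | |].
    - intros u _. apply (is_derive_const (K := R_AbsRing) (V := R_NormedModule)).
    - intros u _. apply Dr.
    - intros u _. apply continuity_pt_const. intros ? ?; reflexivity.
    - intros u _. eapply is_derive_continuity_pt, Dr.
    - intros u Hu. apply pow_le. assert (H0 := Dy 0 u). rewrite Ropp_0, exp_0 in H0. lra. }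
  assert (Hr2 : r t <= t * (1 - exp (- t)) ^ S M).
  { remember ((1 - exp (- t)) ^ S M) as q eqn:Eq.
    assert (H := increment_le r (fun u => q * u) (fun t => (1 - exp (- t)) ^ S M) (fun _ => q) 0 t).
    cut (r t - r 0 <= q * t - q * 0); [lra|]. apply H; [lra| | | | |].
    - intros u _. apply Dr.
    - intros u _. auto_derive; [trivial|ring].
    - intros u _. eapply is_derive_continuity_pt, Dr.
    - intros u _. apply (is_derive_continuity_pt _ _ q). auto_derive; [trivial|ring].
    - intros u Hu. rewrite Eq. apply pow_incr. split; [|apply Dy; lra]. assert (H0 := Dy 0 u). rewrite Ropp_0, exp_0 in H0. lra. }
  unfold r in Hr1, Hr2. set (y := 1 - exp (- t)) in *.
  split; [split|].
  - unfold hasse_sum. fold y. induction M as [|M IH]; [simpl; lra|]. clear r Dr R0 Hr1 Hr2.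
    change (rsum (fun n => y ^ n / INR (S n)) (S (S M))) with (rsum (fun n => y ^ n / INR (S n)) (S M) + y ^ S M / INR (S (S M))).
    assert (0 < y ^ S M / INR (S (S M))) by (apply Rdiv_lt_0_compat; [apply pow_lt; lra|apply lt_0_INR; lia]).
    assert (Hm : forall m, 1 <= rsum (fun n => y ^ n / INR (S n)) (S m)).
    { induction m as [|m IHm]; [simpl; lra|].
      change (rsum (fun n => y ^ n / INR (S n)) (S (S m))) with (rsum (fun n => y ^ n / INR (S n)) (S m) + y ^ S m / INR (S (S m))).
      assert (0 < y ^ S m / INR (S (S m))) by (apply Rdiv_lt_0_compat; [apply pow_lt; lra|apply lt_0_INR; lia]). lra. }
    specialize (Hm M). lra.
  - apply Rmult_le_reg_r with y; [lra|]. unfold Rdiv. rewrite Rmult_assoc, Rinv_l by lra. lra.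
  - apply Rmult_le_reg_r with y; [lra|]. rewrite Rmult_minus_distr_r. unfold Rdiv. rewrite (Rmult_assoc t), Rinv_l by lra.
    cbn [pow] in Hr2. lra.
Qed.

Lemma dn_exp n t a : dn n (fun x => exp (- x * t)) a = exp (- a * t) * (1 - exp (- t)) ^ n.
Proof.
  revert a; induction n as [|n IH]; intros a; [rewrite dn_0; simpl; ring|].
  rewrite dn_S, !IH. replace (- (a + 1) * t) with (- a * t + - t) by ring. rewrite exp_plus. simpl. ring.
Qed.

Lemma dn_id_exp n t a : dn (S n) (fun x => x * exp (- x * t)) a =
  exp (- a * t) * (a * (1 - exp (- t)) ^ S n - INR (S n) * exp (- t) * (1 - exp (- t)) ^ n).
Proof.
  rewrite dn_mult_id, !dn_exp. replace (- (a + 1) * t) with (- a * t + - t) by ring. rewrite exp_plus. ring.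
Qed.

(** The integrand whose Mellin transform is [Gamma s] times a partial sum of Hasse's outer series:
    [x e^{-xt}] has transform [Gamma(s) x^(1-s)], and differences in [x] commute with the
    integral. *)
Definition hasse_kernel (a : R) (M : nat) (t : R) : R :=
  rsum (fun n => / INR (S n) * dn n (fun x => x * exp (- x * t)) a) (S M).

Lemma IG_dn s n a : 0 < s -> 0 < a ->
  IG (fun t => Rpower t (s - 1) * dn n (fun x => x * exp (- x * t)) a) (Gamma s * dn n (fun x => Rpower x (1 - s)) a).
Proof.
  intros Hs. revert a; induction n as [|n IH]; intros a Ha.
  - assert (H := IG_scal a _ _ (IG_gamma_scaled s a Hs Ha)).
    replace (Gamma s * dn 0 (fun x => Rpower x (1 - s)) a) with (a * (Gamma s * Rpower a (- s))).
    + eapply IG_ext; [|exact H]. intros t Ht. simpl. rewrite dn_0. ring.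
    + rewrite dn_0. replace (1 - s) with (1 + - s) by ring. rewrite Rpower_plus, Rpower_1 by exact Ha. ring.
  - assert (H := IG_minus _ _ _ _ (IH a Ha) (IH (a + 1) ltac:(lra))).
    rewrite dn_S, Rmult_minus_distr_l. eapply IG_ext; [|exact H]. intros t Ht. simpl. rewrite dn_S. ring.
Qed.

Lemma IG_hasse_kernel s a M : 0 < s -> 0 < a ->
  IG (fun t => Rpower t (s - 1) * hasse_kernel a M t)
    (Gamma s * rsum (fun n => / INR (S n) * dn n (fun x => Rpower x (1 - s)) a) (S M)).
Proof.
  intros Hs Ha. unfold hasse_kernel.
  rewrite <- rsum_scal.
  apply IG_ext with (fun t => rsum (fun n => Rpower t (s - 1) * (/ INR (S n) * dn n (fun x => x * exp (- x * t)) a)) (S M)).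
  { intros t _. now rewrite rsum_scal. }
  apply (IG_rsum (fun n t => Rpower t (s - 1) * (/ INR (S n) * dn n (fun x => x * exp (- x * t)) a))).
  intros n _. replace (Gamma s * (/ INR (S n) * dn n (fun x => Rpower x (1 - s)) a)) with
    (/ INR (S n) * (Gamma s * dn n (fun x => Rpower x (1 - s)) a)) by ring.
  eapply IG_ext; [|apply IG_scal, (IG_dn s n a Hs Ha)]. intros t Ht. simpl. ring.
Qed.

Lemma hasse_kernel_eq a M t : 0 < t ->
  hasse_kernel a M t = exp (- a * t) * (a * hasse_sum M t - (1 - (1 - exp (- t)) ^ M)
    + exp (- t) / (1 - exp (- t)) * (hasse_sum M t - 1)).
Proof.
  intros Ht. destruct (one_minus_exp_neg t Ht) as [Hy _].
  induction M as [|M IH].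
  - unfold hasse_kernel, hasse_sum. cbn [rsum]. rewrite dn_0. simpl. field. lra.
  - assert (E1 : hasse_kernel a (S M) t = hasse_kernel a M t + / INR (S (S M)) * dn (S M) (fun x => x * exp (- x * t)) a) by reflexivity.
    assert (E2 : hasse_sum (S M) t = hasse_sum M t + (1 - exp (- t)) ^ S M / INR (S (S M))) by reflexivity.
    assert (H := pos_INR (S M)).
    rewrite E1, E2, IH, dn_id_exp. rewrite (S_INR (S M)). cbn [pow]. field.
    repeat split; lra.
Qed.

Definition mellin_kernel (a t : R) : R :=
  exp (- a * t) * (a * (t / (1 - exp (- t))) - 1 + exp (- t) / (1 - exp (- t)) * (t / (1 - exp (- t)) - 1)).

(** The majorant must be independent of [M]. The singular factor [e^{-t}/(1-e^{-t})] is compensated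
    by [hasse_sum M t - 1 <= t] together with [t e^{-t} <= 1 - e^{-t}]. *)
Lemma hasse_kernel_bound a M t : 0 < a -> 0 < t ->
  Rabs (hasse_kernel a M t) <= (a + 2) * ((1 + t) * exp (- a * t)).
Proof.
  intros Ha Ht. rewrite hasse_kernel_eq by exact Ht.
  destruct (one_minus_exp_neg t Ht) as [Hy [_ [H3 [H4 H5]]]].
  destruct (hasse_sum_bounds M t Ht) as [[P1 P2] _].
  set (y := 1 - exp (- t)) in *. set (P := hasse_sum M t) in *.
  assert (He := exp_pos (- a * t)). assert (He1 := exp_pos (- t)).
  rewrite Rabs_mult, (Rabs_pos_eq (exp _)) by lra.
  replace ((a + 2) * ((1 + t) * exp (- a * t))) with (exp (- a * t) * ((a + 2) * (1 + t))) by ring.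
  apply Rmult_le_compat_l; [lra|].
  assert (Hm : 0 <= y ^ M <= 1).
  { split; [apply pow_le; lra|]. rewrite <- (pow1 M). apply pow_incr. lra. }
  assert (Hq : 0 <= exp (- t) / y * (P - 1) <= 1).
  { assert (Hey : 0 < exp (- t) / y) by (apply Rdiv_lt_0_compat; lra).
    split; [apply Rmult_le_pos; lra|].
    apply Rle_trans with (exp (- t) / y * t); [apply Rmult_le_compat_l; lra|].
    apply Rmult_le_reg_r with y; [lra|]. replace (exp (- t) / y * t * y) with (t * exp (- t)) by (field; lra). lra. }
  assert (0 <= a * P <= a * (1 + t)) by (split; [apply Rmult_le_pos; lra|apply Rmult_le_compat_l; lra]).
  apply Rabs_le. assert (a * (1 + t) + 1 <= (a + 2) * (1 + t)) by lra. split; lra.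
Qed.

Lemma mellin_kernel_diff a M t : 0 < a -> 0 < t ->
  Rabs (hasse_kernel a M t - mellin_kernel a t) <= (a * t + 2) * (1 - exp (- t)) ^ M.
Proof.
  intros Ha Ht. rewrite hasse_kernel_eq by exact Ht. unfold mellin_kernel.
  destruct (one_minus_exp_neg t Ht) as [Hy [_ [H3 _]]].
  destruct (hasse_sum_bounds M t Ht) as [[P1 P2] P3].
  set (y := 1 - exp (- t)) in *. set (P := hasse_sum M t) in *.
  assert (He := exp_pos (- a * t)). assert (He1 := exp_pos (- t)).
  assert (He2 : exp (- a * t) <= 1) by (rewrite <- exp_0; left; apply exp_increasing; nra).
  set (d := t / y - P) in *.
  replace (exp (- a * t) * (a * P - (1 - y ^ M) + exp (- t) / y * (P - 1)) -
     exp (- a * t) * (a * (t / y) - 1 + exp (- t) / y * (t / y - 1))) with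
    (exp (- a * t) * (y ^ M - (a + exp (- t) / y) * d)) by (unfold d; ring).
  assert (Hm : 0 <= y ^ M) by (apply pow_le; lra).
  assert (Hd : 0 <= d <= t * y ^ M) by (unfold d in *; lra).
  assert (Hey : 0 < exp (- t) / y) by (apply Rdiv_lt_0_compat; lra).
  assert (Het : exp (- t) / y * t <= 1).
  { apply Rmult_le_reg_r with y; [lra|]. replace (exp (- t) / y * t * y) with (t * exp (- t)) by (field; lra). lra. }
  assert (Hb : 0 <= (a + exp (- t) / y) * d <= (a * t + 1) * y ^ M).
  { split; [apply Rmult_le_pos; lra|].
    apply Rle_trans with ((a + exp (- t) / y) * (t * y ^ M)); [apply Rmult_le_compat_l; lra|].
    rewrite <- Rmult_assoc. apply Rmult_le_compat_r; lra. }
  rewrite Rabs_mult, (Rabs_pos_eq (exp _)) by lra.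
  assert (Hc : Rabs (y ^ M - (a + exp (- t) / y) * d) <= (a * t + 2) * y ^ M) by (apply Rabs_le; lra).
  assert (H0 := Rabs_pos (y ^ M - (a + exp (- t) / y) * d)).
  apply Rle_trans with (1 * Rabs (y ^ M - (a + exp (- t) / y) * d)); [apply Rmult_le_compat_r; lra|lra].
Qed.

Lemma is_lim_seq_geom_scal c q : 0 <= q < 1 -> is_lim_seq (fun M => c * q ^ M) 0.
Proof.
  intros Hq. replace (Finite 0) with (Finite (c * 0)) by (f_equal; ring).
  apply is_lim_seq_mult'; [apply is_lim_seq_const|]. apply is_lim_seq_geom. rewrite Rabs_pos_eq; lra.
Qed.

Lemma mellin_kernel_bound a t : 0 < a -> 0 < t ->
  Rabs (mellin_kernel a t) <= (a + 2) * ((1 + t) * exp (- a * t)).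
Proof.
  intros Ha Ht. destruct (one_minus_exp_neg t Ht) as [Hy _].
  assert (L1 : is_lim_seq (fun M => Rabs (mellin_kernel a t)) (Rabs (mellin_kernel a t))) by apply is_lim_seq_const.
  assert (L2 : is_lim_seq (fun M => (a + 2) * ((1 + t) * exp (- a * t)) + (a * t + 2) * (1 - exp (- t)) ^ M)
    ((a + 2) * ((1 + t) * exp (- a * t)) + 0)).
  { apply is_lim_seq_plus'; [apply is_lim_seq_const|apply is_lim_seq_geom_scal; lra]. }
  rewrite Rplus_0_r in L2.
  refine (is_lim_seq_le _ _ (Finite _) (Finite _) _ L1 L2). intros M. cbv beta.
  assert (H1 := hasse_kernel_bound a M t Ha Ht). assert (H2 := mellin_kernel_diff a M t Ha Ht).
  replace (mellin_kernel a t) with (hasse_kernel a M t - (hasse_kernel a M t - mellin_kernel a t)) at 1 by ring.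
  eapply Rle_trans; [apply Rabs_triang|]. rewrite Rabs_Ropp. apply Rplus_le_compat; assumption.
Qed.

Lemma Rpower_bound_on s u v t : 0 < u -> u <= t <= v -> Rpower t s <= Rpower u s + Rpower v s.
Proof.
  intros Hu Ht. assert (P1 := Rpower_pos u s). assert (P2 := Rpower_pos v s).
  destruct (Rle_dec 0 s) as [Hs|Hs].
  - assert (Rpower t s <= Rpower v s) by (apply Rle_Rpower_l; lra). lra.
  - assert (H : Rpower t s <= Rpower u s); [|lra].
    replace s with (- - s) by ring. rewrite !(Rpower_Ropp _ (- s)).
    apply Rinv_le_contravar; [apply Rpower_pos|]. apply Rle_Rpower_l; lra.
Qed.

Lemma IG_mellin_kernel_exists s a : 0 < s -> 0 < a ->
  exists l, IG (fun t => Rpower t (s - 1) * mellin_kernel a t) l.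
Proof.
  intros Hs Ha.
  assert (G1 := IG_gamma_scaled s a Hs Ha). assert (G2 := IG_gamma_scaled (s + 1) a ltac:(lra) Ha).
  assert (G3 := IG_scal (a + 2) _ _ (IG_plus _ _ _ _ G1 G2)).
  eapply IG_comparison; [| |exact G3].
  - intros t Ht. destruct (one_minus_exp_neg t Ht) as [Hy _].
    apply continuous_Rpower_mult; [exact Ht|].
    apply (ex_derive_continuous (K := R_AbsRing) (V := R_NormedModule)). unfold mellin_kernel. auto_derive.
    repeat split; lra.
  - intros t Ht. assert (P := Rpower_pos t (s - 1)).
    rewrite Rabs_mult, (Rabs_pos_eq (Rpower _ _)) by lra.
    replace (s + 1 - 1) with (1 + (s - 1)) by ring. rewrite Rpower_plus, Rpower_1 by exact Ht.
    replace ((a + 2) * (Rpower t (s - 1) * exp (- a * t) + t * Rpower t (s - 1) * exp (- a * t)))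
      with (Rpower t (s - 1) * ((a + 2) * ((1 + t) * exp (- a * t)))) by ring.
    apply Rmult_le_compat_l; [lra|]. now apply mellin_kernel_bound.
Qed.

(** Dominated convergence of [hasse_kernel] to [mellin_kernel]. The same limit shows that Hasse's
    series converges, without which the [Series] in [hurwitz_zeta] would carry no information. *)
Lemma IG_mellin_kernel s a : 0 < s -> s <> 1 -> 0 < a ->
  IG (fun t => Rpower t (s - 1) * mellin_kernel a t) ((s - 1) * (Gamma s * hurwitz_zeta s a)).
Proof.
  intros Hs Hs1 Ha. destruct (IG_mellin_kernel_exists s a Hs Ha) as [l Hl].
  assert (G1 := IG_gamma_scaled s a Hs Ha). assert (G2 := IG_gamma_scaled (s + 1) a ltac:(lra) Ha).
  assert (G3 := IG_scal (a + 2) _ _ (IG_plus _ _ _ _ G1 G2)).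
  assert (Hg : forall t, 0 < t -> (a + 2) * (Rpower t (s - 1) * exp (- a * t) + Rpower t (s + 1 - 1) * exp (- a * t)) =
     Rpower t (s - 1) * ((a + 2) * ((1 + t) * exp (- a * t)))).
  { intros t Ht. replace (s + 1 - 1) with (1 + (s - 1)) by ring. rewrite Rpower_plus, Rpower_1 by exact Ht. ring. }
  assert (L := IG_dominated _ _ _ _ _ _ (fun M => IG_hasse_kernel s a M Hs Ha) Hl G3).
  assert (L' : is_lim_seq (fun M => Gamma s * rsum (fun n => / INR (S n) * dn n (fun x => Rpower x (1 - s)) a) (S M)) l).
  { apply L.
    - intros M t Ht. rewrite Hg by exact Ht. assert (P := Rpower_pos t (s - 1)).
      rewrite Rabs_mult, (Rabs_pos_eq (Rpower _ _)) by lra. apply Rmult_le_compat_l; [lra|]. now apply hasse_kernel_bound.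
    - intros t Ht. rewrite Hg by exact Ht. assert (P := Rpower_pos t (s - 1)).
      rewrite Rabs_mult, (Rabs_pos_eq (Rpower _ _)) by lra. apply Rmult_le_compat_l; [lra|]. now apply mellin_kernel_bound.
    - intros u v Hu Huv. destruct (one_minus_exp_neg v ltac:(lra)) as [Hv _].
      exists (fun M => ((Rpower u (s - 1) + Rpower v (s - 1)) * (a * v + 2)) * (1 - exp (- v)) ^ M).
      split; [apply is_lim_seq_geom_scal; lra|]. intros M t Ht.
      destruct (one_minus_exp_neg t ltac:(lra)) as [Hy _].
      rewrite <- Rmult_minus_distr_l, Rabs_mult, (Rabs_pos_eq (Rpower _ _)) by (left; apply Rpower_pos).
      rewrite Rmult_assoc. apply Rmult_le_compat; [left; apply Rpower_pos|apply Rabs_pos|apply Rpower_bound_on; lra|].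
      eapply Rle_trans; [apply mellin_kernel_diff; lra|].
      apply Rmult_le_compat; [nra|apply pow_le; lra|nra|].
      apply pow_incr. split; [lra|].
      assert (exp (- v) <= exp (- t)); [|lra].
      destruct (Req_dec t v) as [->|Hne]; [lra|]. left. apply exp_increasing. lra. }
  assert (Hz : (s - 1) * (Gamma s * hurwitz_zeta s a) = l).
  { assert (Gp := Gamma_pos s Hs).
    assert (S1 : is_series (fun n => / INR (n + 1) * sum_f_R0 (fun k => (-1) ^ k * Binomial.C n k * Rpower (a + INR k) (1 - s)) n) (l / Gamma s)).
    { apply (is_lim_seq_ext (fun M => / Gamma s * (Gamma s * rsum (fun n => / INR (S n) * dn n (fun x => Rpower x (1 - s)) a) (S M))) _ (l / Gamma s)).
      - intros M. rewrite sum_n_rsum, <- Rmult_assoc, Rinv_l, Rmult_1_l by lra.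
        apply rsum_ext. intros n _. rewrite Nat.add_1_r. reflexivity.
      - replace (l / Gamma s) with (/ Gamma s * l) by (unfold Rdiv; ring).
        apply is_lim_seq_mult'; [apply is_lim_seq_const|exact L']. }
    unfold hurwitz_zeta. rewrite (is_series_unique _ _ S1). field. split; lra. }
  rewrite Hz. exact Hl.
Qed.

(* Integration by parts: [mellin_kernel a] is minus the derivative of [t e^{-at}/(1-e^{-t})]. *)
Lemma IG_mellin s a kap : 0 < s -> 0 < a -> (kap = 0 /\ 1 < s \/ kap = 1 /\ s < 1) ->
  IG (fun t => Rpower t (s - 1) * (exp (- a * t) / (1 - exp (- t)) - kap / t)) (Gamma s * hurwitz_zeta s a).
Proof.
  intros Hs Ha Hk. assert (Hs1 : s <> 1) by lra.
  destruct (IG_mellin_kernel s a Hs Hs1 Ha) as [F [D1 [D2 D3]]].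
  set (l := (s - 1) * (Gamma s * hurwitz_zeta s a)) in *.
  set (Fk := fun t => exp (- a * t) * (t / (1 - exp (- t))) - kap).
  assert (Hbd : forall t, 0 < t -> 0 < exp (- a * t) * (t / (1 - exp (- t))) <= (1 + t) * exp (- a * t)).
  { intros t Ht. destruct (one_minus_exp_neg t Ht) as [Hy [_ [_ [H4 H5]]]]. assert (P := exp_pos (- a * t)).
    split; [apply Rmult_lt_0_compat; lra|]. rewrite Rmult_comm. apply Rmult_le_compat_r; lra. }
  destruct (Rpower_exp_bound 1 ltac:(lra)) as [c1 [Hc1 Hb1]].
  assert (Hbb : forall t, 0 < t -> (1 + t) * exp (- a * t) <= 1 + c1 / a).
  { intros t Ht. specialize (Hb1 (a * t) ltac:(nra)). rewrite Rpower_1 in Hb1 by nra.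
    replace (- (a * t)) with (- a * t) in Hb1 by ring.
    assert (exp (- a * t) <= 1) by (rewrite <- exp_0; left; apply exp_increasing; nra).
    assert (t * exp (- a * t) <= c1 / a).
    { apply Rmult_le_reg_r with a; [exact Ha|]. replace (c1 / a * a) with c1 by (field; lra). lra. }
    lra. }
  (* For [kap = 0] boundedness of [Fk] and [s > 1] suffice at 0. For [kap = 1] the subtraction makes
     [Fk] of order [t], which turns [t^(s-1)] into [t^s]. *)
  assert (B0 : filterlim (fun t => Rpower t (s - 1) * Fk t) (at_right 0) (locally 0)).
  { destruct Hk as [[-> Hs2]|[-> Hs2]].
    - apply (filterlim_squeeze0 (at_right 0) _ (fun t => (1 + c1 / a) * Rpower t (s - 1))).
      + apply (filter_imp (fun t => 0 < t)); [|exact at_right_pos]. intros t Ht. unfold Fk.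
        rewrite Rminus_0_r, Rabs_mult, !Rabs_pos_eq by (left; try apply Rpower_pos; now apply Hbd).
        rewrite Rmult_comm. apply Rmult_le_compat_r; [left; apply Rpower_pos|].
        eapply Rle_trans; [apply Hbd, Ht|now apply Hbb].
      + replace 0 with ((1 + c1 / a) * 0) at 2 by ring.
        eapply filterlim_comp; [apply Rpower_lim_0; lra|].
        apply (filterlim_scal_r (K := R_AbsRing) (V := R_NormedModule) (1 + c1 / a)).
    - apply (filterlim_squeeze0 (at_right 0) _ (fun t => (a + 1) * Rpower t s)).
      + apply (filter_imp (fun t => 0 < t)); [|exact at_right_pos]. intros t Ht. unfold Fk.
        rewrite Rabs_mult, (Rabs_pos_eq (Rpower _ _)) by (left; apply Rpower_pos).
        replace s with (s - 1 + 1) at 2 by ring. rewrite Rpower_plus, Rpower_1 by exact Ht.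
        replace ((a + 1) * (Rpower t (s - 1) * t)) with (Rpower t (s - 1) * ((a + 1) * t)) by ring.
        apply Rmult_le_compat_l; [left; apply Rpower_pos|].
        destruct (one_minus_exp_neg t Ht) as [Hy [_ [_ [H4 H5]]]]. assert (P := exp_pos (- a * t)).
        assert (E := exp_ineq1_le (- a * t)).
        assert (exp (- a * t) <= 1) by (rewrite <- exp_0; left; apply exp_increasing; nra).
        apply Rabs_le. split.
        * assert (exp (- a * t) * 1 <= exp (- a * t) * (t / (1 - exp (- t)))) by (apply Rmult_le_compat_l; lra). nra.
        * assert (exp (- a * t) * (t / (1 - exp (- t))) <= 1 * (1 + t)) by (apply Rmult_le_compat; lra). nra.
      + replace 0 with ((a + 1) * 0) at 2 by ring.
        eapply filterlim_comp; [apply Rpower_lim_0; lra|].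
        apply (filterlim_scal_r (K := R_AbsRing) (V := R_NormedModule) (a + 1)). }
  assert (Bi : filterlim (fun t => Rpower t (s - 1) * Fk t) (Rbar_locally p_infty) (locally 0)).
  { destruct Hk as [[-> Hs2]|[-> Hs2]].
    - assert (Hex : exists c, forall t, 1 < t -> Rpower t (s - 1) * ((1 + t) * exp (- a * t)) <= c * Rpower t (-1)).
      { destruct (Rpower_exp_bound (s + 1) ltac:(lra)) as [c [Hc Hb]].
        exists (2 * (c * Rpower a (- (s + 1)))). intros t Ht.
        specialize (Hb (a * t) ltac:(nra)). rewrite <- Rpower_mult_distr in Hb by lra.
        replace (- (a * t)) with (- a * t) in Hb by ring.
        assert (Ea : Rpower a (- (s + 1)) * Rpower a (s + 1) = 1).
        { rewrite <- Rpower_plus. replace (- (s + 1) + (s + 1)) with 0 by ring. apply Rpower_O. lra. }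
        assert (Pa := Rpower_pos a (- (s + 1))). assert (Pt := Rpower_pos t (-1)). assert (Pe := exp_pos (- a * t)).
        apply (Rmult_le_compat_l (Rpower a (- (s + 1)))) in Hb; [|lra].
        replace (Rpower a (- (s + 1)) * (Rpower a (s + 1) * Rpower t (s + 1) * exp (- a * t))) with
          ((Rpower a (- (s + 1)) * Rpower a (s + 1)) * (Rpower t (s + 1) * exp (- a * t))) in Hb by ring.
        rewrite Ea, Rmult_1_l in Hb.
        replace (s - 1) with ((s + 1) + (-1) + (-1)) by ring. rewrite !Rpower_plus.
        assert (Et : (1 + t) * Rpower t (-1) <= 2).
        { replace (-1) with (- (1)) by ring. rewrite Rpower_Ropp, Rpower_1 by lra.
          apply Rmult_le_reg_r with t; [lra|]. rewrite Rmult_assoc, Rinv_l by lra. lra. }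
        rewrite <- !Rpower_plus. rewrite !Rpower_plus.
        replace (Rpower t s * Rpower t 1 * Rpower t (-1) * Rpower t (-1) * ((1 + t) * exp (- a * t))) with
          ((((1 + t) * Rpower t (-1)) * (Rpower t s * Rpower t 1 * exp (- a * t))) * Rpower t (-1)) by ring.
        rewrite <- Rpower_plus.
        apply Rmult_le_compat_r; [lra|]. apply Rmult_le_compat; [nra| |exact Et|lra].
        apply Rmult_le_pos; [left; apply Rpower_pos|lra]. }
      destruct Hex as [c Hc].
      apply (filterlim_squeeze0 (Rbar_locally p_infty) _ (fun t => c * Rpower t (-1))).
      + exists 1. intros t Ht. unfold Fk.
        rewrite Rminus_0_r, Rabs_mult, !Rabs_pos_eq by (left; try apply Rpower_pos; apply Hbd; lra).
        eapply Rle_trans; [|apply Hc, Ht]. apply Rmult_le_compat_l; [left; apply Rpower_pos|apply Hbd; lra].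
      + replace 0 with (c * 0) by ring.
        eapply filterlim_comp; [apply Rpower_lim_infty; lra|].
        apply (filterlim_scal_r (K := R_AbsRing) (V := R_NormedModule) c).
    - apply (filterlim_squeeze0 (Rbar_locally p_infty) _ (fun t => (2 + c1 / a) * Rpower t (s - 1))).
      + apply (filter_imp (fun t => 0 < t)); [|exact pinfty_pos]. intros t Ht. unfold Fk.
        rewrite Rabs_mult, (Rabs_pos_eq (Rpower _ _)) by (left; apply Rpower_pos).
        rewrite Rmult_comm. apply Rmult_le_compat_r; [left; apply Rpower_pos|].
        specialize (Hbd t Ht). specialize (Hbb t Ht).
        assert (0 < c1 / a) by (apply Rdiv_lt_0_compat; lra). apply Rabs_le. lra.
      + replace 0 with ((2 + c1 / a) * 0) by ring.
        eapply filterlim_comp; [apply Rpower_lim_infty; lra|].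
        apply (filterlim_scal_r (K := R_AbsRing) (V := R_NormedModule) (2 + c1 / a)). }
  assert (H : IG (fun t => (s - 1) * (Rpower t (s - 1) * (exp (- a * t) / (1 - exp (- t)) - kap / t))) l).
  { exists (fun t => F t + Rpower t (s - 1) * Fk t). split; [|split].
    - intros t Ht. destruct (one_minus_exp_neg t Ht) as [Hy _].
      assert (DR : is_derive (fun t => Rpower t (s - 1)) t ((s - 1) * (Rpower t (s - 1) / t))).
      { unfold Rpower. auto_derive; [exact Ht|]. field. lra. }
      assert (DF : is_derive Fk t (- mellin_kernel a t)).
      { unfold Fk, mellin_kernel. auto_derive; [lra|]. 
        replace (- t) with (-1 * t) by ring. field. replace (-1 * t) with (- t) by ring. lra. }
      evar_last; [apply (is_derive_plus (K := R_AbsRing) (V := R_NormedModule)); [apply D1, Ht|apply is_derive_mult_R; [exact DR|exact DF]]|].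
      unfold plus; simpl. unfold Fk. field. lra.
    - assert (H := filterlim_comp_2 F (fun t => Rpower t (s - 1) * Fk t) Rplus D2 B0
        (filterlim_plus (K := R_AbsRing) (V := R_NormedModule) 0 0)).
      unfold plus in H; simpl in H. rewrite Rplus_0_r in H. exact H.
    - assert (H := filterlim_comp_2 F (fun t => Rpower t (s - 1) * Fk t) Rplus D3 Bi
        (filterlim_plus (K := R_AbsRing) (V := R_NormedModule) l 0)).
      unfold plus in H; simpl in H. rewrite Rplus_0_r in H. exact H. }
  assert (H2 := IG_scal (/ (s - 1)) _ _ H).
  replace (Gamma s * hurwitz_zeta s a) with (/ (s - 1) * l) by (unfold l; field; lra).
  eapply IG_ext; [|exact H2]. intros t Ht. simpl. rewrite <- Rmult_assoc, Rinv_l by lra. ring.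
Qed.

(** * The Lambert series *)

Lemma geom_exp_sum t K : 0 < t ->
  rsum (fun k => exp (- INR (S k) * t)) K = exp (- (1) * t) / (1 - exp (- t)) * (1 - exp (- t) ^ K).
Proof.
  intros Ht. destruct (one_minus_exp_neg t Ht) as [Hy _].
  induction K as [|K IH]; [simpl; ring|]. cbn [rsum]. rewrite IH.
  replace (exp (- INR (S K) * t)) with (exp (- t) ^ S K) by (rewrite exp_pow_INR; f_equal; ring).
  replace (- (1) * t) with (- t) by ring. cbn [pow]. field. lra.
Qed.

(** Hasse's series agrees with the Dirichlet series, by expanding [e^{-t}/(1-e^{-t})] geometrically
    under the Mellin integral. It is the Dirichlet series that the subtracted pole produces at the
    integers when [h >= 1]. *)
Lemma zeta_series s : 1 < s -> is_series (fun n => Rpower (INR (S n)) (- s)) (riemann_zeta s).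
Proof.
  intros Hs. assert (Gp := Gamma_pos s ltac:(lra)).
  assert (HM := IG_mellin s 1 0 ltac:(lra) ltac:(lra) (or_introl (conj eq_refl Hs))).
  assert (Hn : forall K, IG (fun t => rsum (fun k => Rpower t (s - 1) * exp (- INR (S k) * t)) K)
     (rsum (fun k => Gamma s * Rpower (INR (S k)) (- s)) K)).
  { intros K. apply (IG_rsum (fun k t => Rpower t (s - 1) * exp (- INR (S k) * t))). intros k _.
    apply IG_gamma_scaled; [lra|]. apply lt_0_INR; lia. }
  assert (L := IG_dominated _ _ _ _ _ _ Hn HM HM).
  assert (E : forall K t, 0 < t -> rsum (fun k => Rpower t (s - 1) * exp (- INR (S k) * t)) K =
     Rpower t (s - 1) * (exp (- (1) * t) / (1 - exp (- t)) * (1 - exp (- t) ^ K))).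
  { intros K t Ht. now rewrite rsum_scal, geom_exp_sum. }
  assert (L' : is_lim_seq (fun K => rsum (fun k => Gamma s * Rpower (INR (S k)) (- s)) K) (Gamma s * hurwitz_zeta s 1)).
  { apply L.
    - intros K t Ht. rewrite E by exact Ht. destruct (one_minus_exp_neg t Ht) as [Hy _].
      assert (P := Rpower_pos t (s - 1)). assert (P2 := exp_pos (- (1) * t)).
      assert (Hq : 0 <= exp (- t) ^ K <= 1).
      { split; [apply pow_le; lra|]. rewrite <- (pow1 K). apply pow_incr. lra. }
      assert (Hd : 0 < exp (- (1) * t) / (1 - exp (- t))) by (apply Rdiv_lt_0_compat; lra).
      replace (0 / t) with 0 by (unfold Rdiv; ring). rewrite Rminus_0_r.
      rewrite Rabs_pos_eq by (apply Rmult_le_pos; [lra|apply Rmult_le_pos; lra]).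
      apply Rmult_le_compat_l; [lra|].
      assert (exp (- (1) * t) / (1 - exp (- t)) * (1 - exp (- t) ^ K) <= exp (- (1) * t) / (1 - exp (- t)) * 1)
        by (apply Rmult_le_compat_l; lra). lra.
    - intros t Ht. destruct (one_minus_exp_neg t Ht) as [Hy _].
      replace (0 / t) with 0 by (unfold Rdiv; ring). rewrite Rminus_0_r.
      rewrite Rabs_pos_eq; [lra|]. apply Rmult_le_pos; [left; apply Rpower_pos|].
      left. apply Rdiv_lt_0_compat; [apply exp_pos|lra].
    - intros u v Hu Huv. destruct (one_minus_exp_neg u Hu) as [Hyu _].
      exists (fun K => ((Rpower u (s - 1) + Rpower v (s - 1)) / (1 - exp (- u))) * exp (- u) ^ K).
      split; [apply is_lim_seq_geom_scal; assert (H := exp_pos (- u)); lra|].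
      intros K t Ht. rewrite E by lra. destruct (one_minus_exp_neg t ltac:(lra)) as [Hy _].
      replace (0 / t) with 0 by (unfold Rdiv; ring). rewrite Rminus_0_r.
      replace (Rpower t (s - 1) * (exp (- (1) * t) / (1 - exp (- t)) * (1 - exp (- t) ^ K)) -
        Rpower t (s - 1) * (exp (- (1) * t) / (1 - exp (- t)))) with
        (- (Rpower t (s - 1) * (exp (- (1) * t) / (1 - exp (- t)) * exp (- t) ^ K))) by ring.
      assert (Ptu : exp (- t) <= exp (- u)).
      { destruct (Req_dec t u) as [->|Hne]; [lra|]. left. apply exp_increasing. lra. }
      assert (P2 := exp_pos (- t)). assert (PR := Rpower_pos t (s - 1)).
      assert (Hd : 0 < exp (- (1) * t) / (1 - exp (- t)) <= / (1 - exp (- u))).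
      { split; [apply Rdiv_lt_0_compat; [apply exp_pos|lra]|].
        replace (- (1) * t) with (- t) by ring.
        apply Rle_trans with (1 * / (1 - exp (- t))).
        - unfold Rdiv. apply Rmult_le_compat_r; [left; apply Rinv_0_lt_compat; lra|lra].
        - rewrite Rmult_1_l. apply Rinv_le_contravar; lra. }
      assert (Hp : 0 <= exp (- t) ^ K <= exp (- u) ^ K) by (split; [apply pow_le; lra|apply pow_incr; lra]).
      rewrite Rabs_Ropp, Rabs_pos_eq by (apply Rmult_le_pos; [lra|apply Rmult_le_pos; lra]).
      unfold Rdiv at 2. rewrite Rmult_assoc.
      apply Rmult_le_compat; [lra|apply Rmult_le_pos; lra|apply Rpower_bound_on; lra|].
      apply Rmult_le_compat; lra. }
  unfold is_series.
  apply (is_lim_seq_ext (fun K => / Gamma s * rsum (fun k => Gamma s * Rpower (INR (S k)) (- s)) (S K)) _ (riemann_zeta s)).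
  - intros K. rewrite sum_n_rsum, rsum_scal, <- Rmult_assoc, Rinv_l, Rmult_1_l by lra. reflexivity.
  - unfold riemann_zeta. replace (hurwitz_zeta s 1) with (/ Gamma s * (Gamma s * hurwitz_zeta s 1)) by (field; lra).
    apply is_lim_seq_mult'; [apply is_lim_seq_const|].
    now apply (is_lim_seq_incr_1 (fun K => rsum (fun k => Gamma s * Rpower (INR (S k)) (- s)) K)).
Qed.

Lemma pow_exp_decay p N b : (1 <= N)%nat -> 0 < b ->
  exists c, 0 <= c /\ forall u, 0 <= u -> u ^ p * exp (- (b * u ^ N)) <= c / (1 + u ^ 2).
Proof.
  intros HN Hb. destruct (pow_exp_bound (p + 2)) as [c [Hc H]].
  (* Chosen so that [1 + u <= k (1 + b u)]. *)
  set (k := Rmax 1 (/ b)).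
  assert (Hk1 : 1 <= k) by apply Rmax_l. assert (Hk2 : / b <= k) by apply Rmax_r.
  exists (k ^ (p + 2) * (c * exp b)). split.
  { assert (E := exp_pos b). apply Rmult_le_pos; [apply pow_le; lra|nra]. }
  intros u Hu. specialize (H (b * u) ltac:(nra)).
  assert (E1 : exp (- (b * u ^ N)) <= exp b * exp (- (b * u))).
  { rewrite <- exp_plus. assert (Hv : u - 1 <= u ^ N).
    { destruct (Rle_dec u 1) as [H1|H1]; [assert (0 <= u ^ N) by (now apply pow_le); lra|].
      assert (H2 : u ^ 1 <= u ^ N) by (apply Rle_pow; [lra|lia]). rewrite pow_1 in H2. lra. }
    assert (b * (u - 1) <= b * u ^ N) by (apply Rmult_le_compat_l; lra).
    destruct (Req_dec (- (b * u ^ N)) (b + - (b * u))) as [->|Hne]; [lra|]. left. apply exp_increasing. lra. }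
  assert (E2 : u ^ p * (1 + u ^ 2) <= (1 + u) ^ (p + 2)).
  { rewrite pow_add. apply Rmult_le_compat; [now apply pow_le|nra|apply pow_incr; lra|nra]. }
  assert (E3 : (1 + u) ^ (p + 2) <= k ^ (p + 2) * (1 + b * u) ^ (p + 2)).
  { rewrite <- Rpow_mult_distr. apply pow_incr. split; [lra|].
    assert (1 <= k * b) by (apply Rmult_le_reg_r with (/ b); [now apply Rinv_0_lt_compat|]; rewrite Rmult_assoc, Rinv_r by lra; lra).
    nra. }
  apply Rmult_le_reg_r with (1 + u ^ 2); [nra|].
  replace (k ^ (p + 2) * (c * exp b) / (1 + u ^ 2) * (1 + u ^ 2)) with (k ^ (p + 2) * (c * exp b)) by (field; nra).
  assert (P := exp_pos (- (b * u ^ N))). assert (Pb := exp_pos b). assert (Pu := exp_pos (- (b * u))).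
  assert (Kp : 0 <= k ^ (p + 2)) by (apply pow_le; lra).
  assert (Up : 0 <= (1 + b * u) ^ (p + 2)) by (apply pow_le; nra).
  apply Rle_trans with ((k ^ (p + 2) * (1 + b * u) ^ (p + 2)) * (exp b * exp (- (b * u)))).
  - replace (u ^ p * exp (- (b * u ^ N)) * (1 + u ^ 2)) with ((u ^ p * (1 + u ^ 2)) * exp (- (b * u ^ N))) by ring.
    apply Rmult_le_compat; [apply Rmult_le_pos; [now apply pow_le|nra]|lra|lra|exact E1].
  - replace (k ^ (p + 2) * (1 + b * u) ^ (p + 2) * (exp b * exp (- (b * u)))) with
      (k ^ (p + 2) * (((1 + b * u) ^ (p + 2) * exp (- (b * u))) * exp b)) by ring.
    apply Rmult_le_compat_l; [exact Kp|]. apply Rmult_le_compat_r; lra.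
Qed.

Lemma ex_series_of_inv_sq f c : (forall n, Rabs (f n) <= c / INR (S n) ^ 2) -> ex_series f.
Proof.
  intros H. apply (ex_series_le (K := R_AbsRing) (V := R_CompleteNormedModule)) with (fun n => c * / INR (S n) ^ 2).
  - exact H.
  - apply (ex_series_scal c (fun n => / INR (S n) ^ 2)), ex_series_inv_sq.
Qed.

Section Lambert.
Variables (N : nat) (h : Z) (x : R).
Hypothesis HN : (0 < N)%nat.
Hypothesis Hx : 0 < x.
Hypothesis Hh : (2 * h < Z.of_nat N)%Z.

Definition expo : nat := Z.to_nat (Z.of_nat N - 2 * h).
Definition kappa : R := if (1 <=? h)%Z then 1 else 0.
(** The value of [lam] at 0+: for [h = 0] the factor [u^N] exactly compensates the pole [1/(u^N x)];
    for other [h] the limit is 0. *)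
Definition phi0 : R := if (h =? 0)%Z then / x else 0.

(* The pole at [t = 0] is removed only when [h >= 1]: for [h <= 0] the factor [u^(N-2h)] absorbs it. *)
Definition phi_reg (a t : R) : R := exp (- a * t) / (1 - exp (- t)) - kappa / t.
Definition lam (a u : R) : R := u ^ expo * phi_reg a (u ^ N * x).

Lemma expo_Z : Z.of_nat expo = (Z.of_nat N - 2 * h)%Z.
Proof. unfold expo. rewrite Z2Nat.id; lia. Qed.

Lemma expo_pos : (1 <= expo)%nat.
Proof. assert (H := expo_Z). lia. Qed.

Lemma uNx_pos u : 0 < u -> 0 < u ^ N * x.
Proof. intros Hu. apply Rmult_lt_0_compat; [now apply pow_lt|exact Hx]. Qed.

Lemma lhs_seq_eq a n : lhs_seq N h x a n = lam a (INR (S n)) + kappa * (INR (S n) ^ expo / (INR (S n) ^ N * x)).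
Proof.
  unfold lhs_seq, lhs_term, lam, phi_reg.
  rewrite <- expo_Z, <- pow_powerRZ.
  assert (Hs : 0 < INR (S n)) by (apply lt_0_INR; lia).
  assert (Ht := uNx_pos _ Hs). destruct (one_minus_exp_neg _ Ht) as [Hy _].
  replace (- INR (S n) ^ N * x) with (- (INR (S n) ^ N * x)) by ring.
  replace (- a * INR (S n) ^ N * x) with (- a * (INR (S n) ^ N * x)) by ring.
  set (s := INR (S n)) in *. clearbody s.
  assert (0 < s ^ N) by now apply pow_lt.
  field. repeat split; lra.
Qed.

Lemma ex_series_lhs a : 0 < a -> ex_series (lhs_seq N h x a).
Proof.
  intros Ha. destruct (pow_exp_decay expo N (a * x) ltac:(lia) ltac:(nra)) as [c [Hc H]].
  destruct (one_minus_exp_neg x Hx) as [Hyx _].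
  apply ex_series_of_inv_sq with (c * / (1 - exp (- x))). intros n.
  unfold lhs_seq, lhs_term. rewrite <- expo_Z, <- pow_powerRZ.
  assert (Hs : 1 <= INR (S n)) by (rewrite S_INR; assert (H0 := pos_INR n); lra).
  set (s := INR (S n)) in *.
  assert (HsN : 1 <= s ^ N) by (apply pow_R1_Rle; exact Hs).
  specialize (H s ltac:(lra)).
  replace (- a * s ^ N * x) with (- (a * x * s ^ N)) by ring.
  assert (Hy : 1 - exp (- x) <= 1 - exp (- s ^ N * x)).
  { assert (exp (- s ^ N * x) <= exp (- x)); [|lra].
    destruct (Req_dec (- s ^ N * x) (- x)) as [->|Hne]; [lra|]. left. apply exp_increasing.
    assert (1 * x <= s ^ N * x) by (apply Rmult_le_compat_r; lra). lra. }
  assert (P : 0 < s ^ expo * exp (- (a * x * s ^ N))) by (apply Rmult_lt_0_compat; [apply pow_lt; lra|apply exp_pos]).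
  unfold Rdiv at 1. rewrite Rabs_mult, Rabs_pos_eq, Rabs_pos_eq by (try (left; apply Rinv_0_lt_compat); lra).
  replace (c * / (1 - exp (- x)) / s ^ 2) with ((c / s ^ 2) * / (1 - exp (- x))) by (field; lra).
  apply Rmult_le_compat; [lra|left; apply Rinv_0_lt_compat; lra| |apply Rinv_le_contravar; lra].
  eapply Rle_trans; [exact H|]. unfold Rdiv. apply Rmult_le_compat_l; [exact Hc|]. apply Rinv_le_contravar; nra.
Qed.

Definition Phi (a : R) : R := Series (lhs_seq N h x a) - main_terms N h x a.

(** The three origins of [zeta(2h)/x]. For [h >= 1] the subtracted pole is [n^(-2h)/x] at the
    integer [n]; for [h = 0] half the boundary value [1/x] is [-zeta(0)/x]; for [h < 0] nothing is
    left, in agreement with the trivial zeros. *)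
Lemma zeta_even_regularised :
  is_lim_seq (fun M => / 2 * phi0 - rsum (fun k => kappa * (INR (S k) ^ expo / (INR (S k) ^ N * x))) M)
    (- (riemann_zeta (IZR (2 * h)) / x)).
Proof.
  unfold phi0, kappa. destruct (Z.leb_spec 1 h) as [H1|H1].
  - destruct (Z.eqb_spec h 0) as [H0|H0]; [lia|].
    assert (Hs : 1 < IZR (2 * h)) by (apply (IZR_lt 1); lia).
    assert (S1 := zeta_series _ Hs).
    assert (L : is_lim_seq (fun M => rsum (fun n => Rpower (INR (S n)) (- IZR (2 * h))) M) (riemann_zeta (IZR (2 * h)))).
    { apply is_lim_seq_incr_1. apply (is_lim_seq_ext _ _ (riemann_zeta (IZR (2 * h))) (fun n => sum_n_rsum (fun n => Rpower (INR (S n)) (- IZR (2 * h))) n)). exact S1. }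
    replace (Finite (- (riemann_zeta (IZR (2 * h)) / x))) with (Finite (/ 2 * 0 - / x * riemann_zeta (IZR (2 * h)))) by (f_equal; field; lra).
    apply is_lim_seq_ext with (fun M => / 2 * 0 - / x * rsum (fun n => Rpower (INR (S n)) (- IZR (2 * h))) M).
    + intros M. f_equal. f_equal. rewrite <- rsum_scal. apply rsum_ext. intros k _.
      assert (Hk : 0 < INR (S k)) by (apply lt_0_INR; lia).
      rewrite <- (Rpower_pow expo), <- (Rpower_pow N) by exact Hk.
      rewrite !INR_IZR_INZ with (n := expo), expo_Z, !INR_IZR_INZ with (n := N), minus_IZR.
      unfold Rminus. rewrite Rpower_plus. field. split; [lra|]. apply Rgt_not_eq, Rpower_pos.
    + apply is_lim_seq_minus'; [apply is_lim_seq_const|]. apply is_lim_seq_mult'; [apply is_lim_seq_const|exact L].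
  - assert (E : forall M, rsum (fun k => 0 * (INR (S k) ^ expo / (INR (S k) ^ N * x))) M = 0).
    { induction M as [|M IH]; cbn [rsum]; [reflexivity|]. rewrite IH. ring. }
    apply is_lim_seq_ext with (fun _ => / 2 * (if (h =? 0)%Z then / x else 0)); [intros M; rewrite E; ring|].
    eapply is_lim_seq_eq; [apply is_lim_seq_const|]. f_equal.
    destruct (Z.eqb_spec h 0) as [->|H0].
    + simpl (2 * 0)%Z. rewrite zeta_0. field. lra.
    + assert (E2 : IZR (2 * h) = - INR (2 * Z.to_nat (- h))).
      { rewrite INR_IZR_INZ, <- opp_IZR. f_equal. lia. }
      rewrite E2, zeta_neg_even by lia. field. lra.
Qed.

(** The substitution [t = u^N x] in the primitive of the Mellin integral at [s = (N-2h+1)/N]. Since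
    [N (s - 1) = 1 - 2h] is odd, [s] is never 1, and [s < 1] exactly when [h >= 1]; so [kappa]
    selects the right case of [IG_mellin]. *)
Lemma EM_lam a : 0 < a -> EM (fun u => RtoC (lam a u)) (RtoC phi0) (RtoC (Phi a)).
Proof.
  intros Ha.
  assert (HNr : 0 < INR N) by now apply lt_0_INR.
  set (s := IZR (Z.of_nat N - 2 * h + 1) / INR N).
  assert (Hs1 : INR N * s = INR expo + 1).
  { unfold s. rewrite plus_IZR, <- expo_Z, <- INR_IZR_INZ. field. lra. }
  assert (Hs2 : INR N * (s - 1) = 1 - IZR (2 * h)).
  { unfold s. rewrite plus_IZR, minus_IZR, <- INR_IZR_INZ. field. lra. }
  assert (Hs : 0 < s).
  { assert (H := pos_INR expo). apply Rmult_lt_reg_l with (INR N); [exact HNr|]. lra. }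
  assert (Hk : kappa = 0 /\ 1 < s \/ kappa = 1 /\ s < 1).
  { unfold kappa. destruct (Z.leb_spec 1 h) as [H1|H1]; [right|left]; split; try reflexivity;
      apply Rmult_lt_reg_l with (INR N); try exact HNr.
    - assert (2 <= IZR (2 * h)) by (apply (IZR_le 2); lia). lra.
    - assert (IZR (2 * h) <= 0) by (apply (IZR_le _ 0); lia). lra. }
  destruct (IG_mellin s a kappa Hs Ha Hk) as [V [V1 [V2 V3]]].
  set (F := fun u => / INR N * Rpower x (- s) * V (u ^ N * x)).
  assert (DF : forall u, 0 < u -> is_derive F u (lam a u)).
  { intros u Hu. assert (Ht := uNx_pos u Hu). unfold F.
    assert (DN : is_derive (fun u => u ^ N * x) u (x * (INR N * u ^ pred N))).
    { apply is_derive_ext with (fun u => x * u ^ N); [intros; apply Rmult_comm|]. apply is_derive_scal.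
      evar_last; [apply is_derive_pow, (is_derive_id (K := R_AbsRing))|]. unfold one; simpl. ring. }
    evar_last.
    - apply is_derive_scal. apply (is_derive_comp_R V (fun u => u ^ N * x)); [apply V1, Ht|exact DN].
    - unfold lam, phi_reg.
      set (ph := exp (- a * (u ^ N * x)) / (1 - exp (- (u ^ N * x))) - kappa / (u ^ N * x)).
      rewrite <- Rpower_mult_distr by (try apply pow_lt; assumption).
      rewrite <- (Rpower_pow N u), <- (Rpower_pow (pred N) u), <- (Rpower_pow expo u), Rpower_mult by exact Hu.
      rewrite Hs2.
      replace (INR expo) with (1 - IZR (2 * h) + INR (pred N)).
      2: { rewrite (INR_IZR_INZ expo), expo_Z, minus_IZR, <- INR_IZR_INZ. destruct N as [|n]; [lia|]. rewrite S_INR. simpl pred. ring. }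
      rewrite Rpower_plus.
      assert (Ex : Rpower x (- s) * (x * Rpower x (s - 1)) = 1).
      { replace x with (Rpower x 1) at 2 by (now apply Rpower_1). rewrite <- !Rpower_plus.
        replace (- s + (1 + (s - 1))) with 0 by ring. now apply Rpower_O. }
      transitivity ((Rpower x (- s) * (x * Rpower x (s - 1))) * (Rpower u (1 - IZR (2 * h)) * Rpower u (INR (pred N)) * ph)).
      + field. lra.
      + rewrite Ex. ring. }
  exists (fun u => RtoC (F u)). split; [|split].
  - intros u Hu. apply cderiv_RtoC, DF, Hu.
  - assert (K0 : filterlim F (at_right 0) (locally 0)).
    { unfold F. replace 0 with (/ INR N * Rpower x (- s) * 0) at 2 by ring.
      eapply filterlim_comp; [|apply (filterlim_scal_r (K := R_AbsRing) (V := R_NormedModule) (/ INR N * Rpower x (- s)))].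
      eapply filterlim_comp; [|exact V2].
      intros P [d Hd].
      assert (Hd1 : 0 < Rmin 1 (d / x)) by (apply Rmin_pos; [lra|apply Rdiv_lt_0_compat; [apply cond_pos|exact Hx]]).
      exists (mkposreal _ Hd1). intros u Hu Hu0.
      unfold ball in Hu; simpl in Hu; unfold AbsRing_ball, abs, minus, plus, opp in Hu; simpl in Hu.
      rewrite Ropp_0, Rplus_0_r, Rabs_pos_eq in Hu by lra.
      assert (M1 := Rmin_l 1 (d / x)). assert (M2 := Rmin_r 1 (d / x)).
      apply Hd; [|now apply uNx_pos].
      unfold ball; simpl; unfold AbsRing_ball, abs, minus, plus, opp; simpl.
      rewrite Ropp_0, Rplus_0_r, Rabs_pos_eq by (left; now apply uNx_pos).
      assert (HuN : u ^ N <= u).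
      { destruct N as [|n]; [lia|]. cbn [pow]. assert (u ^ n <= 1) by (rewrite <- (pow1 n); apply pow_incr; lra).
        assert (0 <= u ^ n) by (apply pow_le; lra). nra. }
      assert (u * x < d).
      { assert (Hux : u < d / x) by lra. apply (Rmult_lt_compat_r x) in Hux; [|exact Hx].
        replace (d / x * x) with (pos d) in Hux by (field; lra). exact Hux. }
      nra. }
    intros eps Heps. destruct (proj1 (filterlim_locally _ _) K0 (mkposreal _ Heps)) as [d Hd].
    exists d. split; [apply cond_pos|]. intros u Hu. rewrite Cmod_R.
    assert (Hb : ball 0 d u).
    { unfold ball; simpl; unfold AbsRing_ball, abs, minus, plus, opp; simpl. rewrite Ropp_0, Rplus_0_r, Rabs_pos_eq; lra. }
    specialize (Hd u Hb ltac:(lra)). unfold ball in Hd; simpl in Hd; unfold AbsRing_ball, abs, minus, plus, opp in Hd; simpl in Hd.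
    now rewrite Ropp_0, Rplus_0_r in Hd.
  - assert (LF : is_lim_seq (fun M => F (INR M)) (/ INR N * Rpower x (- s) * (Gamma s * hurwitz_zeta s a))).
    { apply filterlim_at_infty_seq. unfold F.
      eapply filterlim_comp; [|apply (filterlim_scal_r (K := R_AbsRing) (V := R_NormedModule) (/ INR N * Rpower x (- s)))].
      eapply filterlim_comp; [|exact V3].
      intros P [K HK]. exists (Rmax 1 (K / x)). intros u Hu. apply HK.
      assert (M1 := Rmax_l 1 (K / x)). assert (M2 := Rmax_r 1 (K / x)).
      assert (HuN : u <= u ^ N).
      { destruct N as [|n]; [lia|]. cbn [pow]. assert (1 <= u ^ n) by (apply pow_R1_Rle; lra). nra. }
      assert (Hux : K / x < u) by lra. apply (Rmult_lt_compat_r x) in Hux; [|exact Hx].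
      replace (K / x * x) with K in Hux by (field; lra). nra. }
    assert (LS : is_lim_seq (fun M => rsum (lhs_seq N h x a) M) (Series (lhs_seq N h x a))).
    { apply is_lim_seq_incr_1.
      apply (is_lim_seq_ext _ _ (Series (lhs_seq N h x a)) (fun n => sum_n_rsum (lhs_seq N h x a) n)).
      apply Series_correct, ex_series_lhs, Ha. }
    assert (L := is_lim_seq_minus' _ _ _ _ (is_lim_seq_plus' _ _ _ _ zeta_even_regularised LS) LF).
    eapply clim_ext; [|apply clim_RtoC; eapply is_lim_seq_eq; [exact L|]].
    + intros M. cbv beta. rewrite csum_RtoC, <- RtoC_mult, <- RtoC_plus, <- RtoC_minus. f_equal.
      rewrite (rsum_ext (lhs_seq N h x a) (fun k => lam a (INR (S k)) + kappa * (INR (S k) ^ expo / (INR (S k) ^ N * x))) M)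
        by (intros; apply lhs_seq_eq).
      rewrite rsum_plus. ring.
    + f_equal. unfold Phi, main_terms. cbv zeta. fold s. ring.
Qed.

(** [e^{-at} - e^{-(a+1)t}] contains the factor [1 - e^{-t}], which cancels the denominator, and the
    subtracted poles cancel. What remains is the function of [EM_pexp_limit], up to scaling. *)
Lemma lam_shift a u : 0 < u -> lam a u - lam (a + 1) u = u ^ expo * exp (- (a * x * u ^ N)).
Proof.
  intros Hu. assert (Ht := uNx_pos u Hu). destruct (one_minus_exp_neg _ Ht) as [Hy _].
  unfold lam, phi_reg. replace (- (a + 1) * (u ^ N * x)) with (- a * (u ^ N * x) + - (u ^ N * x)) by ring.
  rewrite exp_plus. replace (- (a * x * u ^ N)) with (- a * (u ^ N * x)) by ring.
  assert (0 < u ^ N) by now apply pow_lt. field. repeat split; lra.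
Qed.

Lemma exp_diff_le a b t : 0 < t -> / 2 <= a -> / 2 <= b ->
  Rabs (exp (- a * t) - exp (- b * t)) <= Rabs (a - b) * (t * exp (- (t / 2))).
Proof.
  assert (W : forall a b t, 0 < t -> / 2 <= a -> a <= b ->
    Rabs (exp (- a * t) - exp (- b * t)) <= (b - a) * (t * exp (- (t / 2)))).
  { clear. intros a b t Ht Ha Hab.
    assert (E : exp (- b * t) = exp (- a * t) * exp (- ((b - a) * t))) by (rewrite <- exp_plus; f_equal; ring).
    assert (H := exp_ineq1_le (- ((b - a) * t))).
    assert (Hq : exp (- ((b - a) * t)) <= 1).
    { destruct (Req_dec a b) as [->|Hne]; [right; rewrite Rminus_diag, Rmult_0_l, Ropp_0; apply exp_0|].
      rewrite <- exp_0. left. apply exp_increasing. nra. }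
    assert (Ha2 : exp (- a * t) <= exp (- (t / 2))).
    { destruct (Req_dec (- a * t) (- (t / 2))) as [->|Hne]; [lra|]. left. apply exp_increasing. nra. }
    assert (P := exp_pos (- a * t)).
    rewrite E, Rabs_pos_eq by nra.
    replace (exp (- a * t) - exp (- a * t) * exp (- ((b - a) * t))) with (exp (- a * t) * (1 - exp (- ((b - a) * t)))) by ring.
    apply Rle_trans with (exp (- (t / 2)) * ((b - a) * t)); [apply Rmult_le_compat; lra|lra]. }
  intros Ht Ha Hb. destruct (Rle_dec a b) as [H|H].
  - rewrite (Rabs_left1 (a - b)) by lra. replace (- (a - b)) with (b - a) by ring. now apply W.
  - rewrite (Rabs_pos_eq (a - b)) by lra. rewrite <- Rabs_Ropp, Ropp_minus_distr. apply W; lra.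
Qed.

(** In [lam a - lam b] the pole and the boundary value cancel, so [EM_bound] applies. The range
    [a >= 1/2] reaches beyond 1, as the odd case needs at [1 + a]. *)
Lemma Phi_lipschitz : exists c, forall a b, / 2 <= a -> / 2 <= b -> Rabs (Phi a - Phi b) <= c * Rabs (a - b).
Proof.
  destruct (pow_exp_decay expo N (x / 2) ltac:(lia) ltac:(lra)) as [c1 [Hc1 H1]].
  destruct (pow_exp_decay (expo + N) N (x / 2) ltac:(lia) ltac:(lra)) as [c2 [Hc2 H2]].
  exists (6 * (c1 + x * c2)). intros a b Ha Hb.
  assert (E := EM_plus _ _ _ _ _ _ (EM_lam a ltac:(lra)) (EM_scal (RtoC (-1)) _ _ _ (EM_lam b ltac:(lra)))).
  apply EM_bound with (eps := Rabs (a - b) * (c1 + x * c2)) in E.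
  - rewrite <- !RtoC_mult, <- !RtoC_plus, !Cmod_R in E.
    replace (phi0 + -1 * phi0) with 0 in E by ring. rewrite Rabs_R0 in E.
    replace (Phi a + -1 * Phi b) with (Phi a - Phi b) in E by ring. lra.
  - intros u Hu. cbv beta. rewrite <- RtoC_mult, <- RtoC_plus, Cmod_R.
    assert (Ht := uNx_pos u Hu). destruct (one_minus_exp_neg _ Ht) as [Hy [_ [_ [H4 _]]]].
    set (t := u ^ N * x) in *.
    replace (lam a u + -1 * lam b u) with (u ^ expo * ((exp (- a * t) - exp (- b * t)) / (1 - exp (- t)))).
    2: { unfold lam, phi_reg. fold t. field. split; lra. }
    assert (HD := exp_diff_le a b t Ht Ha Hb).
    rewrite Rabs_mult, (Rabs_pos_eq (u ^ expo)) by (apply pow_le; lra).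
    unfold Rdiv at 1. rewrite Rabs_mult, (Rabs_pos_eq (/ _)) by (left; apply Rinv_0_lt_compat; lra).
    assert (Hup : 0 < u ^ expo) by now apply pow_lt.
    assert (Pe := exp_pos (- (t / 2))). assert (Pab := Rabs_pos (a - b)).
    apply Rle_trans with (u ^ expo * (Rabs (a - b) * (exp (- (t / 2)) * (1 + t)))).
    + apply Rmult_le_compat_l; [lra|].
      apply Rle_trans with (Rabs (a - b) * (t * exp (- (t / 2))) * / (1 - exp (- t))).
      * apply Rmult_le_compat_r; [left; apply Rinv_0_lt_compat; lra|exact HD].
      * replace (Rabs (a - b) * (t * exp (- (t / 2))) * / (1 - exp (- t))) with
          (Rabs (a - b) * (exp (- (t / 2)) * (t / (1 - exp (- t))))) by (unfold Rdiv; ring).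
        apply Rmult_le_compat_l; [exact Pab|]. apply Rmult_le_compat_l; lra.
    + specialize (H1 u ltac:(lra)). specialize (H2 u ltac:(lra)).
      replace (x / 2 * u ^ N) with (t / 2) in H1, H2 by (unfold t; field).
      replace (u ^ expo * (Rabs (a - b) * (exp (- (t / 2)) * (1 + t)))) with
        (Rabs (a - b) * (u ^ expo * exp (- (t / 2)) + x * (u ^ (expo + N) * exp (- (t / 2))))) by (rewrite pow_add; unfold t; ring).
      replace (Rabs (a - b) * (c1 + x * c2) / (1 + u ^ 2)) with (Rabs (a - b) * (c1 / (1 + u ^ 2) + x * (c2 / (1 + u ^ 2)))) by (field; nra).
      apply Rmult_le_compat_l; [exact Pab|]. apply Rplus_le_compat; [exact H1|]. apply Rmult_le_compat_l; [lra|exact H2].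
Qed.

End Lambert.

(** * Partial fractions of the Fourier terms *)

Lemma nabn_const K a m : (1 <= K)%nat -> nabn K (fun _ => a) m = RtoC 0.
Proof.
  intros HK. destruct K as [|K]; [lia|]. clear HK. revert m. induction K as [|K IH]; intros m.
  - simpl. unfold nab. ring.
  - change (nabn (S (S K)) (fun _ => a) m) with (nab (nabn (S K) (fun _ => a)) m).
    unfold nab. rewrite !IH. ring.
Qed.

Lemma nabn_mult_id K g m : nabn (S K) (fun m => Cmult (RtoC (IZR m)) (g m)) m =
  Cplus (Cmult (RtoC (IZR m)) (nabn (S K) g m)) (Cmult (RtoC (INR (S K))) (nabn K g (m - 1)%Z)).
Proof.
  revert m; induction K as [|K IH]; intros m.
  - simpl. unfold nab. rewrite minus_IZR, RtoC_minus. ring.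
  - change (nabn (S (S K)) (fun m => Cmult (RtoC (IZR m)) (g m)) m) with
      (nab (nabn (S K) (fun m => Cmult (RtoC (IZR m)) (g m))) m).
    unfold nab at 1. rewrite !IH.
    change (nabn (S (S K)) g m) with (Cminus (nabn (S K) g m) (nabn (S K) g (m - 1)%Z)).
    assert (Ea : nabn (S K) g (m - 1)%Z = Cminus (nabn K g (m - 1)%Z) (nabn K g (m - 1 - 1)%Z)) by reflexivity.
    rewrite Ea, minus_IZR, RtoC_minus, (S_INR (S K)), RtoC_plus. ring.
Qed.

Lemma nabn_pow K i m : (i < K)%nat -> nabn K (fun m => Cpow (RtoC (IZR m)) i) m = RtoC 0.
Proof.
  revert K m; induction i as [|i IH]; intros K m HK.
  - apply (nabn_const K (RtoC 1)). lia.
  - destruct K as [|K]; [lia|].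
    rewrite (nabn_ext (S K) _ (fun m => Cmult (RtoC (IZR m)) (Cpow (RtoC (IZR m)) i))) by reflexivity.
    rewrite nabn_mult_id, !IH by lia. ring.
Qed.

Lemma nabn_csum K (f : nat -> Z -> C) n m :
  nabn K (fun m => csum (fun i => f i m) n) m = csum (fun i => nabn K (f i) m) n.
Proof.
  induction n as [|n IH]; cbn [csum].
  - destruct K as [|K]; [reflexivity|]. apply nabn_const. lia.
  - rewrite nabn_plus, IH. reflexivity.
Qed.

Fixpoint czprod (K : nat) (t : C) (m : Z) : C :=
  match K with O => cz t m | S K' => Cmult (czprod K' t m) (cz t (m - Z.of_nat K)%Z) end.

Lemma czprod_l K t m : czprod (S K) t m = Cmult (cz t m) (czprod K t (m - 1)%Z).
Proof.
  induction K as [|K IH].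
  - reflexivity.
  - change (czprod (S (S K)) t m) with (Cmult (czprod (S K) t m) (cz t (m - Z.of_nat (S (S K)))%Z)).
    rewrite IH. change (czprod (S K) t (m - 1)) with (Cmult (czprod K t (m - 1)) (cz t (m - 1 - Z.of_nat (S K))%Z)).
    replace (m - 1 - Z.of_nat (S K))%Z with (m - Z.of_nat (S (S K)))%Z by lia. ring.
Qed.

(** The denominators form an arithmetic progression, so two adjacent products of [K + 1] reciprocals
    share [K] factors, and the remaining two denominators are [K + 1] steps of [2 pi i] apart. *)
Lemma nabn_cz K t m : Re t <> 0 -> 
  nabn K (cz t) m = Cmult (Cmult (RtoC (INR (fact K))) (Cpow (0, - (2 * PI)) K)) (czprod K t m).
Proof.
  intros Ht. revert m; induction K as [|K IH]; intros m.
  - simpl. ring.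
  - change (nabn (S K) (cz t) m) with (nab (nabn K (cz t)) m). unfold nab. rewrite !IH.
    assert (E : Cminus (czprod K t m) (czprod K t (m - 1)%Z) =
      Cmult (Cmult (RtoC (INR (S K))) (0, - (2 * PI))) (czprod (S K) t m)).
    { assert (D : forall m, Cmult (cz t m) (Cplus t (0, 2 * PI * IZR m)) = RtoC 1).
      { intros j. unfold cz. field. now apply cz_den_neq_0. }
      assert (A1 : czprod K t m = Cmult (czprod (S K) t m) (Cplus t (0, 2 * PI * IZR (m - Z.of_nat (S K))))).
      { cbn [czprod]. rewrite <- Cmult_assoc, D. ring. }
      assert (A2 : czprod K t (m - 1)%Z = Cmult (czprod (S K) t m) (Cplus t (0, 2 * PI * IZR m))).
      { rewrite czprod_l. rewrite (Cmult_comm (cz t m)), <- Cmult_assoc, D. ring. }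
      rewrite A1 at 1. rewrite A2. rewrite minus_IZR, <- INR_IZR_INZ.
      replace (0, 2 * PI * (IZR m - INR (S K))) with (Cplus (0, 2 * PI * IZR m) (Cmult (RtoC (INR (S K))) (0, - (2 * PI))))
        by (apply C_ext; unfold Re, Im; cbn -[INR]; ring). ring. }
    replace (Cminus (Cmult (Cmult (RtoC (INR (fact K))) (Cpow (0, - (2 * PI)) K)) (czprod K t m))
      (Cmult (Cmult (RtoC (INR (fact K))) (Cpow (0, - (2 * PI)) K)) (czprod K t (m - 1)%Z))) with
      (Cmult (Cmult (RtoC (INR (fact K))) (Cpow (0, - (2 * PI)) K)) (Cminus (czprod K t m) (czprod K t (m - 1)%Z))) by ring.
    rewrite E, fact_simpl, mult_INR, RtoC_mult. cbn [Cpow]. ring.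
Qed.

Lemma Cmod_cz_le t m : 0 < t -> Cmod (cz (RtoC t) m) <= 2 / (t + 2 * PI * Rabs (IZR m)).
Proof.
  intros Ht. assert (Hne : Cplus (RtoC t) (0, 2 * PI * IZR m) <> RtoC 0) by (apply cz_den_neq_0; simpl; lra).
  unfold cz. rewrite Cmod_inv by exact Hne.
  assert (Hpi := PI_RGT_0). assert (Ha := Rabs_pos (IZR m)).
  assert (H1 := re_le_Cmod (Cplus (RtoC t) (0, 2 * PI * IZR m))).
  assert (H2 := im_le_Cmod (Cplus (RtoC t) (0, 2 * PI * IZR m))).
  replace (Re (Cplus (RtoC t) (0, 2 * PI * IZR m))) with t in H1 by (unfold Re; simpl; ring).
  replace (Im (Cplus (RtoC t) (0, 2 * PI * IZR m))) with (2 * PI * IZR m) in H2 by (unfold Im; simpl; ring).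
  rewrite Rabs_pos_eq in H1 by lra. rewrite Rabs_mult, (Rabs_pos_eq (2 * PI)) in H2 by lra.
  replace (2 / (t + 2 * PI * Rabs (IZR m))) with (/ ((t + 2 * PI * Rabs (IZR m)) / 2)).
  - apply Rinv_le_contravar; [nra|lra].
  - field. nra.
Qed.

Lemma Cmod_cz_shift_le t m i K : 0 < t -> (2 * Z.of_nat K < Z.abs m)%Z -> (i <= K)%nat ->
  Cmod (cz (RtoC t) (m - Z.of_nat i)) <= 2 / (1 + t) /\
  Cmod (cz (RtoC t) (m - Z.of_nat i)) <= / Rabs (IZR m).
Proof.
  intros Ht Hm Hi. assert (H := Cmod_cz_le t (m - Z.of_nat i) Ht).
  assert (Hpi := PI_ge_2).
  rewrite <- abs_IZR in *.
  assert (Hz : IZR (Z.abs m) <= 2 * IZR (Z.abs (m - Z.of_nat i))).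
  { rewrite <- mult_IZR. apply IZR_le. lia. }
  assert (Hz1 : 1 <= IZR (Z.abs m)) by (apply (IZR_le 1); lia).
  set (A := IZR (Z.abs m)) in *. set (B := IZR (Z.abs (m - Z.of_nat i))) in *.
  assert (HB : 2 * A <= 2 * PI * B) by nra.
  split; (eapply Rle_trans; [exact H|]).
  - unfold Rdiv. apply Rmult_le_compat_l; [lra|]. apply Rinv_le_contravar; lra.
  - replace (/ A) with (2 * / (2 * A)) by (field; lra). unfold Rdiv. apply Rmult_le_compat_l; [lra|].
    apply Rinv_le_contravar; lra.
Qed.

Lemma Cmod_czprod_le t m K J : 0 < t -> (2 * Z.of_nat K < Z.abs m)%Z -> (J <= K)%nat ->
  Cmod (czprod J (RtoC t) m) <= (2 / (1 + t)) ^ S J.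
Proof.
  intros Ht Hm. assert (H2 : 0 < 2 / (1 + t)) by (apply Rdiv_lt_0_compat; lra).
  induction J as [|J IH]; intros HJ.
  - destruct (Cmod_cz_shift_le t m 0 K Ht Hm ltac:(lia)) as [H _].
    simpl. replace (m - Z.of_nat 0)%Z with m in H by lia. lra.
  - destruct (Cmod_cz_shift_le t m (S J) K Ht Hm HJ) as [H _].
    change (czprod (S J) (RtoC t) m) with (Cmult (czprod J (RtoC t) m) (cz (RtoC t) (m - Z.of_nat (S J)))).
    rewrite Cmod_mult. replace ((2 / (1 + t)) ^ S (S J)) with ((2 / (1 + t)) ^ S J * (2 / (1 + t))) by (simpl; ring).
    apply Rmult_le_compat; [apply Cmod_ge_0|apply Cmod_ge_0|apply IH; lia|exact H].
Qed.

(** Of the [K + 3] factors, two give [1/m^2] for summability in [m] and the others give the power of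
    [1/(1+t)] for decay in [u]. The restriction on [m] keeps all shifted indices at distance at
    least [|m|/2] from 0. *)
Lemma nabn_cz_decay K : exists c, 0 <= c /\ forall t m, 0 < t -> (2 * Z.of_nat (S (S K)) < Z.abs m)%Z ->
  Cmod (nabn (S (S K)) (cz (RtoC t)) m) <= c * / (1 + t) ^ S K * / (IZR m) ^ 2.
Proof.
  exists (INR (fact (S (S K))) * (2 * PI) ^ S (S K) * 2 ^ S K).
  assert (Hpi := PI_RGT_0). split.
  { apply Rmult_le_pos; [apply Rmult_le_pos; [apply pos_INR|apply pow_le; lra]|apply pow_le; lra]. }
  intros t m Ht Hm. rewrite nabn_cz by (simpl; lra).
  rewrite !Cmod_mult, Cmod_R, Cmod_pow, Rabs_pos_eq by apply pos_INR.
  replace (Cmod (0, - (2 * PI))) with (2 * PI).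
  2: { replace (0, - (2 * PI)) with (Cmult (Copp Ci) (RtoC (2 * PI))) by (apply C_ext; unfold Re, Im; simpl; ring).
       rewrite Cmod_mult, Cmod_opp, Cmod_Ci, Cmod_R, Rabs_pos_eq by lra. ring. }
  rewrite !Rmult_assoc. apply Rmult_le_compat_l; [apply pos_INR|]. apply Rmult_le_compat_l; [apply pow_le; lra|].
  cbn [czprod]. rewrite !Cmod_mult.
  assert (H0 := Cmod_czprod_le t m (S (S K)) K Ht Hm ltac:(lia)).
  destruct (Cmod_cz_shift_le t m (S K) (S (S K)) Ht Hm ltac:(lia)) as [_ H1].
  destruct (Cmod_cz_shift_le t m (S (S K)) (S (S K)) Ht Hm ltac:(lia)) as [_ H2].
  assert (Hm0 : 0 < Rabs (IZR m)).
  { rewrite <- abs_IZR. apply (IZR_lt 0). lia. }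
  assert (E : (2 / (1 + t)) ^ S K = 2 ^ S K * / (1 + t) ^ S K).
  { unfold Rdiv. rewrite Rpow_mult_distr, pow_inv. reflexivity. }
  rewrite E in H0.
  replace (2 ^ S K * (/ (1 + t) ^ S K * / IZR m ^ 2)) with (2 ^ S K * / (1 + t) ^ S K * (/ Rabs (IZR m)) * / Rabs (IZR m)).
  - apply Rmult_le_compat; [apply Rmult_le_pos; apply Cmod_ge_0|apply Cmod_ge_0| |exact H2].
    apply Rmult_le_compat; [apply Cmod_ge_0|apply Cmod_ge_0|exact H0|exact H1].
  - rewrite <- (pow2_abs (IZR m)). field. split; [lra|]. apply pow_nonzero. lra.
Qed.

(** * Roots of the denominator and partial fractions *)

Lemma geom_factor (v r : C) n :
  Cmult (Cminus v r) (csum (fun i => Cmult (Cpow v (n - 1 - i)) (Cpow r i)) n) = Cminus (Cpow v n) (Cpow r n).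
Proof.
  destruct n as [|n]; [simpl; ring|].
  replace (S n - 1)%nat with n by lia.
  induction n as [|n IH]; [simpl; ring|].
  assert (E : csum (fun i => Cmult (Cpow v (S n - i)) (Cpow r i)) (S (S n)) =
    Cplus (Cmult v (csum (fun i => Cmult (Cpow v (n - i)) (Cpow r i)) (S n))) (Cpow r (S n))).
  { change (csum (fun i => Cmult (Cpow v (S n - i)) (Cpow r i)) (S (S n))) with
      (Cplus (csum (fun i => Cmult (Cpow v (S n - i)) (Cpow r i)) (S n)) (Cmult (Cpow v (S n - S n)) (Cpow r (S n)))).
    rewrite Nat.sub_diag. rewrite <- csum_scal.
    rewrite (csum_ext _ (fun k => Cmult v (Cmult (Cpow v (n - k)) (Cpow r k))) (S n)).
    - simpl Cpow at 3. ring.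
    - intros k Hk. replace (S n - k)%nat with (S (n - k)) by lia. rewrite Cpow_S. ring. }
  rewrite E, Cmult_plus_distr_l.
  replace (Cmult (Cminus v r) (Cmult v (csum (fun i => Cmult (Cpow v (n - i)) (Cpow r i)) (S n)))) with
    (Cmult v (Cmult (Cminus v r) (csum (fun i => Cmult (Cpow v (n - i)) (Cpow r i)) (S n)))) by ring.
  rewrite IH, !Cpow_S. ring.
Qed.

(** The angles are centred, so they lie in [(-pi/2, pi/2)] and [zk] in the right half-plane;
    [rk = - zk^2] runs through the [N]-th roots of [-(y^N)^2], the poles in the variable [u^2]. The
    number [k - (N-1)/2] is the [j] of the statement for odd [N] and its [j + 1/2] for even [N]. *)
Definition ang (N k : nat) : R := PI * (INR k - (INR N - 1) / 2) / INR N.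
Definition zk (N : nat) (y : R) (k : nat) : C := Cmult (RtoC y) (ei (ang N k)).
Definition rk (N : nat) (y : R) (k : nat) : C := Copp (Cmult (zk N y k) (zk N y k)).

Lemma ei_PI : ei PI = Copp (RtoC 1).
Proof. rewrite ei_eq, cos_PI, sin_PI. apply C_ext; unfold Re, Im; simpl; ring. Qed.

Lemma ang_bound N k : (k < N)%nat -> - (PI / 2) < ang N k < PI / 2.
Proof.
  intros Hk. assert (HN : 0 < INR N) by (apply lt_0_INR; lia). assert (Hpi := PI_RGT_0).
  assert (H1 : INR k + 1 <= INR N) by (rewrite <- S_INR; now apply le_INR). assert (H0 := pos_INR k).
  unfold ang. split; apply Rmult_lt_reg_r with (INR N); try exact HN; unfold Rdiv;
    rewrite (Rmult_assoc _ (/ INR N)), Rinv_l by lra; nra.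
Qed.

Lemma cos_ang_pos N k : (k < N)%nat -> 0 < cos (ang N k).
Proof. intros Hk. destruct (ang_bound N k Hk). now apply cos_gt_0. Qed.

Lemma Re_zk N y k : Re (zk N y k) = y * cos (ang N k).
Proof. unfold zk. rewrite re_scal_l. f_equal. rewrite ei_eq. unfold Re; simpl. ring. Qed.

Lemma Re_zk_pos N y k : (k < N)%nat -> 0 < y -> 0 < Re (zk N y k).
Proof. intros Hk Hy. rewrite Re_zk. apply Rmult_lt_0_compat; [exact Hy|now apply cos_ang_pos]. Qed.

Lemma rk_polar N y k : (0 < N)%nat ->
  rk N y k = Cmult (Cmult (RtoC (y ^ 2)) (ei (PI + 2 * ang N 0))) (Cpow (ei (2 * PI / INR N)) k).
Proof.
  intros HN. assert (HNr : 0 < INR N) by now apply lt_0_INR.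
  rewrite <- ei_INR. rewrite <- Cmult_assoc, <- ei_plus.
  replace (PI + 2 * ang N 0 + INR k * (2 * PI / INR N)) with (PI + (ang N k + ang N k))
    by (unfold ang; simpl (INR 0); field; lra).
  rewrite !ei_plus, ei_PI. unfold rk, zk. replace (y ^ 2) with (y * y) by ring. rewrite RtoC_mult. ring.
Qed.

Lemma rk_pow_N N y k : (0 < N)%nat -> Cpow (rk N y k) N = Copp (RtoC ((y ^ N) ^ 2)).
Proof.
  intros HN. assert (HNr : 0 < INR N) by now apply lt_0_INR.
  rewrite rk_polar by exact HN. rewrite !Cpow_mult_l, <- Cpow_mult_r, (Nat.mul_comm k N), Cpow_mult_r.
  rewrite <- (ei_INR N (2 * PI / INR N)), <- (ei_INR N (PI + 2 * ang N 0)).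
  replace (INR N * (2 * PI / INR N)) with (2 * PI * IZR 1) by (field; lra).
  rewrite ei_2PI_Z, Cpow_1_l, <- RtoC_pow.
  replace (INR N * (PI + 2 * ang N 0)) with PI by (unfold ang; simpl (INR 0); field; lra).
  rewrite ei_PI. replace ((y ^ 2) ^ N) with ((y ^ N) ^ 2) by (rewrite <- !pow_mult; f_equal; lia). ring.
Qed.

Lemma csum_geom q n : Cmult (Cminus q (RtoC 1)) (csum (fun k => Cpow q k) n) = Cminus (Cpow q n) (RtoC 1).
Proof.
  induction n as [|n IH]; [simpl; ring|]. cbn [csum]. rewrite Cmult_plus_distr_l, IH, Cpow_S. ring.
Qed.

Lemma rk_powsum_0 N y i : (0 < i < N)%nat -> csum (fun k => Cpow (rk N y k) i) N = RtoC 0.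
Proof.
  intros Hi. assert (HNr : 0 < INR N) by (apply lt_0_INR; lia).
  set (q := ei (INR i * (2 * PI / INR N))).
  rewrite (csum_ext _ (fun k => Cmult (Cpow (Cmult (RtoC (y ^ 2)) (ei (PI + 2 * ang N 0))) i) (Cpow q k))).
  - rewrite csum_scal.
    assert (Hq : Cpow q N = RtoC 1).
    { unfold q. rewrite <- ei_INR. replace (INR N * (INR i * (2 * PI / INR N))) with (2 * PI * IZR (Z.of_nat i)).
      - apply ei_2PI_Z.
      - rewrite <- INR_IZR_INZ. field. lra. }
    assert (Hq1 : Cminus q (RtoC 1) <> RtoC 0).
    { intros H. apply (wz_1_neq_1 (INR i / INR N)).
      - assert (Hi1 : 0 < INR i) by (apply lt_0_INR; lia). assert (Hi2 : INR i < INR N) by (apply lt_INR; lia).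
        split; [now apply Rdiv_lt_0_compat|]. apply Rmult_lt_reg_r with (INR N); [exact HNr|].
        unfold Rdiv. rewrite Rmult_assoc, Rinv_l by lra. lra.
      - apply Ceq_minus in H. rewrite <- H. unfold wz, q. f_equal. field. lra. }
    assert (G := csum_geom q N). rewrite Hq in G.
    replace (Cminus (RtoC 1) (RtoC 1)) with (RtoC 0) in G by ring.
    assert (E0 : csum (fun k => Cpow q k) N = RtoC 0).
    { destruct (Ceq_dec (csum (fun k => Cpow q k) N) (RtoC 0)) as [E|E]; [exact E|].
      elim (Cmult_neq_0 _ _ Hq1 E G). }
    eapply eq_trans; [apply f_equal; exact E0|ring].
  - intros k _. rewrite rk_polar, Cpow_mult_l by lia. f_equal.
    unfold q. rewrite ei_INR, <- !Cpow_mult_r. f_equal. lia.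
Qed.

(** With [c = y^N], the residue at a root [r] of [v^N + c^2] is
    [r^q/(N r^(N-1)) = -r^(q+1)/(N c^2)]. The proof multiplies by the denominator and expands each
    quotient by [geom_factor]; the power sums of the roots vanish except at [i = N - 1 - q]. *)
Lemma partial_fractions N y q v : (q < N)%nat -> 0 < y ->
  (forall k, (k < N)%nat -> Cminus v (rk N y k) <> RtoC 0) ->
  Cplus (Cpow v N) (RtoC ((y ^ N) ^ 2)) <> RtoC 0 ->
  Cdiv (Cpow v q) (Cplus (Cpow v N) (RtoC ((y ^ N) ^ 2))) =
  Cmult (Copp (Cinv (RtoC (INR N * (y ^ N) ^ 2))))
    (csum (fun k => Cmult (Cpow (rk N y k) (S q)) (Cinv (Cminus v (rk N y k)))) N).
Proof.
  intros Hq Hy Hv HD. set (W := Cplus (Cpow v N) (RtoC ((y ^ N) ^ 2))) in *.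
  assert (HNr : 0 < INR N) by (apply lt_0_INR; lia).
  assert (Hc : 0 < (y ^ N) ^ 2) by (apply pow_lt, pow_lt; exact Hy).
  assert (E1 : forall k, (k < N)%nat -> Cmult W (Cinv (Cminus v (rk N y k))) =
     csum (fun i => Cmult (Cpow v (N - 1 - i)) (Cpow (rk N y k) i)) N).
  { intros k Hk. assert (G := geom_factor v (rk N y k) N). rewrite rk_pow_N in G by lia.
    replace (Cminus (Cpow v N) (Copp (RtoC ((y ^ N) ^ 2)))) with W in G by (unfold W; ring).
    rewrite <- G. field. now apply Hv. }
  assert (E2 : Cmult W (csum (fun k => Cmult (Cpow (rk N y k) (S q)) (Cinv (Cminus v (rk N y k)))) N) =
     Cmult (Copp (RtoC (INR N * (y ^ N) ^ 2))) (Cpow v q)).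
  { rewrite <- csum_scal.
    rewrite (csum_ext _ (fun k => csum (fun i => Cmult (Cpow v (N - 1 - i)) (Cpow (rk N y k) (S q + i))) N)).
    - rewrite csum_swap.
      rewrite (csum_single _ N (N - 1 - q)%nat); [|lia|].
      + replace (N - 1 - (N - 1 - q))%nat with q by lia. replace (S q + (N - 1 - q))%nat with N by lia.
        rewrite (csum_ext _ (fun _ => Cmult (Cpow v q) (Copp (RtoC ((y ^ N) ^ 2))))).
        * rewrite csum_const, RtoC_mult. ring.
        * intros k Hk. now rewrite rk_pow_N by lia.
      + intros i Hi Hne. rewrite csum_scal.
        assert (E0 : csum (fun k => Cpow (rk N y k) (S q + i)) N = RtoC 0).
        (* The exponent [q + 1 + i] may exceed [N]; as [r^N] is the same for all roots, it can be
           lowered by [N], and then lies strictly between 0 and [N]. *)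
        { destruct (Nat.lt_ge_cases (S q + i) N) as [Hlt|Hge]; [apply rk_powsum_0; lia|].
          rewrite (csum_ext _ (fun k => Cmult (Copp (RtoC ((y ^ N) ^ 2))) (Cpow (rk N y k) (S q + i - N)))).
          - rewrite csum_scal, rk_powsum_0 by lia. ring.
          - intros k _. replace (S q + i)%nat with (N + (S q + i - N))%nat at 1 by lia.
            now rewrite Cpow_add_r, rk_pow_N by lia. }
        rewrite E0. ring.
    - intros k Hk.
      replace (Cmult W (Cmult (Cpow (rk N y k) (S q)) (Cinv (Cminus v (rk N y k))))) with
        (Cmult (Cpow (rk N y k) (S q)) (Cmult W (Cinv (Cminus v (rk N y k))))) by ring.
      rewrite E1 by exact Hk. rewrite <- csum_scal. apply csum_ext. intros i _. rewrite Cpow_add_r. ring. }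
  assert (Hnz : RtoC (INR N * (y ^ N) ^ 2) <> RtoC 0).
  { intros H. apply RtoC_inj in H. assert (0 < INR N * (y ^ N) ^ 2) by now apply Rmult_lt_0_compat. lra. }
  set (Sg := csum _ N) in *.
  replace Sg with (Cmult (Cinv W) (Cmult W Sg)) by (field; exact HD).
  rewrite E2. field. split; assumption.
Qed.

Definition em_val (e : nat) (z : C) : C := if Nat.even e then Bz z else Lz z.

Definition em_pf (N : nat) (y : R) (e : nat) : C :=
  Cmult (Copp (Cinv (RtoC (INR N * (y ^ N) ^ 2))))
    (csum (fun k => Cmult (Cpow (rk N y k) (S (e / 2))) (em_val e (zk N y k))) N).

(** Partial fractions in [v = u^2]: [u^e] is [v^q] for even [e] and [u v^q] for odd [e], and this
    parity decides between the two kernels. The boundary value relies on [0^0 = 1] when [e = 0]. *)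
Lemma EM_pf N y e : (0 < N)%nat -> (e < 2 * N)%nat -> 0 < y ->
  EM (fun u => RtoC (u ^ e / (u ^ (2 * N) + (y ^ N) ^ 2))) (RtoC (0 ^ e / (y ^ N) ^ 2)) (em_pf N y e).
Proof.
  intros HN He Hy. set (q := (e / 2)%nat).
  assert (Hc : 0 < (y ^ N) ^ 2) by (apply pow_lt, pow_lt; exact Hy).
  assert (Hvr : forall u k, (k < N)%nat -> Cminus (RtoC (u ^ 2)) (rk N y k) <> RtoC 0).
  { intros u k Hk. unfold rk.
    replace (Cminus (RtoC (u ^ 2)) (Copp (Cmult (zk N y k) (zk N y k)))) with
      (Cplus (RtoC (u ^ 2)) (Cmult (zk N y k) (zk N y k))) by ring.
    apply sq_plus_sq_neq_0. now apply Re_zk_pos. }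
  assert (Hden : forall u, 0 < u ^ (2 * N) + (y ^ N) ^ 2).
  { intros u. assert (0 <= u ^ (2 * N)); [|lra]. rewrite pow_mult. apply pow_le, pow2_ge_0. }
  assert (EW : forall u, Cplus (Cpow (RtoC (u ^ 2)) N) (RtoC ((y ^ N) ^ 2)) = RtoC (u ^ (2 * N) + (y ^ N) ^ 2)).
  { intros u. rewrite <- RtoC_pow, <- RtoC_plus, <- pow_mult. reflexivity. }
  assert (HW : forall u, Cplus (Cpow (RtoC (u ^ 2)) N) (RtoC ((y ^ N) ^ 2)) <> RtoC 0).
  { intros u H. rewrite EW in H. apply RtoC_inj in H. specialize (Hden u). lra. }
  assert (Hq : (q < N)%nat) by (apply Nat.Div0.div_lt_upper_bound; lia).
  assert (PF : forall u, RtoC ((u ^ 2) ^ q / (u ^ (2 * N) + (y ^ N) ^ 2)) =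
    Cmult (Copp (Cinv (RtoC (INR N * (y ^ N) ^ 2))))
    (csum (fun k => Cmult (Cpow (rk N y k) (S q)) (Cinv (Cminus (RtoC (u ^ 2)) (rk N y k)))) N)).
  { intros u. rewrite <- partial_fractions by (auto; intros; now apply Hvr).
    rewrite EW, <- RtoC_pow. apply RtoC_div. specialize (Hden u). lra. }
  unfold em_pf. fold q.
  destruct (Nat.Even_or_Odd e) as [[j Hj]|[j Hj]].
  - assert (Eq : q = j) by (unfold q; rewrite Hj, Nat.mul_comm; apply Nat.div_mul; lia).
    assert (Ev : Nat.even e = true) by (apply Nat.even_spec; now exists j).
    eapply EM_ext; [|eapply EM_eq; [apply EM_scal, (EM_csum (fun k u => Cmult (Cpow (rk N y k) (S q)) (Cinv (Cplus (RtoC (u ^ 2)) (Cmult (zk N y k) (zk N y k))))))| |reflexivity]].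
    + intros u _. cbv beta. replace (u ^ e) with ((u ^ 2) ^ q) by (rewrite <- pow_mult; f_equal; lia).
      rewrite PF. f_equal. apply csum_ext. intros k _. do 2 f_equal. unfold rk. ring.
    + intros k Hk. apply EM_scal. unfold em_val. rewrite Ev. apply EM_lorentz. now apply Re_zk_pos.
    + cbv beta. replace (0 ^ e / (y ^ N) ^ 2) with ((0 ^ 2) ^ q / (0 ^ (2 * N) + (y ^ N) ^ 2)).
      * rewrite PF. f_equal. apply csum_ext. intros k _. do 2 f_equal. unfold rk.
        replace (0 ^ 2) with 0 by ring. ring.
      * rewrite <- pow_mult, (pow_i (2 * N)), Rplus_0_l by lia. do 2 f_equal. lia.
  - assert (Eq : q = j).
    { unfold q. rewrite Hj, Nat.mul_comm, Nat.div_add_l by lia. simpl. lia. }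
    assert (Ev : Nat.even e = false) by (rewrite <- Nat.negb_odd; apply Bool.negb_false_iff, Nat.odd_spec; now exists j).
    eapply EM_ext; [|eapply EM_eq; [apply EM_scal, (EM_csum (fun k u => Cmult (Cpow (rk N y k) (S q)) (Cdiv (RtoC u) (Cplus (RtoC (u ^ 2)) (Cmult (zk N y k) (zk N y k))))) (fun k => Cmult (Cpow (rk N y k) (S q)) (RtoC 0)))| |reflexivity]].
    + intros u _. cbv beta. replace (u ^ e / (u ^ (2 * N) + (y ^ N) ^ 2)) with (u * ((u ^ 2) ^ q / (u ^ (2 * N) + (y ^ N) ^ 2))).
      2: { rewrite <- pow_mult. replace e with (S (2 * q)) by lia. cbn [pow]. unfold Rdiv. ring. }
      rewrite (RtoC_mult u), PF.
      rewrite (csum_ext _ (fun k => Cmult (RtoC u) (Cmult (Cpow (rk N y k) (S q)) (Cinv (Cminus (RtoC (u ^ 2)) (rk N y k))))) N).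
      * rewrite csum_scal. ring.
      * intros k _. unfold rk, Cdiv.
        replace (Cminus (RtoC (u ^ 2)) (Copp (Cmult (zk N y k) (zk N y k)))) with
          (Cplus (RtoC (u ^ 2)) (Cmult (zk N y k) (zk N y k))) by ring. ring.
    + intros k Hk. apply EM_scal. unfold em_val. rewrite Ev. apply EM_odd. now apply Re_zk_pos.
    + rewrite pow_i by lia. rewrite (csum_ext _ (fun _ => RtoC 0)) by (intros; ring). rewrite csum_const.
      replace (0 / (y ^ N) ^ 2) with 0 by (unfold Rdiv; ring). ring.
Qed.

(** * Fourier expansion of the Lambert series *)

Lemma nabn_ext_local K f g m : (forall j, (m - Z.of_nat K <= j <= m)%Z -> f j = g j) -> nabn K f m = nabn K g m.
Proof.
  revert m; induction K as [|K IH]; intros m H; simpl; [apply H; simpl; lia|].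
  unfold nab. rewrite IH by (intros; apply H; lia). rewrite (IH (m - 1)%Z) by (intros; apply H; lia). reflexivity.
Qed.

Lemma zsum_tail_bound (f : Z -> C) B M d : 0 <= B -> (1 <= M)%nat ->
  (forall m, (Z.of_nat M < Z.abs m)%Z -> Cmod (f m) <= B * / (IZR m) ^ 2) ->
  Cmod (Cminus (zsum f (M + d)) (zsum f M)) <= 2 * B / INR M.
Proof.
  intros HB HM H.
  assert (E : Cmod (Cminus (zsum f (M + d)) (zsum f M)) <= 2 * B * (/ INR M - / INR (M + d))).
  { induction d as [|d IH].
    - rewrite Nat.add_0_r. replace (Cminus (zsum f M) (zsum f M)) with (RtoC 0) by ring. rewrite Cmod_0. right; ring.
    - rewrite Nat.add_succ_r. cbn [zsum].
      replace (Cminus (Cplus (zsum f (M + d)) (Cplus (f (Z.of_nat (S (M + d)))) (f (- Z.of_nat (S (M + d)))%Z))) (zsum f M)) with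
        (Cplus (Cminus (zsum f (M + d)) (zsum f M)) (Cplus (f (Z.of_nat (S (M + d)))) (f (- Z.of_nat (S (M + d)))%Z))) by ring.
      eapply Rle_trans; [apply Cmod_triangle|].
      assert (H1 := H (Z.of_nat (S (M + d))) ltac:(lia)). assert (H2 := H (- Z.of_nat (S (M + d)))%Z ltac:(lia)).
      rewrite opp_IZR, <- INR_IZR_INZ in H2. rewrite <- INR_IZR_INZ in H1.
      assert (H3 := Cmod_triangle (f (Z.of_nat (S (M + d)))) (f (- Z.of_nat (S (M + d)))%Z)).
      assert (Hs : 1 <= INR (M + d)) by (apply (le_INR 1); lia).
      rewrite S_INR in *. set (s := INR (M + d)) in *.
      replace ((- (s + 1)) ^ 2) with ((s + 1) ^ 2) in H2 by ring.
      assert (H4 : / (s + 1) ^ 2 <= / s - / (s + 1)).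
      { replace (/ s - / (s + 1)) with (/ (s * (s + 1))) by (field; lra). apply Rinv_le_contravar; nra. }
      assert (H5 : B * / (s + 1) ^ 2 <= B * (/ s - / (s + 1))) by (apply Rmult_le_compat_l; lra).
      lra. }
  eapply Rle_trans; [exact E|]. unfold Rdiv. apply Rmult_le_compat_l; [lra|].
  assert (0 < / INR (M + d)) by (apply Rinv_0_lt_compat, lt_0_INR; lia). lra.
Qed.

Section Expansion.
Variables (N : nat) (h : Z) (x : R).
Hypothesis HN : (0 < N)%nat.
Hypothesis Hx : 0 < x.
Hypothesis Hh : (2 * h < Z.of_nat N)%Z.

Let p := expo N h.
(** The exponent is divided by [N] because [u^p/(u^N + i c)] is divided out in the variable [u^N];
    [quo] bounds the number of differences in [m] needed to remove the polynomial quotient. *)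
Definition quo : nat := (expo N h / N)%nat.
Definition rem : nat := (expo N h mod N)%nat.

Lemma expo_quo_rem : expo N h = (N * quo + rem)%nat.
Proof. unfold quo, rem. apply Nat.div_mod. lia. Qed.

Lemma rem_lt : (rem < N)%nat.
Proof. apply Nat.mod_upper_bound. lia. Qed.

Definition cm (m : Z) : R := 2 * PI * IZR m / x.
Definition ym (m : Z) : R := Rpower (Rabs (cm m)) (/ INR N).

Lemma cm_neq_0 m : m <> 0%Z -> cm m <> 0.
Proof.
  intros Hm. unfold cm. assert (Hpi := PI_RGT_0). assert (IZR m <> 0) by now apply not_0_IZR.
  unfold Rdiv. apply Rmult_integral_contrapositive_currified; [|apply Rinv_neq_0_compat; lra].
  apply Rmult_integral_contrapositive_currified; [lra|exact H].
Qed.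

Lemma ym_pow m : m <> 0%Z -> ym m ^ N = Rabs (cm m).
Proof.
  intros Hm. unfold ym. assert (HNr : 0 < INR N) by now apply lt_0_INR.
  assert (Hc := Rabs_pos_lt _ (cm_neq_0 m Hm)).
  rewrite <- Rpower_pow by apply Rpower_pos. rewrite Rpower_mult, Rinv_l, Rpower_1 by lra. reflexivity.
Qed.

Lemma ym_pow2 m : m <> 0%Z -> (ym m ^ N) ^ 2 = cm m ^ 2.
Proof. intros Hm. rewrite ym_pow by exact Hm. apply pow2_abs. Qed.

(* [(-i c)^quo u^rem / (x (u^N + i c))] with [c = cm m], written over the real denominator
   [u^(2N) + c^2]: the remainder of the Fourier term [u^p / (x u^N + 2 pi i m)] after division by [u^N + i c]. *)
Definition Rm (m : Z) (u : R) : C :=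
  if Z.eq_dec m 0 then RtoC 0 else
  Cmult (RtoC (/ x)) (Cplus
    (Cmult (Cpow (0, - cm m) quo) (RtoC (u ^ (N + rem) / (u ^ (2 * N) + (ym m ^ N) ^ 2))))
    (Cmult (Cpow (0, - cm m) (S quo)) (RtoC (u ^ rem / (u ^ (2 * N) + (ym m ^ N) ^ 2))))).

Definition rho (m : Z) : C :=
  if Z.eq_dec m 0 then RtoC 0 else
  Cmult (RtoC (/ x)) (Cplus
    (Cmult (Cpow (0, - cm m) quo) (RtoC (0 ^ (N + rem) / (ym m ^ N) ^ 2)))
    (Cmult (Cpow (0, - cm m) (S quo)) (RtoC (0 ^ rem / (ym m ^ N) ^ 2)))).

Definition dm (m : Z) : C :=
  if Z.eq_dec m 0 then RtoC 0 else
  Cmult (RtoC (/ x)) (Cplus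
    (Cmult (Cpow (0, - cm m) quo) (em_pf N (ym m) (N + rem)))
    (Cmult (Cpow (0, - cm m) (S quo)) (em_pf N (ym m) rem))).

Lemma EM_Rm m : EM (Rm m) (rho m) (dm m).
Proof.
  unfold Rm, rho, dm. destruct (Z.eq_dec m 0) as [E|E]; [apply EM_zero|].
  assert (Hy : 0 < ym m) by apply Rpower_pos. assert (Hr := rem_lt).
  apply EM_scal.
  apply (EM_plus (fun u => Cmult (Cpow (0, - cm m) quo) (RtoC (u ^ (N + rem) / (u ^ (2 * N) + (ym m ^ N) ^ 2))))).
  - apply EM_scal, EM_pf; [exact HN|lia|exact Hy].
  - apply EM_scal, EM_pf; [exact HN|lia|exact Hy].
Qed.

(** The [m = 0] term of the kernel expansion is [1/t], present only when the pole has not been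
    subtracted. It needs no remainder [Rm]: multiplied by [u^p] it is then a monomial, accounted for
    by [poly_part]. *)
Definition cz' (t : R) (m : Z) : C :=
  if Z.eq_dec m 0 then RtoC ((1 - kappa h) / t) else cz (RtoC t) m.

Definition poly_part (u : R) (m : Z) : C :=
  csum (fun i => Cmult (Cmult (RtoC (/ x * u ^ rem)) (Cmult (Cpow (RtoC (u ^ N)) (quo - 1 - i)) (Cpow (0, - (2 * PI / x)) i)))
     (Cpow (RtoC (IZR m)) i)) quo.

Lemma cm_pow m i : Cpow (0, - cm m) i = Cmult (Cpow (0, - (2 * PI / x)) i) (Cpow (RtoC (IZR m)) i).
Proof.
  rewrite <- Cpow_mult_l. f_equal. unfold cm. apply C_ext; unfold Re, Im; simpl; field; lra.
Qed.

Lemma quo_pos_iff : (quo = 0)%nat <-> (1 <= h)%Z.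
Proof.
  assert (E := expo_Z N h HN Hh). assert (E2 := expo_quo_rem). assert (Hr := rem_lt).
  split; intros H.
  - rewrite H in E2. lia.
  - destruct quo as [|q]; [reflexivity|]. assert (N <= expo N h)%nat by (rewrite E2; lia). lia.
Qed.

(** With [U = u^N], [U^quo - (-ic)^quo] is divisible by [U + ic], and the quotient is a polynomial
    in [m] of degree below [quo]. It does not decay in [u], but differences in [m] annihilate it. *)
Lemma pole_split u m : 0 < u ->
  Cmult (RtoC (u ^ p)) (cz' (u ^ N * x) m) = Cplus (Rm m u) (poly_part u m).
Proof.
  intros Hu. set (U := u ^ N). assert (HU : 0 < U) by now apply pow_lt.
  assert (EP : RtoC (u ^ p) = Cmult (Cpow (RtoC U) quo) (RtoC (u ^ rem))).
  { unfold p. rewrite expo_quo_rem, pow_add, pow_mult, RtoC_mult, RtoC_pow. reflexivity. }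
  assert (HUc : RtoC U <> RtoC 0) by (intros H; apply RtoC_inj in H; lra).
  assert (Hxc : RtoC x <> RtoC 0) by (intros H; apply RtoC_inj in H; lra).
  assert (PPE : poly_part u m = Cmult (RtoC (/ x * u ^ rem))
     (csum (fun i => Cmult (Cpow (RtoC U) (quo - 1 - i)) (Cpow (0, - cm m) i)) quo)).
  { unfold poly_part. rewrite <- csum_scal. apply csum_ext. intros i _. rewrite cm_pow. fold U. ring. }
  assert (G := geom_factor (RtoC U) (0, - cm m) quo).
  unfold cz', Rm. destruct (Z.eq_dec m 0) as [E|E].
  - rewrite PPE. destruct (Nat.eq_dec quo 0) as [Eq|Eq].
    + unfold kappa. assert (Hh1 := proj1 quo_pos_iff Eq). apply Z.leb_le in Hh1. rewrite Hh1, Eq. simpl csum.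
      replace ((1 - 1) / (U * x)) with 0 by (unfold Rdiv; ring). ring.
    + assert (Hh1 : (1 <=? h)%Z = false).
      { apply Z.leb_gt. destruct (Z_lt_le_dec h 1) as [H|H]; [exact H|]. elim Eq. now apply quo_pos_iff. }
      unfold kappa. rewrite Hh1. assert (Ec : cm m = 0) by (unfold cm; rewrite E; unfold Rdiv; ring).
      rewrite Ec, Ropp_0 in *. change (0, 0) with (RtoC 0) in *.
      set (Sg := csum _ quo) in *.
      assert (E0 : Cpow (RtoC 0) quo = RtoC 0) by (destruct quo as [|q]; [lia|]; simpl; ring).
      rewrite E0 in G.
      replace ((1 - 0) / (U * x)) with (/ (U * x)) by (field; split; lra).
      rewrite EP, RtoC_inv, !RtoC_mult by nra. rewrite RtoC_inv by lra.
      assert (G' : Cpow (RtoC U) quo = Cmult (RtoC U) Sg) by (transitivity (Cminus (Cpow (RtoC U) quo) (RtoC 0)); [ring|rewrite <- G; ring]).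
      rewrite G'. field. split; assumption.
  - rewrite PPE. set (Sg := csum _ quo) in *.
    assert (Hc := cm_neq_0 m E). rewrite ym_pow2 by exact E.
    replace (u ^ (2 * N)) with (U ^ 2) by (unfold U; rewrite <- pow_mult; f_equal; lia).
    assert (HD : 0 < U ^ 2 + cm m ^ 2) by (assert (H := pow2_ge_0 (cm m)); nra).
    assert (Hp1 : Cplus (RtoC U) (0, cm m) <> RtoC 0) by (apply Re_neq_0; simpl; lra).
    assert (Hp2 : Cplus (RtoC U) (0, - cm m) <> RtoC 0) by (apply Re_neq_0; simpl; lra).
    assert (EC : cz (RtoC (U * x)) m = Cinv (Cmult (RtoC x) (Cplus (RtoC U) (0, cm m)))).
    { unfold cz. f_equal. unfold cm. apply C_ext; unfold Re, Im; simpl; field; lra. }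
    assert (ED : RtoC (U ^ 2 + cm m ^ 2) = Cmult (Cplus (RtoC U) (0, cm m)) (Cplus (RtoC U) (0, - cm m)))
      by (apply C_ext; unfold Re, Im; simpl; ring).
    rewrite EC, EP.
    replace (u ^ (N + rem)) with (U * u ^ rem) by (unfold U; rewrite pow_add; reflexivity).
    rewrite !RtoC_div, !RtoC_mult, ED by lra. rewrite RtoC_inv by lra. rewrite Cpow_S.
    assert (G' : Cpow (RtoC U) quo = Cplus (Cmult (Cplus (RtoC U) (0, cm m)) Sg) (Cpow (0, - cm m) quo)).
    { replace (Cplus (RtoC U) (0, cm m)) with (Cminus (RtoC U) (0, - cm m)) by (apply C_ext; unfold Re, Im; simpl; ring).
      rewrite G. ring. }
    rewrite G'. field. repeat split; assumption.
Qed.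

Lemma nabn_poly_part K u m : (quo <= K)%nat -> nabn K (poly_part u) m = RtoC 0.
Proof.
  intros HK. unfold poly_part. rewrite nabn_csum.
  rewrite (csum_ext _ (fun _ => RtoC 0)).
  - rewrite csum_const. ring.
  - intros i Hi. rewrite nabn_scal, nabn_pow by lia. ring.
Qed.

Lemma nabn_Rm K u m : (quo <= K)%nat -> 0 < u ->
  nabn K (fun j => Rm j u) m = Cmult (RtoC (u ^ p)) (nabn K (cz' (u ^ N * x)) m).
Proof.
  intros HK Hu. rewrite <- nabn_scal.
  rewrite (nabn_ext K (fun k => Cmult (RtoC (u ^ p)) (cz' (u ^ N * x) k)) (fun k => Cplus (Rm k u) (poly_part u k)))
    by (intros; now apply pole_split).
  rewrite nabn_plus, nabn_poly_part by exact HK. ring.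
Qed.

Definition delta0 (m : Z) : C := if Z.eq_dec m 0 then RtoC 1 else RtoC 0.

(** Term by term the boundary values do not match [phi0]: when [N] divides the exponent they differ
    from it by a monomial of degree [quo - 1] in [m]. This too is removed by differences. *)
Lemma nabn_rho K m : (quo <= K)%nat -> nabn K rho m = nabn K (fun j => Cmult (RtoC (phi0 h x)) (delta0 j)) m.
Proof.
  intros HK. assert (E := expo_Z N h HN Hh). assert (E2 := expo_quo_rem). assert (Hr := rem_lt).
  destruct (Nat.eq_dec rem 0) as [Er|Er].
  - assert (Hq : (1 <= quo)%nat) by (assert (H := expo_pos N h HN Hh); destruct quo; lia).
    rewrite (nabn_ext K rho (fun j => Cplus (Cmult (RtoC (phi0 h x)) (delta0 j))
      (Cmult (Copp (Cmult (RtoC (/ x)) (Cpow (0, - (2 * PI / x)) (quo - 1)))) (Cpow (RtoC (IZR j)) (quo - 1))))).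
    + rewrite nabn_plus, nabn_scal, (nabn_scal K (Copp _)), nabn_pow by lia. ring.
    + intros j. unfold rho, delta0. destruct (Z.eq_dec j 0) as [->|Ej].
      * unfold phi0. destruct (Nat.eq_dec quo 1) as [Eq|Eq].
        -- assert (Eh : h = 0%Z) by (rewrite Eq, Er in E2; lia). rewrite Eh, Eq. simpl. ring.
        -- destruct (Z.eqb_spec h 0) as [Eh|Eh].
           ++ exfalso. rewrite Eh, Er in *. assert (quo * N = 1 * N)%nat by lia. apply Nat.mul_cancel_r in H; lia.
           ++ replace (quo - 1)%nat with (S (quo - 2)) by lia. simpl (Cpow (RtoC 0) _). ring.
      * rewrite Er, Nat.add_0_r, pow_i by lia. rewrite ym_pow2 by exact Ej.
        assert (Hc := cm_neq_0 j Ej). assert (Hcc : RtoC (cm j) <> RtoC 0) by (intros H; apply RtoC_inj in H; auto).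
        replace (S quo) with (2 + (quo - 1))%nat by lia. rewrite Cpow_add_r.
        replace (Cpow (0, - cm j) 2) with (Copp (RtoC (cm j ^ 2))) by (apply C_ext; unfold Re, Im; simpl; ring).
        replace (0 / cm j ^ 2) with 0 by (unfold Rdiv; ring).
        rewrite RtoC_div by (now apply pow_nonzero). rewrite (cm_pow j (quo - 1)). simpl (0 ^ 0).
        assert (Hcc2 : RtoC (cm j ^ 2) <> RtoC 0) by (intros H; apply RtoC_inj in H; apply (pow_nonzero _ 2 Hc H)).
        field. exact Hcc2.
  - apply nabn_ext. intros j. unfold rho, delta0, phi0.
    destruct (Z.eqb_spec h 0) as [Eh|Eh].
    { exfalso. rewrite Eh in E. assert (Ee : expo N h = N) by (rewrite Eh; lia). unfold rem in Er. rewrite Ee in Er. apply Er, Nat.Div0.mod_same. }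
    destruct (Z.eq_dec j 0) as [Ej|Ej]; [ring|].
    rewrite !pow_i by lia. unfold Rdiv. rewrite !Rmult_0_l. ring.
Qed.

Lemma zvanish_delta0 : zvanish delta0.
Proof.
  split; (eapply clim_ext_loc; [|apply clim_const]); exists 1%nat; intros n Hn; unfold delta0;
    destruct (Z.eq_dec _ 0); try reflexivity; lia.
Qed.

Lemma zsum_delta0 a M : zsum (fun m => Cmult (wz a m) (delta0 m)) M = RtoC 1.
Proof.
  induction M as [|M IH]; cbn [zsum].
  - unfold delta0. simpl. unfold wz. replace (2 * PI * 0 * a) with 0 by ring. rewrite ei_0. ring.
  - rewrite IH. unfold delta0. destruct (Z.eq_dec (Z.of_nat (S M)) 0); [lia|].
    destruct (Z.eq_dec (- Z.of_nat (S M)) 0); [lia|]. ring.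
Qed.

Lemma zvanish_cz' t : 0 < t -> zvanish (cz' t).
Proof.
  intros Ht. assert (Hpi := PI_ge_2).
  assert (G : forall f : nat -> Z, (forall n, Z.abs (f n) = Z.of_nat n) -> clim (fun n => cz' t (f n)) (RtoC 0)).
  { intros f Hf. apply clim_decr_1. apply clim_squeeze with (fun n => 2 / INR (S n)).
    - intros n. replace (Cminus (cz' t (f (S n))) (RtoC 0)) with (cz' t (f (S n))) by ring.
      unfold cz'. specialize (Hf (S n)). destruct (Z.eq_dec (f (S n)) 0) as [E|E]; [lia|].
      eapply Rle_trans; [apply (Cmod_cz_le t _ Ht)|]. rewrite <- abs_IZR, Hf, <- INR_IZR_INZ.
      assert (Hs : 0 < INR (S n)) by (apply lt_0_INR; lia).
      unfold Rdiv. apply Rmult_le_compat_l; [lra|]. apply Rinv_le_contravar; nra.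
    - apply is_lim_seq_div_INR. }
  split; apply G; intros n; lia.
Qed.

Lemma clim_zsum_cz' t a : 0 < t -> 0 < a < 1 ->
  clim (zsum (fun m => Cmult (wz a m) (cz' t m))) (RtoC (phi_reg h a t)).
Proof.
  intros Ht Ha.
  assert (H := gsum_lim (RtoC t) a ltac:(simpl; lra) Ha).
  assert (E : forall M, zsum (fun m => Cmult (wz a m) (cz' t m)) M = Cplus (gsum (RtoC t) a M) (RtoC (- (kappa h / t)))).
  { assert (Htc : RtoC t <> RtoC 0) by (intros H0; apply RtoC_inj in H0; lra).
    induction M as [|M IH].
    - unfold gsum. cbn [zsum]. unfold cz'. simpl (Z.eq_dec 0 0). cbv iota. unfold wz.
      replace (2 * PI * 0 * a) with 0 by ring. rewrite ei_0. unfold cz.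
      replace (Cplus (RtoC t) (0, 2 * PI * 0)) with (RtoC t) by (apply C_ext; unfold Re, Im; simpl; ring).
      rewrite <- RtoC_inv, <- !RtoC_mult, <- RtoC_plus by lra. f_equal. field. lra.
    - unfold gsum in *. cbn [zsum]. rewrite IH. unfold cz' at 1 2.
      destruct (Z.eq_dec (Z.of_nat (S M)) 0); [lia|]. destruct (Z.eq_dec (- Z.of_nat (S M)) 0); [lia|]. ring. }
  eapply clim_ext; [intros M; symmetry; apply E|].
  eapply clim_eq; [apply clim_plus; [exact H|apply clim_const]|].
  destruct (one_minus_exp_neg t Ht) as [Hy _].
  assert (Ec : forall r, cexp (RtoC r) = RtoC (exp r)).
  { intros r. unfold cexp. apply C_ext; simpl; rewrite ?cos_0, ?sin_0; ring. }
  replace (Copp (Cmult (RtoC t) (RtoC a))) with (RtoC (- a * t)) by (apply C_ext; unfold Re, Im; simpl; ring).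
  replace (Copp (RtoC t)) with (RtoC (- t)) by (rewrite RtoC_opp; reflexivity).
  rewrite !Ec, <- RtoC_minus, <- RtoC_div, <- RtoC_plus by lra. f_equal.
Qed.

(** After [p + 3] differences there are [p + 4] factors: two for [1/m^2], and [p + 2] powers of
    [1/(1+t)]. As [1 + u <= k (1 + t)], the latter absorb [u^p] and still leave [1/(1+u^2)], the
    majorant required by [EM_bound]. *)
Lemma zsum_lam_tail a : 0 < a < 1 -> exists B, 0 <= B /\ forall M u, (2 * (p + 3) <= M)%nat -> 0 < u ->
  Cmod (Cminus (Cmult (Cpow (Cminus (RtoC 1) (wz a 1)) (p + 3)) (RtoC (lam N h x a u)))
    (zsum (fun m => Cmult (wz a m) (nabn (p + 3) (fun j => Rm j u) m)) M)) <= B / INR M / (1 + u ^ 2).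
Proof.
  intros Ha. replace (p + 3)%nat with (S (S (S p))) by lia.
  destruct (nabn_cz_decay (S p)) as [c [Hc HD]].
  set (k := 2 + / x). assert (Hix : 0 < / x) by now apply Rinv_0_lt_compat.
  exists (2 * (c * k ^ (p + 2))). split; [apply Rmult_le_pos; [lra|]; apply Rmult_le_pos; [exact Hc|apply pow_le; unfold k; lra]|].
  intros M u HM Hu. set (t := u ^ N * x).
  assert (Ht : 0 < t) by (apply uNx_pos; assumption).
  assert (Hq : (quo <= S (S (S p)))%nat).
  { assert (E2 := expo_quo_rem). fold p in E2. assert (quo <= N * quo)%nat by (destruct N; lia). lia. }
  assert (E : forall M, zsum (fun m => Cmult (wz a m) (nabn (S (S (S p))) (fun j => Rm j u) m)) M =
    Cmult (RtoC (u ^ p)) (zsum (fun m => Cmult (wz a m) (nabn (S (S (S p))) (cz' t) m)) M)).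
  { intros M'. rewrite <- zsum_scal. apply zsum_ext. intros m _. rewrite nabn_Rm by assumption. fold t. ring. }
  assert (Hup : 0 < u ^ p) by now apply pow_lt.
  assert (HM0 : 0 < INR M) by (apply lt_0_INR; lia).
  assert (HL := clim_zsum_nabn a _ _ (S (S (S p))) (zvanish_cz' t Ht) (clim_zsum_cz' t a Ht Ha)).
  set (W := Cpow (Cminus (RtoC 1) (wz a 1)) (S (S (S p)))) in *.
  set (s := zsum (fun m => Cmult (wz a m) (nabn (S (S (S p))) (cz' t) m))) in *.
  assert (HT : Cmod (Cminus (Cmult W (RtoC (phi_reg h a t))) (s M)) <= 2 * (c * / (1 + t) ^ S (S p)) / INR M).
  { apply clim_Cmod_le with (u := fun M' => Cminus (s M') (s M)).
    - apply clim_minus; [exact HL|apply clim_const].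
    - exists M. intros M' HM'. replace M' with (M + (M' - M))%nat by lia.
      apply zsum_tail_bound; [apply Rmult_le_pos; [exact Hc|left; apply Rinv_0_lt_compat, pow_lt; lra]|lia|].
      intros m Hm. rewrite Cmod_mult, Cmod_wz, Rmult_1_l.
      rewrite (nabn_ext_local _ (cz' t) (cz (RtoC t))).
      + apply HD; [exact Ht|lia].
      + intros j Hj. unfold cz'. destruct (Z.eq_dec j 0); [lia|reflexivity]. }
  rewrite E. fold (s M). unfold lam. fold p t.
  replace (Cminus (Cmult W (RtoC (u ^ p * phi_reg h a t))) (Cmult (RtoC (u ^ p)) (s M))) with
    (Cmult (RtoC (u ^ p)) (Cminus (Cmult W (RtoC (phi_reg h a t))) (s M))) by (rewrite RtoC_mult; ring).
  rewrite Cmod_mult, Cmod_R, Rabs_pos_eq by lra.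
  apply Rle_trans with (u ^ p * (2 * (c * / (1 + t) ^ S (S p)) / INR M)); [apply Rmult_le_compat_l; lra|].
  assert (HU : u ^ p * / (1 + t) ^ S (S p) <= k ^ (p + 2) / (1 + u ^ 2)).
  { assert (H1 : 1 + u <= k * (1 + t)).
    { assert (HuN : u <= 1 + u ^ N).
      { destruct (Rle_dec u 1) as [H1|H1]; [assert (0 < u ^ N) by (now apply pow_lt); lra|].
        assert (H2 : u ^ 1 <= u ^ N) by (apply Rle_pow; [lra|lia]). rewrite pow_1 in H2. lra. }
      assert (/ x * t = u ^ N) by (unfold t; field; lra). unfold k. nra. }
    assert (H2 : u ^ p * (1 + u ^ 2) <= (1 + u) ^ (p + 2)).
    { rewrite pow_add. apply Rmult_le_compat; [lra|nra|apply pow_incr; lra|nra]. }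
    assert (H3 : (1 + u) ^ (p + 2) <= k ^ (p + 2) * (1 + t) ^ (p + 2)).
    { rewrite <- Rpow_mult_distr. apply pow_incr. lra. }
    replace (p + 2)%nat with (S (S p)) in * by lia.
    assert (H4 : 0 < (1 + t) ^ S (S p)) by (apply pow_lt; lra).
    apply Rmult_le_reg_r with ((1 + t) ^ S (S p) * (1 + u ^ 2)); [nra|].
    replace (u ^ p * / (1 + t) ^ S (S p) * ((1 + t) ^ S (S p) * (1 + u ^ 2))) with (u ^ p * (1 + u ^ 2)) by (field; lra).
    replace (k ^ S (S p) / (1 + u ^ 2) * ((1 + t) ^ S (S p) * (1 + u ^ 2))) with (k ^ S (S p) * (1 + t) ^ S (S p)) by (field; nra).
    lra. }
  replace (u ^ p * (2 * (c * / (1 + t) ^ S (S p)) / INR M)) with (2 * c / INR M * (u ^ p * / (1 + t) ^ S (S p)))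
    by (unfold Rdiv; ring).
  replace (2 * (c * k ^ (p + 2)) / INR M / (1 + u ^ 2)) with (2 * c / INR M * (k ^ (p + 2) / (1 + u ^ 2))) by (unfold Rdiv; ring).
  apply Rmult_le_compat_l; [|exact HU]. apply Rmult_le_pos; [lra|left; now apply Rinv_0_lt_compat].
Qed.

(* Multiplying by [(1 - e^{2 pi i a})^K] turns the conditionally convergent Fourier expansion
   into one with rapidly decaying coefficients, for which the sum over [n] may be exchanged. *)
Lemma Phi_expansion a : 0 < a < 1 -> zvanish dm ->
  clim (zsum (fun m => Cmult (wz a m) (dm m))) (RtoC (Phi N h x a)).
Proof.
  intros Ha Hd. apply clim_zsum_of_nabn with (p + 3)%nat; [exact Hd|now apply wz_1_neq_1|].
  destruct (zsum_lam_tail a Ha) as [B [HB HT]].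
  set (W := Cpow (Cminus (RtoC 1) (wz a 1)) (p + 3)) in *.
  assert (Hq : (quo <= p + 3)%nat).
  { assert (E2 := expo_quo_rem). fold p in E2. assert (quo <= N * quo)%nat by (destruct N; lia). lia. }
  set (r := fun M => zsum (fun m => Cmult (wz a m) (nabn (p + 3) rho m)) M).
  assert (Hr : clim r (Cmult W (RtoC (phi0 h x)))).
  { assert (Hr0 := clim_zsum_nabn a delta0 (RtoC 1) (p + 3) zvanish_delta0
      (clim_ext _ _ _ (fun M => eq_sym (zsum_delta0 a M)) (clim_const (RtoC 1)))).
    eapply clim_ext; [|eapply clim_eq; [exact (clim_scal (RtoC (phi0 h x)) _ _ Hr0)|]].
    - intros M. cbv beta. unfold r. rewrite <- zsum_scal. apply zsum_ext. intros m _.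
      rewrite nabn_rho, nabn_scal by exact Hq. ring.
    - fold W. ring. }
  assert (HE := fun M => EM_plus _ _ _ _ _ _ (EM_scal W _ _ _ (EM_lam N h x HN Hx Hh a ltac:(lra)))
    (EM_scal (Copp (RtoC 1)) _ _ _ (EM_zsum _ _ _ M (fun m => EM_scal (wz a m) _ _ _ (EM_nabn (p + 3) Rm rho dm m EM_Rm))))).
  apply clim_squeeze_loc with (fun M => Cmod (Cminus (r M) (Cmult W (RtoC (phi0 h x)))) / 2 + 6 * (B / INR M)).
  - exists (2 * (p + 3))%nat. intros M HM.
    specialize (HE M). apply EM_bound with (eps := B / INR M) in HE.
    + fold (r M) in HE. rewrite Cmod_minus_sym, (Cmod_minus_sym (r M)).
      replace (Cplus (Cmult W (RtoC (phi0 h x))) (Cmult (Copp (RtoC 1)) (r M))) with (Cminus (Cmult W (RtoC (phi0 h x))) (r M)) in HE by ring.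
      eapply Rle_trans; [|exact HE]. right. f_equal. ring.
    + intros u Hu. eapply Rle_trans; [|apply (HT M u HM Hu)]. right. f_equal. ring.
  - replace (Finite 0) with (Finite (0 / 2 + 6 * 0)) by (f_equal; field).
    apply is_lim_seq_plus'.
    + apply is_lim_seq_mult'; [apply (clim_Cmod _ _ Hr)|apply is_lim_seq_const].
    + apply is_lim_seq_mult'; [apply is_lim_seq_const|]. apply is_lim_seq_incr_1. apply is_lim_seq_div_INR.
Qed.

End Expansion.

(** * Identification of the Fourier terms *)

Definition sg1 (n : Z) : R := powerRZ (-1) n.

Lemma sg1_add a b : sg1 (a + b) = sg1 a * sg1 b.
Proof. apply powerRZ_add. lra. Qed.

Lemma sg1_double q : sg1 (2 * q) = 1.
Proof.
  unfold sg1. replace (2 * q)%Z with (q + q)%Z by lia. rewrite powerRZ_add by lra. rewrite <- powerRZ_mult.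
  replace (-1 * -1) with 1 by ring. apply powerRZ_R1.
Qed.

Lemma sg1_eq a b q : a = (b + 2 * q)%Z -> sg1 a = sg1 b.
Proof. intros ->. rewrite sg1_add, sg1_double. ring. Qed.

Lemma sg1_sq a : sg1 a * sg1 a = 1.
Proof. rewrite <- sg1_add. replace (a + a)%Z with (2 * a)%Z by lia. apply sg1_double. Qed.

Lemma sg1_cases a : sg1 a = 1 \/ sg1 a = -1.
Proof. assert (H := sg1_sq a). assert (H0 : (sg1 a - 1) * (sg1 a + 1) = 0) by lra.
  apply Rmult_integral in H0. destruct H0; [left|right]; lra. Qed.

Lemma sg1_nat n : (-1) ^ n = sg1 (Z.of_nat n).
Proof. unfold sg1. now rewrite pow_powerRZ. Qed.

Lemma ei_PI_Z n : ei (PI * IZR n) = RtoC (sg1 n).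
Proof.
  assert (P : forall k, ei (PI * INR k) = RtoC (sg1 (Z.of_nat k))).
  { intros k. rewrite Rmult_comm, ei_INR, ei_PI, <- sg1_nat, RtoC_pow. f_equal.
    apply C_ext; unfold Re, Im; simpl; ring. }
  destruct (Z_le_dec 0 n) as [H|H].
  - rewrite <- (Z2Nat.id n H), <- INR_IZR_INZ. apply P.
  - replace (PI * IZR n) with (- (PI * INR (Z.to_nat (- n)))).
    + rewrite ei_opp, P, Z2Nat.id by lia.
      destruct (sg1_cases (- n)) as [E|E]; rewrite E, <- RtoC_inv by lra;
        rewrite (sg1_eq n (- n) n) by lia; rewrite E; f_equal; field.
    + rewrite INR_IZR_INZ, Z2Nat.id, opp_IZR by lia. ring.
Qed.

Section Powers.
Variables (N : nat) (y : R) (k : nat).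
Hypothesis HN : (0 < N)%nat.
Hypothesis Hy : 0 < y.

(** The [e]-th power of [zk] for any integer [e], in polar form, so that the possibly negative
    exponent [1 - 2h] needs no inverses. *)
Definition zp (e : Z) : C := Cmult (RtoC (powerRZ y e)) (ei (IZR e * ang N k)).

Lemma zp_add a b : zp (a + b) = Cmult (zp a) (zp b).
Proof.
  unfold zp. rewrite powerRZ_add by lra. rewrite plus_IZR, Rmult_plus_distr_r, ei_plus, RtoC_mult. ring.
Qed.

Lemma zp_nat n : Cpow (zk N y k) n = zp (Z.of_nat n).
Proof. unfold zp, zk. rewrite Cpow_mult_l, <- ei_INR, <- pow_powerRZ, RtoC_pow, INR_IZR_INZ. reflexivity. Qed.

Lemma zp_1 : zp 1 = zk N y k.
Proof. transitivity (Cpow (zk N y k) 1); [symmetry; exact (zp_nat 1)|simpl; ring]. Qed.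

Lemma rk_pow n : Cpow (rk N y k) n = Cmult (RtoC (sg1 (Z.of_nat n))) (zp (2 * Z.of_nat n)).
Proof.
  unfold rk. replace (Copp (Cmult (zk N y k) (zk N y k))) with (Cmult (RtoC (-1)) (Cpow (zk N y k) 2)).
  - rewrite Cpow_mult_l, <- Cpow_mult_r, zp_nat, <- RtoC_pow, sg1_nat. f_equal. f_equal. lia.
  - simpl. apply C_ext; unfold Re, Im; simpl; ring.
Qed.

(** [N * ang N k] is a multiple of [pi] for odd [N] and an odd multiple of [pi/2] for even [N]. So
    [z^N] is real here and imaginary for even [N], as [rk_pow_half] expresses; this is the source of
    the different shapes of (i) and (ii). *)
Lemma zp_N n : Z.of_nat N = (2 * n + 1)%Z -> zp (Z.of_nat N) = RtoC (y ^ N * sg1 (Z.of_nat k - n)).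
Proof.
  intros E. assert (HNr : 0 < INR N) by now apply lt_0_INR.
  unfold zp. rewrite <- pow_powerRZ, <- INR_IZR_INZ, RtoC_mult, <- ei_PI_Z. f_equal. f_equal.
  unfold ang. rewrite (INR_IZR_INZ N), E, minus_IZR, plus_IZR, mult_IZR, <- INR_IZR_INZ.
  rewrite (INR_IZR_INZ N), E, plus_IZR, mult_IZR in HNr. field. lra.
Qed.

Lemma rk_pow_half n : Z.of_nat N = (2 * Z.of_nat n)%Z ->
  Cpow (rk N y k) n = Cmult (RtoC (sg1 (Z.of_nat k))) (0, y ^ N).
Proof.
  intros E. assert (HNr : 0 < INR N) by now apply lt_0_INR.
  rewrite rk_pow, <- E. unfold zp. rewrite <- pow_powerRZ, <- INR_IZR_INZ.
  replace (INR N * ang N k) with (PI * IZR (Z.of_nat k - Z.of_nat n) + PI / 2).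
  - rewrite ei_plus, ei_PI_Z, (ei_eq (PI / 2)), cos_PI2, sin_PI2.
    replace (sg1 (Z.of_nat k)) with (sg1 (Z.of_nat n) * sg1 (Z.of_nat k - Z.of_nat n))
      by (rewrite <- sg1_add; f_equal; lia).
    apply C_ext; unfold Re, Im; simpl; ring.
  - unfold ang. rewrite (INR_IZR_INZ N), E, minus_IZR, mult_IZR, <- !INR_IZR_INZ.
    rewrite (INR_IZR_INZ N), E, mult_IZR, <- INR_IZR_INZ in HNr. field. lra.
Qed.

(** [r^N = -(y^N)^2] lowers the exponent to [1 - h], and [r^(1-h)] is [z^(2-2h)] up to sign. Once
    the [1/z] in [Bz] is taken off, this gives the sign [(-1)^(h+1)] and the phase with [1 - 2h] of
    the statement. *)
Lemma rk_key (h : Z) E : Z.of_nat E = (Z.of_nat N + 1 - h)%Z ->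
  Cmult (Copp (Cinv (RtoC ((y ^ N) ^ 2)))) (Cpow (rk N y k) E) = Cmult (RtoC (sg1 (h + 1))) (zp (2 - 2 * h)).
Proof.
  intros HE. assert (HY : 0 < (y ^ N) ^ 2) by (apply pow_lt, pow_lt; exact Hy).
  assert (HYc : RtoC ((y ^ N) ^ 2) <> RtoC 0) by (intros H; apply RtoC_inj in H; lra).
  assert (E1 := rk_pow_N N y k HN). rewrite rk_pow in E1.
  assert (E2 : zp (2 * Z.of_nat N) = Cmult (RtoC (- sg1 (Z.of_nat N))) (RtoC ((y ^ N) ^ 2))).
  { transitivity (Cmult (RtoC (sg1 (Z.of_nat N) * sg1 (Z.of_nat N))) (zp (2 * Z.of_nat N))); [rewrite sg1_sq; ring|].
    rewrite RtoC_mult, <- Cmult_assoc, E1, RtoC_opp. ring. }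
  rewrite rk_pow. replace (2 * Z.of_nat E)%Z with (2 * Z.of_nat N + (2 - 2 * h))%Z by lia. rewrite zp_add, E2.
  rewrite (sg1_eq (h + 1) (Z.of_nat E + Z.of_nat N) (h - Z.of_nat N)) by lia.
  rewrite sg1_add, RtoC_mult, RtoC_opp. field. exact HYc.
Qed.

End Powers.

Section Matching.
Variables (N : nat) (h : Z) (x : R).
Hypothesis HN : (0 < N)%nat.
Hypothesis Hx : 0 < x.
Hypothesis Hh : (2 * h < Z.of_nat N)%Z.

Definition Tk (y : R) (k : nat) : C := Cmult (RtoC (sg1 (h + 1) / (x * INR N))) (zp N y k (1 - 2 * h)).

Lemma ym_pos m : 0 < ym N x m.
Proof. apply Rpower_pos. Qed.

(** For even [N], [-i c] equals [-(sg s) r^(N/2)] with [s = (-1)^k], so the two parts of [dm] are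
    multiples of the same power of [r] and combine to the factor [1 - sg s]. The sign of [m] thus
    selects half of the roots. *)
Lemma dm_even n m sg : N = (2 * n)%nat -> m <> 0%Z -> cm x m = sg * ym N x m ^ N -> sg * sg = 1 ->
  dm N h x m = csum (fun k => Cmult (RtoC (1 - sg * sg1 (Z.of_nat k)))
     (Cmult (Tk (ym N x m) k) (Cmult (zk N (ym N x m) k) (Bz (zk N (ym N x m) k))))) N.
Proof.
  intros HNn Hm Hc Hsg. unfold dm. destruct (Z.eq_dec m 0) as [E|_]; [contradiction|].
  set (y := ym N x m) in *. assert (Hy : 0 < y) by apply ym_pos.
  assert (EZ := expo_Z N h HN Hh). assert (EQ := expo_quo_rem N h HN).
  set (q := quo N h) in *. set (r := rem N h) in *.
  assert (HrE : exists r', r = (2 * r')%nat).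
  { exists (Z.to_nat (Z.of_nat n - h) - n * q)%nat. rewrite EQ in EZ. nia. }
  destruct HrE as [r' Hr'].
  assert (EE : Z.of_nat (n * (q + 1) + S r') = (Z.of_nat N + 1 - h)%Z) by nia.
  assert (HNr : 0 < INR N) by now apply lt_0_INR.
  assert (HY : 0 < (y ^ N) ^ 2) by (apply pow_lt, pow_lt; exact Hy).
  unfold em_pf. rewrite <- !csum_scal, <- csum_plus, <- csum_scal. apply csum_ext. intros k Hk.
  assert (Ev1 : em_val (N + r) (zk N y k) = Bz (zk N y k)).
  { unfold em_val. replace (Nat.even (N + r)) with true; [reflexivity|].
    symmetry. apply Nat.even_spec. exists (n + r')%nat. lia. }
  assert (Ev2 : em_val r (zk N y k) = Bz (zk N y k)).
  { unfold em_val. replace (Nat.even r) with true; [reflexivity|].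
    symmetry. apply Nat.even_spec. exists r'. lia. }
  assert (Ed1 : ((N + r) / 2 = n + r')%nat).
  { replace (N + r)%nat with ((n + r') * 2)%nat by lia. now apply Nat.div_mul. }
  assert (Ed2 : (r / 2 = r')%nat) by (rewrite Hr', Nat.mul_comm; now apply Nat.div_mul).
  rewrite Ev1, Ev2, Ed1, Ed2.
  set (s := sg1 (Z.of_nat k)).
  assert (Ec : (0, - cm x m) = Cmult (RtoC (- (sg * s))) (Cpow (rk N y k) n)).
  { rewrite (rk_pow_half N y k HN n) by lia. fold s. rewrite Hc.
    assert (Hs : s * s = 1) by apply sg1_sq. apply C_ext; unfold Re, Im; simpl; [ring|].
    transitivity (- sg * (s * s) * y ^ N); [rewrite Hs; ring|ring]. }
  assert (Esum : Cplus (Cmult (Cpow (0, - cm x m) q) (Cpow (rk N y k) (S (n + r'))))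
     (Cmult (Cpow (0, - cm x m) (S q)) (Cpow (rk N y k) (S r'))) =
     Cmult (RtoC (1 - sg * s)) (Cmult (RtoC ((- (sg * s)) ^ q)) (Cpow (rk N y k) (n * (q + 1) + S r')))).
  { rewrite Ec, !Cpow_mult_l, <- !Cpow_mult_r.
    replace (Cpow (rk N y k) (n * (q + 1) + S r')) with (Cmult (Cpow (rk N y k) (n * q)) (Cpow (rk N y k) (S (n + r'))))
      by (rewrite <- Cpow_add_r; f_equal; lia).
    replace (Cpow (rk N y k) (S (n + r'))) with (Cmult (Cpow (rk N y k) n) (Cpow (rk N y k) (S r')))
      by (rewrite <- Cpow_add_r; f_equal; lia).
    replace (Cpow (rk N y k) (n * S q)) with (Cmult (Cpow (rk N y k) (n * q)) (Cpow (rk N y k) n))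
      by (rewrite <- Cpow_add_r; f_equal; lia).
    rewrite (Cpow_S (RtoC (- (sg * s))) q), RtoC_pow, RtoC_minus, RtoC_opp. ring. }
  (* [- sg s] is 1 or -1, and when it is -1 the prefactor [1 - sg s] vanishes; so the power [q]
     leaves no trace. *)
  assert (EsQ : Cmult (RtoC (1 - sg * s)) (RtoC ((- (sg * s)) ^ q)) = RtoC (1 - sg * s)).
  { rewrite <- RtoC_mult. f_equal.
    assert (H0 : (sg * s - 1) * (sg * s + 1) = 0).
    { assert (Hs : s * s = 1) by apply sg1_sq. replace ((sg * s - 1) * (sg * s + 1)) with (sg * sg * (s * s) - 1) by ring.
      rewrite Hsg, Hs. ring. }
    apply Rmult_integral in H0. destruct H0 as [H0|H0].
    - replace (1 - sg * s) with 0 by lra. ring.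
    - replace (- (sg * s)) with 1 by lra. rewrite pow1. ring. }
  assert (K := rk_key N y k HN Hy h _ EE).
  replace (2 - 2 * h)%Z with ((1 - 2 * h) + 1)%Z in K by lia. rewrite zp_add, zp_1 in K by exact Hy.
  assert (HYc : RtoC ((y ^ N) ^ 2) <> RtoC 0) by (intros H; apply RtoC_inj in H; lra).
  assert (HNc : RtoC (INR N) <> RtoC 0) by (intros H; apply RtoC_inj in H; lra).
  assert (Hxc : RtoC x <> RtoC 0) by (intros H; apply RtoC_inj in H; lra).
  transitivity (Cmult (Cmult (RtoC (/ x)) (Cmult (Copp (Cinv (RtoC (INR N * (y ^ N) ^ 2)))) (Bz (zk N y k))))
    (Cplus (Cmult (Cpow (0, - cm x m) q) (Cpow (rk N y k) (S (n + r')))) (Cmult (Cpow (0, - cm x m) (S q)) (Cpow (rk N y k) (S r')))));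
    [ring|].
  rewrite Esum.
  transitivity (Cmult (Cmult (RtoC (/ x)) (Cmult (Cinv (RtoC (INR N))) (Bz (zk N y k))))
    (Cmult (Cmult (RtoC (1 - sg * s)) (RtoC ((- (sg * s)) ^ q))) (Cmult (Copp (Cinv (RtoC ((y ^ N) ^ 2)))) (Cpow (rk N y k) (n * (q + 1) + S r'))))).
  { rewrite (RtoC_mult (INR N)). field. split; assumption. }
  rewrite EsQ, K. unfold Tk, Rdiv. rewrite !RtoC_mult, Rinv_mult, RtoC_mult, !RtoC_inv by lra. field. split; assumption.
Qed.

(** The exponents [N + rem] and [rem] have opposite parity, so one part yields [Bz] and the other
    [Lz]. Which is which depends on [h]: [quo = 0], [rem = N - 2h] for [h >= 1], but [quo = 1],
    [rem = 0] for [h = 0]. The values of [r^N] and [z^N] bring both cases to the same form. *)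
Lemma dm_odd n m sg : N = (2 * n + 1)%nat -> (0 <= h)%Z -> m <> 0%Z -> cm x m = sg * ym N x m ^ N -> sg * sg = 1 ->
  dm N h x m = csum (fun k => Cmult (Tk (ym N x m) k)
    (Cplus (Cmult (zk N (ym N x m) k) (Bz (zk N (ym N x m) k)))
      (Cmult (0, sg * sg1 (Z.of_nat k)) (Lz (zk N (ym N x m) k))))) N.
Proof.
  intros HNn Hh0 Hm Hc Hsg. unfold dm. destruct (Z.eq_dec m 0) as [E|_]; [contradiction|].
  set (y := ym N x m) in *. assert (Hy : 0 < y) by apply ym_pos.
  assert (EZ := expo_Z N h HN Hh). assert (EQ := expo_quo_rem N h HN).
  assert (Hr := rem_lt N h HN).
  assert (HNr : 0 < INR N) by now apply lt_0_INR.
  assert (HY1 : 0 < y ^ N) by (apply pow_lt; exact Hy).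
  assert (HYc : RtoC (y ^ N) <> RtoC 0) by (intros H; apply RtoC_inj in H; lra).
  assert (HNc : RtoC (INR N) <> RtoC 0) by (intros H; apply RtoC_inj in H; lra).
  assert (Hxc : RtoC x <> RtoC 0) by (intros H; apply RtoC_inj in H; lra).
  set (n' := Z.of_nat n).
  assert (KK : forall k F, Z.of_nat F = (1 + n' - h)%Z ->
    Cmult (Cinv (RtoC (y ^ N))) (Cpow (rk N y k) F) = Cmult (RtoC (sg1 (Z.of_nat k) * sg1 (h + 1))) (zp N y k (1 - 2 * h))).
  { intros k F HF. rewrite rk_pow by assumption.
    replace (2 * Z.of_nat F)%Z with (Z.of_nat N + (1 - 2 * h))%Z by lia. rewrite zp_add by exact Hy.
    rewrite (zp_N N y k HN n') by lia.
    rewrite <- sg1_add. rewrite (sg1_eq (Z.of_nat k + (h + 1)) (Z.of_nat F + (Z.of_nat k - n')) h) by lia.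
    rewrite sg1_add, !RtoC_mult. field. exact HYc. }
  unfold em_pf. rewrite <- !csum_scal, <- csum_plus, <- csum_scal. apply csum_ext. intros k Hk.
  unfold Tk, Rdiv. rewrite (RtoC_mult (sg1 (h + 1))), Rinv_mult, (RtoC_mult (/ x)), (RtoC_inv (INR N)) by lra.
  assert (EI : (0, - cm x m) = Cmult (Copp Ci) (RtoC (sg * y ^ N))) by (rewrite Hc; apply C_ext; unfold Re, Im; simpl; ring).
  assert (EJ : (0, sg * sg1 (Z.of_nat k)) = Cmult Ci (Cmult (RtoC sg) (RtoC (sg1 (Z.of_nat k))))) by (apply C_ext; unfold Re, Im; simpl; ring).
  rewrite EI, EJ, (RtoC_mult sg).
  assert (HsgC : Cmult (RtoC sg) (RtoC sg) = RtoC 1) by (rewrite <- RtoC_mult, Hsg; reflexivity).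
  assert (Hi2 : Cmult Ci Ci = Copp (RtoC 1)) by (apply C_ext; unfold Re, Im; simpl; ring).
  set (q := quo N h) in *. set (r := rem N h) in *.
  destruct (Z_lt_le_dec 0 h) as [Hh1|Hh1].
  - assert (Eq : q = 0%nat) by (apply (quo_pos_iff N h HN Hh); lia).
    assert (Er : r = expo N h) by (rewrite EQ, Eq; lia).
    assert (Ev1 : em_val (N + r) (zk N y k) = Bz (zk N y k)).
    { unfold em_val. replace (Nat.even (N + r)) with true; [reflexivity|].
      symmetry. apply Nat.even_spec. exists (N - Z.to_nat h)%nat. lia. }
    assert (Ev2 : em_val r (zk N y k) = Lz (zk N y k)).
    { unfold em_val. replace (Nat.even r) with false; [reflexivity|].
      symmetry. rewrite <- Nat.negb_odd. apply Bool.negb_false_iff, Nat.odd_spec. exists (n - Z.to_nat h)%nat. lia. }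
    assert (Ed1 : ((N + r) / 2 = N - Z.to_nat h)%nat).
    { replace (N + r)%nat with ((N - Z.to_nat h) * 2)%nat by lia. now apply Nat.div_mul. }
    assert (Ed2 : (r / 2 = n - Z.to_nat h)%nat).
    { replace r with ((n - Z.to_nat h) * 2 + 1)%nat by lia. rewrite Nat.div_add_l by lia. simpl. lia. }
    rewrite Ev1, Ev2, Ed1, Ed2, Eq.
    assert (K := rk_key N y k HN Hy h (S (N - Z.to_nat h)) ltac:(lia)).
    replace (2 - 2 * h)%Z with ((1 - 2 * h) + 1)%Z in K by lia. rewrite zp_add, zp_1 in K by exact Hy.
    assert (K2 := KK k (S (n - Z.to_nat h)) ltac:(lia)).
    set (R1 := Cpow (rk N y k) (S (N - Z.to_nat h))) in *. set (R2 := Cpow (rk N y k) (S (n - Z.to_nat h))) in *.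
    rewrite (RtoC_mult (INR N)). rewrite (RtoC_mult (sg1 (Z.of_nat k))) in K2. rewrite (RtoC_pow (y ^ N)) in *.
    set (Y := RtoC (y ^ N)) in *.
    transitivity (Cmult (RtoC (/ x)) (Cmult (Cinv (RtoC (INR N)))
       (Cplus (Cmult (Cmult (Copp (Cinv (Cpow Y 2))) R1) (Bz (zk N y k)))
          (Cmult (Cmult Ci (RtoC sg)) (Cmult (Cmult (Cinv Y) R2) (Lz (zk N y k))))))).
    + simpl Cpow. field. split; assumption.
    + rewrite K, K2. ring.
  - assert (Eh : (h = 0)%Z) by lia.
    assert (Ee : expo N h = N) by lia.
    assert (Eq : q = 1%nat) by (unfold q, quo; rewrite Ee; apply Nat.div_same; lia).
    assert (Er : r = 0%nat) by (unfold r, rem; rewrite Ee; apply Nat.Div0.mod_same).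
    assert (Ev1 : em_val N (zk N y k) = Lz (zk N y k)).
    { unfold em_val. replace (Nat.even N) with false; [reflexivity|].
      symmetry. rewrite <- Nat.negb_odd. apply Bool.negb_false_iff, Nat.odd_spec. exists n. lia. }
    assert (Ed1 : (N / 2 = n)%nat).
    { replace N with (n * 2 + 1)%nat by lia. rewrite Nat.div_add_l by lia. simpl. lia. }
    rewrite Er, Eq, Nat.add_0_r, Ev1, Ed1. change (0 / 2)%nat with 0%nat. change (em_val 0 (zk N y k)) with (Bz (zk N y k)).
    assert (K := rk_key N y k HN Hy h (S N) ltac:(lia)).
    assert (EN := rk_pow_N N y k HN). rewrite Cpow_S, EN in K.
    replace (2 - 2 * h)%Z with ((1 - 2 * h) + 1)%Z in K by lia. rewrite zp_add, zp_1 in K by exact Hy.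
    assert (K2 := KK k (S n) ltac:(lia)).
    rewrite (RtoC_mult (INR N)). rewrite (RtoC_mult (sg1 (Z.of_nat k))) in K2. rewrite (RtoC_pow (y ^ N)) in *.
    set (Y := RtoC (y ^ N)) in *. set (R2 := Cpow (rk N y k) (S n)) in *.
    assert (K1 : rk N y k = Cmult (RtoC (sg1 (h + 1))) (Cmult (zp N y k (1 - 2 * h)) (zk N y k))).
    { rewrite <- K. field. assumption. }
    transitivity (Cmult (RtoC (/ x)) (Cmult (Cinv (RtoC (INR N)))
       (Cplus (Cmult (Copp (Cmult (Cmult Ci Ci) (Cmult (RtoC sg) (RtoC sg)))) (Cmult (rk N y k) (Bz (zk N y k))))
          (Cmult (Cmult Ci (RtoC sg)) (Cmult (Cmult (Cinv Y) R2) (Lz (zk N y k))))))).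
    + simpl Cpow. field. split; assumption.
    + rewrite HsgC, Hi2, K2, K1. ring.
Qed.

End Matching.

Lemma is_lim_seq_Rpower_0 s : s < 0 -> is_lim_seq (fun m => Rpower (INR (S m)) s) 0.
Proof.
  intros Hs. apply (is_lim_seq_incr_1 (fun m => Rpower (INR m) s)).
  apply (filterlim_at_infty_seq (fun t => Rpower t s)). now apply Rpower_lim_infty.
Qed.

Lemma cex_series_of_inv_sq u c : (forall m, Cmod (u m) <= c / INR (S m) ^ 2) -> cex_series u.
Proof.
  intros H. split; apply ex_series_of_inv_sq with c; intros m; eapply Rle_trans; try apply H.
  - apply re_le_Cmod.
  - apply im_le_Cmod.
Qed.

Lemma is_lim_seq_Series u : ex_series u -> is_lim_seq (rsum u) (Series u).
Proof.
  intros H. apply is_lim_seq_incr_1. eapply is_lim_seq_ext; [|exact (Series_correct _ H)].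
  intros n. apply sum_n_rsum.
Qed.

Lemma clim_cSeries u : cex_series u -> clim (csum u) (cSeries u).
Proof.
  intros [H1 H2]. split; simpl.
  - eapply is_lim_seq_ext; [|exact (is_lim_seq_Series _ H1)]. intros n. symmetry; apply Re_csum.
  - eapply is_lim_seq_ext; [|exact (is_lim_seq_Series _ H2)]. intros n. symmetry; apply Im_csum.
Qed.

(** * The terms of the stated series and their size *)

Section Terms.
Variables (N : nat) (h : Z) (x : R).
Hypothesis HN : (0 < N)%nat.
Hypothesis Hx : 0 < x.
Hypothesis Hh : (2 * h < Z.of_nat N)%Z.

Definition yn (m : nat) : R := ym N x (Z.of_nat (S m)).
Definition eik (k : nat) : C := ei (IZR (1 - 2 * h) * ang N k).
Definition den (k m : nat) : C :=
  Cmult (RtoC (npow N h (S m))) (Cminus (cexp (Cmult (RtoC 2) (Cmult (RtoC PI) (zk N (yn m) k)))) (RtoC 1)).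

Lemma yn_pos m : 0 < yn m.
Proof. apply Rpower_pos. Qed.

Lemma yn_eq m : yn m = Rpower (2 * PI / x * INR (S m)) (/ INR N).
Proof.
  unfold yn, ym, cm. rewrite <- INR_IZR_INZ.
  assert (Hs : 0 < INR (S m)) by (apply lt_0_INR; lia). assert (Hpi := PI_RGT_0).
  rewrite Rabs_pos_eq.
  - f_equal. field. lra.
  - left. unfold Rdiv. apply Rmult_lt_0_compat; [nra|now apply Rinv_0_lt_compat].
Qed.

Lemma coef_pos : 0 < 2 * PI / x.
Proof. assert (Hpi := PI_RGT_0). apply Rdiv_lt_0_compat; lra. Qed.

Lemma ym_opp m : ym N x (- m) = ym N x m.
Proof.
  unfold ym, cm. f_equal. rewrite opp_IZR. rewrite <- (Rabs_Ropp (2 * PI * IZR m / x)). f_equal. unfold Rdiv; ring.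
Qed.

Lemma cm_yn m : cm x (Z.of_nat (S m)) = 1 * yn m ^ N.
Proof.
  unfold yn. rewrite ym_pow by (assumption || lia). rewrite Rmult_1_l, Rabs_pos_eq; [reflexivity|].
  unfold cm. rewrite <- INR_IZR_INZ. assert (H := coef_pos). assert (H2 := pos_INR (S m)).
  replace (2 * PI * INR (S m) / x) with (2 * PI / x * INR (S m)) by (unfold Rdiv; ring). nra.
Qed.

Lemma cm_yn_opp m : cm x (- Z.of_nat (S m)) = -1 * ym N x (- Z.of_nat (S m)) ^ N.
Proof.
  rewrite ym_opp. change (ym N x (Z.of_nat (S m))) with (yn m).
  assert (H := cm_yn m). unfold cm in *. rewrite opp_IZR.
  replace (2 * PI * - IZR (Z.of_nat (S m)) / x) with (- (2 * PI * IZR (Z.of_nat (S m)) / x)) by (unfold Rdiv; ring).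
  rewrite H. ring.
Qed.

(** With [y^N = 2 pi n / x], the argument [A_{N,j}(n/x)] is [pi z_k], so [exp(2 A) - 1] is the
    denominator occurring in [Bz]. *)
Lemma A_eq j k m : PI * j / INR N = ang N k -> A_ N j (INR (S m) / x) = Cmult (RtoC PI) (zk N (yn m) k).
Proof.
  intros Hj. unfold A_, zk. rewrite Hj, RtoC_mult. fold (ei (ang N k)).
  rewrite yn_eq. replace (2 * PI * (INR (S m) / x)) with (2 * PI / x * INR (S m)) by (field; lra).
  replace (1 / INR N) with (/ INR N) by (unfold Rdiv; ring). ring.
Qed.

Lemma npow_pos m : 0 < npow N h (S m).
Proof. apply Rpower_pos. Qed.

Lemma Tk_eq k m : Tk N h x (yn m) k = Cmult (RtoC (pref N h x / (2 * PI) / npow N h (S m))) (eik k).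
Proof.
  assert (HNr : 0 < INR N) by now apply lt_0_INR.
  assert (Hs : 0 < INR (S m)) by (apply lt_0_INR; lia). assert (Hpi := PI_RGT_0). assert (Hc := coef_pos).
  unfold Tk, zp. fold (eik k). rewrite Cmult_assoc, <- RtoC_mult. do 2 f_equal.
  unfold pref, npow, sg1. rewrite (powerRZ_Rpower (yn m)) by apply yn_pos. rewrite yn_eq, Rpower_mult.
  replace (IZR (Z.of_nat N - 2 * h + 1) / INR N) with (1 + / INR N * IZR (1 - 2 * h)).
  2: { rewrite plus_IZR, !minus_IZR, !mult_IZR, <- INR_IZR_INZ. field. lra. }
  rewrite Rpower_plus, Rpower_1 by exact Hc. rewrite <- Rpower_mult_distr by assumption.
  replace (/ INR N * IZR (1 - 2 * h)) with (- (IZR (2 * h - 1) / INR N)).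
  2: { rewrite !minus_IZR, !mult_IZR. field. lra. }
  rewrite (Rpower_Ropp (INR (S m))).
  assert (P := Rpower_pos (INR (S m)) (IZR (2 * h - 1) / INR N)). field. lra.
Qed.

Lemma exp_2PIz_neq_1 k m : (k < N)%nat -> Cminus (cexp (Cmult (RtoC 2) (Cmult (RtoC PI) (zk N (yn m) k)))) (RtoC 1) <> RtoC 0.
Proof.
  intros Hk H. assert (Hz := Re_zk_pos N (yn m) k Hk (yn_pos m)). assert (Hpi := PI_RGT_0).
  apply Ceq_minus in H. revert H. apply cexp_neq_1.
  rewrite !re_scal_l. nra.
Qed.

Lemma den_neq_0 k m : (k < N)%nat -> den k m <> RtoC 0.
Proof.
  intros Hk. apply Cmult_neq_0; [|now apply exp_2PIz_neq_1].
  intros H. apply RtoC_inj in H. assert (H0 := npow_pos m). lra.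
Qed.

Lemma TzB_eq k m : (k < N)%nat ->
  Cmult (Tk N h x (yn m) k) (Cmult (zk N (yn m) k) (Bz (zk N (yn m) k))) =
  Cmult (Cmult (RtoC (pref N h x / 2)) (eik k)) (Cinv (den k m)).
Proof.
  intros Hk. assert (Hpi := PI_RGT_0). assert (Hn := npow_pos m).
  assert (H1 := exp_2PIz_neq_1 k m Hk).
  assert (Hz := half_plane_neq_0 _ (Re_zk_pos N (yn m) k Hk (yn_pos m))).
  rewrite Tk_eq. unfold Bz, den.
  replace (Cmult (RtoC (2 * PI)) (zk N (yn m) k)) with (Cmult (RtoC 2) (Cmult (RtoC PI) (zk N (yn m) k)))
    by (rewrite RtoC_mult; ring).
  set (Ee := Cminus _ _) in *.
  replace (RtoC (pref N h x / (2 * PI) / npow N h (S m))) with (Cdiv (RtoC (pref N h x / 2)) (Cmult (RtoC PI) (RtoC (npow N h (S m))))).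
  - assert (Hnc : RtoC (npow N h (S m)) <> RtoC 0) by (intros H; apply RtoC_inj in H; lra).
    assert (Hpc : RtoC PI <> RtoC 0) by (intros H; apply RtoC_inj in H; lra).
    field. repeat split; assumption.
  - rewrite <- RtoC_mult, <- RtoC_div by nra. f_equal. field. lra.
Qed.

(** The exponential of a positive multiple of [n^(1/N)] beats every power of [n]. Exponent [d = 2]
    gives convergence; [d = 3] leaves room for the factor [n] that a change of [a] in the phase
    costs. *)
Lemma den_decay d k : (k < N)%nat -> exists c, 0 <= c /\ forall m, Cmod (Cinv (den k m)) <= c / INR (S m) ^ d.
Proof.
  intros Hk. assert (HNr : 1 <= INR N) by (apply (le_INR 1); lia).
  assert (Hpi := PI_RGT_0). assert (Hcos := cos_ang_pos N k Hk). assert (Hc0 := coef_pos).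
  set (b := 2 * PI * cos (ang N k)). assert (Hb : 0 < b) by (unfold b; nra).
  (* [N * q] powers of [v], which is proportional to [n^(1/N)], give [n^q]; of these, [e] compensate
     [npow], which is at least [n^(-e)]. *)
  set (e := Z.to_nat (Z.abs (1 - 2 * h))). set (q := (e + d)%nat).
  destruct (pow_exp_bound (N * q)) as [c [Hc HE]].
  set (v := fun m => b * yn m).
  assert (Hv : forall m, 0 < v m) by (intros m; apply Rmult_lt_0_compat; [exact Hb|apply yn_pos]).
  set (kap := b ^ (N * q) * (2 * PI / x) ^ q).
  assert (Hkap : 0 < kap) by (apply Rmult_lt_0_compat; now apply pow_lt).
  assert (Hvp : forall m, v m ^ (N * q) = kap * INR (S m) ^ q).
  { intros m. unfold v. rewrite Rpow_mult_distr, (pow_mult (yn m)). assert (E := cm_yn m). rewrite Rmult_1_l in E. rewrite <- E.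
    unfold cm. rewrite <- INR_IZR_INZ. replace (2 * PI * INR (S m) / x) with (2 * PI / x * INR (S m)) by (unfold Rdiv; ring).
    rewrite Rpow_mult_distr. unfold kap. ring. }
  set (del := 1 - exp (- v 0%nat)).
  assert (Hdel : 0 < del).
  { unfold del. assert (H := exp_increasing (- v 0%nat) 0). rewrite exp_0 in H. specialize (Hv 0%nat). assert (exp (- v 0%nat) < 1) by (apply H; lra). lra. }
  exists (c / (del * kap)). split; [apply Rdiv_le_0_compat; nra|].
  intros m. set (n := INR (S m)). assert (Hn : 1 <= n) by (unfold n; apply (le_INR 1); lia).
  assert (Hnp := npow_pos m).
  rewrite Cmod_inv by now apply den_neq_0. unfold den. rewrite Cmod_mult, Cmod_R, Rabs_pos_eq by lra.
  set (w := Cmult (RtoC 2) (Cmult (RtoC PI) (zk N (yn m) k))).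
  assert (Ew : Re w = v m) by (unfold w, v, b; rewrite !re_scal_l, Re_zk; ring).
  assert (H1 : exp (v m) - 1 <= Cmod (Cminus (cexp w) (RtoC 1))).
  { assert (H := Cmod_triangle_inv (cexp w) (Copp (RtoC 1))). rewrite Cmod_opp, Cmod_1, Cmod_cexp, Ew in H. exact H. }
  assert (Hvm : v 0%nat <= v m).
  { unfold v. apply Rmult_le_compat_l; [lra|]. rewrite !yn_eq. apply Rle_Rpower_l; [left; apply Rinv_0_lt_compat; lra|].
    change (INR 1) with 1. fold n. split; nra. }
  assert (H2 : exp (v m) * del <= exp (v m) - 1).
  { unfold del. assert (Hm : exp (v m) * exp (- v m) = 1) by (rewrite <- exp_plus, Rplus_opp_r; apply exp_0).
    assert (He : exp (- v m) <= exp (- v 0%nat)).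
    { destruct Hvm as [Hl|He]; [left; apply exp_increasing; lra|rewrite He; lra]. }
    assert (P := exp_pos (v m)). nra. }
  assert (H3 : kap * n ^ q <= c * exp (v m)).
  { assert (HEm := HE (v m) ltac:(specialize (Hv m); lra)).
    assert (Hm : exp (v m) * exp (- v m) = 1) by (rewrite <- exp_plus, Rplus_opp_r; apply exp_0).
    assert (P := exp_pos (v m)).
    assert (Hi : v m ^ (N * q) <= (1 + v m) ^ (N * q)) by (apply pow_incr; specialize (Hv m); lra).
    rewrite Hvp in Hi. fold n in Hi.
    replace (kap * n ^ q) with (exp (v m) * exp (- v m) * (kap * n ^ q)) by (rewrite Hm; ring).
    apply Rle_trans with (exp (v m) * ((1 + v m) ^ (N * q) * exp (- v m))).
    - replace (exp (v m) * ((1 + v m) ^ (N * q) * exp (- v m))) with (exp (v m) * exp (- v m) * (1 + v m) ^ (N * q)) by ring.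
      rewrite Hm, !Rmult_1_l. exact Hi.
    - rewrite (Rmult_comm c). apply Rmult_le_compat_l; lra. }
  assert (H4 : / n ^ e <= npow N h (S m)).
  { unfold npow. fold n. rewrite <- Rpower_pow by lra. rewrite <- Rpower_Ropp.
    apply Rle_Rpower; [exact Hn|]. unfold e. rewrite INR_IZR_INZ, Z2Nat.id by lia.
    rewrite <- opp_IZR.
    apply Rmult_le_reg_r with (INR N); [lra|]. unfold Rdiv. rewrite Rmult_assoc, Rinv_l, Rmult_1_r by lra.
    assert (Hz : IZR (- Z.abs (1 - 2 * h)) <= 0) by (apply (IZR_le _ 0); lia).
    apply Rle_trans with (IZR (- Z.abs (1 - 2 * h))); [nra|]. apply IZR_le. lia. }
  set (CM := Cmod (Cminus (cexp w) (RtoC 1))) in *.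
  assert (Hne : 0 < n ^ e) by (apply pow_lt; lra).
  assert (Hq : n ^ q = n ^ e * n ^ d) by (unfold q; apply pow_add).
  assert (P := exp_pos (v m)).
  assert (HCM : 0 < CM) by nra.
  assert (Hinv : 1 <= n ^ e * npow N h (S m)).
  { replace 1 with (n ^ e * / n ^ e) by (field; lra). apply Rmult_le_compat_l; lra. }
  assert (H5 : del * kap * n ^ d <= c * (npow N h (S m) * CM)).
  { assert (H6 : kap * n ^ q * del <= c * CM).
    { apply Rle_trans with (c * exp (v m) * del); [apply Rmult_le_compat_r; lra|].
      rewrite Rmult_assoc. apply Rmult_le_compat_l; lra. }
    rewrite Hq in H6.
    assert (H7 : del * kap * n ^ d * 1 <= del * kap * n ^ d * (n ^ e * npow N h (S m))).
    { apply Rmult_le_compat_l; [|exact Hinv]. apply Rmult_le_pos; [nra|apply pow_le; lra]. }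
    assert (H8 : npow N h (S m) * (kap * (n ^ e * n ^ d) * del) <= npow N h (S m) * (c * CM)) by (apply Rmult_le_compat_l; lra).
    lra. }
  assert (Hnd : 0 < n ^ d) by (apply pow_lt; lra).
  assert (HD : 0 < npow N h (S m) * CM) by now apply Rmult_lt_0_compat.
  apply Rmult_le_reg_r with (npow N h (S m) * CM * (del * kap * n ^ d)); [apply Rmult_lt_0_compat; [exact HD|]; apply Rmult_lt_0_compat; [nra|exact Hnd]|].
  replace (/ (npow N h (S m) * CM) * (npow N h (S m) * CM * (del * kap * n ^ d))) with (del * kap * n ^ d) by (field; lra).
  replace (c / (del * kap) / n ^ d * (npow N h (S m) * CM * (del * kap * n ^ d))) with (c * (npow N h (S m) * CM)) by (field; lra).
  exact H5.
Qed.

Lemma wz_pos a m : wz a (Z.of_nat (S m)) = Cplus (RtoC (cos (2 * PI * INR (S m) * a))) (Cmult Ci (RtoC (sin (2 * PI * INR (S m) * a)))).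
Proof. unfold wz. rewrite <- INR_IZR_INZ. apply ei_eq. Qed.

Lemma wz_neg a m : wz a (- Z.of_nat (S m)) = Cminus (RtoC (cos (2 * PI * INR (S m) * a))) (Cmult Ci (RtoC (sin (2 * PI * INR (S m) * a)))).
Proof.
  unfold wz. rewrite opp_IZR, <- INR_IZR_INZ.
  replace (2 * PI * - INR (S m) * a) with (- (2 * PI * INR (S m) * a)) by ring.
  rewrite ei_eq, cos_neg, sin_neg, RtoC_opp. ring.
Qed.

(** Since [dm] is 0 at [m = 0], the symmetric sums are partial sums of an ordinary series over
    [n >= 1], the form used in the statement. *)
Lemma zsum_pairs a (u : nat -> C) :
  (forall m, Cplus (Cmult (wz a (Z.of_nat (S m))) (dm N h x (Z.of_nat (S m))))
                   (Cmult (wz a (- Z.of_nat (S m))) (dm N h x (- Z.of_nat (S m)))) = u m) ->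
  forall M, zsum (fun m => Cmult (wz a m) (dm N h x m)) M = csum u M.
Proof.
  intros Hu. induction M as [|M IH]; cbn [zsum csum].
  - unfold dm. destruct (Z.eq_dec 0 0); [ring|lia].
  - rewrite IH, Hu. reflexivity.
Qed.

End Terms.

Lemma rsum_const c n : rsum (fun _ => c) n = INR n * c.
Proof. induction n as [|n IH]; [simpl; ring|]. cbn [rsum]. rewrite IH, S_INR. ring. Qed.

Lemma sg1_succ k : sg1 (k + 1) = - sg1 k.
Proof. rewrite sg1_add. unfold sg1 at 2. simpl. ring. Qed.

Lemma sum_n_pred (f : nat -> C) N : (0 < N)%nat -> sum_n f (N - 1) = csum f N.
Proof. intros HN. rewrite sum_n_csum. f_equal. lia. Qed.

Lemma zvanish_of_bound (d : Z -> C) e : is_lim_seq e 0 ->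
  (forall m, Cmod (d (Z.of_nat (S m))) <= e m) -> (forall m, Cmod (d (- Z.of_nat (S m))%Z) <= e m) -> zvanish d.
Proof.
  intros He H1 H2. split; apply clim_decr_1; apply clim_squeeze with e; auto; intros m.
  - replace (Cminus (d (Z.of_nat (S m))) (RtoC 0)) with (d (Z.of_nat (S m))) by ring. apply H1.
  - replace (Cminus (d (- Z.of_nat (S m))%Z) (RtoC 0)) with (d (- Z.of_nat (S m))%Z) by ring. apply H2.
Qed.

Lemma ex_common_bound (u : nat -> nat -> R) N : 
  (forall k, (k < N)%nat -> exists c, 0 <= c /\ forall m, u k m <= c / INR (S m) ^ 2) ->
  exists c, 0 <= c /\ forall k m, (k < N)%nat -> u k m <= c / INR (S m) ^ 2.
Proof.
  induction N as [|N IH]; intros H.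
  - exists 0. split; [lra|]. intros; lia.
  - destruct IH as [c1 [Hc1 H1]]; [intros; apply H; lia|]. destruct (H N ltac:(lia)) as [c2 [Hc2 H2]].
    exists (c1 + c2). split; [lra|]. intros k m Hk.
    assert (Hs : 0 < / INR (S m) ^ 2) by (apply Rinv_0_lt_compat, pow_lt, lt_0_INR; lia).
    destruct (Nat.eq_dec k N) as [->|Hne].
    + specialize (H2 m). unfold Rdiv in *. nra.
    + specialize (H1 k m ltac:(lia)). unfold Rdiv in *. nra.
Qed.

Lemma is_lim_seq_inv_sq c : 0 <= c -> is_lim_seq (fun m => c / INR (S m) ^ 2) 0.
Proof.
  intros Hc. apply is_lim_seq_le_le with (fun _ => 0) (fun m => c / INR (S m)).
  - intros m. assert (Hs : 1 <= INR (S m)) by (apply (le_INR 1); lia).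
    split; [apply Rdiv_le_0_compat; [exact Hc|apply pow_lt; lra]|].
    unfold Rdiv. apply Rmult_le_compat_l; [exact Hc|]. apply Rinv_le_contravar; nra.
  - apply is_lim_seq_const.
  - apply is_lim_seq_div_INR.
Qed.

(** * The expansion for even N *)

Section Even.
Variables (N : nat) (h : Z) (x : R) (n : nat).
Hypothesis HN : (0 < N)%nat.
Hypothesis Hx : 0 < x.
Hypothesis Hh : (2 * h < Z.of_nat N)%Z.
Hypothesis Hn : N = (2 * n)%nat.

Lemma jeven_eq k : jeven N k = (Z.of_nat k - Z.of_nat n)%Z.
Proof. unfold jeven. rewrite Hn, (Nat.mul_comm 2 n), Nat.div_mul by lia. reflexivity. Qed.

Lemma jeven_ang k : PI * (IZR (jeven N k) + / 2) / INR N = ang N k.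
Proof.
  assert (HNr : 0 < INR N) by now apply lt_0_INR.
  rewrite jeven_eq. unfold ang. rewrite minus_IZR, <- !INR_IZR_INZ.
  rewrite Hn, mult_INR in *. simpl (INR 2) in *. field. lra.
Qed.

Lemma even_term_eq a k m : even_term N h x a (jeven N k) m =
  Cdiv (Cplus (RtoC (cos (2 * PI * INR (S m) * a)))
    (Cmult (0, - sg1 (Z.of_nat k)) (RtoC (sin (2 * PI * INR (S m) * a))))) (den N h x k m).
Proof.
  unfold even_term. rewrite (A_eq N x HN Hx _ k m (jeven_ang k)). unfold den.
  replace (jeven N k + Z.of_nat (N / 2) + 1)%Z with (Z.of_nat k + 1)%Z.
  - change (powerRZ (-1) (Z.of_nat k + 1)) with (sg1 (Z.of_nat k + 1)). rewrite sg1_succ. reflexivity.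
  - unfold jeven. lia.
Qed.

Lemma S_even_eq a : S_even N h x a =
  csum (fun k => Cmult (Cmult (RtoC (pref N h x)) (eik N h k)) (cSeries (even_term N h x a (jeven N k)))) N.
Proof.
  unfold S_even. rewrite sum_n_pred by exact HN. cbv zeta. rewrite <- csum_scal. apply csum_ext. intros k _.
  rewrite Cmult_assoc. do 2 f_equal. unfold eik, ei. do 2 f_equal. rewrite <- jeven_ang. field.
  apply not_0_INR. lia.
Qed.

Lemma even_term_bound : exists c, 0 <= c /\ forall a k m, (k < N)%nat ->
  Cmod (even_term N h x a (jeven N k) m) <= c / INR (S m) ^ 2.
Proof.
  destruct (ex_common_bound (fun k m => Cmod (Cinv (den N h x k m))) N) as [c [Hc H]].
  { intros k Hk. apply (den_decay N h x HN Hx 2 k Hk). }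
  exists (2 * c). split; [lra|]. intros a k m Hk. rewrite even_term_eq. unfold Cdiv. rewrite Cmod_mult.
  specialize (H k m Hk). assert (H0 := Cmod_ge_0 (Cinv (den N h x k m))).
  assert (H1 : Cmod (Cplus (RtoC (cos (2 * PI * INR (S m) * a)))
    (Cmult (0, - sg1 (Z.of_nat k)) (RtoC (sin (2 * PI * INR (S m) * a))))) <= 2).
  { eapply Rle_trans; [apply Cmod_le_abs|].
    replace (Re _) with (cos (2 * PI * INR (S m) * a)) by (unfold Re; simpl; ring).
    replace (Im _) with (- sg1 (Z.of_nat k) * sin (2 * PI * INR (S m) * a)) by (unfold Im; simpl; ring).
    assert (Hs : Rabs (- sg1 (Z.of_nat k) * sin (2 * PI * INR (S m) * a)) <= 1).
    { rewrite Rabs_mult, Rabs_Ropp. replace (Rabs (sg1 (Z.of_nat k))) with 1.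
      - rewrite Rmult_1_l. apply Rabs_le, SIN_bound.
      - destruct (sg1_cases (Z.of_nat k)) as [E|E]; rewrite E; unfold Rabs; destruct (Rcase_abs _); lra. }
    assert (Hc' : Rabs (cos (2 * PI * INR (S m) * a)) <= 1) by apply Rabs_le, COS_bound. lra. }
  replace (2 * c / INR (S m) ^ 2) with (2 * (c / INR (S m) ^ 2)) by (unfold Rdiv; ring).
  apply Rmult_le_compat; [apply Cmod_ge_0|exact H0|exact H1|exact H].
Qed.

Lemma even_cex_series a k : (k < N)%nat -> cex_series (even_term N h x a (jeven N k)).
Proof.
  intros Hk. destruct even_term_bound as [c [Hc H]]. apply cex_series_of_inv_sq with c. intros m. now apply H.
Qed.

Lemma dm_even_sides m :
  dm N h x (Z.of_nat (S m)) = csum (fun k => Cmult (RtoC (1 - sg1 (Z.of_nat k)))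
    (Cmult (Cmult (RtoC (pref N h x / 2)) (eik N h k)) (Cinv (den N h x k m)))) N /\
  dm N h x (- Z.of_nat (S m)) = csum (fun k => Cmult (RtoC (1 + sg1 (Z.of_nat k)))
    (Cmult (Cmult (RtoC (pref N h x / 2)) (eik N h k)) (Cinv (den N h x k m)))) N.
Proof.
  split.
  - rewrite (dm_even N h x HN Hx Hh n _ 1 Hn) by first [lia|apply cm_yn; assumption|ring].
    fold (yn N x m).
    apply csum_ext. intros k Hk. rewrite (TzB_eq N h x HN Hx k m Hk). do 2 f_equal. ring.
  - rewrite (dm_even N h x HN Hx Hh n _ (-1) Hn) by first [lia|apply cm_yn_opp; assumption|ring].
    rewrite ym_opp. fold (yn N x m).
    apply csum_ext. intros k Hk. rewrite (TzB_eq N h x HN Hx k m Hk). do 2 f_equal. ring.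
Qed.

Lemma zvanish_dm_even : zvanish (dm N h x).
Proof.
  destruct (ex_common_bound (fun k m => Cmod (Cinv (den N h x k m))) N) as [c [Hc H]].
  { intros k Hk. apply (den_decay N h x HN Hx 2 k Hk). }
  assert (G : forall s m, (forall k, Rabs (s k) <= 2) ->
    Cmod (csum (fun k => Cmult (RtoC (s k)) (Cmult (Cmult (RtoC (pref N h x / 2)) (eik N h k)) (Cinv (den N h x k m)))) N) <=
    INR N * (Rabs (pref N h x) * c) / INR (S m) ^ 2).
  { intros s m Hs. eapply Rle_trans; [apply Cmod_csum|].
    eapply Rle_trans; [apply rsum_le with (g := fun _ => Rabs (pref N h x) * c / INR (S m) ^ 2)|].
    - intros k Hk. rewrite !Cmod_mult, !Cmod_R. unfold eik. rewrite Cmod_ei, Rmult_1_r.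
      specialize (H k m Hk). specialize (Hs k).
      unfold Rdiv at 1. rewrite Rabs_mult, (Rabs_pos_eq (/ 2)) by lra.
      assert (P := Rabs_pos (pref N h x)). assert (P2 := Cmod_ge_0 (Cinv (den N h x k m))). assert (P3 := Rabs_pos (s k)).
      replace (Rabs (pref N h x) * c / INR (S m) ^ 2) with (2 * (Rabs (pref N h x) * / 2 * (c / INR (S m) ^ 2))) by (field; apply not_0_INR; lia).
      apply Rmult_le_compat; [exact P3|apply Rmult_le_pos; [lra|exact P2]|exact Hs|].
      apply Rmult_le_compat_l; lra.
    - right. rewrite rsum_const. unfold Rdiv. ring. }
  apply zvanish_of_bound with (fun m => INR N * (Rabs (pref N h x) * c) / INR (S m) ^ 2).
  - apply is_lim_seq_inv_sq. apply Rmult_le_pos; [apply pos_INR|]. apply Rmult_le_pos; [apply Rabs_pos|exact Hc].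
  - intros m. rewrite (proj1 (dm_even_sides m)). apply (G (fun k => 1 - sg1 (Z.of_nat k))).
    intros k. destruct (sg1_cases (Z.of_nat k)) as [E|E]; rewrite E; unfold Rabs; destruct (Rcase_abs _); lra.
  - intros m. rewrite (proj2 (dm_even_sides m)). apply (G (fun k => 1 + sg1 (Z.of_nat k))).
    intros k. destruct (sg1_cases (Z.of_nat k)) as [E|E]; rewrite E; unfold Rabs; destruct (Rcase_abs _); lra.
Qed.

(** With [w = e^{2 pi i n a}] and [s = (-1)^k], the pair [n], [-n] gives
    [((1-s) w + (1+s)/w)/2 = cos - i s sin], the numerator of the statement. The limit is then split
    over the finitely many [k], each series being convergent. *)
Lemma Phi_even a : 0 < a < 1 -> RtoC (Phi N h x a) = S_even N h x a.
Proof.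
  intros Ha. assert (L := Phi_expansion N h x HN Hx Hh a Ha zvanish_dm_even).
  set (u := fun m => csum (fun k => Cmult (Cmult (RtoC (pref N h x)) (eik N h k)) (even_term N h x a (jeven N k) m)) N).
  assert (Hu := zsum_pairs N h x HN a u).
  assert (L2 : clim (zsum (fun m => Cmult (wz a m) (dm N h x m))) (S_even N h x a)).
  { eapply clim_ext; [intros M; symmetry; apply Hu|].
    - intros m. rewrite wz_pos, wz_neg. destruct (dm_even_sides m) as [E1 E2]. rewrite E1, E2.
      rewrite <- !csum_scal, <- csum_plus. apply csum_ext. intros k Hk. rewrite even_term_eq.
      assert (Hd := den_neq_0 N h x k m Hk).
      replace (0, - sg1 (Z.of_nat k)) with (Copp (Cmult Ci (RtoC (sg1 (Z.of_nat k))))) by (apply C_ext; unfold Re, Im; simpl; ring).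
      rewrite RtoC_minus, RtoC_plus, RtoC_div by lra.
      field. exact Hd.
    - rewrite S_even_eq. unfold u.
      eapply clim_ext; [intros M; symmetry; apply (csum_swap (fun m k => Cmult (Cmult (RtoC (pref N h x)) (eik N h k)) (even_term N h x a (jeven N k) m)))|].
      apply (clim_csum (fun M k => csum (fun m => Cmult (Cmult (RtoC (pref N h x)) (eik N h k)) (even_term N h x a (jeven N k) m)) M)).
      intros k Hk. eapply clim_ext; [intros M; symmetry; apply csum_scal|].
      apply clim_scal, clim_cSeries. now apply even_cex_series. }
  exact (clim_unique _ _ _ L L2).
Qed.

End Even.

Lemma cex_series_ext u v : (forall m, u m = v m) -> cex_series u -> cex_series v.
Proof. intros E [H1 H2]. split; [eapply ex_series_ext; [|exact H1]|eapply ex_series_ext; [|exact H2]]; intros m; cbv beta; now rewrite E. Qed.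

Lemma cex_series_plus u v : cex_series u -> cex_series v -> cex_series (fun m => Cplus (u m) (v m)).
Proof. intros [A1 A2] [B1 B2]. split; apply (ex_series_plus (V := R_NormedModule)); assumption. Qed.

Lemma cex_series_scal_RtoC (c : C) (r : nat -> R) : ex_series r -> cex_series (fun m => Cmult c (RtoC (r m))).
Proof.
  intros H. split.
  - apply ex_series_ext with (fun m => scal (Re c) (r m)).
    + intros m. unfold scal, mult, Re; simpl. unfold mult; simpl. ring.
    + apply (ex_series_scal (V := R_NormedModule)). exact H.
  - apply ex_series_ext with (fun m => scal (Im c) (r m)).
    + intros m. unfold scal, mult, Im; simpl. unfold mult; simpl. ring.
    + apply (ex_series_scal (V := R_NormedModule)). exact H.
Qed.

Lemma cex_series_csum (f : nat -> nat -> C) K : (forall j, cex_series (f j)) ->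
  cex_series (fun m => csum (fun j => f j m) K).
Proof.
  intros H. induction K as [|K IH]; cbn [csum].
  - split; exists (rsum (fun _ => 0) 0); apply (is_series_finite (fun _ => 0)); reflexivity.
  - now apply cex_series_plus.
Qed.

(** * The expansion for odd N and the sine series *)

Section Odd.
Variables (N : nat) (h : Z) (x : R) (n : nat).
Hypothesis HN : (0 < N)%nat.
Hypothesis Hx : 0 < x.
Hypothesis Hh0 : (0 <= h)%Z.
Hypothesis Hh : (2 * h < Z.of_nat N)%Z.
Hypothesis Hn : N = (2 * n + 1)%nat.

Lemma jodd_eq k : jodd N k = (Z.of_nat k - Z.of_nat n)%Z.
Proof. unfold jodd. replace (N - 1)%nat with (n * 2)%nat by lia. rewrite Nat.div_mul by lia. reflexivity. Qed.

Lemma jodd_ang k : PI * IZR (jodd N k) / INR N = ang N k.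
Proof.
  assert (HNr : 0 < INR N) by now apply lt_0_INR.
  rewrite jodd_eq. unfold ang. rewrite minus_IZR, <- !INR_IZR_INZ.
  rewrite Hn, plus_INR, mult_INR in *. simpl (INR 2) in *. simpl (INR 1) in *. field. lra.
Qed.

Lemma odd_cos_term_eq a k m : odd_cos_term N h x a (jodd N k) m =
  Cdiv (RtoC (cos (2 * PI * INR (S m) * a))) (den N h x k m).
Proof. unfold odd_cos_term. rewrite (A_eq N x HN Hx _ k m (jodd_ang k)). reflexivity. Qed.

Lemma odd_sin_term_eq a k m : odd_sin_term N h x a (jodd N k) m =
  Cmult (RtoC (sin (2 * PI * INR (S m) * a) / npow N h (S m))) (Lz (zk N (yn N x m) k)).
Proof.
  assert (Hpi := PI_RGT_0).
  unfold odd_sin_term. rewrite (A_eq N x HN Hx _ k m (jodd_ang k)). set (z := zk N (yn N x m) k).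
  replace (Cmult (RtoC (/ PI)) (Cmult (RtoC PI) z)) with z.
  - replace (Cmult (0, / PI) (Cmult (RtoC PI) z)) with (Cmult Ci z); [reflexivity|].
    rewrite Cmult_assoc. f_equal. apply C_ext; unfold Re, Im; simpl; field; lra.
  - rewrite Cmult_assoc, <- RtoC_mult, Rinv_l by lra. ring.
Qed.

Lemma S_odd_eq a : S_odd N h x a =
  csum (fun k => Cmult (Cmult (RtoC (pref N h x)) (eik N h k))
    (Cplus (cSeries (odd_cos_term N h x a (jodd N k)))
      (Cmult (RtoC (- sg1 (Z.of_nat k) / PI)) (cSeries (odd_sin_term N h x a (jodd N k)))))) N.
Proof.
  unfold S_odd. rewrite sum_n_pred by exact HN. cbv zeta. rewrite <- csum_scal. apply csum_ext. intros k _.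
  rewrite Cmult_assoc. f_equal.
  - f_equal. unfold eik, ei. do 2 f_equal. rewrite <- jodd_ang. field. apply not_0_INR. lia.
  - replace (jodd N k + Z.of_nat ((N + 1) / 2))%Z with (Z.of_nat k + 1)%Z.
    + change (powerRZ (-1) (Z.of_nat k + 1)) with (sg1 (Z.of_nat k + 1)). now rewrite sg1_succ.
    + rewrite jodd_eq. replace (N + 1)%nat with ((n + 1) * 2)%nat by lia. rewrite Nat.div_mul by lia. lia.
Qed.

Lemma odd_cos_cex_series a k : (k < N)%nat -> cex_series (odd_cos_term N h x a (jodd N k)).
Proof.
  intros Hk. destruct (den_decay N h x HN Hx 2 k Hk) as [c [Hc H]]. apply cex_series_of_inv_sq with c.
  intros m. rewrite odd_cos_term_eq. unfold Cdiv. rewrite Cmod_mult, Cmod_R.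
  specialize (H m). assert (H0 := Cmod_ge_0 (Cinv (den N h x k m))).
  assert (Hc' : Rabs (cos (2 * PI * INR (S m) * a)) <= 1) by apply Rabs_le, COS_bound.
  assert (Hc0 := Rabs_pos (cos (2 * PI * INR (S m) * a))). nra.
Qed.

(** The factor of [sin(2 pi n a)] in the [j]-th term of the expansion of [Lz]: up to a constant it
    is [n^(-(2h+1+j)/N)]. It decreases to 0 because [h >= 0], but need not be summable. *)
Definition al (j m : nat) : R := / (npow N h (S m) * yn N x m ^ (j + 2)).

Lemma al_pos j m : 0 < al j m.
Proof.
  apply Rinv_0_lt_compat, Rmult_lt_0_compat; [apply Rpower_pos|]. apply pow_lt. apply Rpower_pos.
Qed.

Lemma al_eq j m : al j m = Rpower (2 * PI / x) (- (INR (j + 2) / INR N)) *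
  Rpower (INR (S m)) (- (IZR (2 * h + 1 + Z.of_nat j) / INR N)).
Proof.
  assert (HNr : 0 < INR N) by now apply lt_0_INR.
  assert (Hs : 0 < INR (S m)) by (apply lt_0_INR; lia). assert (Hc := coef_pos x Hx).
  unfold al, npow. rewrite yn_eq by assumption. rewrite <- Rpower_pow by apply Rpower_pos.
  rewrite Rpower_mult, <- Rpower_mult_distr by assumption.
  replace (Rpower (INR (S m)) (- (IZR (2 * h + 1 + Z.of_nat j) / INR N))) with
    (Rpower (INR (S m)) (- (IZR (2 * h - 1) / INR N) + - (/ INR N * INR (j + 2)))).
  - rewrite Rpower_plus, !Rpower_Ropp.
    replace (INR (j + 2) / INR N) with (/ INR N * INR (j + 2)) by (unfold Rdiv; ring).
    field. repeat split; apply Rgt_not_eq, Rpower_pos.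
  - f_equal. rewrite plus_INR, !plus_IZR, minus_IZR, <- INR_IZR_INZ. simpl (INR 2). field. lra.
Qed.

Lemma al_lim j : is_lim_seq (al j) 0.
Proof.
  eapply is_lim_seq_ext; [intros m; symmetry; apply al_eq|].
  replace (Finite 0) with (Finite (Rpower (2 * PI / x) (- (INR (j + 2) / INR N)) * 0)) by (f_equal; ring).
  apply is_lim_seq_mult'; [apply is_lim_seq_const|]. apply is_lim_seq_Rpower_0.
  apply Ropp_lt_gt_0_contravar. apply Rdiv_lt_0_compat; [apply (IZR_lt 0); lia|now apply lt_0_INR].
Qed.

Lemma al_decr j m : al j (S m) <= al j m.
Proof.
  rewrite !al_eq. apply Rmult_le_compat_l; [left; apply Rpower_pos|]. rewrite !Rpower_Ropp.
  apply Rinv_le_contravar; [apply Rpower_pos|]. apply Rle_Rpower_l.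
  - left. apply Rdiv_lt_0_compat; [apply (IZR_lt 0); lia|now apply lt_0_INR].
  - split; [apply lt_0_INR; lia|apply le_INR; lia].
Qed.

Lemma al_bound : exists c, forall m, al (2 * N - 1) m <= c / INR (S m) ^ 2.
Proof.
  assert (HNr : 0 < INR N) by now apply lt_0_INR.
  exists (Rpower (2 * PI / x) (- (INR (2 * N - 1 + 2) / INR N))). intros m. rewrite al_eq. unfold Rdiv at 5.
  apply Rmult_le_compat_l; [left; apply Rpower_pos|].
  assert (Hs : 1 <= INR (S m)) by (apply (le_INR 1); lia).
  rewrite <- Rpower_pow by lra. rewrite <- Rpower_Ropp. apply Rle_Rpower; [exact Hs|].
  apply Ropp_le_contravar. apply Rmult_le_reg_r with (INR N); [exact HNr|].
  unfold Rdiv. rewrite Rmult_assoc, Rinv_l, Rmult_1_r by lra. rewrite !INR_IZR_INZ, <- mult_IZR. apply IZR_le. lia.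
Qed.

Lemma ang_unit k : (k < N)%nat -> 0 < Re (ei (ang N k)) /\ Cmod (ei (ang N k)) = 1.
Proof.
  intros Hk. split; [|apply Cmod_ei]. rewrite ei_eq.
  replace (Re _) with (cos (ang N k)) by (unfold Re; simpl; ring). now apply cos_ang_pos.
Qed.

(** After [2 N] terms of the expansion of [Lz] the remainder is bounded by a multiple of
    [n^(-(2h+2N)/N)], hence of [n^(-2)]. The explicit terms converge by Dirichlet's test, for which
    [0 < a < 1] bounds the partial sums of the sines. *)
Lemma odd_sin_cex_series a k : (k < N)%nat -> 0 < a < 1 -> cex_series (odd_sin_term N h x a (jodd N k)).
Proof.
  intros Hk Ha. destruct (ang_unit k Hk) as [H1 H2].
  destruct (Lz_expansion (ei (ang N k)) (2 * N) H1 H2) as [b [B HB]].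
  set (s := fun m => sin (2 * PI * INR (S m) * a)).
  set (E := fun m => Cminus (Lz (zk N (yn N x m) k)) (csum (fun j => Cdiv (b j) (RtoC (yn N x m ^ (j + 2)))) (2 * N))).
  apply cex_series_ext with (fun m => Cplus (csum (fun j => Cmult (b j) (RtoC (s m * al j m))) (2 * N))
    (Cmult (RtoC (s m / npow N h (S m))) (E m))).
  - intros m. rewrite odd_sin_term_eq. fold (s m). unfold E.
    rewrite (csum_ext _ (fun j => Cmult (RtoC (s m / npow N h (S m))) (Cdiv (b j) (RtoC (yn N x m ^ (j + 2)))))).
    + rewrite csum_scal. ring.
    + intros j _. unfold al. assert (Hy : 0 < yn N x m ^ (j + 2)) by (apply pow_lt, Rpower_pos).
      assert (Hp := npow_pos N h m). rewrite Rinv_mult. unfold Rdiv, Cdiv. rewrite <- RtoC_inv by lra. rewrite !RtoC_mult. ring.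
  - apply cex_series_plus.
    + apply (cex_series_csum (fun j m => Cmult (b j) (RtoC (s m * al j m)))). intros j. apply cex_series_scal_RtoC.
      apply dirichlet_test with (/ sin (PI * a)).
      * intros i. now apply sin_partial_sums_bounded.
      * apply al_decr.
      * apply al_lim.
    + destruct al_bound as [c Hc].
      assert (HB0 : 0 <= B).
      { assert (Hb1 := HB 1 Rlt_0_1). rewrite pow1 in Hb1. assert (P := Cmod_ge_0 (Cminus (Lz (Cmult (RtoC 1) (ei (ang N k))))
          (csum (fun j => Cdiv (b j) (RtoC (1 ^ (j + 2)))) (2 * N)))). lra. }
      apply cex_series_of_inv_sq with (B * c). intros m.
      rewrite Cmod_mult, Cmod_R. assert (Hp := npow_pos N h m). assert (Hy := yn_pos N x m).
      specialize (HB (yn N x m) Hy). fold (zk N (yn N x m) k) in HB. fold (E m) in HB.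
      assert (Hs : Rabs (s m) <= 1) by apply Rabs_le, SIN_bound.
      unfold Rdiv at 1. rewrite Rabs_mult, (Rabs_pos_eq (/ npow N h (S m))) by (left; now apply Rinv_0_lt_compat).
      assert (Hip := Rinv_0_lt_compat _ Hp).
      apply Rle_trans with (/ npow N h (S m) * (B / yn N x m ^ (2 * N + 1))).
      * apply Rmult_le_compat; [apply Rmult_le_pos; [apply Rabs_pos|lra]|apply Cmod_ge_0|nra|exact HB].
      * apply Rle_trans with (B * al (2 * N - 1) m).
        -- right. unfold al. replace (2 * N - 1 + 2)%nat with (2 * N + 1)%nat by lia.
           field. split; [apply pow_nonzero|]; lra.
        -- unfold Rdiv in *. rewrite Rmult_assoc. apply Rmult_le_compat_l; [exact HB0|apply Hc].
Qed.

Definition Tcos (k m : nat) : C := Cmult (Cmult (RtoC (pref N h x / 2)) (eik N h k)) (Cinv (den N h x k m)).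
Definition Tsin (k m : nat) : C :=
  Cmult (Cmult (RtoC (pref N h x / (2 * PI) / npow N h (S m))) (eik N h k)) (Cmult (0, sg1 (Z.of_nat k)) (Lz (zk N (yn N x m) k))).

Lemma dm_odd_sides m :
  dm N h x (Z.of_nat (S m)) = csum (fun k => Cplus (Tcos k m) (Tsin k m)) N /\
  dm N h x (- Z.of_nat (S m)) = csum (fun k => Cminus (Tcos k m) (Tsin k m)) N.
Proof.
  split.
  - rewrite (dm_odd N h x HN Hx Hh n _ 1 Hn Hh0) by first [lia|apply cm_yn; assumption|ring].
    fold (yn N x m).
    apply csum_ext. intros k Hk. rewrite Cmult_plus_distr_l, (TzB_eq N h x HN Hx k m Hk), (Tk_eq N h x HN Hx).
    rewrite Rmult_1_l. reflexivity.
  - rewrite (dm_odd N h x HN Hx Hh n _ (-1) Hn Hh0) by first [lia|apply cm_yn_opp; assumption|ring].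
    rewrite ym_opp. fold (yn N x m).
    apply csum_ext. intros k Hk. rewrite Cmult_plus_distr_l, (TzB_eq N h x HN Hx k m Hk), (Tk_eq N h x HN Hx).
    replace (0, -1 * sg1 (Z.of_nat k)) with (Copp (0, sg1 (Z.of_nat k))) by (apply C_ext; unfold Re, Im; simpl; ring).
    unfold Tcos, Tsin. ring.
Qed.

Lemma Tcos_bound : exists c, 0 <= c /\ forall k m, (k < N)%nat -> Cmod (Tcos k m) <= c / INR (S m) ^ 2.
Proof.
  apply (ex_common_bound (fun k m => Cmod (Tcos k m))). intros k Hk.
  destruct (den_decay N h x HN Hx 2 k Hk) as [c [Hc H]].
  exists (Rabs (pref N h x / 2) * c). split; [apply Rmult_le_pos; [apply Rabs_pos|exact Hc]|].
  intros m. unfold Tcos, eik. rewrite !Cmod_mult, Cmod_R, Cmod_ei, Rmult_1_r. unfold Rdiv at 2. rewrite Rmult_assoc.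
  apply Rmult_le_compat_l; [apply Rabs_pos|apply H].
Qed.

Lemma Tsin_bound k : (k < N)%nat -> exists c, 0 <= c /\ forall m, Cmod (Tsin k m) <= c * al 0 m.
Proof.
  intros Hk. destruct (ang_unit k Hk) as [H1 H2].
  destruct (Lz_expansion (ei (ang N k)) 1 H1 H2) as [b [B HB]].
  set (P := Rabs (pref N h x / (2 * PI))).
  assert (HB0 : 0 <= Cmod (b O) + B).
  { assert (Hb1 := HB 1 Rlt_0_1). rewrite pow1 in Hb1. assert (Q := Cmod_ge_0 (Cminus (Lz (Cmult (RtoC 1) (ei (ang N k))))
      (csum (fun j => Cdiv (b j) (RtoC (1 ^ (j + 2)))) 1))). assert (Q2 := Cmod_ge_0 (b O)). lra. }
  assert (HP : 0 <= P) by apply Rabs_pos.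
  exists (P * (Cmod (b O) + B)). split; [now apply Rmult_le_pos|].
  intros m. assert (Hp := npow_pos N h m). assert (Hy := yn_pos N x m).
  assert (Hy2 : 0 < yn N x m ^ 2) by now apply pow_lt.
  assert (HL : Cmod (Lz (zk N (yn N x m) k)) <= (Cmod (b O) + B) / yn N x m ^ 2).
  { specialize (HB (yn N x m) Hy). fold (zk N (yn N x m) k) in HB. cbn [csum] in HB. simpl (0 + 2)%nat in HB. simpl (1 + 1)%nat in HB.
    assert (Hyc : RtoC (yn N x m ^ 2) <> RtoC 0) by (intros H; apply RtoC_inj in H; lra).
    assert (T := Cmod_triangle (Cminus (Lz (zk N (yn N x m) k)) (Cplus (RtoC 0) (Cdiv (b O) (RtoC (yn N x m ^ 2))))) (Cdiv (b O) (RtoC (yn N x m ^ 2)))).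
    replace (Cplus (Cminus (Lz (zk N (yn N x m) k)) (Cplus (RtoC 0) (Cdiv (b O) (RtoC (yn N x m ^ 2))))) (Cdiv (b O) (RtoC (yn N x m ^ 2)))) with (Lz (zk N (yn N x m) k)) in T by ring.
    rewrite (Cmod_div _ _ Hyc), Cmod_R, (Rabs_pos_eq (yn N x m ^ 2)) in T by lra.
    replace ((Cmod (b O) + B) / yn N x m ^ 2) with (B / yn N x m ^ 2 + Cmod (b O) / yn N x m ^ 2) by (unfold Rdiv; ring). lra. }
  unfold Tsin, eik. rewrite !Cmod_mult, Cmod_R, Cmod_ei, Rmult_1_r.
  replace (Cmod (0, sg1 (Z.of_nat k))) with 1.
  - rewrite Rmult_1_l. unfold Rdiv at 1. rewrite Rabs_mult, (Rabs_pos_eq (/ npow N h (S m))) by (left; now apply Rinv_0_lt_compat).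
    fold P. unfold al. simpl (0 + 2)%nat. rewrite Rinv_mult.
    replace (P * (Cmod (b O) + B) * (/ npow N h (S m) * / yn N x m ^ 2)) with (P * / npow N h (S m) * ((Cmod (b O) + B) / yn N x m ^ 2)) by (unfold Rdiv; ring).
    apply Rmult_le_compat_l; [|exact HL]. apply Rmult_le_pos; [exact HP|left; now apply Rinv_0_lt_compat].
  - replace (0, sg1 (Z.of_nat k)) with (Cmult Ci (RtoC (sg1 (Z.of_nat k)))) by (apply C_ext; unfold Re, Im; simpl; ring).
    rewrite Cmod_mult, Cmod_Ci, Cmod_R. destruct (sg1_cases (Z.of_nat k)) as [E|E]; rewrite E; unfold Rabs; destruct (Rcase_abs _); lra.
Qed.

Lemma Tsin_common_bound : exists c, 0 <= c /\ forall k m, (k < N)%nat -> Cmod (Tsin k m) <= c * al 0 m.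
Proof.
  assert (G : forall K, (K <= N)%nat -> exists c, 0 <= c /\ forall k m, (k < K)%nat -> Cmod (Tsin k m) <= c * al 0 m).
  { induction K as [|K IH]; intros HK.
    - exists 0. split; [lra|]. intros; lia.
    - destruct IH as [c1 [Hc1 H1]]; [lia|]. destruct (Tsin_bound K ltac:(lia)) as [c2 [Hc2 H2]].
      exists (c1 + c2). split; [lra|]. intros k m Hk. assert (Hs := al_pos 0 m).
      destruct (Nat.eq_dec k K) as [->|Hne]; [specialize (H2 m)|specialize (H1 k m ltac:(lia))]; nra. }
  destruct (G N (Nat.le_refl N)) as [c H]. now exists c.
Qed.

(** The part coming from [Lz] is only shown to be [O(n^(-(2h+1)/N))]. Tending to 0 is all that
    summation by parts requires. *)
Lemma zvanish_dm_odd : zvanish (dm N h x).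
Proof.
  destruct Tcos_bound as [c1 [Hc1 H1]]. destruct Tsin_common_bound as [c2 [Hc2 H2]].
  assert (G : forall m (f : nat -> C), (forall k, (k < N)%nat -> Cmod (f k) <= Cmod (Tcos k m) + Cmod (Tsin k m)) ->
    Cmod (csum f N) <= INR N * (c1 / INR (S m) ^ 2 + c2 * al 0 m)).
  { intros m f Hf. eapply Rle_trans; [apply Cmod_csum|]. rewrite <- rsum_const. apply rsum_le. intros k Hk.
    eapply Rle_trans; [now apply Hf|]. apply Rplus_le_compat; auto. }
  apply zvanish_of_bound with (fun m => INR N * (c1 / INR (S m) ^ 2 + c2 * al 0 m)).
  - replace (Finite 0) with (Finite (INR N * (0 + c2 * 0))) by (f_equal; ring).
    apply is_lim_seq_mult'; [apply is_lim_seq_const|]. apply is_lim_seq_plus'; [now apply is_lim_seq_inv_sq|].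
    apply is_lim_seq_mult'; [apply is_lim_seq_const|apply al_lim].
  - intros m. rewrite (proj1 (dm_odd_sides m)). apply G. intros k _. apply Cmod_triangle.
  - intros m. rewrite (proj2 (dm_odd_sides m)). apply G. intros k _.
    unfold Cminus. rewrite <- (Cmod_opp (Tsin k m)). apply Cmod_triangle.
Qed.

(** In the pair [n], [-n] the part with [Bz] keeps the cosine, while the part with [Lz] changes sign
    and keeps [i sin]. Its own factor [i (-1)^k] makes this [-(-1)^k sin], and [-(-1)^k] is the sign
    [(-1)^(j+(N+1)/2)] of the statement. *)
Lemma Phi_odd a : 0 < a < 1 -> RtoC (Phi N h x a) = S_odd N h x a.
Proof.
  intros Ha. assert (L := Phi_expansion N h x HN Hx Hh a Ha zvanish_dm_odd). assert (Hpi := PI_RGT_0).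
  set (v := fun k m => Cmult (Cmult (RtoC (pref N h x)) (eik N h k))
    (Cplus (odd_cos_term N h x a (jodd N k) m) (Cmult (RtoC (- sg1 (Z.of_nat k) / PI)) (odd_sin_term N h x a (jodd N k) m)))).
  set (u := fun m => csum (fun k => v k m) N).
  assert (Hu := zsum_pairs N h x HN a u).
  assert (L2 : clim (zsum (fun m => Cmult (wz a m) (dm N h x m))) (S_odd N h x a)).
  { eapply clim_ext; [intros M; symmetry; apply Hu|].
    - intros m. rewrite wz_pos, wz_neg. destruct (dm_odd_sides m) as [E1 E2]. rewrite E1, E2.
      rewrite <- !csum_scal, <- csum_plus. apply csum_ext. intros k Hk. unfold v. rewrite odd_cos_term_eq, odd_sin_term_eq.
      assert (Hd := den_neq_0 N h x k m Hk). assert (Hp := npow_pos N h m).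
      assert (Hpc : RtoC PI <> RtoC 0) by (intros H; apply RtoC_inj in H; lra).
      assert (Hnc : RtoC (npow N h (S m)) <> RtoC 0) by (intros H; apply RtoC_inj in H; lra).
      assert (Hi2 : Cmult Ci Ci = Copp (RtoC 1)) by (apply C_ext; unfold Re, Im; simpl; ring).
      unfold Tcos, Tsin.
      replace (0, sg1 (Z.of_nat k)) with (Cmult Ci (RtoC (sg1 (Z.of_nat k)))) by (apply C_ext; unfold Re, Im; simpl; ring).
      rewrite !RtoC_div, RtoC_opp, RtoC_mult by lra.
      set (L' := Lz _). set (co := RtoC (cos _)). set (si := RtoC (sin _)). set (sg := RtoC (sg1 _)). set (pr := RtoC (pref _ _ _)).
      set (D := den N h x k m) in *. set (np := RtoC (npow N h (S m))) in *. set (ek := eik N h k).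
      transitivity (Cplus (Cmult (Cmult pr ek) (Cdiv co D)) (Cmult (Cmult (Cmult Ci Ci) (Cmult pr ek)) (Cdiv (Cmult si (Cmult sg L')) (Cmult (RtoC PI) np)))).
      + field. repeat split; assumption.
      + rewrite Hi2. field. repeat split; assumption.
    - rewrite S_odd_eq. unfold u.
      eapply clim_ext; [intros M; symmetry; apply (csum_swap (fun m k => v k m))|].
      apply (clim_csum (fun M k => csum (fun m => v k m) M)).
      intros k Hk. unfold v. eapply clim_ext; [intros M; symmetry; apply csum_scal|]. apply clim_scal.
      eapply clim_ext; [intros M; symmetry; apply csum_plus|]. apply clim_plus.
      + apply clim_cSeries. now apply odd_cos_cex_series.
      + eapply clim_ext; [intros M; symmetry; apply csum_scal|]. apply clim_scal, clim_cSeries. now apply odd_sin_cex_series. }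
  exact (clim_unique _ _ _ L L2).
Qed.

End Odd.

(** * The endpoint a = 1 *)

Lemma Cmod_cSeries_le u c : 0 <= c -> (forall m, Cmod (u m) <= c / INR (S m) ^ 2) -> Cmod (cSeries u) <= 2 * c.
Proof.
  intros Hc H. apply clim_Cmod_le with (csum u); [apply clim_cSeries; now apply cex_series_of_inv_sq with c|].
  exists 1%nat. intros M HM.
  assert (E : Cmod (csum u (S (M - 1))) <= c * (2 - / INR (S (M - 1)))).
  { induction (M - 1)%nat as [|K IH].
    - specialize (H O). cbn [csum]. simpl (INR 1) in *. rewrite Cplus_0_l. lra.
    - change (csum u (S (S K))) with (Cplus (csum u (S K)) (u (S K))).
      eapply Rle_trans; [apply Cmod_triangle|]. specialize (H (S K)).
      rewrite (S_INR (S K)) in *. assert (Hs : 1 <= INR (S K)) by (apply (le_INR 1); lia). set (s := INR (S K)) in *.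
      assert (H4 : / (s + 1) ^ 2 <= / s - / (s + 1)).
      { replace (/ s - / (s + 1)) with (/ (s * (s + 1))) by (field; lra). apply Rinv_le_contravar; nra. }
      assert (H5 : c * / (s + 1) ^ 2 <= c * (/ s - / (s + 1))) by (apply Rmult_le_compat_l; lra).
      unfold Rdiv in H. lra. }
  replace M with (S (M - 1)) by lia. eapply Rle_trans; [exact E|].
  assert (0 < / INR (S (M - 1))) by (apply Rinv_0_lt_compat, lt_0_INR; lia). nra.
Qed.

Lemma cSeries_minus u v : cex_series u -> cex_series v ->
  cSeries (fun m => Cminus (u m) (v m)) = Cminus (cSeries u) (cSeries v).
Proof.
  intros [U1 U2] [V1 V2]. apply C_ext.
  - exact (Series_minus _ _ U1 V1).
  - exact (Series_minus _ _ U2 V2).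
Qed.

Lemma cSeries_lipschitz (f : R -> nat -> C) c : 0 <= c ->
  (forall a, cex_series (f a)) ->
  (forall a b m, Cmod (Cminus (f a m) (f b m)) <= c * Rabs (a - b) / INR (S m) ^ 2) ->
  forall a b, Cmod (Cminus (cSeries (f a)) (cSeries (f b))) <= 2 * c * Rabs (a - b).
Proof.
  intros Hc Hex H a b. rewrite <- cSeries_minus by apply Hex. rewrite Rmult_assoc.
  apply Cmod_cSeries_le; [apply Rmult_le_pos; [exact Hc|apply Rabs_pos]|]. intros m. apply H.
Qed.

Lemma lipschitz_of_derive (f df : R -> R) : (forall t, is_derive f t (df t)) -> (forall t, Rabs (df t) <= 1) ->
  forall u v, Rabs (f u - f v) <= Rabs (u - v).
Proof.
  intros Hd Hb u v. destruct (MVT_gen f v u df) as [t [_ E]].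
  - intros t _. apply Hd.
  - intros t _. apply is_derive_continuity_pt with (df t). apply Hd.
  - rewrite E, Rabs_mult. specialize (Hb t). assert (P := Rabs_pos (u - v)). nra.
Qed.

Lemma cos_lipschitz u v : Rabs (cos u - cos v) <= Rabs (u - v).
Proof.
  apply (lipschitz_of_derive cos (fun t => - sin t)); [apply is_derive_cos|].
  intros t. rewrite Rabs_Ropp. apply Rabs_le, SIN_bound.
Qed.

Lemma sin_lipschitz u v : Rabs (sin u - sin v) <= Rabs (u - v).
Proof.
  apply (lipschitz_of_derive sin cos); [apply is_derive_sin|]. intros t. apply Rabs_le, COS_bound.
Qed.

Lemma phase_diff a b m : Rabs (2 * PI * INR (S m) * a - 2 * PI * INR (S m) * b) = 2 * PI * INR (S m) * Rabs (a - b).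
Proof.
  assert (Hpi := PI_RGT_0). rewrite <- Rmult_minus_distr_l, Rabs_mult, (Rabs_pos_eq (2 * PI * INR (S m))); [reflexivity|].
  assert (H := pos_INR (S m)). nra.
Qed.

Lemma csum_lipschitz (F : nat -> R -> C) N :
  (forall k, (k < N)%nat -> exists c, forall a b, Cmod (Cminus (F k a) (F k b)) <= c * Rabs (a - b)) ->
  exists c, forall a b, Cmod (Cminus (csum (fun k => F k a) N) (csum (fun k => F k b) N)) <= c * Rabs (a - b).
Proof.
  induction N as [|N IH]; intros H; cbn [csum].
  - exists 0. intros a b. replace (Cminus (RtoC 0) (RtoC 0)) with (RtoC 0) by ring. rewrite Cmod_0. right; ring.
  - destruct IH as [c1 H1]; [intros; apply H; lia|]. destruct (H N ltac:(lia)) as [c2 H2].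
    exists (c1 + c2). intros a b.
    replace (Cminus (Cplus (csum (fun k => F k a) N) (F N a)) (Cplus (csum (fun k => F k b) N) (F N b))) with
      (Cplus (Cminus (csum (fun k => F k a) N) (csum (fun k => F k b) N)) (Cminus (F N a) (F N b))) by ring.
    eapply Rle_trans; [apply Cmod_triangle|]. specialize (H1 a b). specialize (H2 a b). lra.
Qed.

Lemma scal_lipschitz (p : C) (F : R -> C) : (exists c, forall a b, Cmod (Cminus (F a) (F b)) <= c * Rabs (a - b)) ->
  exists c, forall a b, Cmod (Cminus (Cmult p (F a)) (Cmult p (F b))) <= c * Rabs (a - b).
Proof.
  intros [c H]. exists (Cmod p * c). intros a b.
  replace (Cminus (Cmult p (F a)) (Cmult p (F b))) with (Cmult p (Cminus (F a) (F b))) by ring.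
  rewrite Cmod_mult, Rmult_assoc. apply Rmult_le_compat_l; [apply Cmod_ge_0|apply H].
Qed.

Lemma le_linear_eq_0 r c d0 : 0 < d0 -> (forall d, 0 < d <= d0 -> r <= c * d) -> r <= 0.
Proof.
  intros Hd H. destruct (Rle_lt_dec r 0) as [H0|H0]; [exact H0|exfalso].
  assert (Hc : 0 < Rabs c + 1) by (assert (P := Rabs_pos c); lra).
  set (d := Rmin d0 (r / (2 * (Rabs c + 1)))).
  assert (Hr : 0 < r / (2 * (Rabs c + 1))) by (apply Rdiv_lt_0_compat; lra).
  assert (Hd1 : 0 < d) by (apply Rmin_pos; assumption).
  assert (H1 := H d (conj Hd1 (Rmin_l _ _))). assert (H2 : d <= r / (2 * (Rabs c + 1))) by apply Rmin_r.
  assert (H3 : c <= Rabs c) by apply Rle_abs.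
  assert (H4 : d * (2 * (Rabs c + 1)) <= r).
  { apply Rle_trans with (r / (2 * (Rabs c + 1)) * (2 * (Rabs c + 1))); [apply Rmult_le_compat_r; lra|right; field; lra]. }
  nra.
Qed.

Lemma C_eq_of_lipschitz (z w : C) c d0 : 0 < d0 -> (forall d, 0 < d <= d0 -> Cmod (Cminus z w) <= c * d) -> z = w.
Proof.
  intros Hd H. apply Ceq_minus, Cmod_eq_0. apply Rle_antisym; [|apply Cmod_ge_0]. now apply le_linear_eq_0 with c d0.
Qed.

Section EvenEnd.
Variables (N : nat) (h : Z) (x : R) (n : nat).
Hypothesis HN : (0 < N)%nat.
Hypothesis Hx : 0 < x.
Hypothesis Hh : (2 * h < Z.of_nat N)%Z.
Hypothesis Hn : N = (2 * n)%nat.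

(** Moving [a] changes the phase at rate [2 pi n]; this factor [n] is paid for by [den_decay] with
    exponent 3. *)
Lemma S_even_lipschitz : exists c, forall a b, Cmod (Cminus (S_even N h x a) (S_even N h x b)) <= c * Rabs (a - b).
Proof.
  assert (Hpi := PI_RGT_0).
  destruct (csum_lipschitz (fun k a => Cmult (Cmult (RtoC (pref N h x)) (eik N h k)) (cSeries (even_term N h x a (jeven N k)))) N) as [c H].
  - intros k Hk. apply scal_lipschitz. destruct (den_decay N h x HN Hx 3 k Hk) as [c [Hc H]].
    exists (2 * (c * (4 * PI))). apply cSeries_lipschitz; [nra| |].
    + intros a. now apply even_cex_series with n.
    + intros a b m. rewrite !(even_term_eq N h x n) by assumption.
      set (ca := cos (2 * PI * INR (S m) * a)). set (sa := sin (2 * PI * INR (S m) * a)).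
      set (cb := cos (2 * PI * INR (S m) * b)). set (sb := sin (2 * PI * INR (S m) * b)).
      set (sg := sg1 (Z.of_nat k)).
      replace (Cminus (Cdiv (Cplus (RtoC ca) (Cmult (0, - sg) (RtoC sa))) (den N h x k m)) (Cdiv (Cplus (RtoC cb) (Cmult (0, - sg) (RtoC sb))) (den N h x k m)))
        with (Cmult (ca - cb, - sg * (sa - sb)) (Cinv (den N h x k m))).
      2: { replace (ca - cb, - sg * (sa - sb)) with (Cminus (Cplus (RtoC ca) (Cmult (0, - sg) (RtoC sa))) (Cplus (RtoC cb) (Cmult (0, - sg) (RtoC sb))))
             by (apply C_ext; unfold Re, Im; simpl; ring). unfold Cdiv. ring. }
      rewrite Cmod_mult. specialize (H m).
      assert (E1 : Cmod (ca - cb, - sg * (sa - sb)) <= 4 * PI * INR (S m) * Rabs (a - b)).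
      { eapply Rle_trans; [apply Cmod_le_abs|]. simpl Re. simpl Im.
        assert (Q1 := cos_lipschitz (2 * PI * INR (S m) * a) (2 * PI * INR (S m) * b)).
        assert (Q2 := sin_lipschitz (2 * PI * INR (S m) * a) (2 * PI * INR (S m) * b)).
        rewrite phase_diff in Q1, Q2. fold ca cb in Q1. fold sa sb in Q2.
        replace (Rabs (- sg * (sa - sb))) with (Rabs (sa - sb)); [lra|].
        destruct (sg1_cases (Z.of_nat k)) as [E|E]; unfold sg; rewrite E; [rewrite <- Rabs_Ropp|]; f_equal; ring. }
      assert (Hs : INR (S m) <> 0) by (apply not_0_INR; lia).
      replace (c * (4 * PI) * Rabs (a - b) / INR (S m) ^ 2) with (4 * PI * INR (S m) * Rabs (a - b) * (c / INR (S m) ^ 3)) by (field; exact Hs).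
      apply Rmult_le_compat; [apply Cmod_ge_0|apply Cmod_ge_0|exact E1|exact H].
  - exists c. intros a b. rewrite !(S_even_eq N h x n) by assumption. apply H.
Qed.

Lemma Phi_even_all a : 0 < a <= 1 -> RtoC (Phi N h x a) = S_even N h x a.
Proof.
  intros Ha. destruct (Req_dec a 1) as [->|Hne]; [|apply Phi_even with n; auto; lra].
  destruct S_even_lipschitz as [c1 H1]. destruct (Phi_lipschitz N h x HN Hx Hh) as [c2 H2].
  apply C_eq_of_lipschitz with (c1 + c2) (/ 2); [lra|]. intros d Hd.
  assert (E := Phi_even N h x n HN Hx Hh Hn (1 - d) ltac:(lra)).
  specialize (H1 (1 - d) 1). specialize (H2 1 (1 - d) ltac:(lra) ltac:(lra)). rewrite <- E in H1.
  replace (1 - (1 - d)) with d in H2 by ring. replace (1 - d - 1) with (- d) in H1 by ring.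
  rewrite Rabs_Ropp in H1. rewrite (Rabs_pos_eq d) in * by lra.
  rewrite <- Cmod_R, RtoC_minus in H2.
  replace (Cminus (RtoC (Phi N h x 1)) (S_even N h x 1)) with
    (Cplus (Cminus (RtoC (Phi N h x 1)) (RtoC (Phi N h x (1 - d)))) (Cminus (RtoC (Phi N h x (1 - d))) (S_even N h x 1))) by ring.
  eapply Rle_trans; [apply Cmod_triangle|]. lra.
Qed.

End EvenEnd.

Section OddEnd.
Variables (N : nat) (h : Z) (x : R) (n : nat).
Hypothesis HN : (0 < N)%nat.
Hypothesis Hx : 0 < x.
Hypothesis Hh0 : (0 <= h)%Z.
Hypothesis Hh : (2 * h < Z.of_nat N)%Z.
Hypothesis Hn : N = (2 * n + 1)%nat.

(** The cosine part is separated because it is Lipschitz in [a] up to the endpoint and even under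
    [a -> 1 - a]. The sine part is odd under this reflection, so it drops out of
    [Phi a + Phi (1 - a)]. *)
Definition S_cos (a : R) : C :=
  csum (fun k => Cmult (Cmult (RtoC (pref N h x)) (eik N h k)) (cSeries (odd_cos_term N h x a (jodd N k)))) N.
Definition S_sin (a : R) : C :=
  csum (fun k => Cmult (Cmult (RtoC (pref N h x)) (eik N h k))
    (Cmult (RtoC (- sg1 (Z.of_nat k) / PI)) (cSeries (odd_sin_term N h x a (jodd N k))))) N.

Lemma S_odd_split a : S_odd N h x a = Cplus (S_cos a) (S_sin a).
Proof.
  rewrite (S_odd_eq N h x n) by assumption. unfold S_cos, S_sin. rewrite <- csum_plus. apply csum_ext. intros k _. ring.
Qed.

Lemma S_cos_lipschitz : exists c, forall a b, Cmod (Cminus (S_cos a) (S_cos b)) <= c * Rabs (a - b).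
Proof.
  assert (Hpi := PI_RGT_0).
  apply (csum_lipschitz (fun k a => Cmult (Cmult (RtoC (pref N h x)) (eik N h k)) (cSeries (odd_cos_term N h x a (jodd N k))))).
  intros k Hk. apply scal_lipschitz. destruct (den_decay N h x HN Hx 3 k Hk) as [c [Hc H]].
  exists (2 * (c * (2 * PI))). apply cSeries_lipschitz; [nra| |].
  - intros a. now apply odd_cos_cex_series with n.
  - intros a b m. rewrite !(odd_cos_term_eq N h x n) by assumption.
    set (ca := cos _) at 1. set (cb := cos _).
    replace (Cminus (Cdiv (RtoC ca) (den N h x k m)) (Cdiv (RtoC cb) (den N h x k m))) with
      (Cmult (RtoC (ca - cb)) (Cinv (den N h x k m))) by (rewrite RtoC_minus; unfold Cdiv; ring).
    rewrite Cmod_mult, Cmod_R. specialize (H m).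
    assert (Q1 := cos_lipschitz (2 * PI * INR (S m) * a) (2 * PI * INR (S m) * b)). rewrite phase_diff in Q1.
    assert (Hs : INR (S m) <> 0) by (apply not_0_INR; lia).
    replace (c * (2 * PI) * Rabs (a - b) / INR (S m) ^ 2) with (2 * PI * INR (S m) * Rabs (a - b) * (c / INR (S m) ^ 3)) by (field; exact Hs).
    apply Rmult_le_compat; [apply Rabs_pos|apply Cmod_ge_0|exact Q1|exact H].
Qed.

Lemma cos_sin_reflect a m :
  cos (2 * PI * INR (S m) * (1 - a)) = cos (2 * PI * INR (S m) * a) /\
  sin (2 * PI * INR (S m) * (1 - a)) = - sin (2 * PI * INR (S m) * a).
Proof.
  replace (2 * PI * INR (S m) * (1 - a)) with (- (2 * PI * INR (S m) * a) + 2 * INR (S m) * PI) by ring.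
  rewrite cos_period, sin_period, cos_neg, sin_neg. split; reflexivity.
Qed.

Lemma cSeries_ext u v : (forall m, u m = v m) -> cSeries u = cSeries v.
Proof. intros E. unfold cSeries. f_equal; apply Series_ext; intros m; now rewrite E. Qed.

Lemma S_cos_reflect a : S_cos (1 - a) = S_cos a.
Proof.
  apply csum_ext. intros k _. f_equal. apply cSeries_ext. intros m. unfold odd_cos_term. cbv zeta.
  now rewrite (proj1 (cos_sin_reflect a m)).
Qed.

Lemma cSeries_opp u : cSeries (fun m => Copp (u m)) = Copp (cSeries u).
Proof. unfold cSeries, Copp. simpl. rewrite !Series_opp. reflexivity. Qed.

Lemma S_sin_reflect a : S_sin (1 - a) = Copp (S_sin a).
Proof.
  unfold S_sin. transitivity (Cmult (Copp (RtoC 1)) (S_sin a)); [|unfold S_sin; ring]. unfold S_sin.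
  rewrite <- csum_scal. apply csum_ext. intros k _.
  rewrite (cSeries_ext (odd_sin_term N h x (1 - a) (jodd N k)) (fun m => Copp (odd_sin_term N h x a (jodd N k) m))).
  - rewrite cSeries_opp. ring.
  - intros m. unfold odd_sin_term. cbv zeta. rewrite (proj2 (cos_sin_reflect a m)).
    unfold Rdiv. rewrite Ropp_mult_distr_l_reverse, RtoC_opp. ring.
Qed.

Lemma odd_sin_term_1 k m : odd_sin_term N h x 1 (jodd N k) m = RtoC 0.
Proof.
  unfold odd_sin_term. cbv zeta.
  replace (sin (2 * PI * INR (S m) * 1)) with 0.
  - unfold Rdiv. rewrite Rmult_0_l. ring.
  - replace (2 * PI * INR (S m) * 1) with (0 + 2 * INR (S m) * PI) by ring. now rewrite sin_period, sin_0.
Qed.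

Lemma odd_sin_cex_series_all a k : (k < N)%nat -> 0 < a <= 1 -> cex_series (odd_sin_term N h x a (jodd N k)).
Proof.
  intros Hk Ha. destruct (Req_dec a 1) as [->|Hne]; [|apply odd_sin_cex_series with n; auto; lra].
  apply cex_series_of_inv_sq with 0. intros m. rewrite odd_sin_term_1, Cmod_0. unfold Rdiv. rewrite Rmult_0_l. lra.
Qed.

Lemma S_sin_1 : S_sin 1 = RtoC 0.
Proof.
  unfold S_sin. rewrite (csum_ext _ (fun _ => RtoC 0)); [rewrite csum_const; ring|]. intros k _.
  rewrite (cSeries_ext _ (fun _ => RtoC 0)) by (intros; apply odd_sin_term_1).
  replace (cSeries (fun _ => RtoC 0)) with (RtoC 0); [ring|].
  assert (E : Series (fun _ => 0) = 0) by (apply is_series_unique, (is_series_finite (fun _ => 0) 0); reflexivity).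
  unfold cSeries, Re, Im, RtoC. simpl. now rewrite E.
Qed.

Lemma S_cos_1 : S_cos 1 = S_cos 0.
Proof. rewrite <- (S_cos_reflect 1). f_equal. ring. Qed.

(* Letting [a -> 0+] in [Phi a + Phi (1 - a) = 2 S_cos a] and [Phi a = Psi a + Phi (1 + a)]. *)
Lemma Phi_1_odd : RtoC (Phi N h x 1) = Cplus (S_cos 1) (RtoC (- / 2 * riemann_zeta (IZR (- Z.of_nat N + 2 * h)))).
Proof.
  assert (EZ := expo_Z N h HN Hh). set (p := expo N h) in *.
  assert (Hp : Nat.odd p = true) by (apply Nat.odd_spec; exists (n - Z.to_nat h)%nat; lia).
  replace (IZR (- Z.of_nat N + 2 * h)) with (- INR p) by (rewrite INR_IZR_INZ, <- opp_IZR; f_equal; lia).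
  destruct (EM_pexp_limit N p ltac:(lia) Hp) as [c0 H0].
  destruct S_cos_lipschitz as [c1 H1]. destruct (Phi_lipschitz N h x HN Hx Hh) as [c2 H2].
  set (z := riemann_zeta (- INR p)) in *.
  assert (Hc2 : 0 <= c2).
  { specialize (H2 1 2 ltac:(lra) ltac:(lra)). assert (Q := Rabs_pos (Phi N h x 1 - Phi N h x 2)).
    replace (1 - 2) with (- (1)) in H2 by ring. rewrite Rabs_Ropp, Rabs_R1 in H2. lra. }
  assert (Hc1 : 0 <= c1).
  { specialize (H1 1 2). assert (Q := Cmod_ge_0 (Cminus (S_cos 1) (S_cos 2))).
    replace (1 - 2) with (- (1)) in H1 by ring. rewrite Rabs_Ropp, Rabs_R1 in H1. lra. }
  apply C_eq_of_lipschitz with (c0 + (c1 + c2) / x) (Rmin 1 (x / 2)); [apply Rmin_pos; lra|].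
  intros d [Hd0 Hd].
  assert (Hd1 : d <= 1) by (eapply Rle_trans; [exact Hd|apply Rmin_l]).
  assert (Hd2 : d <= x / 2) by (eapply Rle_trans; [exact Hd|apply Rmin_r]).
  (* With this choice [exp(-a x u^N)] is [exp(-(d u)^N)], as in [EM_pexp_limit], and [a <= d/x]
     makes every error linear in [d]. *)
  set (a := d ^ N / x).
  assert (HdN : 0 < d ^ N) by now apply pow_lt.
  assert (HdN1 : d ^ N <= d).
  { replace N with (S (N - 1)) by lia. cbn [pow]. assert (d ^ (N - 1) <= 1 ^ (N - 1)) by (apply pow_incr; lra).
    rewrite pow1 in H. nra. }
  assert (Ha0 : 0 < a) by now apply Rdiv_lt_0_compat.
  assert (Had : a <= d / x) by (unfold a, Rdiv; apply Rmult_le_compat_r; [left; now apply Rinv_0_lt_compat|exact HdN1]).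
  assert (Ha2 : a <= / 2).
  { eapply Rle_trans; [exact Had|]. apply Rmult_le_reg_r with x; [exact Hx|]. unfold Rdiv. rewrite Rmult_assoc, Rinv_l; lra. }
  assert (HEM := EM_plus _ _ _ _ _ _ (EM_lam N h x HN Hx Hh a Ha0) (EM_scal (Copp (RtoC 1)) _ _ _ (EM_lam N h x HN Hx Hh (a + 1) ltac:(lra)))).
  assert (HEM2 : EM (fun u => RtoC (u ^ p * exp (- (d * u) ^ N))) (RtoC 0) (RtoC (Phi N h x a - Phi N h x (a + 1)))).
  { eapply EM_ext; [|eapply EM_eq; [exact HEM|ring|rewrite RtoC_minus; ring]].
    intros u Hu. cbv beta. transitivity (RtoC (lam N h x a u - lam N h x (a + 1) u)); [rewrite RtoC_minus; ring|].
    rewrite (lam_shift N h x Hx a u Hu). fold p. f_equal. f_equal. f_equal. f_equal. rewrite Rpow_mult_distr. unfold a. field. lra. }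
  specialize (H0 d _ ltac:(lra) HEM2).
  assert (E1 := Phi_odd N h x n HN Hx Hh0 Hh Hn a ltac:(lra)).
  assert (E2 := Phi_odd N h x n HN Hx Hh0 Hh Hn (1 - a) ltac:(lra)).
  rewrite S_odd_split in E1, E2. rewrite S_cos_reflect, S_sin_reflect in E2.
  assert (H1' := H1 a 0). rewrite <- S_cos_1 in H1'. replace (a - 0) with a in H1' by ring.
  assert (H2a := H2 1 (a + 1) ltac:(lra) ltac:(lra)). assert (H2b := H2 1 (1 - a) ltac:(lra) ltac:(lra)).
  replace (1 - (a + 1)) with (- a) in H2a by ring. replace (1 - (1 - a)) with a in H2b by ring.
  rewrite Rabs_Ropp in H2a. rewrite (Rabs_pos_eq a) in * by lra.
  rewrite <- Cmod_R in H2a, H2b. rewrite RtoC_minus in H0, H2a, H2b.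
  set (P1 := RtoC (Phi N h x 1)) in *. set (Pa := RtoC (Phi N h x a)) in *. set (Pb := RtoC (Phi N h x (1 - a))) in *.
  set (Pc := RtoC (Phi N h x (a + 1))) in *.
  assert (Esum : Cplus Pa Pb = Cmult (RtoC 2) (S_cos a)) by (rewrite E1, E2; ring).
  replace (RtoC (- / 2 * z)) with (Copp (Cmult (RtoC (/ 2)) (RtoC z))) by (rewrite <- RtoC_mult, <- RtoC_opp; f_equal; ring).
  assert (Ehalf : RtoC (/ 2) = Cinv (RtoC 2)) by (apply RtoC_inv; lra).
  (* The difference splits into the Lipschitz errors of [Phi] at [1 + a] and [1 - a], that of
     [S_cos] between [a] and 1, and half the error of [Phi a - Phi (1 + a)] as an approximation of
     the zeta value. *)
  replace (Cminus P1 (Cplus (S_cos 1) (Copp (Cmult (RtoC (/ 2)) (RtoC z))))) with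
    (Cplus (Cplus (Cmult (RtoC (/ 2)) (Cplus (Cminus P1 Pc) (Cminus P1 Pb))) (Cminus (S_cos a) (S_cos 1)))
      (Copp (Cmult (RtoC (/ 2)) (Cminus (Cminus Pa Pc) (RtoC z))))).
  2: { replace (S_cos a) with (Cmult (RtoC (/ 2)) (Cplus Pa Pb)) by (rewrite Esum, Ehalf; field). rewrite Ehalf. field. }
  eapply Rle_trans; [apply Cmod_triangle|]. rewrite Cmod_opp, Cmod_mult, Cmod_R, (Rabs_pos_eq (/ 2)) by lra.
  eapply Rle_trans; [apply Rplus_le_compat_r, Cmod_triangle|].
  rewrite Cmod_mult, Cmod_R, (Rabs_pos_eq (/ 2)) by lra.
  assert (T := Cmod_triangle (Cminus P1 Pc) (Cminus P1 Pb)).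
  assert (Q := Cmod_ge_0 (Cminus (Cminus Pa Pc) (RtoC z))).
  assert (B1 : c1 * a <= c1 * (d / x)) by now apply Rmult_le_compat_l.
  assert (B2 : c2 * a <= c2 * (d / x)) by now apply Rmult_le_compat_l.
  replace ((c0 + (c1 + c2) / x) * d) with (c0 * d + c1 * (d / x) + c2 * (d / x)) by (unfold Rdiv; ring).
  lra.
Qed.

Lemma Phi_odd_all a : 0 < a <= 1 -> RtoC (Phi N h x a) = Cplus (S_odd N h x a) (RtoC (g_ N h a)).
Proof.
  intros Ha. unfold g_. destruct (Req_EM_T a 1) as [->|Hne].
  - rewrite Phi_1_odd, S_odd_split, S_sin_1. ring.
  - rewrite (Phi_odd N h x n HN Hx Hh0 Hh Hn) by lra. ring.
Qed.

End OddEnd.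

Theorem theorem1p16 (N : nat) (h : Z) (x a : R) :
  (0 < N)%nat -> 0 < x -> 0 < a <= 1 ->
  (* (i) N odd, 0 <= h < N/2 *)
  (Nat.odd N = true -> (0 <= h)%Z -> (2 * h < Z.of_nat N)%Z ->
     (forall k, (k < N)%nat ->
        cex_series (odd_cos_term N h x a (jodd N k)) /\
        cex_series (odd_sin_term N h x a (jodd N k))) /\
     ex_series (lhs_seq N h x a) /\
     RtoC (Series (lhs_seq N h x a)) =
       Cplus (RtoC (main_terms N h x a)) (Cplus (S_odd N h x a) (RtoC (g_ N h a)))) /\
  (* (ii) N even, every integer h < N/2 (i.e. 0 <= h < N/2, and also every h < 0) *)
  (Nat.even N = true -> (2 * h < Z.of_nat N)%Z ->
     (forall k, (k < N)%nat -> cex_series (even_term N h x a (jeven N k))) /\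
     ex_series (lhs_seq N h x a) /\
     RtoC (Series (lhs_seq N h x a)) =
       Cplus (RtoC (main_terms N h x a)) (S_even N h x a)).
Proof.
  intros HN Hx Ha.
  assert (E : RtoC (Series (lhs_seq N h x a)) = Cplus (RtoC (main_terms N h x a)) (RtoC (Phi N h x a))).
  { rewrite <- RtoC_plus. f_equal. unfold Phi. ring. }
  split.
  - intros Hodd Hh0 Hh. apply Nat.odd_spec in Hodd. destruct Hodd as [n Hn]. split; [|split].
    + intros k Hk. split; [now apply odd_cos_cex_series with n|now apply odd_sin_cex_series_all with n].
    + apply ex_series_lhs; auto; lra.
    + rewrite E. f_equal. now apply Phi_odd_all with n.
  - intros Heven Hh. apply Nat.even_spec in Heven. destruct Heven as [n Hn]. split; [|split].
    + intros k Hk. now apply even_cex_series with n.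
    + apply ex_series_lhs; auto; lra.
    + rewrite E. f_equal. now apply Phi_even_all with n.
Qed.
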